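(* Let $(Z_n)$ be a branching process in an i.i.d. random environment with immigration (BPREI) as in the context. Fix $\alpha>0$ in the interior of $\mathcal D_\Lambda$ and assume: (a) the law of $\log M$ is non-arithmetic, $\mathbf E|\log M|<\infty$, $\mu:=\mathbf E\log M\ge0$, $\rho:=\Lambda'(\alpha)>\mu$, $v_\alpha^2:=\Lambda''(\alpha)\in(0,\infty)$; (b) $\mathbf EZ_0^\alpha<\infty$ and, for some $C<\infty$ and $0\le\beta<\alpha$, $\mathbf E|D(k)|^\alpha\le C(1+k^\beta)$ for all $k\in\mathbb N_0$; (c) $\mathbf P(Z_0>0)+\mathbf P(\eta>0)>0$. Then there is a nonnegative random variable $V_\infty$ with $\mathbf P_\alpha(V_\infty>0)>0$ such that $$\frac{Z_n}{\Pi_n}\longrightarrow V_\infty\qquad\mathbf P_\alpha\text{-almost surely and in }L^\alpha(\mathbf P_\alpha).$$ Moreover $$\lim_{n\to\infty}e^{-n\Lambda(\alpha)}\mathbf E[Z_n^\alpha]=c_Z(\alpha):=\mathbf E_\alpha[V_\infty^\alpha]\in(0,\infty),$$ and, with $I(\rho):=\alpha\rho-\Lambda(\alpha)$, for every fixed $y\in\mathbb R$ $$\lim_{n\to\infty}\sqrt n\,e^{nI(\rho)}\,\mathbf P\bigl(Z_n>e^{\rho n+y}\bigr)=\frac{c_Z(\alpha)e^{-\alpha y}}{\alpha v_\alpha\sqrt{2\pi}} .$$ The conclusion holds in both the case $\mu>0$ and the case $\mu=0$.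
   Context: Notation: $\mathbb N_0=\{0,1,2,\dots\}$. BPREI. $\mathcal E_n=(Q_n,G_n)$, $n\ge0$, are i.i.d. marks, where $Q_n$ (reproduction law) and $G_n$ (immigration law) are random probability measures on $\mathbb N_0$, possibly dependent on each other. Conditional on the environment $(\mathcal E_n)_{n\ge0}$, $$Z_{n+1}=\sum_{i=1}^{Z_n}\xi_{n,i}+\eta_{n+1},$$ where all the variables $\xi_{n,i}$ and $\eta_{n+1}$ are independent, $\xi_{n,i}$ has law $Q_n$ and $\eta_{n+1}$ has law $G_n$. The $\mathbb N_0$-valued $Z_0$ is independent of the environment and of the reproduction and immigration variables. $M_n$ is the mean of $Q_n$, with $M_n\in(0,\infty)$ a.s.; $\Pi_n:=\prod_{j=0}^{n-1}M_j$. Generic objects: for a generic mark with reproduction mean $M$, let $\xi_1,\xi_2,\dots,\eta$ have the associated one-generation conditional laws (conditionally independent given the mark), and $D(k):=\sum_{i=1}^k(\xi_i-M)+\eta$. $\Lambda(\vartheta):=\log\mathbf E[M^\vartheta]$, $\mathcal D_\Lambda:=\{\vartheta\in\mathbb R:\Lambda(\vartheta)<\infty\}$. Tilted law: $\mathbf P_\alpha$ (expectation $\mathbf E_\alpha$) has density $\Pi_n^\alpha e^{-n\Lambda(\alpha)}$ with respect to $\mathbf P$ on $\sigma(\mathcal E_0,\dots,\mathcal E_{n-1})$ for every $n$; conditional on the marks, the reproduction and immigration mechanisms are unchanged, and the law and independence of $Z_0$ are unchanged.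
   Formalization: ''Non-arithmetic'' is taken as: the law of log M is not carried by any shifted progression a+hZ (nonlattice); excluding only hZ, the tail limit fails, e.g. for M equal to 2 or 6 with probability 1/2 each, deterministic offspring, no immigration and Z_0=1. *)

(* Defs.v *)
From HB Require Import structures.
From mathcomp Require Import all_boot all_order all_algebra.
From mathcomp Require Import all_classical all_reals all_analysis.

Set Implicit Arguments.
Unset Strict Implicit.
Unset Printing Implicit Defensive.

Import Order.TTheory GRing.Theory Num.Theory.
Import numFieldNormedType.Exports.

Local Open Scope classical_set_scope.
Local Open Scope ring_scope.

(* A mark (Q, G): reproduction law and immigration law.  [pprobability nat R]
   is the space of probability measures on N_0 with the sigma-algebra generated
   by the evaluations. *)
Notation mark R := (pprobability nat R * pprobability nat R)%type.

Section generated_sigma_algebras.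
Context d d' (T : measurableType d) (T' : measurableType d').

(* sigma(X_i, i in J) *)
Definition sigma_gen (I : Type) (J : set I) (X : I -> T -> T') : set (set T) :=
  <<s \bigcup_(i in J) preimage_set_system setT (X i) measurable >>.

Context (R : realType).

Definition mutually_independent (P : probability T R) (I : eqType)
    (X : I -> T -> T') : Prop :=
  forall (s : seq I) (B : I -> set T'), uniq s -> (forall i, measurable (B i)) ->
    (P (\bigcap_(i in [set` s]) (X i @^-1` B i))
     = \prod_(i <- s) P (X i @^-1` B i))%E.

Definition identically_distributed (P : probability T R) (I : Type)
    (X : I -> T -> T') : Prop :=
  forall (i j : I) (B : set T'), measurable B ->
    P (X i @^-1` B) = P (X j @^-1` B).

End generated_sigma_algebras.

(* Convergence in L^p for real p > 0, including 0 < p < 1; convergence of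
   [Lnorm] to 0 is then the convergence of E[|X_n - Y|^p] to 0. *)
Definition cvg_in_Lp d (T : measurableType d) (R : realType)
    (P : probability T R) (p : R) (X : nat -> T -> R) (Y : T -> R) : Prop :=
  [/\ forall n, finite_norm P p%:E (X n),
      finite_norm P p%:E Y
    & Lnorm P p%:E (EFin \o (fun w => X n w - Y w)) @[n --> \oo] --> 0%E].

(* The law of X is not carried by any progression a + h Z, with a shift a
   allowed (X is nonlattice).  Excluding a = 0 only would not suffice for tail
   asymptotics: if M takes the values 2 and 6 then log M is in
   log 2 + (log 3) Z, and the atoms of Pi_n oscillate around e^(rho n + y). *)
Definition non_arithmetic d (T : measurableType d) (R : realType)
    (P : probability T R) (X : T -> R) : Prop :=
  forall a h : R, 0 < h ->
    ~ {ae P, forall w, exists k : int, X w = a + h * k%:~R}.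

(* [offspring n i] is the offspring number of the (i+1)-st individual of generation
   n, and [immig n.+1] is the immigration into generation n.+1; [immig 0] is not
   used. *)
Record bprei_data d (T : measurableType d) (R : realType) := BpreiData {
  env : nat -> {mfun T >-> mark R} ;
  offspring : nat -> nat -> {mfun T >-> nat} ;
  immig : nat -> {mfun T >-> nat} ;
  Z0 : {mfun T >-> nat} }.

Section bprei.
Context d (T : measurableType d) (R : realType).
Implicit Types (P : probability T R) (X : bprei_data T R).

Definition Q X n (w : T) : probability nat R := (env X n w).1.
Definition G X n (w : T) : probability nat R := (env X n w).2.

Fixpoint Z X (n : nat) (w : T) : nat :=
  if n is m.+1 then (\sum_(i < Z X m w) offspring X m i w + immig X m.+1 w)%N
  else Z0 X w.

Definition mean (q : probability nat R) : \bar R :=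
  (\int[q]_k (k%:R : R)%:E)%E.

Definition M X n (w : T) : R := fine (mean (Q X n w)).

Definition Pi X n (w : T) : R := \prod_(j < n) M X j w.

(* All the variables xi_{n,i} and eta_{n+1} as one family, with their
   conditional laws given the environment. *)
Definition mech_var X (v : nat * nat + nat) : T -> nat :=
  match v with inl (n, i) => offspring X n i | inr n => immig X n.+1 end.

Definition mech_law X (v : nat * nat + nat) : T -> probability nat R :=
  match v with inl (n, _) => Q X n | inr n => G X n end.

(* Given the whole environment, the variables xi_{n,i}, eta_{n+1} are
   independent, with laws Q_n and G_n: for every finite subfamily, the
   conditional probability given sigma(env) of the product event is the product
   of the conditional laws. *)
Definition mechanism P X : Prop :=
  forall (A : set T) (s : seq (nat * nat + nat))
         (B : nat * nat + nat -> set nat),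
    sigma_gen setT (env X) A -> uniq s ->
    (P (A `&` \bigcap_(v in [set` s]) (mech_var X v @^-1` B v))
     = \int[P]_(w in A) \prod_(v <- s) mech_law X v w (B v))%E.

Definition Z0_independent P X : Prop :=
  forall (A : set T) (B : set nat),
    <<s sigma_gen setT (env X) `|` sigma_gen setT (mech_var X) >> A ->
    (P (A `&` Z0 X @^-1` B) = P A * P (Z0 X @^-1` B))%E.

Record is_bprei P X : Prop := IsBprei {
  env_independent : mutually_independent P (env X) ;
  env_identical : identically_distributed P (env X) ;
  bprei_mechanism : mechanism P X ;
  bprei_Z0 : Z0_independent P X ;
  mean_pos_finite :
    forall n, {ae P, forall w, (0 < mean (Q X n w) < +oo)%E} }.

(* The generic mark and its generic one-generation variables are those of
   generation 0. *)
Definition D X (k : nat) (w : T) : R :=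
  \sum_(i < k) ((offspring X 0 i w)%:R - M X 0 w) + (immig X 1 w)%:R.

Definition Lambda P X (theta : R) : \bar R :=
  lne ('E_P[fun w => (M X 0 w `^ theta)%R])%E.

Definition DLambda P X : set R := [set theta | (Lambda P X theta < +oo)%E].

(* Lambda as a real function; meaningful on DLambda only. *)
Definition rLambda P X (theta : R) : R := fine (Lambda P X theta).

(* [Pa] is the tilted law P_alpha.  It is a law on the same measurable space,
   determined on the sigma-algebra generated by all the variables; it is not
   absolutely continuous with respect to P in general. *)
Record is_tilted P X (alpha : R) (Pa : probability T R) : Prop := IsTilted {
  tilted_density : forall (n : nat) (A : set T), sigma_gen `I_n (env X) A ->
    (Pa A = \int[P]_(w in A)
       (Pi X n w `^ alpha * expR (- (n%:R * rLambda P X alpha)))%:E)%E ;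
  tilted_mechanism : mechanism Pa X ;
  tilted_Z0 : Z0_independent Pa X ;
  tilted_Z0_law : forall B : set nat, Pa (Z0 X @^-1` B) = P (Z0 X @^-1` B) }.

End bprei.

(* Main.v *)
Require Import Defs.
From HB Require Import structures.
From mathcomp Require Import all_boot all_order all_algebra.
From mathcomp Require Import all_classical all_reals all_analysis measurable_realfun.
From mathcomp Require Import ring lra zify.

Set Implicit Arguments.
Unset Strict Implicit.
Unset Printing Implicit Defensive.

Import Order.TTheory GRing.Theory Num.Theory.
Import numFieldNormedType.Exports.

Local Open Scope classical_set_scope.
Local Open Scope ring_scope.

(* Write m = E[M^alpha] and V_n = Z_n / Pi_n.  The Markov property and the bound
   on E|D(k)|^alpha give E[Z_n^b] = O(k^n) with beta < b < alpha and k < m, hence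
   geometric decay of E_alpha|V_(n+1) - V_n|^alpha; this yields the limit V almost
   surely and in L^alpha.  Started from {Z_n = k} with k large, the same bound makes
   V = 0 almost surely impossible, since k^alpha dominates 1 + k^b.
   Under the tilted law, ln Pi_n - rho n is a centred random walk with variance v^2
   and non-arithmetic steps.  Smoothing with the Fejer kernel, whose Fourier transform
   has compact support, gives the local limit sqrt(n) E[exp(-alpha (S_n - x)); S_n > x]
   -> 1 / (alpha v sqrt(2 pi)), uniformly bounded in n and x, and undoing the tilt
   gives the tail of Pi_l.  Finally Z_n is compared with Z_m Pi_n / Pi_m: the difference
   is a sum of terms D_k Pi_n / Pi_(k+1), whose tails are estimated by a union bound
   with geometric weights and contribute O(q^m) on the right scale. *)

(** * Measures with a density, and equality of laws from a pi-system *)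

Section weighted_laws.
Local Open Scope ereal_scope.
Context (R : realType).
Import HBNNSimple.

(** [Pa] is tied to [P] only by densities on finite horizons, so each passage between the two laws
    concerns the past up to a fixed generation; the density, given on environments, extends to
    population sizes because both laws share the mechanism. As alpha may be below 1, increments are
    summed after taking alpha-th roots and no martingale convergence is invoked. Strict growth m >
    1, for mu = 0 as for mu > 0, comes from exp x >= 1 + x and its equality case, since ln M is not
    almost surely 0. By convexity E[M^b] < m, which leaves room for a growth factor 1 < k < m of the
    b-th moments. The Fejer kernel has a single width: a window of large radius delta keeps most of
    its mass but costs a factor exp(2 alpha delta). Rescaling walk and exponent together reconciles
    the two; this is why the characteristic function of a step must have modulus below 1 at every t
    > 0. The bounds comparing Z_n with Z_m Pi_n / Pi_m are uniform in n, so n tends to infinity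
    first, then m, and the relative margin tends to 0 last. *)

Lemma density_measure d (T : measurableType d) (mu : {measure set T -> \bar R})
    (g : T -> R) (mg : measurable_fun setT g) (g0 : forall x, (0 <= g x)%R) :
  exists nu : {measure set T -> \bar R},
    (forall A, measurable A -> nu A = \int[mu]_(x in A) (g x)%:E) /\
    forall f : T -> \bar R, (forall x, 0 <= f x) -> measurable_fun setT f ->
      \int[nu]_x f x = \int[mu]_x (f x * (g x)%:E).
Proof.
have mgE : measurable_fun setT (EFin \o g) by exact/measurable_EFinP.
pose nu0 A := \int[mu]_(x in A) (g x)%:E.
have nu00 : nu0 set0 = 0 by rewrite /nu0 integral_set0.
have nu0ge0 A : 0 <= nu0 A by apply: integral_ge0 => x _; rewrite lee_fin.
have nu0s : semi_sigma_additive nu0.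
  move=> F mF tF mUF; rewrite /nu0.
  rewrite ge0_integral_bigcup//; last 2 first.
  - exact: measurable_funTS.
  - by move=> x _; rewrite lee_fin.
  by apply: is_cvg_nneseries => n _ _; exact: nu0ge0.
pose nu : {measure set T -> \bar R} :=
  HB.pack nu0 (isMeasure.Build d T R nu0 nu00 nu0ge0 nu0s).
exists nu; split => // f f0 mf.
pose h := nnsfun_approx (@measurableT _ T) mf.
have -> : \int[nu]_x f x = limn (fun n => \int[nu]_x (EFin \o h n) x).
  have fE x : f x = limn (fun n => (EFin \o h n) x).
    by apply/esym/cvg_lim => //; exact: cvg_nnsfun_approx.
  under eq_integral do rewrite fE.
  apply: monotone_convergence => //.
  - by move=> n; apply/measurable_EFinP; exact/measurable_funP.
  - by move=> n x _ //=; rewrite lee_fin.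
  - by move=> x _ a b ab; rewrite lee_fin; exact/lefP/nd_nnsfun_approx.
have -> : \int[mu]_x (f x * (g x)%:E) =
    limn (fun n => \int[mu]_x ((EFin \o h n) \* (EFin \o g)) x).
  have fg x : f x * (g x)%:E = limn (fun n => ((EFin \o h n) \* (EFin \o g)) x).
    by apply/esym/cvg_lim => //; apply: cvgeZr => //; exact: cvg_nnsfun_approx.
  under eq_integral do rewrite fg.
  apply: monotone_convergence => [//| | |].
  - by move=> n; apply/emeasurable_funM => //; exact/measurable_EFinP.
  - by move=> n x _ /=; rewrite mule_ge0 ?lee_fin.
  - by move=> x _ a b ab/=; rewrite lee_wpmul2r ?lee_fin//; exact/lefP/nd_nnsfun_approx.
suff suf n : \int[mu]_x ((EFin \o h n) x * (EFin \o g) x) =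
    \int[nu]_x (EFin \o h n) x.
  by under [in RHS]eq_fun do rewrite suf.
transitivity (\int[nu]_x
   (\sum_(y \in range (h n)) (y * \1_(h n @^-1` [set y]) x)%:E)); last first.
  by apply: eq_integral => t tE; rewrite /= fimfunE -fsumEFin.
rewrite ge0_integral_fsum//; [|by move=> r; exact/measurable_EFinP/measurable_funM
  |by move=> m y Ey; exact: nnfun_muleindic_ge0].
transitivity (\int[mu]_x (\sum_(y \in range (h n))
    (y * \1_(h n @^-1` [set y]) x)%:E * (g x)%:E)).
  under [RHS]eq_integral => x xE.
    rewrite -ge0_mule_fsuml => [|y]; last exact: nnfun_muleindic_ge0.
    rewrite fsumEFin // -(fimfunE _ x); over.
  by [].
rewrite ge0_integral_fsum//; last 2 first.
  - by move=> y; apply: emeasurable_funM => //; exact/measurable_EFinP/measurable_funM.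
  - by move=> m y Ey; rewrite mule_ge0 ?lee_fin// -lee_fin nnfun_muleindic_ge0.
apply: eq_fsbigr => r rhn.
rewrite integralZl_indic_nnsfun//.
under eq_integral do rewrite EFinM -muleA.
rewrite ge0_integralZl//.
- rewrite integral_indic// setIT [in RHS]/= /nu0; congr (_ * _).
  rewrite [RHS]integral_mkcond; apply: eq_integral => x _.
  by rewrite patchE indicE; case: ifP => _; rewrite ?mul1e ?mul0e.
- by apply: emeasurable_funM => //; exact/measurable_EFinP.
- by move=> t Et; rewrite mule_ge0 ?lee_fin.
- by move: rhn; rewrite inE => -[t _ <-]; rewrite lee_fin.
Qed.

(** The two images under [phi1] and [phi2] of the measures with densities [g1] and [g2] are finite
    and agree on a pi-system, hence coincide. The conditional path formula and the change of measure
    below are instances, with a smaller sigma-algebra on the same space as target. *)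
Lemma eq_weighted_law d1 d2 d' (T1 : measurableType d1) (T2 : measurableType d2)
    (T' : measurableType d')
    (mu1 : {measure set T1 -> \bar R}) (mu2 : {measure set T2 -> \bar R})
    (g1 : T1 -> R) (g2 : T2 -> R) (phi1 : T1 -> T') (phi2 : T2 -> T')
    (G : set (set T')) :
  measurable_fun setT g1 -> (forall x, (0 <= g1 x)%R) ->
  measurable_fun setT g2 -> (forall x, (0 <= g2 x)%R) ->
  measurable_fun setT phi1 -> measurable_fun setT phi2 ->
  measurable = <<s G >> -> setI_closed G -> G setT ->
  \int[mu1]_x (g1 x)%:E < +oo ->
  (forall B, G B -> \int[mu1]_(x in phi1 @^-1` B) (g1 x)%:E =
                   \int[mu2]_(x in phi2 @^-1` B) (g2 x)%:E) ->
  forall f : T' -> \bar R, (forall x, 0 <= f x) -> measurable_fun setT f ->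
    \int[mu1]_x (f (phi1 x) * (g1 x)%:E) = \int[mu2]_x (f (phi2 x) * (g2 x)%:E).
Proof.
move=> mg1 g10 mg2 g20 mphi1 mphi2 mG IG GT foo GE f f0 mf.
have [nu1 [nu1E i1]] := density_measure mu1 mg1 g10.
have [nu2 [nu2E i2]] := density_measure mu2 mg2 g20.
have mp1 B : measurable B -> measurable (phi1 @^-1` B).
  by move=> mB; rewrite -[X in measurable X]setTI; exact: mphi1.
have mp2 B : measurable B -> measurable (phi2 @^-1` B).
  by move=> mB; rewrite -[X in measurable X]setTI; exact: mphi2.
rewrite -(i1 (f \o phi1)); [|by move=> x; exact: f0|exact: measurableT_comp].
rewrite -(i2 (f \o phi2)); [|by move=> x; exact: f0|exact: measurableT_comp].
pose p1 : {mfun T1 >-> T'} := HB.pack phi1 (isMeasurableFun.Build _ _ _ _ _ mphi1).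
pose p2 : {mfun T2 >-> T'} := HB.pack phi2 (isMeasurableFun.Build _ _ _ _ _ mphi2).
rewrite -(ge0_integral_pushforward mphi1 nu1 measurableT mf)//.
rewrite -(ge0_integral_pushforward mphi2 nu2 measurableT mf)//.
apply: eq_measure_integral => A mA _.
have /= := @measure_unique _ _ _ G (fun=> setT) mG IG (fun=> GT) _
  (pushforward nu1 p1) (pushforward nu2 p2).
apply => //.
- by rewrite bigcup_const//; exists 0%N.
- move=> B GB; rewrite /pushforward.
  have mB : measurable B by rewrite mG; exact: sub_sigma_algebra.
  by rewrite nu1E ?nu2E ?GE//; [exact: mp2|exact: mp1].
- by move=> _; rewrite /pushforward/= nu1E//; [exact: mp1].
Qed.

Lemma eq_law d1 d2 d' (T1 : measurableType d1) (T2 : measurableType d2)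
    (T' : measurableType d')
    (mu1 : probability T1 R) (mu2 : probability T2 R)
    (phi1 : T1 -> T') (phi2 : T2 -> T') (G : set (set T')) :
  measurable_fun setT phi1 -> measurable_fun setT phi2 ->
  measurable = <<s G >> -> setI_closed G -> G setT ->
  (forall B, G B -> mu1 (phi1 @^-1` B) = mu2 (phi2 @^-1` B)) ->
  forall f : T' -> \bar R, (forall x, 0 <= f x) -> measurable_fun setT f ->
    \int[mu1]_x (f (phi1 x)) = \int[mu2]_x (f (phi2 x)).
Proof.
move=> mphi1 mphi2 mG IG GT GE f f0 mf.
have int1 d (T : measurableType d) (mu : {measure set T -> \bar R}) (D : set T) :
    measurable D -> \int[mu]_(x in D) (cst 1%R x)%:E = mu D.
  by move=> mD; rewrite (@integral_cst _ _ _ mu D mD 1%:E) mul1e.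
have h := @eq_weighted_law _ _ _ _ _ _ mu1 mu2 (cst 1%R) (cst 1%R) phi1 phi2 G.
have {}h := h (measurable_cst _) (fun=> ler01) (measurable_cst _) (fun=> ler01)
  mphi1 mphi2 mG IG GT.
under eq_integral do rewrite -[f _]mule1.
under [RHS]eq_integral do rewrite -[f _]mule1.
apply: h => //.
- by rewrite int1// (le_lt_trans (probability_le1 mu1 measurableT)) ?ltry.
- move=> B GB; have mB : measurable B by rewrite mG; exact: sub_sigma_algebra.
  rewrite !int1; [exact: GE| |].
  + by rewrite -[X in measurable X]setTI; exact: mphi2.
  + by rewrite -[X in measurable X]setTI; exact: mphi1.
Qed.

(** On rectangles, the pair has under [mu] the law of (X z.1, Y z.2) under the product of [mu] with
    itself; Tonelli on that product then freezes the first variable. *)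
Lemma independent_tonelli d d1 d2 (T : measurableType d) (T1 : measurableType d1)
    (T2 : measurableType d2) (mu : probability T R) (X : T -> T1) (Y : T -> T2) :
  measurable_fun setT X -> measurable_fun setT Y ->
  (forall A B, measurable A -> measurable B ->
    mu (X @^-1` A `&` Y @^-1` B) = mu (X @^-1` A) * mu (Y @^-1` B)) ->
  forall f : T1 * T2 -> \bar R, (forall x, 0 <= f x) -> measurable_fun setT f ->
    \int[mu]_w f (X w, Y w) = \int[mu]_w \int[mu]_w' f (X w, Y w').
Proof.
move=> mX mY ind f f0 mf.
pose phi2 (z : T * T) := (X z.1, Y z.2).
have mphi2 : measurable_fun setT phi2.
  by apply: measurable_fun_pair; apply: measurableT_comp.
have mphi1 : measurable_fun setT (fun w => (X w, Y w)).
  exact: measurable_fun_pair.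
transitivity (\int[product_measure1 mu mu]_z (f (phi2 z))); last first.
  rewrite (@fubini_tonelli1 _ _ _ _ _ mu mu (f \o phi2))//; by [move=> x; exact: f0|exact: measurableT_comp].
have mu1 : product_measure1 mu mu setT = 1.
  rewrite -setXTT; transitivity (mu setT * mu setT); first exact: product_measure1E.
  by rewrite probability_setT mul1e.
pose PP : probability (T * T)%type R := HB.pack (product_measure1 mu mu)
  (Measure_isProbability.Build _ _ _ (product_measure1 mu mu) mu1).
apply: (@eq_law _ _ _ _ _ _ mu PP _ phi2 [set A `*` B | A in measurable & B in measurable]) => //.
- exact: measurable_prod_measurableType.
- by move=> _ _ [A mA [B mB <-]] [C mC [D mD <-]]; rewrite -setXI;
    exists (A `&` C); [exact: measurableI|exists (B `&` D) => //; exact: measurableI].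
- by exists setT => //; exists setT => //; rewrite setXTT.
- move=> _ [A mA [B mB <-]].
  have -> : phi2 @^-1` (A `*` B) = (X @^-1` A) `*` (Y @^-1` B) by [].
  rewrite [in RHS]/= product_measure1E; [| |]; last 2 first.
  + by rewrite -[X in measurable X]setTI; exact: mX.
  + by rewrite -[X in measurable X]setTI; exact: mY.
  by rewrite -ind.
Qed.

End weighted_laws.

(** * Conditional law of the next population size given the environment *)

Section genealogy.
Context d (T : measurableType d) (R : realType).
Implicit Types (P : probability T R) (X : bprei_data T R).

Local Notation V := (nat * nat + nat)%type.

(** Size that generation k+1 would have if generation k had j individuals. With j imposed it
    involves variables of one generation only, and Z_(k+1) is [S X k] taken at Z_k. *)
Definition S X k j w : nat := (\sum_(i < j) offspring X k i w + immig X k.+1 w)%N.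

(* The law of [S X k j] given the mark [e] of generation [k]. *)
Fixpoint pk (e : mark R) (j z : nat) : R :=
  if j is i.+1 then \sum_(b < z.+1) fine (e.1 [set (b : nat)]) * pk e i (z - b)
  else fine (e.2 [set z]).

Lemma pk_ge0 e j z : 0 <= pk e j z.
Proof.
elim: j z => [|j IH] z /=; first exact: fine_ge0.
by apply: sumr_ge0 => b _; rewrite mulr_ge0 // fine_ge0.
Qed.

Lemma Sj0 X k z : [set w | S X k 0 w = z] = immig X k.+1 @^-1` [set z].
Proof. by apply/seteqP; split => w /=; rewrite /S big_ord0. Qed.

Lemma Sj1 X k j z : [set w | S X k j.+1 w = z] =
  \big[setU/set0]_(b < z.+1)
    (offspring X k j @^-1` [set (b : nat)] `&` [set w | S X k j w = (z - b)%N]).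
Proof.
rewrite -(bigcup_mkord _ (fun b => offspring X k j @^-1` [set b] `&`
  [set w | S X k j w = (z - b)%N])); apply/seteqP; split => w /=.
- rewrite /S big_ord_recr/= => e; exists (offspring X k j w) => /=.
    by rewrite -e ltnS -addnA addnCA leq_addr.
  by split => //; rewrite -e -addnA addnCA addKn.
- case=> b /= bz [e1 e2].
  by move: e2; rewrite /S big_ord_recr/= e1 addnAC => ->; rewrite subnK.
Qed.

(** Constraints on finitely many variables are kept in a list, so that an induction can add one of
    them; [lookup] recovers the family of sets that [mechanism] expects. *)
Fixpoint cyl X (l : seq (V * set nat)) : set T :=
  if l is c :: l' then mech_var X c.1 @^-1` c.2 `&` cyl X l' else setT.

Fixpoint lookup (l : seq (V * set nat)) (v : V) : set nat :=
  if l is c :: l' then (if v == c.1 then c.2 else lookup l' v) else setT.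

Lemma cylE X l : uniq (map fst l) ->
  \bigcap_(v in [set` map fst l]) (mech_var X v @^-1` lookup l v) = cyl X l.
Proof.
elim: l => [|c l IH] /=; first by move=> _; apply/seteqP; split.
case/andP => cl ul; rewrite -IH//.
have ne v : v \in map fst l -> (v == c.1) = false.
  by move=> vl; apply/eqP => e; rewrite -e vl in cl.
apply/seteqP; split => w /= H.
- split; first by have := H c.1; rewrite /= mem_head eqxx; exact.
  by move=> v /= vl; have := H v; rewrite /= inE vl orbT ne//; exact.
- case: H => H1 H2 v /=; rewrite inE; case: eqP => [-> //|_ /= vl].
  exact: H2.
Qed.

Definition mlaw X (c : V * set nat) w : R := fine (mech_law X c.1 w c.2).

Lemma mlaw_ge0 X c w : 0 <= mlaw X c w. Proof. exact: fine_ge0. Qed.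

Lemma mechanism_cyl P X A l : mechanism P X ->
  sigma_gen setT (env X) A -> uniq (map fst l) ->
  (P (A `&` cyl X l) = \int[P]_(w in A) (\prod_(c <- l) mlaw X c w)%:E)%E.
Proof.
move=> mech sA ul; rewrite -cylE// mech//.
apply: eq_integral => w _; rewrite /mlaw.
elim: l ul => [|c l IH] /=; first by rewrite !big_nil.
case/andP => cl ul; rewrite !big_cons/= eqxx EFinM fineK ?fin_num_measure//.
congr (_ * _)%E; rewrite -IH//.
apply: eq_big_seq => v vl.
by case: eqP vl cl => // -> ->.
Qed.

Definition gen (v : V) : nat := match v with inl (n, _) => n | inr n => n end.

Fixpoint PS X (r : seq nat) (a b : nat -> nat) : set T :=
  if r is n :: r' then [set w | S X n (a n) w = b n] `&` PS X r' a b else setT.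

Lemma measurable_S X k j z : measurable [set w | S X k j w = z].
Proof.
elim: j z => [|j IH] z.
  by rewrite Sj0 -[X in measurable X]setTI; exact: measurable_funP.
rewrite Sj1; apply: bigsetU_measurable => b _; apply: measurableI => //.
by rewrite -[X in measurable X]setTI; exact: measurable_funP.
Qed.

Lemma measurable_PS X r a b : measurable (PS X r a b).
Proof. by elim: r => //= n r IH; apply: measurableI => //; exact: measurable_S. Qed.

Lemma measurable_mech_var X v B : measurable (mech_var X v @^-1` B).
Proof. by case: v => [[n i]|n] /=; rewrite -[X in measurable X]setTI; exact: measurable_funP. Qed.

Lemma measurable_cyl X l : measurable (cyl X l).
Proof. by elim: l => //= c l IH; apply: measurableI => //; exact: measurable_mech_var. Qed.

Lemma sigma_gen_measurable d' (T' : measurableType d') (I : Type) (J : set I)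
    (Y : I -> T -> T') : (forall i, measurable_fun setT (Y i)) ->
  sigma_gen J Y `<=` measurable.
Proof.
move=> mY; apply: smallest_sub; first exact: sigma_algebra_measurable.
by move=> A [i Ji [B mB <-]]; exact: mY.
Qed.

Lemma sigma_env_measurable X J : sigma_gen J (env X) `<=` measurable.
Proof. by apply: sigma_gen_measurable => i; exact: measurable_funP. Qed.

Lemma measurable_eval (B : set nat) : measurable_fun setT (fun q : pprobability nat R => q B).
Proof. exact: (measurable_kernel (kprobability (@measurable_id _ (pprobability nat R) setT))). Qed.

Lemma measurable_pk j z : measurable_fun setT (fun e : mark R => pk e j z).
Proof.
elim: j z => [|j IH] z /=.
  by apply: measurableT_comp => //; apply: (measurableT_comp (measurable_eval _)).
apply: measurable_sum => b; apply: measurable_funM => //.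
by apply: measurableT_comp => //; apply: (measurableT_comp (measurable_eval _)).
Qed.

Lemma measurable_mlaw X c : measurable_fun setT (mlaw X c).
Proof.
rewrite /mlaw; apply: measurableT_comp => //; case: c => -[[n i]|n] B /=.
- apply: (measurableT_comp (measurable_eval B)).
  by apply: (measurableT_comp measurable_fst); exact: measurable_funP.
- apply: (measurableT_comp (measurable_eval B)).
  by apply: (measurableT_comp measurable_snd); exact: measurable_funP.
Qed.

(** Given the environment, distinct generations are independent and contribute the factors [pk]. The
    extra list [l] carries the induction: removing the last individual of a generation turns its
    offspring number into a constraint of [l]. *)
Lemma mechanism_PS P X A r a b l : mechanism P X ->
  sigma_gen setT (env X) A -> uniq r -> uniq (map fst l) ->
  {in map fst l, forall v, gen v \notin r} ->
  (P (A `&` (PS X r a b `&` cyl X l)) =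
   \int[P]_(w in A) (\prod_(i <- r) pk (env X i w) (a i) (b i)
                     * \prod_(c <- l) mlaw X c w)%:E)%E.
Proof.
move=> mech sA; elim: r l => [|n r IH] l /=.
  move=> _ ul _; rewrite setTI mechanism_cyl//.
  by apply: eq_integral => w _; rewrite big_nil mul1r.
case/andP => nr ur ul lr.
have mA : measurable A by exact: sigma_env_measurable sA.
(* Inside generation [n], the list may already constrain individuals of index at least [j], but
   neither those below [j] nor the immigration. *)
suff H : forall j z l, uniq (map fst l) ->
  {in map fst l, forall v, gen v \notin r} ->
  {in map fst l, forall v, v != inr n /\ forall i, (i < j)%N -> v != inl (n, i)} ->
  (P (A `&` (PS X r a b `&` ([set w | S X n j w = z] `&` cyl X l))) =
   \int[P]_(w in A) (\prod_(i <- r) pk (env X i w) (a i) (b i)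
       * (pk (env X n w) j z * \prod_(c <- l) mlaw X c w))%:E)%E.
  rewrite -[in LHS](setIA [set w | S X n (a n) w = b n]) setICA.
  rewrite H//.
  - by apply: eq_integral => w _; rewrite big_cons mulrCA mulrA.
  - by move=> v vl; have := lr v vl; rewrite inE negb_or => /andP[].
  - by move=> v vl; have := lr v vl; rewrite inE negb_or => /andP[] /eqP gn _;
      split => [|i _]; apply/eqP => ev; rewrite ev in gn.
elim => [|j IHj] z {ul lr}l ul lr ln.
  rewrite Sj0.
  have /= := IH ((inr n, [set z]) :: l) ur; rewrite ul andbT => -> //.
  - by apply: eq_integral => w _; rewrite big_cons.
  - by apply/negP => /ln[]; rewrite eqxx.
  - by move=> v; rewrite inE => /orP[/eqP ->//|]; exact: lr.
pose F b0 := A `&` (PS X r a b `&` ([set w | S X n j w = (z - b0)%N] `&`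
   cyl X ((inl (n, j), [set b0]) :: l))).
have -> : A `&` (PS X r a b `&` ([set w | S X n j.+1 w = z] `&` cyl X l)) =
   \big[setU/set0]_(b0 < z.+1) F b0.
  rewrite Sj1 big_distrl/= big_distrr/= big_distrr/=; apply: eq_bigr => b0 _.
  rewrite /F/=; congr (_ `&` (_ `&` _)).
  by rewrite setICA setIA.
have mF b0 : measurable (F b0).
  rewrite /F; apply: measurableI => //; apply: measurableI.
    exact: measurable_PS.
  by apply: measurableI; [exact: measurable_S|exact: measurable_cyl].
rewrite measure_bigsetU//; last first.
  apply/trivIsetP => i k _ _ ik; rewrite -subset0 => w [] [_ [_ [_ []]]] /= e1 _.
  by case=> _ [_ [_ []]] /= e2 _; move: ik; rewrite -e1 -e2 eqxx.
under [RHS]eq_integral.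
  move=> w _.
  have -> : (\prod_(i <- r) pk (env X i w) (a i) (b i)
       * (pk (env X n w) j.+1 z * \prod_(c <- l) mlaw X c w))%:E =
    (\sum_(b0 < z.+1) (\prod_(i <- r) pk (env X i w) (a i) (b i) *
     (pk (env X n w) j (z - b0) * \prod_(c <- (inl (n, j), [set (b0 : nat)]) :: l)
          mlaw X c w))%:E)%E.
    rewrite sumEFin; congr EFin; rewrite /= mulr_suml mulr_sumr.
    apply: eq_bigr => b0 _; rewrite big_cons.
    have -> : mlaw X (inl (n, j), [set (b0 : nat)]) w = fine ((env X n w).1 [set (b0 : nat)]) by [].
    by ring.
  over.
rewrite ge0_integral_sum//=; last 2 first.
- move=> b0; apply/measurable_EFinP; apply: measurable_funTS.
  apply: measurable_funM; first by apply: measurable_prod => i _;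
    apply: (measurableT_comp (measurable_pk _ _)); exact: measurable_funP.
  apply: measurable_funM; first by apply: (measurableT_comp (measurable_pk _ _)); exact: measurable_funP.
  by apply: measurable_prod => i _; exact: measurable_mlaw.
- move=> b0 w _; rewrite lee_fin mulr_ge0 ?mulr_ge0 ?prodr_ge0 ?pk_ge0// => *;
  by rewrite ?pk_ge0 ?mlaw_ge0.
apply: eq_bigr => b0 _; rewrite IHj//.
- rewrite /= ul andbT; apply/negP => /ln[_ /(_ j)]; rewrite ltnSn eqxx.
  by move=> /(_ isT).
- by move=> v; rewrite inE => /orP[/eqP ->//|]; exact: lr.
- move=> v; rewrite inE => /orP[/eqP ->//=|/ln[v1 v2]]; last by split => // i ij; apply: v2; rewrite ltnS ltnW.
  split => // i ij; apply/eqP => -[ji]; by rewrite ji ltnn in ij.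
Qed.

End genealogy.

(** * Independence extended from generators *)

Section measure_aux.
Context d (T : measurableType d) (R : realType).
Implicit Types (P : probability T R).

Lemma measurable_preimage d' (T' : measurableType d') (f : T -> T') B :
  measurable_fun setT f -> measurable B -> measurable (f @^-1` B).
Proof. by move=> mf mB; rewrite -[X in measurable X]setTI; exact: mf. Qed.

Lemma measurable_nat_fun (f : T -> nat) :
  (forall z, measurable [set w | f w = z]) -> measurable_fun setT f.
Proof.
move=> H _ Y _; rewrite setTI.
have -> : f @^-1` Y = \bigcup_(z in Y) [set w | f w = z].
  by apply/seteqP; split => [w Yw|w [z + /= fz]] /=; [exists (f w)|rewrite -fz].
exact: bigcup_measurable.
Qed.

(** The restriction of [P] to [D] and the multiple P(D) P are finite measures that agree on the
    pi-system. *)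
Lemma indep_ext P (G : set (set T)) (D : set T) :
  setI_closed G -> G `<=` measurable -> measurable D -> G setT ->
  (forall B, G B -> P (B `&` D) = (P B * P D)%E) ->
  forall B, <<s G >> B -> P (B `&` D) = (P B * P D)%E.
Proof.
move=> IG Gm mD GT H B sB.
pose c := fine (P D).
have c0 : (0 <= c)%R by exact: fine_ge0.
have PD : P D = c%:E by rewrite fineK ?fin_num_measure.
pose cn : {nonneg R} := NngNum c0.
have cover : \bigcup_(k : nat) (setT : set T) = setT.
  by rewrite bigcup_const//; exists 0%N.
have GE A : G A -> mrestr P mD A = mscale cn P A.
  by move=> GA; rewrite /mrestr /mscale/= H// PD muleC.
have Goo (k : nat) : (mrestr P mD setT < +oo)%E by rewrite /mrestr setTI PD ltry.
have := @g_sigma_algebra_measure_unique _ _ _ G Gm (fun=> setT) (fun=> GT) cover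
  (mrestr P mD) (mscale cn P) IG GE Goo B sB.
by move=> e; transitivity (c%:E * P B)%E; [exact: e|rewrite PD muleC].
Qed.

Lemma indep_prod d1 d2 (T1 : measurableType d1)
    (T2 : measurableType d2) P (X : T -> T1) (Y : T -> T2) :
  measurable_fun setT X -> measurable_fun setT Y ->
  (forall A B, measurable A -> measurable B ->
    P (X @^-1` A `&` Y @^-1` B) = (P (X @^-1` A) * P (Y @^-1` B))%E) ->
  forall (f : T1 -> \bar R) (g : T2 -> \bar R), (forall x, 0 <= f x)%E ->
    (forall x, 0 <= g x)%E -> measurable_fun setT f -> measurable_fun setT g ->
    (\int[P]_w (f (X w) * g (Y w)) = \int[P]_w f (X w) * \int[P]_w g (Y w))%E.
Proof.
move=> mX mY ind f g f0 g0 mf mg.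
have mh : measurable_fun setT (fun z : T1 * T2 => (f z.1 * g z.2)%E).
  apply: emeasurable_funM; first exact: (measurableT_comp mf measurable_fst).
  exact: (measurableT_comp mg measurable_snd).
have h0 (z : T1 * T2) : (0 <= f z.1 * g z.2)%E by apply: mule_ge0.
rewrite (independent_tonelli mX mY ind h0 mh)/=.
under eq_integral.
  move=> w _; rewrite ge0_integralZl//; [over|exact: measurableT_comp].
rewrite ge0_integralZr//; first exact: measurableT_comp.
by apply: integral_ge0 => w _.
Qed.

End measure_aux.

(** * The past of environment and population up to a generation *)

Section past.
Context d (T : measurableType d) (R : realType).
Implicit Types (P : probability T R) (X : bprei_data T R).

Definition zpath X (z : nat -> nat) n : set T := [set w | forall i, (i <= n)%N -> Z X i w = z i].

Fixpoint desc n := if n is m.+1 then m :: desc m else [::].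

Lemma mem_desc n i : (i \in desc n) = (i < n)%N.
Proof.
elim: n => [|n IH] /=; first by rewrite ltn0.
by rewrite inE IH ltnS [in RHS]leq_eqVlt.
Qed.

Lemma desc_uniq n : uniq (desc n).
Proof. by elim: n => //= n ->; rewrite mem_desc ltnn. Qed.

Lemma PS_eq X r a b a' b' : {in r, a =1 a'} -> {in r, b =1 b'} ->
  PS X r a b = PS X r a' b'.
Proof.
elim: r => //= n r IH ha hb; rewrite ha ?mem_head// hb ?mem_head//.
by rewrite IH// => i ir; [apply: ha|apply: hb]; rewrite inE ir orbT.
Qed.

(** Along a prescribed path each Z_i in the recursion can be replaced by the value z i, so that no
    sum of random length remains. *)
Lemma zpathE X z n : zpath X z n =
  [set w | Z0 X w = z 0%N] `&` PS X (desc n) z (fun i => z i.+1).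
Proof.
elim: n => [|n IH].
  apply/seteqP; split => w /=; first by move=> H; split => //; exact: (H 0%N).
  by move=> [e _] i; rewrite leqn0 => /eqP ->.
have -> : zpath X z n.+1 = [set w | S X n (z n) w = z n.+1] `&` zpath X z n.
  apply/seteqP; split => w /=.
    move=> H; split; last by move=> i ni; apply: H; rewrite leqW.
    by rewrite -(H n.+1)//= (H n).
  by move=> [H1 H2] i; rewrite leq_eqVlt ltnS => /orP[/eqP -> /=|/H2//]; rewrite H2.
by rewrite IH setICA.
Qed.

Lemma measurable_Z0 X B : measurable (Z0 X @^-1` B).
Proof. by rewrite -[X in measurable X]setTI; exact: measurable_funP. Qed.

Lemma measurable_path X z n : measurable (zpath X z n).
Proof.
rewrite zpathE; apply: measurableI; last exact: measurable_PS.
exact: (measurable_Z0 X [set z 0%N]).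
Qed.

Lemma measurable_Z X n : measurable_fun setT (Z X n).
Proof.
elim: n => [|n IH]; first exact: measurable_funP.
apply: measurable_nat_fun => z.
have -> : [set w | Z X n.+1 w = z] =
    \bigcup_j ([set w | Z X n w = j] `&` [set w | S X n j w = z]).
  apply/seteqP; split => w /=; first by move=> e; exists (Z X n w).
  by move=> [j _ /= [<-]].
apply: bigcup_measurable => j _; apply: measurableI; last exact: measurable_S.
exact: (measurable_preimage IH (B := [set j])).
Qed.

Lemma sigma_genS d' (T' : measurableType d') (I : Type) (J K : set I)
    (Y : I -> T -> T') : J `<=` K -> sigma_gen J Y `<=` sigma_gen K Y.
Proof.
move=> JK; apply: smallest_sub; first exact: smallest_sigma_algebra.
by move=> A [i Ji H]; apply: sub_sigma_algebra; exists i => //; exact: JK.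
Qed.

Lemma PS_sigma X A r a b : sigma_gen setT (env X) A ->
  <<s sigma_gen setT (env X) `|` sigma_gen setT (mech_var X) >> (A `&` PS X r a b).
Proof.
move=> sA; set H := _ `|` _.
have mv v B : <<s H >> (mech_var X v @^-1` B).
  apply: sub_sigma_algebra; right; apply: sub_sigma_algebra; exists v => //.
  by exists B => //; rewrite setTI.
have mS k j z : measurable ([set w | S X k j w = z] : set (g_sigma_algebraType H)).
  elim: j z => [|j IH] z; first by rewrite Sj0; exact: (mv (inr k)).
  rewrite Sj1; apply: bigsetU_measurable => i _; apply: measurableI => //.
  exact: (mv (inl (k, j))).
have mA : measurable (A : set (g_sigma_algebraType H)).
  by apply: sub_sigma_algebra; left.
suff : measurable (A `&` PS X r a b : set (g_sigma_algebraType H)) by [].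
apply: measurableI => //.
elim: r => [|n r IH] /=; first exact: (@measurableT _ (g_sigma_algebraType H)).
exact: measurableI.
Qed.

Lemma mechanism_path P X A z a b r : mechanism P X -> Z0_independent P X ->
  sigma_gen setT (env X) A -> uniq r ->
  (P (A `&` ([set w | Z0 X w = z] `&` PS X r a b)) = P [set w | Z0 X w = z] *
   \int[P]_(w in A) (\prod_(i <- r) pk (env X i w) (a i) (b i))%:E)%E.
Proof.
move=> mech hZ sA ur.
rewrite setICA setIC (hZ _ [set z]); last exact: PS_sigma.
rewrite muleC; congr (_ * _)%E.
have := mechanism_PS a b (l := [::]) mech sA ur isT.
rewrite /= setIT => ->//; by apply: eq_integral => w _; rewrite big_nil mulr1.
Qed.

(** Events that constrain each of the first [k] marks separately form a pi-system; on them the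
    factorisation is mutual independence for the list [k :: iota 0 k]. *)
Lemma env_past_indep P X k A C : mutually_independent P (env X) ->
  sigma_gen `I_k (env X) A -> measurable C ->
  P (A `&` env X k @^-1` C) = (P A * P (env X k @^-1` C))%E.
Proof.
move=> ind sA mC.
pose G := [set \bigcap_(i in [set` iota 0 k]) (env X i @^-1` B i) |
    B in [set B : nat -> set (mark R) | forall i, measurable (B i)]].
have mE i B : measurable B -> measurable (env X i @^-1` B).
  by move=> mB; exact: measurable_preimage.
apply: (@indep_ext _ _ _ P G (env X k @^-1` C)).
- move=> _ _ [B mB <-] [B' mB' <-].
  exists (fun i => B i `&` B' i); first by move=> i; exact: measurableI.
  by rewrite -bigcapI.
- by move=> _ [B mB <-]; apply: fin_bigcap_measurable => // i _; exact: mE.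
- exact: mE.
- exists (fun=> setT); first by move=> i; exact: measurableT.
  by apply/seteqP; split.
- move=> _ [B mB <-].
  pose B' i := if i == k then C else B i.
  have mB' i : measurable (B' i) by rewrite /B'; case: ifP.
  have neq i : i \in iota 0 k -> (i == k) = false.
    by rewrite mem_iota /= => ik; apply/eqP => e; rewrite e add0n ltnn in ik.
  have e1 : \bigcap_(i in [set` iota 0 k]) (env X i @^-1` B i) =
            \bigcap_(i in [set` iota 0 k]) (env X i @^-1` B' i).
    by apply: eq_bigcapr => i /= /neq e; rewrite /B' e.
  have Bk : B' k = C by rewrite /B' eqxx.
  have u1 : uniq (k :: iota 0 k) by rewrite /= iota_uniq mem_iota add0n ltnn.
  have i1 := ind (k :: iota 0 k) B' u1 mB'.
  have i2 := ind (iota 0 k) B' (iota_uniq _ _) mB'.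
  rewrite big_cons Bk -i2 in i1.
  rewrite e1 muleC -i1.
  congr (P _); apply/seteqP; split => w /=.
    move=> [H1 H2] i; rewrite /= inE => /orP[/eqP ->|ii]; first by rewrite Bk.
    exact: H1.
  move=> H; split; last by have := H k; rewrite /= mem_head Bk; exact.
  by move=> i /= ii; have := H i; rewrite /= inE ii orbT; exact.
- move: A sA; apply: smallest_sub; first exact: smallest_sigma_algebra.
  move=> _ [i /= ik [B mB <-]]; apply: sub_sigma_algebra.
  exists (fun j => if j == i then B else setT); first by move=> j; case: ifP => // _; exact: measurableT.
  rewrite setTI; apply/seteqP; split => w /=.
    by move=> /(_ i); rewrite eqxx /= mem_iota; exact.
  by move=> H j _; case: eqP => [->|].
Qed.

(** Generators of the sigma-algebra of the marks before [k] and the sizes up to [k]. The whole space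
    is adjoined because the uniqueness theorem for measures asks for it in the pi-system. *)
Definition past_gen X k : set (set T) :=
  [set B | B = setT \/ exists A z, sigma_gen `I_k (env X) A /\ B = A `&` zpath X z k].

Definition past X k := <<s past_gen X k >>.

Lemma past_genI X k : setI_closed (past_gen X k).
Proof.
move=> B B' [->|[A [z [sA ->]]]]; first by rewrite setTI.
move=> [->|[A' [z' [sA' ->]]]]; first by rewrite setIT; right; exists A, z.
(* Two paths that differ somewhere up to [k] are incompatible; the empty intersection is written as
   a generator with environment event [set0]. *)
right; have [e|ne] := pselect (forall i, (i <= k)%N -> z i = z' i).
  exists (A `&` A'), z; split.
    exact: (@measurableI _ (g_sigma_algebraType (\bigcup_(i in `I_k) preimage_set_system setT (env X i) measurable))).
  rewrite setIACA; congr (_ `&` _).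
  apply/seteqP; split => w /=; first by case.
  by move=> H; split => // i ik; rewrite -e//; exact: H.
exists set0, z; split.
  exact: (@measurable0 _ (g_sigma_algebraType (\bigcup_(i in `I_k) preimage_set_system setT (env X i) measurable))).
rewrite set0I -subset0 => w [[_ H] [_ H']]; apply: ne => i ik.
by rewrite -(H i)// (H' i).
Qed.

Lemma past_gen_measurable X k : past_gen X k `<=` measurable.
Proof.
move=> B [->|[A [z [sA ->]]]]; first exact: measurableT.
apply: measurableI; last exact: measurable_path.
exact: sigma_env_measurable sA.
Qed.

Lemma past_measurable X k : past X k `<=` measurable.
Proof.
apply: smallest_sub; first exact: sigma_algebra_measurable.
exact: past_gen_measurable.
Qed.

Lemma past_env X k A : sigma_gen `I_k (env X) A -> past X k A.
Proof.
move=> sA.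
(* Finite sequences of naturals are countably many and cover all paths up to [k]. *)
have -> : A = \bigcup_(s : seq nat) (A `&` zpath X (nth 0%N s) k).
  apply/seteqP; split => [w Aw|w [s _ []]]//.
  exists [seq Z X i w | i <- iota 0 k.+1] => //; split => // i ik.
  by rewrite (nth_map 0%N) ?size_iota ?nth_iota.
apply: (@countable_bigcupT_measurable _ (g_sigma_algebraType (past_gen X k))) => //.
by move=> s; apply: sub_sigma_algebra; right; exists A, (nth 0%N s).
Qed.

Lemma past_Z X k i B : (i <= k)%N -> past X k (Z X i @^-1` B).
Proof.
move=> ik.
have -> : Z X i @^-1` B =
    \bigcup_(s : seq nat) ((if nth 0%N s i \in B then setT else set0) `&` zpath X (nth 0%N s) k).
  apply/seteqP; split => [w Bw|w [s _ []]].
    exists [seq Z X i w | i <- iota 0 k.+1] => //; split => [|j jk].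
      by rewrite (nth_map 0%N) ?size_iota// nth_iota//= mem_set.
    by rewrite (nth_map 0%N) ?size_iota ?nth_iota.
  by case: ifP => // /set_mem Bs _ H; rewrite /preimage/= H.
pose U := g_sigma_algebraType (\bigcup_(i in `I_k) preimage_set_system setT (env X i) measurable).
apply: (@countable_bigcupT_measurable _ (g_sigma_algebraType (past_gen X k))) => //.
move=> s; apply: sub_sigma_algebra; right; exists (if nth 0%N s i \in B then setT else set0), (nth 0%N s).
by split => //; case: ifP => _; [exact: (@measurableT _ U)|exact: (@measurable0 _ U)].
Qed.

End past.

Lemma integral_indic_mul d (T : measurableType d) (R : realType) (P : {measure set T -> \bar R}) (A : set T) (f : T -> \bar R) :
  (\int[P]_(w in A) f w = \int[P]_w (f w * (\1_A w)%:E))%E.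
Proof.
rewrite integral_mkcond; apply: eq_integral => w _.
by rewrite patchE indicE; case: ifP => _; rewrite ?mule1 ?mule0.
Qed.

(** * The Markov property *)

Section markov.
Context d (T : measurableType d) (R : realType).
Implicit Types (P : probability T R) (X : bprei_data T R).

Definition markmean (e : mark R) : R := fine (mean e.1).

Lemma measurable_markmean : measurable_fun setT markmean.
Proof.
apply: measurableT_comp => //; apply: measurableT_comp; last exact: measurable_fst.
apply: (measurable_fun_integral_kernel (l := fun q : pprobability nat R => (q : {measure set nat -> \bar R}))).
- by move=> U _; exact: measurable_eval.
- by move=> z; rewrite lee_fin.
- by [].
Qed.

Lemma ME X n w : M X n w = markmean (env X n w). Proof. by []. Qed.

Lemma markmean_ge0 e : 0 <= markmean e.
Proof. by apply/fine_ge0/integral_ge0 => k _; rewrite lee_fin. Qed.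

Lemma M_ge0 X n w : 0 <= M X n w. Proof. exact: markmean_ge0. Qed.

Definition Pik X k l w : R := \prod_(i < l) M X (k + i) w.

Lemma Pik0 X l w : Pik X 0 l w = Pi X l w. Proof. by []. Qed.

Lemma Pik_ge0 X k l w : 0 <= Pik X k l w.
Proof. by apply: prodr_ge0 => i _; exact: M_ge0. Qed.

Lemma Pi_ge0 X l w : 0 <= Pi X l w. Proof. exact: (Pik_ge0 X 0). Qed.

Lemma sub_sigma_fun d' (T' : measurableType d') (G H : set (set T)) (f : T -> T') :
  G `<=` <<s H >> ->
  measurable_fun setT (f : g_sigma_algebraType G -> T') ->
  measurable_fun setT (f : g_sigma_algebraType H -> T').
Proof.
move=> GH mf _ B mB; have := mf measurableT B mB.
have : <<s G >> `<=` <<s H >>.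
  by apply: smallest_sub => //; exact: smallest_sigma_algebra.
by move=> /[apply].
Qed.

Definition envs X (J : set nat) := \bigcup_(i in J) preimage_set_system setT (env X i) measurable.

Lemma envs_env X J i : J i -> measurable_fun setT (env X i : g_sigma_algebraType (envs X J) -> mark R).
Proof. by move=> Ji _ B mB; apply: sub_sigma_algebra; exists i => //; exists B. Qed.

Lemma envs_M X J i : J i -> measurable_fun setT (M X i : g_sigma_algebraType (envs X J) -> R).
Proof. move=> Ji; have h := measurableT_comp measurable_markmean (@envs_env X J i Ji); exact h. Qed.

Lemma envs_Pi X n : measurable_fun setT (Pi X n : g_sigma_algebraType (envs X `I_n) -> R).
Proof. by apply: measurable_prod => -[i ni] _; exact: envs_M. Qed.

Lemma envs_pk X J i j z : J i ->
  measurable_fun setT (fun w : g_sigma_algebraType (envs X J) => pk (env X i w) j z).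
Proof. move=> Ji; have h := measurableT_comp (@measurable_pk R j z) (@envs_env X J i Ji); exact h. Qed.

Lemma measurable_env X i : measurable_fun setT (env X i). Proof. exact: measurable_funP. Qed.

Lemma measurable_M X i : measurable_fun setT (M X i).
Proof. by apply: (measurableT_comp measurable_markmean); exact: measurable_env. Qed.

Lemma measurable_Pik X k n : measurable_fun setT (Pik X k n).
Proof. by apply: measurable_prod => i _; exact: measurable_M. Qed.

Lemma measurable_Pi X n : measurable_fun setT (Pi X n).
Proof. exact: (measurable_Pik X 0). Qed.

Lemma measurable_id_sub (G : set (set T)) : G `<=` measurable ->
  measurable_fun setT (id : T -> g_sigma_algebraType G).
Proof.
move=> Gm _ B mB; rewrite setTI preimage_id.
by apply: (smallest_sub (@sigma_algebra_measurable _ T) Gm).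
Qed.

Lemma envs_measurable X J : envs X J `<=` measurable.
Proof. by move=> A sA; apply: (sigma_env_measurable (X := X) (J := J)); exact: sub_sigma_algebra. Qed.

(** The constant [c] will be the probability of a past event independent of the variable under
    study. *)
Lemma eq_law_set d1 d2 d' (T1 : measurableType d1) (T2 : measurableType d2)
    (T' : measurableType d') (P1 : {measure set T1 -> \bar R})
    (P2 : {measure set T2 -> \bar R})
    (X1 : T1 -> T') (X2 : T2 -> T') (B1 : set T1) (B2 : set T2) (c : R) :
  measurable_fun setT X1 -> measurable_fun setT X2 -> measurable B1 -> measurable B2 ->
  0 <= c -> (P1 B1 < +oo)%E ->
  (forall C, measurable C -> P1 (B1 `&` X1 @^-1` C) = (c%:E * P2 (B2 `&` X2 @^-1` C))%E) ->
  forall f : T' -> \bar R, (forall x, 0 <= f x)%E -> measurable_fun setT f ->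
  (\int[P1]_(w in B1) f (X1 w) = c%:E * \int[P2]_(w in B2) f (X2 w))%E.
Proof.
move=> mX1 mX2 mB1 mB2 c0 foo h f f0 mf.
rewrite (integral_indic_mul P1 B1) (integral_indic_mul P2 B2).
rewrite (@eq_weighted_law _ _ _ _ _ _ _ P1 P2 \1_B1 (fun w => c * \1_B2 w) X1 X2 measurable)//.
- under eq_integral do rewrite EFinM muleCA.
  rewrite ge0_integralZl//.
  + apply: emeasurable_funM; first exact: measurableT_comp.
    exact/measurable_EFinP.
  + by move=> x _; rewrite mule_ge0// lee_fin.
- exact: measurable_funM.
- by move=> x; rewrite mulr_ge0.
- by rewrite sigma_algebra_id//; exact: sigma_algebra_measurable.
- by move=> A B; exact: measurableI.
- by rewrite integral_indic// setIT.
- move=> C mC.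
  have m1 := measurable_preimage mX1 mC; have m2 := measurable_preimage mX2 mC.
  rewrite integral_indic// h//.
  under eq_integral do rewrite EFinM.
  by rewrite ge0_integralZl ?integral_indic//; exact/measurable_EFinP.
Qed.

Lemma identically_distributed_integral P X k (f : mark R -> \bar R) :
  identically_distributed P (env X) -> (forall x, 0 <= f x)%E -> measurable_fun setT f ->
  (\int[P]_w f (env X k w) = \int[P]_w f (env X 0 w))%E.
Proof.
move=> idd f0 mf; apply: (@eq_law _ _ _ _ _ _ _ P P (env X k) (env X 0) measurable) => //.
- by rewrite sigma_algebra_id//; exact: sigma_algebra_measurable.
- by move=> A B; exact: measurableI.
- by move=> B mB; exact: idd.
Qed.

Lemma mechanism_one P X k C j z : mechanism P X -> measurable C ->
  (P (env X k @^-1` C `&` [set w | S X k j w = z]) =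
   \int[P]_w (\1_C (env X k w) * pk (env X k w) j z)%:E)%E.
Proof.
move=> mech mC.
have sC : sigma_gen setT (env X) (env X k @^-1` C).
  by apply: sub_sigma_algebra; exists k => //; exists C => //; rewrite setTI.
have := @mechanism_PS _ _ _ P X _ [:: k] (fun=> j) (fun=> z) [::] mech sC isT isT.
rewrite /= !setIT => ->//; rewrite integral_indic_mul; apply: eq_integral => w _.
by rewrite big_nil big_seq1 mulr1 muleC.
Qed.

(** For a generator of the past, path and next step form one event of the type [PS], whose
    conditional probability is a product: a function of the marks before [k] times a function of
    mark [k]. Independence of the marks separates the two, and their common law replaces [k] by
    0. *)
Lemma past_next P X k B C j z : is_bprei P X -> past X k B -> measurable C ->
  (P (B `&` (env X k @^-1` C `&` [set w | S X k j w = z])) =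
   P B * P (env X 0 @^-1` C `&` [set w | S X 0 j w = z]))%E.
Proof.
move=> hX + mC.
have [ind idd mech hZ _] := hX.
have fm : measurable_fun setT (fun e : mark R => (\1_C e * pk e j z)%:E).
  by apply/measurable_EFinP; apply: measurable_funM => //; exact: measurable_pk.
have f0 (e : mark R) : (0 <= (\1_C e * pk e j z)%:E)%E.
  by rewrite lee_fin mulr_ge0// pk_ge0.
have same : P (env X k @^-1` C `&` [set w | S X k j w = z]) =
            P (env X 0 @^-1` C `&` [set w | S X 0 j w = z]).
  rewrite !mechanism_one//.
  by rewrite (@identically_distributed_integral P X k (fun e => (\1_C e * pk e j z)%:E)).
rewrite -same => sB.
apply: (indep_ext (G := past_gen X k)) sB.
- exact: past_genI.
- exact: past_gen_measurable.
- apply: measurableI; last exact: measurable_S.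
  by apply: measurable_preimage => //; exact: measurable_env.
- by left.
move=> _ [->|[A [y [sA ->]]]]; first by rewrite setTI probability_setT mul1e.
have sAT : sigma_gen setT (env X) A by apply: sigma_genS sA.
have mA : measurable A by exact: sigma_env_measurable sA.
have mEC : measurable (env X k @^-1` C) by apply: measurable_preimage => //; exact: measurable_env.
have sAC : sigma_gen setT (env X) (A `&` env X k @^-1` C).
  apply: (@measurableI _ (g_sigma_algebraType (envs X setT))) => //.
  by apply: sub_sigma_algebra; exists k => //; exists C => //; rewrite setTI.
(* The path up to [k] is prolonged by the step from [j] to [z], whatever the path does at time
   [k]. *)
pose a i := if i == k then j else y i.
pose b i := if i == k then z else y i.+1.
have neq i : i \in desc k -> (i == k) = false.
  by rewrite mem_desc => ik; apply/eqP => e; rewrite e ltnn in ik.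
have -> : A `&` zpath X y k `&` (env X k @^-1` C `&` [set w | S X k j w = z]) =
   A `&` env X k @^-1` C `&` ([set w | Z0 X w = y 0%N] `&` PS X (k :: desc k) a b).
  rewrite setIACA zpathE [in RHS]/= /a /b !eqxx.
  rewrite [PS X _ (fun i => if _ then j else _) _](@PS_eq _ _ _ _ _ _ _ y (fun i => y i.+1)).
  - by congr (_ `&` _); rewrite -setIA; congr (_ `&` _); rewrite setIC.
  - by move=> i /neq ->.
  - by move=> i /neq ->.
rewrite mechanism_path//=; last by rewrite desc_uniq mem_desc ltnn.
rewrite zpathE mechanism_path ?desc_uniq// -muleA; congr (_ * _)%E.
rewrite mechanism_one// (integral_indic_mul P (A `&` _)) (integral_indic_mul P A).
(* The factor that depends on the marks before [k] only. *)
pose f (w : g_sigma_algebraType (envs X `I_k)) :=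
  ((\prod_(i <- desc k) pk (env X i w) (y i) (y i.+1))%:E * (\1_A w)%:E)%E.
have ei : measurable_fun setT (id : T -> g_sigma_algebraType (envs X `I_k)).
  exact: measurable_id_sub (@envs_measurable X `I_k).
have := @indep_prod _ T R _ _ (g_sigma_algebraType (envs X `I_k)) _ P id (env X k) ei (measurable_env X k) _ f
  (fun e => (\1_C e * pk e j z)%:E) _ f0 _ fm.
move=> <-.
- apply: eq_integral => w _.
  rewrite /f big_cons {1}/a {1}/b eqxx indicI /= -!EFinM; congr EFin.
  rewrite (eq_big_seq (fun i => pk (env X i w) (y i) (y i.+1))); last first.
    by move=> i ik; rewrite /a /b neq.
  have -> : \1_(env X k @^-1` C) w = \1_C (env X k w) :> R by [].
  by ring.
- by move=> A' B' sA' mB'; exact: env_past_indep.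
- by move=> w; rewrite /f -EFinM lee_fin mulr_ge0// prodr_ge0// => i _; exact: pk_ge0.
- rewrite /f; apply: emeasurable_funM.
    apply/measurable_EFinP; apply: measurable_prod => i; rewrite mem_desc => ik.
    exact: envs_pk.
  apply/measurable_EFinP.
  exact: (@measurable_indic _ (g_sigma_algebraType (envs X `I_k)) R setT A).
Qed.

Lemma integral_nat_decomp (P : {measure set T -> \bar R}) (N : T -> nat) (B : set T) (g : T -> \bar R) :
  measurable_fun setT N -> measurable B -> measurable_fun setT g ->
  (forall w, 0 <= g w)%E ->
  (\int[P]_(w in B) g w = \sum_(0 <= j <oo) \int[P]_(w in B `&` N @^-1` [set j]) g w)%E.
Proof.
move=> mN mB mg g0.
have -> : B = \bigcup_j (B `&` N @^-1` [set j]).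
  by apply/seteqP; split => [w Bw|w [j _ []]]//; exists (N w).
rewrite ge0_integral_bigcup//.
- apply: eq_eseriesr => j _; congr integral; apply/seteqP; split => w.
  + by move=> H; split; [exists j|case: H].
  + by move=> [[i _ []]].
- by move=> j; apply: measurableI => //; exact: measurable_preimage.
- exact: measurable_funTS.
- by move=> i j _ _ [w [[_ /= <-] [_ /= <-]]].
Qed.

Lemma past_next_integral P X k B j (f : mark R -> nat -> \bar R) :
  is_bprei P X -> past X k B -> (forall e z, 0 <= f e z)%E ->
  (forall z, measurable_fun setT (f ^~ z)) ->
  (\int[P]_(w in B) f (env X k w) (S X k j w) =
   P B * \int[P]_w f (env X 0 w) (S X 0 j w))%E.
Proof.
move=> hX pB f0 mf.
have mB : measurable B by exact: past_measurable pB.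
have mS i : measurable_fun setT (S X i j).
  by apply: measurable_nat_fun => z; exact: measurable_S.
have mg i : measurable_fun setT (fun w => f (env X i w) (S X i j w)).
  move=> _ Y mY; rewrite setTI.
  have -> : (fun w => f (env X i w) (S X i j w)) @^-1` Y =
    \bigcup_z (S X i j @^-1` [set z] `&` (fun w => f (env X i w) z) @^-1` Y).
    by apply/seteqP; split => [w Yw|w [z _ [/= <-]]]//; exists (S X i j w).
  apply: bigcup_measurable => z _; apply: measurableI.
    exact: measurable_preimage.
  apply: measurable_preimage => //.
  by apply: measurableT_comp (mf z) _; exact: measurable_env.
rewrite (@integral_nat_decomp P (S X k j) B)//.
rewrite (@integral_nat_decomp P (S X 0 j) setT)//.
have PB : P B = (fine (P B))%:E by rewrite fineK ?fin_num_measure.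
rewrite PB -nneseriesZl//; last first.
  by move=> i _; apply: integral_ge0.
apply: eq_eseriesr => z _.
rewrite setTI.
have := @eq_law_set _ _ _ _ _ _ P P (env X k) (env X 0)
  (B `&` S X k j @^-1` [set z]) (S X 0 j @^-1` [set z]) (fine (P B))
  (measurable_env X k) (measurable_env X 0) _ _ _ _ _ (f ^~ z) (f0 ^~ z) (mf z).
move=> h; transitivity (\int[P]_(w in B `&` S X k j @^-1` [set z]) f (env X k w) z)%E.
  by apply: eq_integral => w; rewrite inE => -[_ /= ->].
rewrite h.
- by congr (_ * _)%E; apply: eq_integral => w; rewrite inE /= => ->.
- by apply: measurableI => //; exact: measurable_preimage.
- exact: measurable_preimage.
- exact: fine_ge0.
- by apply: (le_lt_trans (probability_le1 P _)); rewrite ?ltry//; apply: measurableI => //; exact: measurable_preimage.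
- move=> C mC; rewrite -PB.
  transitivity (P (B `&` (env X k @^-1` C `&` [set w | S X k j w = z]))).
    by congr (P _); rewrite -setIA; congr (_ `&` _); exact: setIC.
  by rewrite (past_next _ _ hX pB mC); congr (_ * P _)%E; exact: setIC.
Qed.

(** The event is split along the values of Z_k. On {Z_k = j} the next size is [S X k j] with [j]
    deterministic, to which [past_next_integral] applies. *)
Lemma Markov_step P X k B (phi : mark R -> nat -> nat -> \bar R) :
  is_bprei P X -> past X k B -> (forall e j z, 0 <= phi e j z)%E ->
  (forall j z, measurable_fun setT (fun e => phi e j z)) ->
  (\int[P]_(w in B) phi (env X k w) (Z X k w) (Z X k.+1 w) =
   \int[P]_(w in B) \int[P]_w' phi (env X 0 w') (Z X k w) (S X 0 (Z X k w) w'))%E.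
Proof.
move=> hX pB f0 mf.
have mB : measurable B by exact: past_measurable pB.
have mZ := measurable_Z X k.
have mg : measurable_fun setT (fun w => phi (env X k w) (Z X k w) (Z X k.+1 w)).
  move=> _ Y mY; rewrite setTI.
  have -> : (fun w => phi (env X k w) (Z X k w) (Z X k.+1 w)) @^-1` Y =
    \bigcup_j \bigcup_z (Z X k @^-1` [set j] `&` (Z X k.+1 @^-1` [set z] `&` (fun w => phi (env X k w) j z) @^-1` Y)).
    apply/seteqP; split => [w Yw|w [j _ [z _ [e1 [e2 /=]]]]].
      by exists (Z X k w) => //; exists (Z X k.+1 w).
    by rewrite -e1 -e2.
  apply: bigcup_measurable => j _; apply: bigcup_measurable => z _; apply: measurableI.
    exact: measurable_preimage.
  apply: measurableI; first by apply: measurable_preimage => //; exact: measurable_Z.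
  apply: measurable_preimage => //.
  by apply: measurableT_comp (mf j z) _; exact: measurable_env.
have mgZ (F : nat -> \bar R) : measurable_fun setT (fun w => F (Z X k w)).
  exact: (measurableT_comp (f := F)).
rewrite (@integral_nat_decomp P (Z X k) B)//.
rewrite [RHS](@integral_nat_decomp P (Z X k) B)//; last 2 first.
- exact: (mgZ (fun j => \int[P]_w' phi (env X 0 w') j (S X 0 j w'))%E).
- by move=> w; apply: integral_ge0.
apply: eq_eseriesr => j _.
have pBj : past X k (B `&` Z X k @^-1` [set j]).
  apply: (@measurableI _ (g_sigma_algebraType (past_gen X k))) => //.
  exact: past_Z.
transitivity (\int[P]_(w in B `&` Z X k @^-1` [set j]) phi (env X k w) j (S X k j w))%E.
  by apply: eq_integral => w; rewrite inE => -[_ /= ->].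
rewrite (@past_next_integral P X k _ j (fun e => phi e j))//.
transitivity (\int[P]_(w in B `&` Z X k @^-1` [set j])
   cst (\int[P]_w' phi (env X 0 w') j (S X 0 j w')) w)%E; last first.
  by apply: eq_integral => w; rewrite inE => -[_ /= ->].
by rewrite integral_cst; [exact: muleC|exact: past_measurable pBj].
Qed.

End markov.

Lemma integral_gt0 d (T : measurableType d) (R : realType)
    (P : {measure set T -> \bar R}) (f : T -> \bar R) :
  measurable_fun setT f -> (forall w, 0 <= f w)%E ->
  (0 < P [set w | 0 < f w])%E -> (0 < \int[P]_w f w)%E.
Proof.
move=> mf f0 Pf; rewrite lt0e integral_ge0// andbT; apply/eqP => If.
have : ae_eq P setT f (cst 0%E).
  apply/ae_eq_integral_abs => //; rewrite -[RHS]If; apply: eq_integral => w _.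
  by rewrite gee0_abs.
move=> [N [mN N0 sN]]; move: Pf; rewrite lt0e => /andP[/eqP + _]; apply.
apply: (subset_measure0 _ mN) => //.
- by rewrite -[X in measurable X]setTI; exact: emeasurable_fun_o_infty.
- by move=> w /= fw; apply: sN => /= H; rewrite H// ltxx in fw.
Qed.

Lemma measure_nat_gt0 d (T : measurableType d) (R : realType)
    (P : {measure set T -> \bar R}) (N : T -> nat) (B : set nat) :
  measurable_fun setT N -> (0 < P (N @^-1` B))%E ->
  exists2 j, B j & (0 < P (N @^-1` [set j]))%E.
Proof.
move=> mN; apply: contraPP => H; apply/negP; rewrite -leNgt.
have -> : N @^-1` B = \bigcup_(j in B) (N @^-1` [set j]).
  by apply/seteqP; split => [w Bw|w [j + /= Nj]] /=; [exists (N w)|rewrite -Nj].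
rewrite measure_bigcup.
- rewrite eseries0// => j _ /set_mem Bj; apply/eqP; rewrite eq_le measure_ge0 andbT leNgt.
  by apply/negP => Pj; apply: H; exists j.
- by move=> j _; exact: measurable_preimage.
- by move=> i j _ _ [w [/= <- <-]].
Qed.

(** * Products of future means are independent of the past *)

Section future.
Context d (T : measurableType d) (R : realType).
Implicit Types (P : probability T R) (X : bprei_data T R).

Lemma past_env_integral P X k B (f : mark R -> \bar R) :
  is_bprei P X -> past X k B -> (forall e, 0 <= f e)%E -> measurable_fun setT f ->
  (\int[P]_(w in B) f (env X k w) = P B * \int[P]_w f (env X 0 w))%E.
Proof. by move=> hX pB f0 mf; exact: (past_next_integral 0 (f := fun e _ => f e)). Qed.

Lemma past_indep_set P X k B C : is_bprei P X -> past X k B -> measurable C ->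
  P (B `&` env X k @^-1` C) = (P B * P (env X k @^-1` C))%E.
Proof.
move=> hX pB mC; have mB : measurable B by exact: past_measurable pB.
have mE i : measurable (env X i @^-1` C).
  by apply: measurable_preimage => //; exact: measurable_env.
have := past_env_integral (f := fun e => (\1_C e)%:E) hX pB _ _.
have -> : P (env X k @^-1` C) = P (env X 0 @^-1` C) by exact: (env_identical hX).
have i1 i (D : set T) : measurable D ->
    (\int[P]_(w in D) (\1_C (env X i w))%:E = P (env X i @^-1` C `&` D))%E.
  by move=> mD; rewrite -integral_indic.
rewrite !i1// setIT setIC; apply => [e|]; first by rewrite lee_fin.
exact/measurable_EFinP.
Qed.

Lemma past_indep_tonelli P X k d' (T' : measurableType d') (Y : T -> T')
    (F : T' * mark R -> \bar R) : is_bprei P X ->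
  measurable_fun setT (Y : g_sigma_algebraType (past_gen X k) -> T') ->
  (forall x, 0 <= F x)%E -> measurable_fun setT F ->
  (\int[P]_w F (Y w, env X k w) = \int[P]_w \int[P]_w' F (Y w, env X 0 w'))%E.
Proof.
move=> hX mY F0 mF.
have mY' : measurable_fun setT Y.
  move=> _ B mB; rewrite setTI; apply: (@past_measurable _ _ _ X k).
  by rewrite -[X in past _ _ X]setTI; exact: mY.
have ind A B : measurable A -> measurable B ->
    P (Y @^-1` A `&` env X k @^-1` B) = (P (Y @^-1` A) * P (env X k @^-1` B))%E.
  move=> mA mB; apply: past_indep_set => //.
  by rewrite -[X in past _ _ X]setTI; exact: mY.
rewrite (@independent_tonelli _ _ _ _ _ _ _ P Y (env X k) mY' (measurable_env X k) ind F F0 mF).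
apply: eq_integral => w _.
apply: (@identically_distributed_integral _ _ _ P X k (fun e => F (Y w, e))).
- exact: (env_identical hX).
- by move=> e.
- exact: (measurableT_comp mF (measurable_pair1 _)).
Qed.

Lemma past_le X k l : (k <= l)%N -> past X k `<=` past X l.
Proof.
move=> kl; apply: smallest_sub; first exact: smallest_sigma_algebra.
pose U := g_sigma_algebraType (past_gen X l).
move=> B [->|[A [z [sA ->]]]]; first exact: (@measurableT _ U).
apply: (@measurableI _ U).
  by apply: past_env; apply: sigma_genS sA => i /= ik; exact: leq_trans ik kl.
have -> : zpath X z k = \bigcap_(i in [set i | (i <= k)%N]) (Z X i @^-1` [set z i]) by [].
apply: (@bigcap_measurable _ U); first by exists 0%N.
by move=> i /= ik; apply: past_Z; exact: leq_trans ik kl.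
Qed.

Local Notation U X k := (g_sigma_algebraType (past_gen X k)).

Lemma past_fun X k d' (T' : measurableType d') (f : T -> T') :
  measurable_fun setT (f : g_sigma_algebraType (envs X `I_k) -> T') ->
  measurable_fun setT (f : U X k -> T').
Proof.
apply: sub_sigma_fun => A eA; apply: past_env.
exact: sub_sigma_algebra.
Qed.

Lemma past_fun_measurable X k d' (T' : measurableType d') (f : T -> T') :
  measurable_fun setT (f : U X k -> T') -> measurable_fun setT f.
Proof.
move=> mf _ B mB; rewrite setTI; apply: (@past_measurable _ _ _ X k).
by rewrite -[X in past _ _ X]setTI; exact: mf.
Qed.

Lemma past_M X k i : (i < k)%N -> measurable_fun setT (M X i : U X k -> R).
Proof. by move=> ik; apply: past_fun; exact: envs_M. Qed.

Lemma past_Pik X k j l : (j + l <= k)%N -> measurable_fun setT (Pik X j l : U X k -> R).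
Proof.
move=> jk; apply: measurable_prod => -[i /= il] _; apply: past_M.
by apply: leq_trans jk; rewrite ltn_add2l.
Qed.

Lemma past_Z_fun X k i : (i <= k)%N -> measurable_fun setT (Z X i : U X k -> nat).
Proof. by move=> ik _ B _; rewrite setTI; exact: past_Z. Qed.

(** Induction on the number of factors: the last one is independent of the past before it, so
    averaging over it replaces [f] by another nonnegative function of a shorter product. Hence [f]
    is generalised. *)
Lemma past_Pik_integral P X k l B (f : R -> \bar R) :
  is_bprei P X -> past X k B -> (forall x, 0 <= f x)%E -> measurable_fun setT f ->
  (\int[P]_(w in B) f (Pik X k l w) = P B * \int[P]_w f (Pi X l w))%E.
Proof.
move=> hX; elim: l f B => [|l IH] f B pB f0 mf.
  have mB : measurable B by exact: past_measurable pB.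
  rewrite [LHS](_ : _ = \int[P]_(w in B) (cst (f 1%R)) w)%E; last first.
    by apply: eq_integral => w _; rewrite /Pik big_ord0.
  rewrite [X in (_ * X)%E](_ : _ = \int[P]_w (cst (f 1%R)) w)%E; last first.
    by apply: eq_integral => w _; rewrite /Pi big_ord0.
  have c1 (A : set T) (r : \bar R) : measurable A -> (\int[P]_(w in A) cst r w = r * P A)%E.
    by move=> mA; exact: integral_cst.
  by rewrite !c1// probability_setT mule1 muleC.
have step k' (B' : set T) : past X (k' + l) B' ->
  (\int[P]_(w in B') f (Pik X k' l.+1 w) =
   \int[P]_(w in B') \int[P]_w' f (Pik X k' l w * markmean (env X 0 w'))%R)%E.
  move=> pB'; rewrite !(integral_indic_mul P B').
  have mm : measurable_fun setT (fun z : (R * R) * mark R => z.1.1 * markmean z.2).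
    apply: measurable_funM.
      exact: (measurableT_comp measurable_fst measurable_fst).
    exact: (measurableT_comp (@measurable_markmean R) measurable_snd).
  (* The indicator of the past event is passed as a real coordinate; its absolute value makes the
     integrand nonnegative for every value of that coordinate. *)
  have := @past_indep_tonelli P X (k' + l) _ _
    (fun w => (Pik X k' l w, \1_B' w : R))
    (fun z => f (z.1.1 * markmean z.2)%R * (`|z.1.2|)%:E)%E hX _ _ _.
  move=> h; transitivity (\int[P]_w (f (Pik X k' l w * markmean (env X (k' + l) w))%R * (`|\1_B' w : R|)%:E))%E.
    apply: eq_integral => w _; rewrite ger0_norm//.
    by rewrite /Pik big_ord_recr.
  rewrite {}h.
  - apply: eq_integral => w _ /=; rewrite ger0_norm// ge0_integralZr//.
    apply: (measurableT_comp mf); apply: measurable_funM => //.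
    exact: (measurableT_comp (@measurable_markmean R) (measurable_env X 0)).
  - apply: measurable_fun_pair; first exact: past_Pik.
    exact: (@measurable_indic _ (U X (k' + l)) R setT B').
  - by move=> z; apply: mule_ge0.
  - apply: emeasurable_funM; first exact: (measurableT_comp mf mm).
    apply/measurable_EFinP; apply: measurableT_comp => //.
    exact: (measurableT_comp measurable_snd measurable_fst).
rewrite step; last by apply: past_le pB; rewrite leq_addr.
have mF2 : measurable_fun setT (fun z : R * T => f (z.1 * markmean (env X 0 z.2))).
  apply: (measurableT_comp mf); apply: measurable_funM => //.
  apply: (measurableT_comp (@measurable_markmean R)).
  exact: (measurableT_comp (measurable_env X 0) measurable_snd).
pose f2 x := (\int[P]_w' f (x * markmean (env X 0 w'))%R)%E.
have f20 x : (0 <= f2 x)%E by apply: integral_ge0.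
have mf2 : measurable_fun setT f2.
  exact: (@measurable_fun_fubini_tonelli_F _ _ _ _ R P (fun z : R * T => f (z.1 * markmean (env X 0 z.2)))).
rewrite (IH f2)//; congr (_ * _)%E.
have := step 0%N setT; rewrite add0n => ->//.
exact: (@measurableT _ (U X l)).
Qed.

Lemma past_Pik_tonelli P X k l d' (T' : measurableType d') (Y : T -> T')
    (F : T' * R -> \bar R) : is_bprei P X ->
  measurable_fun setT (Y : U X k -> T') ->
  (forall x, 0 <= F x)%E -> measurable_fun setT F ->
  (\int[P]_w F (Y w, Pik X k l w) = \int[P]_w \int[P]_w' F (Y w, Pi X l w'))%E.
Proof.
move=> hX mY F0 mF.
have mY' := past_fun_measurable mY.
have key B (f : R -> \bar R) := @past_Pik_integral P X k l B f hX.
have keyS B C : past X k B -> measurable C ->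
    P (B `&` Pik X k l @^-1` C) = (P B * P (Pi X l @^-1` C))%E.
  move=> pB mC; have mB : measurable B by exact: past_measurable pB.
  have mPC : measurable (Pik X k l @^-1` C).
    by apply: measurable_preimage => //; exact: measurable_Pik.
  have mPC' : measurable (Pi X l @^-1` C).
    by apply: measurable_preimage => //; exact: measurable_Pi.
  have := key B (fun x => (\1_C x)%:E) pB _ _.
  rewrite [X in (_ * X)%E](_ : _ = P (Pi X l @^-1` C)); last first.
    by rewrite -[in RHS](setIT (Pi X l @^-1` C)) -integral_indic.
  move=> <-; last 2 first.
  - by move=> x; rewrite lee_fin.
  - exact/measurable_EFinP.
  by rewrite setIC -integral_indic.
have mP := measurable_Pik X k l.
have ind A B : measurable A -> measurable B ->
    P (Y @^-1` A `&` Pik X k l @^-1` B) = (P (Y @^-1` A) * P (Pik X k l @^-1` B))%E.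
  move=> mA mB; rewrite keyS//; last first.
    by rewrite -[X in past _ _ X]setTI; exact: mY.
  rewrite -[Pik X k l @^-1` B]setTI keyS ?probability_setT ?mul1e//.
  exact: (@measurableT _ (U X k)).
rewrite (@independent_tonelli _ _ _ _ _ _ _ P Y (Pik X k l) mY' mP ind F F0 mF).
apply: eq_integral => w _.
have := key setT (fun x => F (Y w, x)); rewrite probability_setT mul1e; apply.
- exact: (@measurableT _ (U X k)).
- by [].
- exact: (measurableT_comp mF (measurable_pair1 _)).
Qed.

End future.

(** * The change of measure on the past *)

Section tilting.
Context d (T : measurableType d) (R : realType).
Implicit Types (P : probability T R) (X : bprei_data T R).

Local Notation U X k := (g_sigma_algebraType (past_gen X k)).

Definition W X (alpha lam : R) n w : R := Pi X n w `^ alpha * expR (- (n%:R * lam)).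

Lemma W_ge0 X alpha lam n w : 0 <= W X alpha lam n w.
Proof. by rewrite mulr_ge0// ?powR_ge0 ?expR_ge0. Qed.

Lemma envs_W X alpha lam n :
  measurable_fun setT (W X alpha lam n : g_sigma_algebraType (envs X `I_n) -> R).
Proof.
apply: measurable_funM => //.
have h := measurableT_comp (@measurable_powR R alpha) (@envs_Pi _ _ _ X n); exact h.
Qed.

Lemma past_W X alpha lam n : measurable_fun setT (W X alpha lam n : U X n -> R).
Proof. by apply: past_fun; exact: envs_W. Qed.

Lemma measurable_W X alpha lam n : measurable_fun setT (W X alpha lam n).
Proof. exact: past_fun_measurable (@past_W X alpha lam n). Qed.

Lemma sigma_envs X J : measurable = <<s (measurable : set (set (g_sigma_algebraType (envs X J)))) >>.
Proof. by rewrite sigma_algebra_id//; exact: sigma_algebra_measurable. Qed.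

Lemma integral_cst1 (P : {measure set T -> \bar R}) (A : set T) :
  measurable A -> (\int[P]_(w in A) (1%:E) = P A)%E.
Proof. by move=> mA; rewrite (@integral_cst _ _ _ P A mA 1%:E) mul1e. Qed.

Lemma tilt_env P X alpha Pa n (f : T -> \bar R) :
  is_tilted P X alpha Pa -> (forall w, 0 <= f w)%E ->
  measurable_fun setT (f : g_sigma_algebraType (envs X `I_n) -> \bar R) ->
  (\int[Pa]_w f w = \int[P]_w (f w * (W X alpha (rLambda P X alpha) n w)%:E))%E.
Proof.
move=> ht f0 mf.
have mid := measurable_id_sub (@envs_measurable _ _ _ X `I_n).
rewrite -(@eq_weighted_law R _ _ _ T T (g_sigma_algebraType (envs X `I_n)) Pa P
  (cst 1) (W X alpha (rLambda P X alpha) n) id id measurable) //.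
- by apply: eq_integral => w _; rewrite mule1.
- exact: measurable_W.
- by move=> w; exact: W_ge0.
- exact: sigma_envs.
- by move=> A B; exact: measurableI.
- by rewrite integral_cst1// (le_lt_trans (probability_le1 Pa measurableT)) ?ltry.
- move=> B sB; rewrite preimage_id integral_cst1.
    exact: (tilted_density ht).
  exact: sigma_env_measurable sB.
Qed.

(** Conditioning on the environment: the indicator of a path integrates to its conditional
    probability, a product of [pk] that is the same function of the marks under [P] and under
    [Pa]. *)
Lemma mechanism_zpath P X z n (f : T -> \bar R) :
  mechanism P X -> Z0_independent P X -> (forall w, 0 <= f w)%E ->
  measurable_fun setT (f : g_sigma_algebraType (envs X setT) -> \bar R) ->
  (\int[P]_(w in zpath X z n) f w = P [set w | Z0 X w = z 0%N] *
     \int[P]_w (f w * (\prod_(i <- desc n) pk (env X i w) (z i) (z i.+1))%:E))%E.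
Proof.
move=> mech hZ f0 mf.
have mid := measurable_id_sub (@envs_measurable _ _ _ X setT).
have mf' : measurable_fun setT f.
  move=> _ B mB; rewrite setTI; have := mf measurableT B mB; rewrite setTI.
  by move=> /sigma_env_measurable.
have mp : measurable_fun setT (fun w => \prod_(i <- desc n) pk (env X i w) (z i) (z i.+1)).
  apply: measurable_prod => i _.
  exact: (measurableT_comp (@measurable_pk R _ _) (measurable_env X i)).
have p0 w : 0 <= \prod_(i <- desc n) pk (env X i w) (z i) (z i.+1).
  by apply: prodr_ge0 => i _; exact: pk_ge0.
pose c := fine (P [set w | Z0 X w = z 0%N]).
have c0 : 0 <= c by exact: fine_ge0.
have mZ0 : measurable [set w | Z0 X w = z 0%N] by exact: (measurable_Z0 X [set z 0%N]).
have cE : P [set w | Z0 X w = z 0%N] = c%:E by rewrite fineK ?fin_num_measure.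
have mfp : measurable_fun setT (fun w => f w * (\prod_(i <- desc n) pk (env X i w) (z i) (z i.+1))%:E)%E.
  by apply: emeasurable_funM => //; exact/measurable_EFinP.
have fp0 w : setT w -> (0 <= f w * (\prod_(i <- desc n) pk (env X i w) (z i) (z i.+1))%:E)%E.
  by move=> _; rewrite mule_ge0// lee_fin.
rewrite cE -(ge0_integralZl P measurableT mfp fp0) ?lee_fin//.
rewrite (integral_indic_mul P (zpath X z n)).
rewrite (@eq_weighted_law R _ _ _ T T (g_sigma_algebraType (envs X setT)) P P
  \1_(zpath X z n) (fun w => c * \prod_(i <- desc n) pk (env X i w) (z i) (z i.+1)) id id measurable _ _ _ _ _ _ _ _ _ _ _ f) //.
- by apply: eq_integral => w _; rewrite EFinM muleCA.
- by apply: measurable_indic; exact: measurable_path.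
- exact: measurable_funM.
- by move=> w; rewrite mulr_ge0.
- exact: sigma_envs.
- by move=> A B; exact: measurableI.
- rewrite integral_indic//; last exact: measurable_path.
  by rewrite setIT (le_lt_trans (probability_le1 P (measurable_path _ _ _))) ?ltry.
- move=> B sB; rewrite preimage_id.
  have mB := sigma_env_measurable sB.
  rewrite integral_indic//; last exact: measurable_path.
  under [RHS]eq_integral do rewrite EFinM.
  rewrite ge0_integralZl//.
  + transitivity (P (B `&` zpath X z n)); first by congr (P _); exact: setIC.
    by rewrite zpathE mechanism_path ?desc_uniq// -cE.
  + by apply/measurable_EFinP; exact: measurable_funTS.
  + by move=> w _; rewrite lee_fin.
Qed.

(** The definition of the tilt prescribes the density on environments only. Given the environment, a
    path has the same probability under both laws, so the formula extends to environment events
    intersected with paths, and from there to the whole past by uniqueness of measures. *)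
Lemma tilt_set P X alpha Pa n B : is_bprei P X -> is_tilted P X alpha Pa ->
  past X n B ->
  (Pa B = \int[P]_(w in B) (W X alpha (rLambda P X alpha) n w)%:E)%E.
Proof.
move=> hX ht.
have [_ _ mech hZ _] := hX.
have [nu [nuE _]] := density_measure P (@measurable_W X alpha (rLambda P X alpha) n)
  (@W_ge0 X alpha (rLambda P X alpha) n).
have cover : \bigcup_(k : nat) (setT : set T) = setT.
  by rewrite bigcup_const//; exists 0%N.
have GT : past_gen X n setT by left.
move=> pB; rewrite -nuE; last exact: past_measurable pB.
have oo (k : nat) : (Pa setT < +oo)%E by rewrite (le_lt_trans (probability_le1 Pa measurableT)) ?ltry.
suff GE A : past_gen X n A -> Pa A = nu A.
  have e := g_sigma_algebra_measure_unique _ (@past_gen_measurable _ _ _ X n) (fun=> setT)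
    (fun=> GT) cover Pa nu (@past_genI _ _ _ X n) GE oo _ pB.
  exact e.
move: A => {B pB} B GB; rewrite nuE; last exact: past_gen_measurable GB.
case: GB => [->|[A [z [sA ->]]]].
  apply: (tilted_density ht).
  exact: (@measurableT _ (g_sigma_algebraType (envs X `I_n))).
have sAT : sigma_gen setT (env X) A by apply: sigma_genS sA.
have mA : measurable A by exact: sigma_env_measurable sA.
have mz := measurable_path X z n.
have -> : (\int[P]_(w in A `&` zpath X z n) (W X alpha (rLambda P X alpha) n w)%:E =
    \int[P]_(w in zpath X z n) ((W X alpha (rLambda P X alpha) n w)%:E * (\1_A w)%:E))%E.
  rewrite (integral_indic_mul P (A `&` _)) (integral_indic_mul P (zpath _ _ _)).
  by apply: eq_integral => w _; rewrite indicI -!EFinM /=; congr EFin; ring.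
rewrite mechanism_zpath//; last 2 first.
- by move=> w; rewrite mule_ge0// lee_fin// W_ge0.
- apply: emeasurable_funM; apply/measurable_EFinP.
    have sub : envs X `I_n `<=` <<s envs X setT >>.
      by move=> C [i _ H]; apply: sub_sigma_algebra; exists i.
    have h := sub_sigma_fun sub (@envs_W X alpha (rLambda P X alpha) n); exact h.
  exact: (@measurable_indic _ (g_sigma_algebraType (envs X setT)) R setT A).
have -> : (Pa (A `&` zpath X z n) = \int[Pa]_(w in zpath X z n) ((\1_A w)%:E))%E.
  by rewrite integral_indic.
rewrite (mechanism_zpath z n (tilted_mechanism ht) (tilted_Z0 ht)); last 2 first.
- by move=> w; rewrite lee_fin.
- apply/measurable_EFinP.
  exact: (@measurable_indic _ (g_sigma_algebraType (envs X setT)) R setT A).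
rewrite (tilted_Z0_law ht [set z 0%N]); congr (_ * _)%E.
rewrite (@tilt_env P X alpha Pa n)//.
- by apply: eq_integral => w _; rewrite -!EFinM; congr EFin; ring.
- by move=> w; rewrite mule_ge0// lee_fin// prodr_ge0// => i _; exact: pk_ge0.
- apply: emeasurable_funM; apply/measurable_EFinP.
    exact: (@measurable_indic _ (g_sigma_algebraType (envs X `I_n)) R setT A).
  by apply: measurable_prod => i; rewrite mem_desc => ik; exact: envs_pk.
Qed.

Lemma tilt_fun P X alpha Pa n (f : T -> \bar R) :
  is_bprei P X -> is_tilted P X alpha Pa -> (forall w, 0 <= f w)%E ->
  measurable_fun setT (f : U X n -> \bar R) ->
  (\int[Pa]_w f w = \int[P]_w (f w * (W X alpha (rLambda P X alpha) n w)%:E))%E.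
Proof.
move=> hX ht f0 mf.
have mid := measurable_id_sub (@past_gen_measurable _ _ _ X n).
rewrite -(@eq_weighted_law R _ _ _ T T (U X n) Pa P
  (cst 1) (W X alpha (rLambda P X alpha) n) id id measurable) //.
- by apply: eq_integral => w _; rewrite mule1.
- exact: measurable_W.
- by move=> w; exact: W_ge0.
- by rewrite sigma_algebra_id//; exact: sigma_algebra_measurable.
- by move=> A B; exact: measurableI.
- by rewrite integral_cst1// (le_lt_trans (probability_le1 Pa measurableT)) ?ltry.
- move=> B sB; rewrite preimage_id integral_cst1; first exact: tilt_set.
  exact: past_measurable sB.
Qed.

End tilting.

(** * Arbitrarily large populations have positive probability *)

Section positivity.
Context d (T : measurableType d) (R : realType).
Implicit Types (P : probability T R) (X : bprei_data T R).

(** Given the mark, all j individuals have at least two children with probability Q({2, 3, ...})^j,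
    which is positive wherever Q({2, 3, ...}) is. *)
Lemma S0_ge2 P X j : is_bprei P X ->
  (0 < P [set w | 0 < Q X 0 w [set n | (2 <= n)%N]]%E)%E ->
  (0 < P [set w | (2 * j <= S X 0 j w)%N])%E.
Proof.
move=> [_ _ mech _ _] hQ.
pose l := [seq (inl (0%N, i) : nat * nat + nat, [set n | (2 <= n)%N]) | i <- iota 0 j].
have ul : uniq (map fst l).
  rewrite -map_comp map_inj_in_uniq ?iota_uniq// => a b _ _ /=.
  by move=> [].
have mC : measurable (cyl X l) by exact: measurable_cyl.
apply: (@lt_le_trans _ _ (P (cyl X l))); last first.
  apply: le_measure; rewrite ?inE//.
    have mS : measurable_fun setT (S X 0 j).
      by apply: measurable_nat_fun => z; exact: measurable_S.
    exact: (measurable_preimage mS (B := [set n | (2 * j <= n)%N])).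
  move=> w Cw; rewrite /= /S.
  apply: leq_trans (leq_addr _ _).
  have H i : (i < j)%N -> (2 <= offspring X 0 i w)%N.
    move=> ij; have : i \in iota 0 j by rewrite mem_iota.
    move: Cw; rewrite /l; elim: (iota 0 j) => //= a s IH [H1 H2].
    by rewrite inE => /orP[/eqP ->//|]; exact: IH.
  apply: (@leq_trans (\sum_(i < j) 2)); first by rewrite sum_nat_const card_ord mulnC.
  by apply: leq_sum => i _; exact: H.
have := @mechanism_cyl _ _ _ P X setT l mech _ ul.
rewrite setTI => ->; last exact: (@measurableT _ (g_sigma_algebraType (envs X setT))).
apply: integral_gt0.
- by apply/measurable_EFinP; apply: measurable_prod => c _; exact: measurable_mlaw.
- by move=> w; rewrite lee_fin prodr_ge0// => c _; exact: mlaw_ge0.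
- apply: lt_le_trans hQ _; apply: le_measure; rewrite ?inE//.
  + apply: (measurable_preimage (f := fun w => Q X 0 w [set n | (2 <= n)%N]) (B := [set x | 0 < x]%E)).
      apply: (measurableT_comp (@measurable_eval R _)).
      exact: (measurableT_comp measurable_fst (measurable_env X 0)).
    by rewrite -[X in measurable X]setTI; exact: emeasurable_fun_o_infty.
  + rewrite -[X in measurable X]setTI; apply: emeasurable_fun_o_infty => //.
    by apply/measurable_EFinP; apply: measurable_prod => c _; exact: measurable_mlaw.
  + move=> w /= Qw; rewrite lte_fin big_map prodr_gt0// => i _.
    by rewrite /mlaw/= fine_gt0// Qw/= ltey_eq fin_num_measure.
Qed.

(** A positive initial size or a positive first immigration gives a start of at least one
    individual; from then on the size at least doubles at each generation with positive probability.
    A single value [j] is extracted at the end, because the positivity of the limit is tested on an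
    event {Z_n = j}. *)
Lemma Z_unbounded P X : is_bprei P X ->
  (0 < P [set w | 0 < Q X 0 w [set n | (2 <= n)%N]]%E)%E ->
  (0 < P [set w | (0 < Z0 X w)%N] + P [set w | (0 < immig X 1 w)%N])%E ->
  forall K : nat, exists n j, (K <= j)%N /\ (0 < P (Z X n @^-1` [set j]))%E.
Proof.
move=> hX hQ hpos.
have base : exists n, (0 < P (Z X n @^-1` [set j | (1 <= j)%N]))%E.
  have [e|] := eqVneq (P [set w | (0 < Z0 X w)%N]) 0%E; last first.
    by move=> ne; exists 0%N; rewrite lt0e ne/= measure_ge0.
  exists 1%N; rewrite e add0e in hpos; apply: lt_le_trans hpos _.
  apply: le_measure; rewrite ?inE//.
  - exact: (measurable_mech_var X (inr 0%N) [set n | (0 < n)%N]).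
  - by apply: measurable_preimage => //; exact: measurable_Z.
  - by move=> w /= iw; apply: leq_trans (leq_addl _ _).
have step n k : (0 < P (Z X n @^-1` [set j | (k <= j)%N]))%E ->
    (0 < P (Z X n.+1 @^-1` [set j | (2 * k <= j)%N]))%E.
  move=> /(measure_nat_gt0 (measurable_Z X n))[j /= kj Pj].
  have := @past_next_integral _ _ _ P X n (Z X n @^-1` [set j]) j
    (fun _ z => (\1_[set z | (2 * j <= z)%N] z)%:E) hX (past_Z _ (leqnn n)) _ _.
  have mS k' : measurable_fun setT (S X k' j).
    by apply: measurable_nat_fun => z; exact: measurable_S.
  have mSB k' : measurable (S X k' j @^-1` [set z | (2 * j <= z)%N]).
    exact: measurable_preimage.
  have mZj : measurable (Z X n @^-1` [set j]).
    by apply: measurable_preimage => //; exact: measurable_Z.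
  have i1 k' (D : set T) : measurable D ->
    (\int[P]_(w in D) (\1_[set z | (2 * j <= z)%N] (S X k' j w))%:E =
     P (S X k' j @^-1` [set z | (2 * j <= z)%N] `&` D))%E.
    by move=> mD; rewrite -integral_indic.
  rewrite !i1// setIT => e.
  apply: (@lt_le_trans _ _ (P (S X n j @^-1` [set z | (2 * j <= z)%N] `&` Z X n @^-1` [set j]))).
    rewrite {}e; last 2 first.
    - by move=> _ z; rewrite lee_fin.
    - by move=> z.
    by rewrite mule_gt0//; exact: S0_ge2.
  apply: le_measure; rewrite ?inE//.
  - exact: measurableI.
  - exact: (measurable_preimage (measurable_Z X n.+1)).
  - move=> w [/= H1 H2]; apply: (@leq_trans (2 * j)%N); first by rewrite leq_mul2l.
    by apply: leq_trans H1 _; rewrite /S H2.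
case: base => n0 base K.
have H k : (0 < P (Z X (n0 + k) @^-1` [set j | (2 ^ k <= j)%N]))%E.
  elim: k => [|k IH]; first by rewrite addn0 expn0.
  by rewrite addnS expnS; exact: step.
have [j /= Kj Pj] := measure_nat_gt0 (measurable_Z X _) (H K).
exists (n0 + K)%N, j; split => //; apply: leq_trans Kj.
by apply: ltnW; exact: ltn_expl.
Qed.

End positivity.

(** * Taylor bounds for sine, cosine and the exponential *)

Section taylor.
Context {R : realType}.
Implicit Types x y : R.

(** Each of the next bounds has the previous one as its derivative: the chain starts from cos <= 1
    and alternates between sine and cosine. *)
Lemma nonneg_of_derive (f df : R -> R) : (forall x, is_derive x 1 f (df x)) ->
  (forall x, 0 <= x -> 0 <= df x) -> f 0 = 0 -> forall x, 0 <= x -> 0 <= f x.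
Proof.
move=> fdf df0 f0 x; rewrite le_eqVlt => /predU1P[<-|x0]; first by rewrite f0.
have cf : continuous f.
  by move=> y; apply/differentiable_continuous/derivable1_diffP; exact: ex_derive.
have [|c c0x] := MVT x0 (fun y _ => fdf y).
  exact: continuous_subspaceT.
rewrite f0 !subr0 => ->; apply: mulr_ge0; last exact: ltW.
by apply: df0; move: c0x; rewrite in_itv/= => /andP[/ltW].
Qed.

Lemma sin_le y : 0 <= y -> sin y <= y.
Proof.
move=> y0; rewrite -subr_ge0.
apply: (@nonneg_of_derive (fun y => y - sin y) (fun y => 1 - cos y)) y0.
- by move=> x _; rewrite subr_ge0 cos_le1.
- by rewrite sin0 subr0.
Qed.

Lemma cos_ge y : 0 <= y -> 0 <= cos y - 1 + 2^-1 * y ^+ 2.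
Proof.
apply: (@nonneg_of_derive (fun y => cos y - 1 + 2^-1 * y ^+ 2) (fun y => y - sin y)).
- by move=> x /=; apply: is_derive_eq; rewrite /GRing.scale/=; lra.
- by move=> x x0; rewrite subr_ge0 sin_le.
- by rewrite cos0 expr0n/=; lra.
Qed.

Lemma sin_ge y : 0 <= y -> 0 <= sin y - y + 6^-1 * y ^+ 3.
Proof.
apply: (@nonneg_of_derive (fun y => sin y - y + 6^-1 * y ^+ 3) (fun y => cos y - 1 + 2^-1 * y ^+ 2)).
- by move=> x /=; apply: is_derive_eq; rewrite /GRing.scale/=; lra.
- by move=> x x0; rewrite cos_ge.
- by rewrite sin0 expr0n/=; lra.
Qed.

Lemma cos_le y : 0 <= y -> 0 <= 1 - 2^-1 * y ^+ 2 + 24^-1 * y ^+ 4 - cos y.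
Proof.
apply: (@nonneg_of_derive (fun y => 1 - 2^-1 * y ^+ 2 + 24^-1 * y ^+ 4 - cos y)
  (fun y => sin y - y + 6^-1 * y ^+ 3)).
- by move=> x /=; apply: is_derive_eq; rewrite /GRing.scale/=; lra.
- by move=> x x0; rewrite sin_ge.
- by rewrite cos0 !expr0n/=; lra.
Qed.

Lemma sin_taylor y : `|sin y - y| <= `|y| ^+ 3.
Proof.
wlog y0 : y / 0 <= y.
  move=> H; have [/H//|/ltW y0] := leP 0 y.
  have := H (- y); rewrite oppr_ge0 => /(_ y0); rewrite sinN normrN.
  by rewrite -opprD normrN.
rewrite (ger0_norm y0) ler0_norm; last by rewrite subr_le0 sin_le.
have := sin_ge y0; have : 0 <= y ^+ 3 by rewrite exprn_ge0.
lra.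
Qed.

Lemma cos_taylor y : `|cos y - 1 + 2^-1 * y ^+ 2| <= `|y| ^+ 3.
Proof.
wlog y0 : y / 0 <= y.
  move=> H; have [/H//|/ltW y0] := leP 0 y.
  have := H (- y); rewrite oppr_ge0 => /(_ y0); rewrite cosN normrN sqrrN.
  by [].
rewrite (ger0_norm y0) ger0_norm; last exact: cos_ge.
have := cos_le y0; have := cos_le1 y.
have [y1|/ltW y1] := leP y 1.
  have : y ^+ 4 <= y ^+ 3 by rewrite exprS ler_piMl// exprn_ge0.
  have : 0 <= y ^+ 4 by rewrite exprn_ge0.
  lra.
have : y ^+ 2 <= y ^+ 3 by rewrite [leRHS]exprS ler_peMl// exprn_ge0.
have : 0 <= y ^+ 2 by rewrite exprn_ge0.
lra.
Qed.

Lemma expRN_taylor y : 0 <= y -> `|expR (- y) - 1 + y| <= y ^+ 2.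
Proof.
move=> y0; rewrite ger0_norm; last by have := expR_ge1Dx (- y); lra.
suff : 0 <= y ^+ 2 - (expR (- y) - 1 + y) by lra.
apply: (@nonneg_of_derive (fun y => y ^+ 2 - (expR (- y) - 1 + y))
  (fun y => y + y - (1 - expR (- y)))) y0.
- by move=> x /=; apply: is_derive_eq; rewrite /GRing.scale/=; lra.
- by move=> x x0; have := expR_ge1Dx (- x); lra.
- by rewrite oppr0 expR0 expr0n/=; lra.
Qed.

End taylor.

Lemma measurable_invr (R : realType) : measurable_fun setT (fun x : R => x^-1).
Proof.
rewrite (_ : (fun _ => _) = fun x : R => x * (x ^+ 2) `^ (-1)).
  by apply: measurable_funM => //; apply: (measurableT_comp (measurable_powR _));
    exact: measurable_funX.
apply/funext => x; rewrite powR_inv1 ?sqr_ge0//.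
by have [->|x0] := eqVneq x 0; [rewrite invr0 mul0r|field].
Qed.

(** * The Fejer kernel and its Fourier representation *)

Section kernel.
Context {R : realType}.
Implicit Types x y z : R.
Local Notation mu := (@lebesgue_measure R).

(** The Fejer kernel (sin(x/2) / (x/2))^2, with its limit as value at 0; it is the Fourier transform
    of the triangle function on [-1, 1]. *)
Definition hker x : R := if x == 0 then 1 else 2 * (1 - cos x) / x ^+ 2.

Lemma hker_ge0 x : 0 <= hker x.
Proof.
rewrite /hker; case: eqP => // _; apply: divr_ge0; last exact: sqr_ge0.
by rewrite mulr_ge0// subr_ge0 cos_le1.
Qed.

Lemma hkerN x : hker (- x) = hker x.
Proof. by rewrite /hker oppr_eq0 cosN sqrrN. Qed.

Lemma measurable_cos : measurable_fun setT (@cos R).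
Proof. by apply: continuous_measurable_fun; exact: continuous_cos. Qed.

Lemma measurable_sin : measurable_fun setT (@sin R).
Proof. by apply: continuous_measurable_fun; exact: continuous_sin. Qed.

Lemma measurable_hker : measurable_fun setT hker.
Proof.
apply: measurable_fun_ifT => //.
  by apply: (measurable_fun_bool true); rewrite setTI; 
    rewrite [X in measurable X](_ : _ = [set 0])//; apply/seteqP; split => x /= /eqP.
apply: measurable_funM.
  by apply: measurable_funM => //; apply: measurable_funB => //; exact: measurable_cos.
by apply: (measurableT_comp (@measurable_invr R)); exact: measurable_funX.
Qed.

(** The summand 1 is the integral of 2 (1 - t). Adding it keeps the integrand nonnegative, so that
    expectation and integral can later be exchanged by Tonelli. *)
Lemma hker_fourier x :
  (\int[mu]_(t in `[0%R, 1%R]) (2 * (1 - t) * (1 + cos (t * x)))%:E = (1 + hker x)%:E)%E.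
Proof.
have cont (F dF : R -> R) : (forall t : R, is_derive t 1 F (dF t)) -> continuous F.
  by move=> H y; apply/differentiable_continuous/derivable1_diffP; exact: ex_derive.
have cf : continuous (fun t : R => 2 * (1 - t) * (1 + cos (t * x))).
  apply: (cont _ (fun t => - 2 * (1 + cos (t * x)) + 2 * (1 - t) * (- sin (t * x) * x))) => t.
  by apply: is_derive_eq; rewrite /GRing.scale/=; ring.
have FTC (F : R -> R) : (forall t : R, is_derive t 1 F (2 * (1 - t) * (1 + cos (t * x)))) ->
    (\int[mu]_(t in `[0%R, 1%R]) (2 * (1 - t) * (1 + cos (t * x)))%:E = (F 1)%:E - (F 0)%:E)%E.
  move=> dF; apply: continuous_FTC2 => //.
  - exact: continuous_subspaceT.
  - have cF := cont _ _ dF.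
    split; first by move=> y _; exact: ex_derive.
      by apply: cvg_at_right_filter; exact: cF.
    by apply: cvg_at_left_filter; exact: cF.
  - by move=> t _; rewrite derive1E; exact: derive_val.
rewrite /hker; have [x0|x0] := eqVneq x 0.
  have d (t : R) : is_derive t 1 (fun t : R => 4 * t - 2 * t ^+ 2) (2 * (1 - t) * (1 + cos (t * x))).
    by apply: is_derive_eq; rewrite /GRing.scale/= x0 mulr0 cos0; lra.
  by rewrite (FTC _ d) -EFinB; congr EFin; lra.
have d (t : R) : is_derive t 1 (fun t : R => 2 * t - t ^+ 2 + (2 * x^-1) * ((1 - t) * sin (t * x))
    - (2 * (x^-1 ^+ 2)) * cos (t * x)) (2 * (1 - t) * (1 + cos (t * x))).
  by apply: is_derive_eq; rewrite /GRing.scale/=; field.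
rewrite (FTC _ d) -EFinB; congr EFin.
by rewrite !mul0r !mul1r sin0 cos0; field.
Qed.

Lemma lebesgue_reflect (c : R) (f : R -> \bar R) : (forall x, 0 <= f x)%E ->
  measurable_fun setT f -> (\int[mu]_z f (c - z)%R = \int[mu]_z f z)%E.
Proof.
move=> f0 mf.
have mphi : measurable_fun setT (fun z : measurableTypeR R => (c - z : measurableTypeR R)).
  exact: measurable_funB.
have e A : measurable A -> pushforward mu (fun z : measurableTypeR R => (c - z : measurableTypeR R)) A = mu A.
  move=> mA; apply/esym.
  pose phi : {mfun measurableTypeR R >-> measurableTypeR R} :=
    HB.pack (fun z : measurableTypeR R => (c - z : measurableTypeR R)) (isMeasurableFun.Build _ _ _ _ _ mphi).
  apply: (@lebesgue_measure_unique R (pushforward mu phi)) => //= _ [[a b]] _ <-.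
  rewrite /pushforward/=.
  have -> : phi @^-1` `]a, b] = `[c - b, c - a[%classic.
    by apply/seteqP; split => z; rewrite /phi/= !in_itv/= => /andP[? ?]; apply/andP; split; lra.
  rewrite !lebesgue_measure_itv/= !lte_fin ltrD2l ltrN2.
  by case: ifP => // _; congr EFin; lra.
have := ge0_integral_pushforward mphi mu measurableT mf (fun y _ => f0 y).
rewrite preimage_setT => <-.
by apply: eq_measure_integral => A mA _; exact: e.
Qed.

(** The point 0 is set apart because 4 / 0 is 0 by convention while the kernel equals 1 there. *)
Lemma hker_dom x : hker x <= 4 / x ^+ 2 \/ x = 0.
Proof.
have [->|x0] := eqVneq x 0; [by right|left].
rewrite /hker (negbTE x0) ler_pM2r ?invr_gt0 ?exprn_even_gt0//.
have := cos_geN1 x; lra.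
Qed.

Lemma cvg0_bound_inv (F : R -> R) (K : R) : (forall x, 0 < x -> `|F x| <= K / x) ->
  F x @[x --> +oo%R] --> (0 : R).
Proof.
move=> FK; apply/cvgrPdist_le => /= e e0.
near=> x; rewrite sub0r normrN.
have x0 : 0 < x by near: x; exact: nbhs_pinfty_gt.
apply: (le_trans (FK x x0)); rewrite ler_pdivrMr// mulrC -ler_pdivrMr//.
Unshelve. all: end_near. Qed.

Lemma expRN_le_inv (u : R) : 0 < u -> expR (- u) <= 1 / u.
Proof.
move=> u0; rewrite expRN div1r lef_pV2 ?posrE ?expR_gt0//.
by have := expR_ge1Dx u; lra.
Qed.

Lemma mul_expRN_le_inv (u : R) : 0 < u -> u * expR (- u) <= 4 / u.
Proof.
move=> u0; rewrite expRN ler_pdivrMr ?expR_gt0//.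
rewrite mulrAC ler_pdivlMr//.
have e : u * u = 4 * (u / 2) ^+ 2 by field.
have e2 : expR u = expR (u / 2) ^+ 2.
  by rewrite -expRM_natl; congr expR; field.
rewrite e e2 ler_pM2l// lerXn2r ?nnegrE ?expR_ge0//; first by lra.
by have := expR_ge1Dx (u / 2); lra.
Qed.

Lemma FTC0y (f F : R -> R) : (forall x, 0 <= x -> 0 <= f x) ->
  (forall x : R, is_derive x 1 F (f x)) -> continuous f ->
  F x @[x --> +oo%R] --> (0 : R) ->
  (\int[mu]_(x in `[0%R, +oo[) (f x)%:E = (- F 0)%:E)%E.
Proof.
move=> f0 dF cf Fy.
have cF : continuous F.
  by move=> y; apply/differentiable_continuous/derivable1_diffP; exact: ex_derive.
rewrite (ge0_continuous_FTC2y f0 _ Fy); first by rewrite sub0e.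
- exact: continuous_subspaceT.
- by move=> x _; exact: ex_derive.
- by apply: cvg_at_right_filter; exact: cF.
- by move=> t _; rewrite derive1E; exact: derive_val.
Qed.

Lemma derive_cont (F dF : R -> R) : (forall t : R, is_derive t 1 F (dF t)) -> continuous F.
Proof. by move=> H y; apply/differentiable_continuous/derivable1_diffP; exact: ex_derive. Qed.

Lemma int_y_expRN x : 0 < x ->
  (\int[mu]_(y in `[0%R, +oo[) (y * expR (- (x * y)))%:E = (x^-1 ^+ 2)%:E)%E.
Proof.
move=> x0; have xn : x != 0 by rewrite gt_eqF.
have d (y : R) : is_derive y 1 (fun y : R => - ((x^-1 * y + x^-1 ^+ 2) * expR (- (x * y)))) (y * expR (- (x * y))).
  by apply: is_derive_eq; rewrite /GRing.scale/=; field.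
rewrite (FTC0y _ d).
- by congr EFin; rewrite mulr0 add0r mulr0 oppr0 expR0 mulr1 opprK.
- by move=> y y0; rewrite mulr_ge0// expR_ge0.
- apply: (derive_cont (dF := fun y => expR (- (x * y)) - x * y * expR (- (x * y)))) => y.
  by apply: is_derive_eq; rewrite /GRing.scale/=; ring.
- apply: (@cvg0_bound_inv _ (4 * x^-1 ^+ 3 + x^-1 ^+ 3)) => y y0.
  have xy0 : 0 < x * y by rewrite mulr_gt0.
  rewrite normrN ger0_norm; last first.
    by rewrite mulr_ge0 ?expR_ge0// addr_ge0 ?sqr_ge0// mulr_ge0 ?invr_ge0 ?ltW.
  have h1 := expRN_le_inv xy0; have h2 := mul_expRN_le_inv xy0.
  have x20 : 0 < x^-1 ^+ 2 by rewrite exprn_gt0// invr_gt0.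
  have -> : (x^-1 * y + x^-1 ^+ 2) * expR (- (x * y)) =
     x^-1 ^+ 2 * (x * y * expR (- (x * y)) + expR (- (x * y))) by field.
  have -> : (4 * x^-1 ^+ 3 + x^-1 ^+ 3) / y = x^-1 ^+ 2 * (4 / (x * y) + 1 / (x * y)).
    by field; rewrite xn gt_eqF.
  by rewrite ler_pM2l// lerD.
Qed.

Lemma int_cos_expRN y : 0 < y ->
  (\int[mu]_(x in `[0%R, +oo[) ((1 - cos x) * expR (- (x * y)))%:E = (y^-1 * (1 + y ^+ 2)^-1)%:E)%E.
Proof.
move=> y0; have yn : y != 0 by rewrite gt_eqF.
have y2 : 0 < 1 + y ^+ 2 by rewrite ltr_wpDr// sqr_ge0.
have y2n : 1 + y ^+ 2 != 0 by rewrite gt_eqF.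
have d (x : R) : is_derive x 1 (fun x : R => expR (- (x * y)) * ((1 + y ^+ 2)^-1 * (y * cos x - sin x) - y^-1)) ((1 - cos x) * expR (- (x * y))).
  by apply: is_derive_eq; rewrite /GRing.scale/=; field; rewrite y2n yn.
rewrite (FTC0y _ d).
- by congr EFin; rewrite mul0r oppr0 expR0 sin0 cos0; field; rewrite y2n yn.
- by move=> x _; rewrite mulr_ge0 ?expR_ge0// subr_ge0 cos_le1.
- apply: (derive_cont (dF := fun x => sin x * expR (- (x * y)) - (1 - cos x) * y * expR (- (x * y)))) => x.
  by apply: is_derive_eq; rewrite /GRing.scale/=; ring.
- pose K := (1 + y ^+ 2)^-1 * (y + 1) + y^-1.
  have K0 : 0 <= K by rewrite addr_ge0 ?invr_ge0 ?(ltW y0)// mulr_ge0 ?invr_ge0 ?(ltW y2)// addr_ge0// ltW.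
  apply: (@cvg0_bound_inv _ (K / y)) => x x0.
  have xy0 : 0 < x * y by rewrite mulr_gt0.
  rewrite normrM (ger0_norm (expR_ge0 _)).
  have -> : K / y / x = (1 / (x * y)) * K by field; rewrite yn gt_eqF.
  apply: ler_pM => //; rewrite ?expR_ge0 ?expRN_le_inv//.
  apply: (le_trans (ler_normB _ _)); rewrite (ger0_norm (x := y^-1)) ?invr_ge0 ?(ltW y0)//.
  rewrite lerD2r normrM (ger0_norm (x := (1 + y ^+ 2)^-1)) ?invr_ge0 ?(ltW y2)//.
  rewrite ler_pM2l ?invr_gt0//; apply: (le_trans (ler_normB _ _)).
  rewrite normrM (ger0_norm (ltW y0)) lerD//; last exact: sin_max.
  by rewrite ler_piMr ?(ltW y0)//; exact: cos_max.
Qed.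

End kernel.

(** * Mass and tails of the kernel *)

Section kernel_mass.
Context {R : realType}.
Implicit Types x y z : R.
Local Notation mu := (@lebesgue_measure R).

Lemma ge0_integral_even (f : R -> \bar R) : (forall x, 0 <= f x)%E ->
  measurable_fun setT f -> (forall x, f (- x)%R = f x) ->
  (\int[mu]_x f x = 2%:E * \int[mu]_(x in `[0%R, +oo[) f x)%E.
Proof.
move=> f0 mf fN.
have -> : (setT : set R) = `]-oo, 0%R[ `|` `[0%R, +oo[.
  by apply/seteqP; split => x //= _; rewrite !in_itv/= andbT; have [|] := leP 0 x; [right|left].
rewrite ge0_integral_setU//.
- rewrite integral_itv_bndo_bndc; last exact: measurable_funTS.
  rewrite [X in (X + _)%E](_ : _ = \int[mu]_(x in `[0%R, +oo[) f x)%E; last first.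
    by rewrite ge0_integration_by_substitution0//; apply: eq_integral => x _; rewrite fN.
  by rewrite [X in _ = (X * _)%E](_ : _ = 1 + 1)%E ?ge0_muleDl ?mul1e//.
- exact: measurable_funTS.
- rewrite disj_set2E; apply/eqP; rewrite -subset0 => x []/=; rewrite !in_itv/= andbT => h1 h2.
  by rewrite ltNge h2 in h1.
Qed.

Lemma hker_half : (\int[mu]_(x in `[0%R, +oo[) (hker x)%:E = (pi : R)%:E)%E.
Proof.
have m0 : measurable (`[0%R, +oo[%classic : set R) by [].
have mh : measurable_fun setT (fun x => (hker x)%:E).
  by apply/measurable_EFinP; exact: measurable_hker.
pose D : set R := `[0%R, +oo[%classic.
(* The indicators are factors of the integrand, so that Tonelli runs over the whole plane. *)
pose f (z : R * R) : \bar R := ((2 * ((1 - cos z.1) * (z.2 * expR (- (z.1 * z.2))))) * (\1_D z.1 * \1_D z.2))%:E.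
have mz1 : measurable_fun setT (fun z : R * R => z.1) by exact: measurable_fst.
have mz2 : measurable_fun setT (fun z : R * R => z.2) by exact: measurable_snd.
have mf : measurable_fun setT f.
  apply/measurable_EFinP; apply: measurable_funM.
    apply: measurable_funM => //; apply: measurable_funM.
      by apply: measurable_funB => //; exact: (measurableT_comp measurable_cos).
    apply: measurable_funM => //; apply: measurableT_comp => //.
    by apply: measurableT_comp => //; exact: measurable_funM.
  by apply: measurable_funM; apply: measurableT_comp.
have D1 (x : R) : 0 <= x -> \1_D x = 1 :> R.
  by move=> x0; rewrite indicE mem_set// /D/= in_itv/= andbT.
have D0 (x : R) : x < 0 -> \1_D x = 0 :> R.
  by move=> x0; rewrite indicE; case: (boolP (x \in D)) => //; rewrite inE /D /= ?in_itv/= ?andbT leNgt x0.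
have f0 (z : R * R) : (0 <= f z)%E.
  rewrite lee_fin; have [z20|/D0 ->] := leP 0 z.2; last by rewrite !mulr0.
  by rewrite mulr_ge0// mulr_ge0// mulr_ge0 ?subr_ge0 ?cos_le1// mulr_ge0// expR_ge0.
have D1' (x : R) : 0 < x -> \1_`]0%R, +oo[%classic x = 1 :> R.
  by move=> x0; rewrite indicE mem_set// /D/= in_itv/= andbT.
have D0' (x : R) : x <= 0 -> \1_`]0%R, +oo[%classic x = 0 :> R.
  by move=> x0; rewrite indicE; case: (boolP (_ \in _)) => //; rewrite inE /= ?in_itv/= ?andbT ltNge x0.
have := @fubini_tonelli _ _ _ _ R mu mu f mf f0.
have m01 : measurable_fun setT (\1_D : R -> R) by exact: measurable_indic.
rewrite [LHS](_ : _ = \int[mu]_(x in `[0%R, +oo[) (hker x)%:E)%E; last first.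
  rewrite -[RHS]integral_itv_obnd_cbnd; last exact: measurable_funTS.
  rewrite [RHS]integral_indic_mul; apply: eq_integral => x _; rewrite /f/=.
  have [x0|x0] := ltP 0 x; last first.
    rewrite D0'// mule0 integral0_eq// => y _.
    have [x0'|/D0 ->] := leP 0 x; last by rewrite mul0r mulr0.
    have -> : x = 0 by apply/eqP; rewrite eq_le x0 x0'.
    by rewrite cos0 subrr mul0r mulr0 mul0r.
  rewrite D1'// mule1 D1 ?(ltW x0)//.
  have e1 : (\int[mu]_y (2 * ((1 - cos x) * (y * expR (- (x * y)))) * (1 * \1_D y))%:E =
     \int[mu]_(y in D) ((2 * (1 - cos x))%:E * (y * expR (- (x * y)))%:E))%E.
    rewrite [RHS]integral_indic_mul; apply: eq_integral => y _.
    by rewrite -!EFinM; congr EFin; ring.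
  rewrite e1 ge0_integralZl//.
  - by rewrite int_y_expRN// /hker gt_eqF// -EFinM exprVn.
  - apply/measurable_EFinP; apply: measurable_funTS; apply: measurable_funM => //.
    by do 2 apply: measurableT_comp => //; exact: measurable_funM.
  - by move=> y; rewrite /D/= in_itv/= andbT => y0; rewrite lee_fin mulr_ge0// expR_ge0.
move=> ->.
have minv : measurable_fun setT (fun y : R => (1 + y ^+ 2)^-1).
  by apply: (measurableT_comp (@measurable_invr R)); apply: measurable_funD => //; exact: measurable_funX.
transitivity (\int[mu]_(y in D) (2 * (1 + y ^+ 2)^-1)%:E)%E; last first.
  under eq_integral do rewrite EFinM.
  rewrite ge0_integralZl//.
  - by rewrite (integral0y_oneDsqr R) -EFinM; congr EFin; field.
  - by apply/measurable_EFinP; exact: measurable_funTS.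
  - by move=> y _; rewrite lee_fin invr_ge0 addr_ge0// sqr_ge0.
rewrite -[RHS]integral_itv_obnd_cbnd; last first.
  by apply/measurable_EFinP; apply: measurable_funTS; exact: measurable_funM.
rewrite [RHS]integral_indic_mul; apply: eq_integral => y _; rewrite /f/=.
have [y0|y0] := ltP 0 y; last first.
  rewrite D0'// mule0 integral0_eq// => x _.
  have [y0'|/D0 ->] := leP 0 y; last by rewrite !mulr0.
  have -> : y = 0 by apply/eqP; rewrite eq_le y0 y0'.
  by rewrite mul0r mulr0 mulr0 mul0r.
rewrite D1'// mule1 D1 ?(ltW y0)//.
have e2 : (\int[mu]_x (2 * ((1 - cos x) * (y * expR (- (x * y)))) * (\1_D x * 1))%:E =
   \int[mu]_(x in D) ((2 * y)%:E * ((1 - cos x) * expR (- (x * y)))%:E))%E.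
  rewrite [RHS]integral_indic_mul; apply: eq_integral => x _.
  by rewrite -!EFinM; congr EFin; ring.
rewrite e2 ge0_integralZl//.
- rewrite int_cos_expRN// -EFinM; congr EFin.
  by field; rewrite ?gt_eqF// ltr_wpDr// sqr_ge0.
- apply/measurable_EFinP; apply: measurable_funTS; apply: measurable_funM.
    by apply: measurable_funB => //; exact: measurable_cos.
  by do 2 apply: measurableT_comp => //; exact: measurable_funM.
- by rewrite lee_fin; apply: mulr_ge0 => //; exact: ltW.
Qed.

Lemma hker_mass : (\int[mu]_x (hker x)%:E = (2 * pi)%:E)%E.
Proof.
rewrite ge0_integral_even.
- by rewrite hker_half.
- by move=> x; rewrite lee_fin hker_ge0.
- by apply/measurable_EFinP; exact: measurable_hker.
- by move=> x; rewrite hkerN.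
Qed.

Lemma hker_tail (dl : R) : 0 < dl ->
  (\int[mu]_(x in [set x | (dl < `|x|)%R]) (hker x)%:E <= (8 / dl)%:E)%E.
Proof.
move=> d0.
have mD : measurable [set x : R | dl < `|x|].
  rewrite (_ : [set x : R | dl < `|x|] = (@Num.norm R R) @^-1` `]dl, +oo[).
    by rewrite -[X in measurable X]setTI; apply: normr_measurable.
  by apply/seteqP; split => x/=; rewrite in_itv/= andbT.
have mh : measurable_fun setT (fun x => ((hker x)%:E * (\1_[set x | dl < `|x|] x)%:E)%E).
  apply: emeasurable_funM; apply/measurable_EFinP; first exact: measurable_hker.
  exact: measurable_indic.
rewrite integral_indic_mul ge0_integral_even//; last 2 first.
- by move=> x; rewrite mule_ge0// lee_fin ?hker_ge0.
- by move=> x; rewrite hkerN !indicE; congr (_ * (_ _)%:R%:E)%E; apply/idP/idP; rewrite !inE/= normrN.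
rewrite (_ : 8 / dl = 2 * (4 / dl)); last by field; rewrite gt_eqF.
rewrite EFinM lee_pmul2l//.
have Fy : (fun x : R => (- 4) * x^-1) x @[x --> +oo%R] --> (0 : R).
  apply: (@cvg0_bound_inv _ _ 4) => x x0; rewrite mulNr normrN ger0_norm//.
  by rewrite divr_ge0// ltW.
have m1 : measurable_fun setT (fun x : R => 4 * (x ^+ 2)^-1).
  apply: measurable_funM => //; apply: (measurableT_comp (@measurable_invr R)).
  exact: measurable_funX.
have cinv (x : R) : x != 0 -> {for x, continuous (fun x : R => 4 * (x ^+ 2)^-1)}.
  move=> x0; apply: cvgM; first exact: cvg_cst.
  apply: cvgV; first by rewrite expf_neq0.
  by apply: exprn_continuous.
have dF (x : R) : x != 0 -> is_derive x 1 (fun x : R => (- 4) * x^-1) (4 * (x ^+ 2)^-1).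
  move=> x0; have h : is_derive x 1 (fun y : R => y^-1) (- x ^- 2 *: 1) by exact: is_deriveV.
  by apply: is_derive_eq; rewrite /GRing.scale/=; field.
have FTC : (\int[mu]_(x in `[dl, +oo[) (4 * (x ^+ 2)^-1)%:E = (4 / dl)%:E)%E.
  have cd (x : R) : dl <= x -> x != 0 by move=> dx; rewrite gt_eqF// (lt_le_trans d0).
  rewrite (ge0_continuous_FTC2y _ _ Fy).
  - by rewrite sub0e; congr EFin; rewrite mulNr opprK.
  - by move=> x dx; rewrite mulr_ge0// invr_ge0 sqr_ge0.
  - apply: continuous_in_subspaceT => x; rewrite inE/= in_itv/= andbT => dx.
    by apply: cinv; exact: cd.
  - by move=> x dx; have := dF x (cd _ (ltW dx)) => H; exact: ex_derive.
  - have H := dF dl (cd _ (lexx _)).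
    have c : {for dl, continuous (fun x : R => (- 4) * x^-1)}.
      by apply/differentiable_continuous/derivable1_diffP; exact: ex_derive.
    by apply: cvg_at_right_filter; exact: c.
  - move=> x; rewrite in_itv/= andbT => dx; rewrite derive1E.
    by have H := dF x (cd _ (ltW dx)); exact: derive_val.
rewrite -FTC (integral_indic_mul mu `[0%R, +oo[) (integral_indic_mul mu `[dl, +oo[).
apply: ge0_le_integral => //.
- by move=> x _; rewrite !mule_ge0// lee_fin ?hker_ge0.
- apply: emeasurable_funM => //; exact/measurable_EFinP.
- by apply: emeasurable_funM; exact/measurable_EFinP.
- move=> x _; have [dx|dx] := ltP dl `|x|; last first.
    rewrite [X in (_ * X%:E * _)%E]indicE memNset ?mule0 ?mul0e; last by rewrite /= ltNge dx.
    by rewrite mule_ge0// lee_fin// mulr_ge0// invr_ge0 sqr_ge0.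
  have [x0|x0] := leP 0 x; last first.
    rewrite [X in (_ * X%:E <= _)%E]indicE memNset ?mule0; last by rewrite /= in_itv/= andbT leNgt x0.
    by rewrite mule_ge0// lee_fin// mulr_ge0// invr_ge0 sqr_ge0.
  have e1 : x \in [set x | dl < `|x|] by rewrite mem_set.
  have e2 : x \in `[0%R, +oo[%classic by rewrite mem_set//= in_itv/= andbT.
  have e3 : x \in `[dl, +oo[%classic by rewrite mem_set//= in_itv/= andbT -(ger0_norm x0) ltW.
  rewrite !indicE e1 e2 e3 !mule1.
  rewrite lee_fin; have [//|xe] := hker_dom x.
  by rewrite xe normr0 ltNge (ltW d0) in dx.
Qed.

Lemma hker_center (dl : R) : 0 < dl ->
  ((2 * pi - 8 / dl)%:E <= \int[mu]_(x in [set x | (`|x| <= dl)%R]) (hker x)%:E)%E.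
Proof.
move=> d0.
have mD : measurable [set x : R | dl < `|x|].
  rewrite (_ : [set x : R | dl < `|x|] = (@Num.norm R R) @^-1` `]dl, +oo[).
    by rewrite -[X in measurable X]setTI; apply: normr_measurable.
  by apply/seteqP; split => x/=; rewrite in_itv/= andbT.
have CE : [set x : R | `|x| <= dl] = ~` [set x : R | dl < `|x|].
  by apply/seteqP; split => x /=; rewrite leNgt => /negP.
have mh : measurable_fun setT (fun x => (hker x)%:E).
  by apply/measurable_EFinP; exact: measurable_hker.
have := hker_mass; rewrite -(setUv [set x : R | dl < `|x|]) ge0_integral_setU//; last 4 first.
- exact: measurableC.
- exact: measurable_funTS.
- by move=> x _; rewrite lee_fin hker_ge0.
- by rewrite disj_set2E setICr.
rewrite -CE EFinB => <-.
rewrite leeBlDl//; first by rewrite leeD2r// hker_tail.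
Qed.

End kernel_mass.

(** * The Gaussian integral *)

Section gaussian.
Context {R : realType}.
Local Notation mu := (@lebesgue_measure R).

Lemma measurable_gauss (k : R) : measurable_fun setT (fun s : R => expR (- (k * s ^+ 2))).
Proof.
by do 2 apply: measurableT_comp => //; apply: measurable_funM => //; exact: measurable_funX.
Qed.

(** Total mass of the centred normal density of variance 1 / (2 k), halved by symmetry. *)
Lemma gauss_half (k : R) : 0 < k ->
  (\int[mu]_(s in `[0%R, +oo[) (expR (- (k * s ^+ 2)))%:E = (Num.sqrt (pi / k) / 2)%:E)%E.
Proof.
move=> k0; pose sg : R := Num.sqrt (1 / (2 * k)).
have sg2 : sg ^+ 2 = 1 / (2 * k) by rewrite sqr_sqrtr// divr_ge0// mulr_ge0// ltW.
have sg0 : sg != 0 by rewrite gt_eqF// sqrtr_gt0 divr_gt0// mulr_gt0.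
have pk : normal_peak sg = (Num.sqrt (pi / k))^-1.
  rewrite /normal_peak sg2; congr (Num.sqrt _)^-1.
  by rewrite -mulr_natl; field; rewrite gt_eqF.
have pk0 : 0 < Num.sqrt (pi / k) by rewrite sqrtr_gt0 divr_gt0// pi_gt0.
have := integral_normal_pdf (0 : R) sg.
have -> : (\int[mu]_x (normal_pdf 0 sg x)%:E)%E =
   (\int[mu]_x ((normal_peak sg)%:E * (expR (- (k * x ^+ 2)))%:E))%E.
  apply: eq_integral => x _; rewrite normal_pdfE// -EFinM; congr (_ * expR _)%:E.
  by rewrite subr0 -mulr_natl sg2; field; rewrite gt_eqF.
have mg : measurable_fun setT (fun x : R => (expR (- (k * x ^+ 2)))%:E).
  by apply/measurable_EFinP; exact: measurable_gauss.
have g0 (x : R) : (0 <= (expR (- (k * x ^+ 2)))%:E)%E by rewrite lee_fin expR_ge0.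
have gN (x : R) : (expR (- (k * (- x) ^+ 2)))%:E = (expR (- (k * x ^+ 2)))%:E by rewrite sqrrN.
rewrite (ge0_integralZl mu measurableT mg) ?lee_fin ?normal_peak_ge0// (ge0_integral_even g0 mg gN).
set I := integral _ _ _.
have I0 : (0 <= I)%E by apply: integral_ge0 => x _; rewrite lee_fin expR_ge0.
rewrite muleA pk -EFinM.
have a0 : 0 < (Num.sqrt (pi / k))^-1 * 2 by rewrite mulr_gt0// invr_gt0.
case: I I0 => [r|_|//]; last first.
  by rewrite gt0_muley ?lte_fin.
move=> _; rewrite -EFinM => -[e]; congr EFin.
have : r = (Num.sqrt (pi / k))^-1 * 2 * r * (Num.sqrt (pi / k) / 2).
  by field; rewrite gt_eqF.
by rewrite e mul1r.
Qed.

End gaussian.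

Lemma sqrtn_inv_cvg (R : realType) : (Num.sqrt n%:R)^-1 @[n --> \oo] --> (0 : R).
Proof.
apply/cvgrPdist_le => /= e e0; near=> n; rewrite sub0r normrN.
have n0 : (0 < n)%N by near: n; exact: nbhs_infty_gt.
have r0 : 0 < Num.sqrt n%:R :> R by rewrite sqrtr_gt0 ltr0n.
rewrite ger0_norm ?invr_ge0 ?(ltW r0)// -[leRHS]invrK lef_pV2 ?posrE ?invr_gt0//.
rewrite -(ler_pXn2r (n := 2)) ?nnegrE ?invr_ge0 ?(ltW r0) ?(ltW e0)//.
rewrite sqr_sqrtr//; near: n; exact: nbhs_infty_ger.
Unshelve. all: end_near. Qed.

Lemma cvg_dist_sqrtn (R : realType) (f : nat -> R) (l B : R) :
  (forall n, (0 < n)%N -> `|f n - l| <= B * (Num.sqrt n%:R)^-1) ->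
  f n @[n --> \oo] --> l.
Proof.
move=> H; have := @sqrtn_inv_cvg R => /(cvgMl_tmp (a := B)); rewrite mulr0 => hB.
apply/cvgrPdist_le => /= e e0.
move/cvgrPdist_le : hB => /(_ e e0) hB; near=> n.
rewrite distrC.
have n0 : (0 < n)%N by near: n; exact: nbhs_infty_gt.
apply: (le_trans (H n n0)); apply: (le_trans (ler_norm _)).
by rewrite -normrN -sub0r; near: n; exact: hB.
Unshelve. all: end_near. Qed.

(** * Powers of a characteristic function *)

Section cf.
Context {R : realType}.
Local Notation mu := (@lebesgue_measure R).
(** [C] and [Sg] stand for the real and imaginary parts of the characteristic function of one step,
    [c n] and [s n] for those of its n-th power; the recursions [cS] and [sS] are complex
    multiplication. [CK] and [SK] say that the step is centred with variance v^2. *)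
Variables (C Sg : R -> R) (c s : nat -> R -> R) (v K : R).
Hypothesis c0 : forall t, c 0 t = 1.
Hypothesis s0 : forall t, s 0 t = 0.
Hypothesis cS : forall n t, c n.+1 t = c n t * C t - s n t * Sg t.
Hypothesis sS : forall n t, s n.+1 t = s n t * C t + c n t * Sg t.
Hypothesis cC : continuous C.
Hypothesis cSg : continuous Sg.
Hypothesis v0 : 0 < v.
Hypothesis K0 : 0 <= K.
Hypothesis CK : forall t, `|C t - 1 + 2^-1 * (v * t) ^+ 2| <= K * `|t| ^+ 3.
Hypothesis SK : forall t, `|Sg t| <= K * `|t| ^+ 3.
Hypothesis mod1 : forall t, C t ^+ 2 + Sg t ^+ 2 <= 1.
Hypothesis mod_lt1 : forall t, 0 < t -> t <= 1 -> C t ^+ 2 + Sg t ^+ 2 < 1.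

Lemma cf_cont n : continuous (c n) /\ continuous (s n).
Proof.
elim: n => [|n [IHc IHs]].
  by split; [rewrite (_ : c 0 = cst 1)|rewrite (_ : s 0 = cst 0)];
    try (by apply/funext => t; rewrite ?c0 ?s0); move=> t; exact: cvg_cst.
split.
- rewrite (_ : c n.+1 = fun t => c n t * C t - s n t * Sg t); last by apply/funext.
  by move=> t; apply: cvgB; apply: cvgM; [exact: IHc|exact: cC|exact: IHs|exact: cSg].
- rewrite (_ : s n.+1 = fun t => s n t * C t + c n t * Sg t); last by apply/funext.
  by move=> t; apply: cvgD; apply: cvgM; [exact: IHs|exact: cC|exact: IHc|exact: cSg].
Qed.

Lemma cf_mod n t : c n t ^+ 2 + s n t ^+ 2 = (C t ^+ 2 + Sg t ^+ 2) ^+ n.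
Proof.
elim: n => [|n IH]; first by rewrite c0 s0 expr0; ring.
by rewrite [RHS]exprSr -IH cS sS; ring.
Qed.

Lemma sqsum_ge0 (x y : R) : 0 <= x ^+ 2 + y ^+ 2.
Proof. by rewrite addr_ge0// sqr_ge0. Qed.

Lemma cf_le1 n t : `|c n t| <= 1 /\ `|s n t| <= 1.
Proof.
have h : c n t ^+ 2 + s n t ^+ 2 <= 1.
  by rewrite cf_mod exprn_ile1 ?sqsum_ge0.
have [h1 h2] := (sqr_ge0 (c n t), sqr_ge0 (s n t)).
by split; rewrite -(ler_pXn2r (n := 2))// ?nnegrE// expr1n real_normK ?num_real//; lra.
Qed.

(** Real form of |z^n - g^n| <= n |z - g| for numbers of modulus at most 1. *)
Lemma cf_approx n t (g : R) : 0 <= g -> g <= 1 ->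
  `|c n t - g ^+ n| <= n%:R * (`|C t - g| + `|Sg t|) /\
  `|s n t| <= n%:R * (`|C t - g| + `|Sg t|).
Proof.
move=> g0 g1; elim: n => [|n [IH1 IH2]].
  by rewrite c0 s0 expr0 subrr normr0 mul0r.
have [h1 h2] := cf_le1 n t.
set e := `|C t - g| + `|Sg t|.
have m (x y : R) : `|x| <= 1 -> `|x * y| <= `|y|.
  by move=> x1; rewrite normrM ler_piMl.
rewrite -natr1 mulrDl mul1r; split.
- have -> : c n.+1 t - g ^+ n.+1 = g * (c n t - g ^+ n) + (c n t * (C t - g) - s n t * Sg t).
    by rewrite cS exprS; ring.
  apply: (le_trans (ler_normD _ _)); apply: lerD.
    by apply: le_trans IH1; apply: m; rewrite ger0_norm.
  by apply: (le_trans (ler_normB _ _)); apply: lerD; exact: m.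
- have -> : s n.+1 t = g * s n t + (s n t * (C t - g) + c n t * Sg t).
    by rewrite sS; ring.
  apply: (le_trans (ler_normD _ _)); apply: lerD.
    by apply: le_trans IH2; apply: m; rewrite ger0_norm.
  by apply: (le_trans (ler_normD _ _)); apply: lerD; exact: m.
Qed.

(** Near 0 the second-order expansion bounds the modulus by a Gaussian; on the rest of (0, 1] the
    modulus has a maximum below 1, by compactness. This yields one Gaussian majorant on the whole
    support of the Fourier transform of the kernel. *)
Lemma cf_decay : exists2 k : R, 0 < k &
  forall t, 0 <= t -> t <= 1 -> C t ^+ 2 + Sg t ^+ 2 <= expR (- (2 * k * t ^+ 2)).
Proof.
have hK0 : 0 <= K := K0.
pose f t := C t ^+ 2 + Sg t ^+ 2.
have cf : continuous f.
  by move=> t; apply: cvgD; rewrite !expr2; apply: cvgM; [exact: cC|exact: cC|exact: cSg|exact: cSg].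
(* Small enough for the cubic error to be at most v^2 t^2 / 8 ([h1]) and for [C] to stay nonnegative
   on [0, dl] ([h2]). *)
pose dl := Num.min 1 (v ^+ 2 / (8 * (K + v ^+ 2 + 1) * (v ^+ 2 + 1))).
have v20 : 0 < v ^+ 2 by rewrite exprn_gt0.
have den : 0 < 8 * (K + v ^+ 2 + 1) * (v ^+ 2 + 1).
  have q1 : 0 < K + v ^+ 2 + 1 by move: K0 v20; lra.
  have q2 : 0 < v ^+ 2 + 1 by move: v20; lra.
  by rewrite !mulr_gt0.
have dl0 : 0 < dl by rewrite lt_min ltr01 divr_gt0.
have dl1 : dl <= 1 by rewrite ge_min lexx.
have dlv : dl * (8 * (K + v ^+ 2 + 1) * (v ^+ 2 + 1)) <= v ^+ 2.
  by rewrite -ler_pdivlMr// ge_min lexx orbT.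
have h1 : dl * (8 * K) <= v ^+ 2.
  apply: le_trans dlv; rewrite ler_pM2l// -mulrA ler_pM2l//.
  have : 0 <= (K + v ^+ 2 + 1) * v ^+ 2 by rewrite mulr_ge0//; lra.
  lra.
have h2 : dl * (8 * (K + v ^+ 2)) <= 1.
  rewrite -(ler_pM2r (x := v ^+ 2 + 1)); last by lra.
  apply: (@le_trans _ _ (v ^+ 2)); last by lra.
  apply: le_trans dlv; rewrite -!mulrA ler_pM2l// ler_pM2l// ler_pM2r//; last by lra.
  lra.
have small t : 0 <= t -> t <= dl -> f t <= expR (- (v ^+ 2 / 4 * t ^+ 2)).
  move=> t0 tdl; have t1 : t <= 1 by exact: le_trans tdl dl1.
  have t2 : 0 <= t ^+ 2 by rewrite sqr_ge0.
  have t3 : 0 <= t ^+ 3 by rewrite exprn_ge0.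
  have kt : K * t ^+ 3 <= v ^+ 2 / 8 * t ^+ 2.
    have -> : K * t ^+ 3 = (t * (8 * K)) / 8 * t ^+ 2 by field.
    rewrite ler_wpM2r// ler_pM2r// ?invr_gt0//; apply: le_trans h1.
    by rewrite ler_wpM2r// mulr_ge0.
  have := CK t; have := SK t; rewrite (ger0_norm t0) => hS.
  rewrite ler_norml => /andP[hC1 hC2].
  rewrite exprMn in hC1 hC2.
  have C1 : C t ^+ 2 <= 1 by have := mod1 t; have := sqr_ge0 (Sg t); lra.
  have Cpos : 0 <= C t.
    have : v ^+ 2 * t ^+ 2 + K * t ^+ 3 <= 1.
      have a1 : K * t ^+ 3 <= K * t.
        by rewrite ler_wpM2l// exprS ler_piMr// expr_le1.
      have a2 : v ^+ 2 * t ^+ 2 <= v ^+ 2 * t.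
        by rewrite ler_pM2l// expr2 ler_piMr.
      have a3 : (K + v ^+ 2) * t <= (K + v ^+ 2) * dl.
        by rewrite ler_wpM2l//; lra.
      lra.
    lra.
  have Cle1 : C t <= 1 by rewrite -(ler_pXn2r (n := 2))// ?nnegrE// expr1n.
  have Sle : Sg t ^+ 2 <= `|Sg t|.
    rewrite -[X in X <= _]ger0_norm ?sqr_ge0// normrX expr2 ler_piMl//.
    rewrite -(ler_pXn2r (n := 2))// ?nnegrE// expr1n real_normK ?num_real//.
    by have := mod1 t; have := sqr_ge0 (C t); lra.
  have CC : C t ^+ 2 <= C t by rewrite expr2 ler_piMl.
  apply: le_trans (expR_ge1Dx _); rewrite /f; lra.
have [x] := @EVT_max R f dl 1 dl1 (continuous_subspaceT cf).
rewrite in_itv/= => /andP[dx x1] fmax.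
pose m := Num.max (f x) (expR (-1)).
have m0 : 0 < m by rewrite lt_max expR_gt0 orbT.
have m1 : m < 1.
  rewrite gt_max; apply/andP; split.
    by apply: mod_lt1 => //; exact: lt_le_trans dl0 dx.
  by apply: (@lt_le_trans _ _ (expR 0)); [rewrite ltr_expR; lra|rewrite expR0].
pose k := Num.min (v ^+ 2 / 8) (- ln m / 2).
have lm : 0 < - ln m by rewrite oppr_gt0 ln_lt0// m0.
exists k; first by rewrite lt_min !divr_gt0.
move=> t t0 t1; have t2 : 0 <= t ^+ 2 by rewrite sqr_ge0.
have [tdl|dlt] := leP t dl.
  apply: (le_trans (small t t0 tdl)); rewrite ler_expR lerN2 ler_wpM2r//.
  have : k <= v ^+ 2 / 8 by rewrite ge_min lexx.
  lra.
apply: (@le_trans _ _ m).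
  apply: (@le_trans _ _ (f x)); last by rewrite le_max lexx.
  by apply: fmax; rewrite in_itv/= ltW.
rewrite -[X in X <= _](lnK m0) ler_expR lerNr.
have kl : k <= - ln m / 2 by rewrite ge_min lexx orbT.
have tt : t ^+ 2 <= 1 by rewrite expr_le1.
apply: (@le_trans _ _ (- ln m * t ^+ 2)); first by rewrite ler_wpM2r//; lra.
by rewrite ler_piMr// ltW.
Qed.

(** Real part of exp(- i t u) times the n-th power of the characteristic function, that is, the
    expectation of cos(t (S_n - u)). *)
Definition psi n u t := cos (t * u) * c n t + sin (t * u) * s n t.

Lemma psi_sq n u t : psi n u t ^+ 2 <= (C t ^+ 2 + Sg t ^+ 2) ^+ n.
Proof.
rewrite -cf_mod /psi; set a := cos _; set b := sin _.
have ab : a ^+ 2 + b ^+ 2 = 1 by exact: cos2Dsin2.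
have -> : c n t ^+ 2 + s n t ^+ 2 = (a * c n t + b * s n t) ^+ 2 + (a * s n t - b * c n t) ^+ 2.
  by rewrite -[LHS]mul1r -ab; ring.
by rewrite lerDl sqr_ge0.
Qed.

Lemma psi_cont n u : continuous (psi n u).
Proof.
have [h1 h2] := cf_cont n.
have l : continuous (fun t : R => t * u) by move=> t; apply: cvgM; [exact: cvg_id|exact: cvg_cst].
move=> t; apply: cvgD; apply: cvgM.
- by apply: continuous_comp; [exact: l|exact: continuous_cos].
- exact: h1.
- by apply: continuous_comp; [exact: l|exact: continuous_sin].
- exact: h2.
Qed.

(** The smoothed integrand after the substitution t = x / sqrt n, extended by 0 so that the domain
    of integration no longer depends on n. *)
Definition gsc n u (x : R) : R :=
  2 * (1 - x / Num.sqrt n%:R) * psi n u (x / Num.sqrt n%:R)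
  * \1_(`[0, Num.sqrt n%:R]%classic : set R) x.

Lemma sqrtn_gt0 n : (0 < n)%N -> 0 < Num.sqrt n%:R :> R.
Proof. by move=> n0; rewrite sqrtr_gt0 ltr0n. Qed.

Lemma gsc_scale n u : (0 < n)%N ->
  (\int[mu]_(t in `[0%R, 1%R]) (Num.sqrt n%:R * (2 * (1 - t) * psi n u t))%:E =
   \int[mu]_(x in `[0%R, +oo[) (gsc n u x)%:E)%E.
Proof.
move=> n0; have r0 := sqrtn_gt0 n0; set r := Num.sqrt n%:R in r0 *.
have rn : r != 0 by rewrite gt_eqF.
pose F (x : R) : R := x * r^-1.
pose G (t : R) : R := r * (2 * (1 - t) * psi n u t).
have dF (x : R) : is_derive x 1 F r^-1.
  by apply: is_derive_eq; rewrite /GRing.scale/=; ring.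
have F'E : (F^`())%classic = cst r^-1.
  by apply/funext => x; rewrite derive1E; exact: derive_val.
have F0 : F 0 = 0 by rewrite /F mul0r.
have F1 : F r = 1 by rewrite /F divff.
have cG : continuous G.
  move=> t; apply: cvgM; first exact: cvg_cst.
  apply: cvgM; last exact: psi_cont.
  by apply: cvgM; [exact: cvg_cst|apply: cvgB; [exact: cvg_cst|exact: cvg_id]].
have cF := derive_cont dF.
have := @integration_by_substitution_increasing R F G 0 r (ltW r0).
rewrite F0 F1 F'E => ->.
- rewrite (integral_indic_mul mu `[0%R, r]) (integral_indic_mul mu `[0%R, +oo[).
  apply: eq_integral => x _; rewrite -!EFinM; congr EFin; rewrite /gsc -/r /G /F /=.
  rewrite [\1_`[0, +oo[%classic x]indicE [\1_`[0, r]%classic x]indicE.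
  have [xr|xr] := boolP (x \in `[0, r]%classic); last by rewrite !mulr0 mul0r.
  have -> : x \in `[0, +oo[%classic.
    by move: xr; rewrite !inE/= !in_itv/= andbT => /andP[].
  rewrite !mulr1; transitivity (r * (2 * (1 - x / r) * psi n u (x / r)) * r^-1); first by [].
  by field.
- by move=> x y _ _ xy; rewrite /F ltr_pM2r// invr_gt0.
- by move=> x _; exact: cvg_cst.
- exact: is_cvg_cst.
- exact: is_cvg_cst.
- split; first by move=> y _; exact: ex_derive.
    by apply: cvg_at_right_filter; exact: cF.
  by apply: cvg_at_left_filter; exact: cF.
- exact: continuous_subspaceT.
Qed.

Lemma measurable_gsc n u : measurable_fun setT (gsc n u).
Proof.
apply: measurable_funM; last exact: measurable_indic.
have m1 : measurable_fun setT (fun x : R => x / Num.sqrt n%:R) by exact: measurable_funM.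
apply: measurable_funM.
  by apply: measurable_funM => //; exact: measurable_funB.
by apply: measurableT_comp => //; apply: continuous_measurable_fun; exact: psi_cont.
Qed.

Lemma gsc_dom : exists2 k : R, 0 < k &
  forall n u x, (0 < n)%N -> `|gsc n u x| <= 2 * expR (- (k * x ^+ 2)).
Proof.
have [k k0 hk] := cf_decay; exists k => // n u x n0.
have r0 := sqrtn_gt0 n0; rewrite /gsc; set r := Num.sqrt n%:R in r0 *.
have r2 : r ^+ 2 = n%:R by rewrite sqr_sqrtr.
rewrite indicE; have [|] := boolP (x \in _); last first.
  by rewrite mulr0 normr0 mulr_ge0// expR_ge0.
rewrite inE/= in_itv/= mulr1 => /andP[x0 xr].
have t0 : 0 <= x / r by rewrite divr_ge0// ltW.
have t1 : x / r <= 1 by rewrite ler_pdivrMr// mul1r.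
rewrite !normrM -mulrA ger0_norm// ler_pM2l// -[leRHS]mul1r.
apply: ler_pM => //; first by rewrite ger0_norm; lra.
rewrite -(ler_pXn2r (n := 2))// ?nnegrE ?expR_ge0// real_normK ?num_real//.
apply: (le_trans (psi_sq _ _ _)).
apply: (@le_trans _ _ (expR (- (2 * k * (x / r) ^+ 2)) ^+ n)).
  by apply: lerXn2r (hk _ t0 t1); rewrite nnegrE ?sqsum_ge0 ?expR_ge0.
rewrite -!expRM_natl ler_expR -r2.
by rewrite le_eqVlt; apply/orP; left; apply/eqP; field; rewrite gt_eqF.
Qed.

(** Central limit behaviour of the n-th power at x / sqrt n; the translation u disappears because x
    u / sqrt n tends to 0. *)
Lemma gsc_cvg u x : 0 <= x ->
  gsc n u x @[n --> \oo] --> 2 * expR (- (v ^+ 2 / 2 * x ^+ 2)).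
Proof.
have hK0 : 0 <= K := K0.
move=> x0.
pose g := expR (- (v ^+ 2 / 2 * x ^+ 2)).
pose r n : R := Num.sqrt n%:R.
(* The cubic term collects the errors of [CK] and [SK], the square comes from replacing 1 - y by
   exp(- y). At t = x / sqrt n, multiplied by n, both are O(1 / sqrt n). *)
pose B : R := 2 * K * x ^+ 3 + (v ^+ 2 / 2 * x ^+ 2) ^+ 2.
have B0 : 0 <= B by rewrite addr_ge0 ?sqr_ge0// mulr_ge0 ?exprn_ge0// mulr_ge0.
have key n : (0 < n)%N -> `|c n (x / r n) - g| <= B * (r n)^-1 /\ `|s n (x / r n)| <= B * (r n)^-1.
  move=> n0; have r0 := sqrtn_gt0 n0; rewrite -/(r n) in r0.
  have rn : r n != 0 by rewrite gt_eqF.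
  have r2 : r n ^+ 2 = n%:R by rewrite sqr_sqrtr.
  have r1 : 1 <= r n by rewrite -(ler_pXn2r (n := 2)) ?nnegrE ?(ltW r0)// expr1n r2 ler1n.
  pose t := x / r n.
  have t0 : 0 <= t by rewrite divr_ge0// ltW.
  pose y := v ^+ 2 / 2 * t ^+ 2.
  have y0 : 0 <= y by rewrite mulr_ge0 ?sqr_ge0// mulr_ge0 ?sqr_ge0.
  have gn : expR (- y) ^+ n = g.
    rewrite -expRM_natl /g; congr expR; rewrite /y /t -r2; field.
    by rewrite rn.
  have gle1 : expR (- y) <= 1 by rewrite -expR0 ler_expR; lra.
  have [h1 h2] := @cf_approx n t _ (expR_ge0 _) gle1; rewrite gn in h1.
  suff H : n%:R * (`|C t - expR (- y)| + `|Sg t|) <= B * (r n)^-1.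
    by split; [exact: le_trans h1 H|exact: le_trans h2 H].
  have e1 : `|C t - expR (- y)| <= K * t ^+ 3 + y ^+ 2.
    have -> : C t - expR (- y) = (C t - 1 + 2^-1 * (v * t) ^+ 2) - (expR (- y) - 1 + y).
      by rewrite /y; field.
    apply: (le_trans (ler_normB _ _)); apply: lerD; last exact: expRN_taylor.
    by have := CK t; rewrite (ger0_norm t0).
  have e2 : `|Sg t| <= K * t ^+ 3 by have := SK t; rewrite (ger0_norm t0).
  apply: (@le_trans _ _ (n%:R * (2 * K * t ^+ 3 + y ^+ 2))).
    rewrite ler_wpM2l//; lra.
  have -> : n%:R * (2 * K * t ^+ 3 + y ^+ 2) =
     2 * K * x ^+ 3 * (r n)^-1 + (v ^+ 2 / 2 * x ^+ 2) ^+ 2 * (r n)^-1 * (r n)^-1.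
    by rewrite -r2 /y /t; field; rewrite rn.
  have -> : B * (r n)^-1 = 2 * K * x ^+ 3 * (r n)^-1 + (v ^+ 2 / 2 * x ^+ 2) ^+ 2 * (r n)^-1.
    by rewrite /B mulrDl.
  rewrite lerD2l ler_piMr ?invf_le1//.
  by rewrite mulr_ge0 ?sqr_ge0// invr_ge0 ltW.
have cn : c n (x / r n) @[n --> \oo] --> g by exact: (cvg_dist_sqrtn (fun n n0 => (key n n0).1)).
have sn : s n (x / r n) @[n --> \oo] --> (0 : R).
  by apply: (@cvg_dist_sqrtn _ _ _ B) => n n0; rewrite subr0; exact: (key n n0).2.
have xr : x / r n @[n --> \oo] --> (0 : R).
  by rewrite -[X in _ --> X](mulr0 x); apply: cvgM; [exact: cvg_cst|exact: sqrtn_inv_cvg].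
have xru : x / r n * u @[n --> \oo] --> (0 : R).
  by rewrite -[X in _ --> X](mul0r u); apply: cvgM; [exact: xr|exact: cvg_cst].
have cosx : cos (x / r n * u) @[n --> \oo] --> (1 : R).
  by rewrite -[X in _ --> X](@cos0 R); exact: (cvg_comp _ _ xru (@continuous_cos R 0)).
have sinx : sin (x / r n * u) @[n --> \oo] --> (0 : R).
  by rewrite -[X in _ --> X](@sin0 R); exact: (cvg_comp _ _ xru (@continuous_sin R 0)).
have main : 2 * (1 - x / r n) * psi n u (x / r n) @[n --> \oo] --> 2 * (1 - 0) * (1 * g + 0 * 0).
  apply: cvgM; first by apply: cvgM; [exact: cvg_cst|apply: cvgB => //; exact: cvg_cst].
  by apply: cvgD; apply: cvgM.
rewrite subr0 mulr1 mul1r mulr0 addr0 in main.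
apply: cvg_trans main; apply: near_eq_cvg; near=> n.
rewrite /gsc -/(r n) indicE mem_set ?mulr1//= in_itv/= x0/=.
rewrite -(ler_pXn2r (n := 2)) ?nnegrE ?sqrtr_ge0// sqr_sqrtr//.
by near: n; exact: nbhs_infty_ger.
Unshelve. all: end_near. Qed.

(** Dominated convergence with the majorant of [gsc_dom]. Since this majorant does not involve u,
    the bound is uniform in u. *)
Lemma gsc_integral_cvg u :
  ((\int[mu]_(x in `[0%R, +oo[) (gsc n u x)%:E)%E @[n --> \oo] --> (Num.sqrt (2 * pi) / v)%:E) /\
  exists2 B : R, 0 <= B & forall n u', (0 < n)%N ->
    (`| \int[mu]_(x in `[0%R, +oo[) (gsc n u' x)%:E | <= B%:E)%E.
Proof.
have [k k0 hk] := gsc_dom.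
have mg : measurable_fun setT (fun x : R => (2 * expR (- (k * x ^+ 2)))%:E).
  by apply/measurable_EFinP; apply: measurable_funM => //; exact: measurable_gauss.
have Ig : (\int[mu]_(x in `[0%R, +oo[) (2 * expR (- (k * x ^+ 2)))%:E = (2 * (Num.sqrt (pi / k) / 2))%:E)%E.
  under eq_integral do rewrite EFinM.
  have mg1 : measurable_fun (`[0%R, +oo[%classic : set R) (fun x : R => (expR (- (k * x ^+ 2)))%:E).
    by apply/measurable_EFinP; apply: measurable_funTS; exact: measurable_gauss.
  have g0 (x : R) : (`[0%R, +oo[%classic : set R) x -> (0 <= (expR (- (k * x ^+ 2)))%:E)%E.
    by move=> _; rewrite lee_fin expR_ge0.
  have m0 : measurable (`[0%R, +oo[%classic : set R) by [].
  by rewrite (ge0_integralZl mu m0 mg1 g0) ?lee_fin// gauss_half.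
split; last first.
  exists (2 * (Num.sqrt (pi / k) / 2)); first by rewrite mulr_ge0// divr_ge0// sqrtr_ge0.
  move=> n u' n0; rewrite -Ig.
  apply: (le_trans (le_abse_integral _ _ _)) => //.
    by apply/measurable_EFinP; apply: measurable_funTS; exact: measurable_gsc.
  apply: ge0_le_integral => //.
  - apply: measurableT_comp => //; apply/measurable_EFinP; apply: measurable_funTS; exact: measurable_gsc.
  - exact: measurable_funTS.
  - by move=> x _; rewrite lee_fin hk.
have v20 : 0 < v ^+ 2 / 2 by rewrite divr_gt0// exprn_gt0.
have -> : Num.sqrt (2 * pi) / v = 2 * (Num.sqrt (pi / (v ^+ 2 / 2)) / 2).
  have -> : pi / (v ^+ 2 / 2) = 2 * pi * v^-1 ^+ 2 by field; rewrite gt_eqF.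
  have -> : Num.sqrt (2 * pi * v^-1 ^+ 2) = Num.sqrt (2 * pi) * v^-1.
    rewrite [in LHS]mulrC sqrtrM ?sqr_ge0// sqrtr_sqr ger0_norm ?invr_ge0 ?(ltW v0)//.
    by rewrite mulrC.
  by field; rewrite gt_eqF.
have -> : (2 * (Num.sqrt (pi / (v ^+ 2 / 2)) / 2))%:E =
   (\int[mu]_(x in `[0%R, +oo[) (2 * expR (- (v ^+ 2 / 2 * x ^+ 2)))%:E)%E.
  under [RHS]eq_integral do rewrite EFinM.
  have mg1 : measurable_fun (`[0%R, +oo[%classic : set R) (fun x : R => (expR (- (v ^+ 2 / 2 * x ^+ 2)))%:E).
    by apply/measurable_EFinP; apply: measurable_funTS; exact: measurable_gauss.
  have g0 (x : R) : (`[0%R, +oo[%classic : set R) x -> (0 <= (expR (- (v ^+ 2 / 2 * x ^+ 2)))%:E)%E.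
    by move=> _; rewrite lee_fin expR_ge0.
  have m0 : measurable (`[0%R, +oo[%classic : set R) by [].
  by rewrite (ge0_integralZl mu m0 mg1 g0) ?lee_fin// gauss_half.
have intg : mu.-integrable `[0%R, +oo[ (fun x : R => (2 * expR (- (k * x ^+ 2)))%:E).
  apply/integrableP; split; first exact: measurable_funTS.
  under eq_integral do rewrite gee0_abs ?lee_fin ?mulr_ge0 ?expR_ge0//.
  by rewrite Ig ltry.
(* The majorant is available for positive n, hence the shift by one. *)
rewrite -(cvg_shiftS (fun n => (\int[mu]_(x in `[0%R, +oo[) (gsc n u x)%:E)%E)).
apply: (@dominated_cvg _ _ _ mu _ _ (fun n x => (gsc n.+1 u x)%:E) _ (fun x : R => (2 * expR (- (k * x ^+ 2)))%:E)) => //.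
- by move=> n; apply/measurable_EFinP; apply: measurable_funTS; exact: measurable_gsc.
- move=> x; rewrite /= in_itv/= andbT => x0; apply: cvg_EFin; first exact: nearW.
  have := gsc_cvg u x0; rewrite -(cvg_shiftS (fun n => gsc n u x)); exact.
- by move=> n x _; rewrite lee_fin hk.
Qed.

End cf.

(** * Expectation of the kernel along a walk *)

Section smoothing.
Context d (T : measurableType d) (R : realType) (P : probability T R).
Local Notation mu := (@lebesgue_measure R).

Lemma bounded_integrable (f : T -> R) (K : R) : measurable_fun setT f ->
  (forall w, `|f w| <= K) -> P.-integrable setT (EFin \o f).
Proof.
move=> mf fK; apply/integrableP; split; first exact/measurable_EFinP.
apply: (@le_lt_trans _ _ (\int[P]_w (cst K%:E w))%E).
  apply: ge0_le_integral => //.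
  - by apply: measurableT_comp => //; exact/measurable_EFinP.
  - by move=> w _; rewrite /= lee_fin.
rewrite integral_cst//; apply: (@le_lt_trans _ _ (K%:E * 1)%E); last by rewrite mule1 ltry.
have K0 : 0 <= K by exact: le_trans (normr_ge0 _) (fK point).
by rewrite lee_wpmul2l ?lee_fin//; exact: probability_le1.
Qed.

(** What the local limit asks of the characteristic functions of a walk. The last clause covers
    every t > 0, so that the property is stable under multiplication of the walk by a positive
    constant. *)
Definition cfhyp (c s : nat -> R -> R) (v : R) : Prop :=
  [/\ forall t, c 0%N t = 1 /\ s 0%N t = 0,
      forall n t, c n.+1 t = c n t * c 1%N t - s n t * s 1%N t /\
                  s n.+1 t = s n t * c 1%N t + c n t * s 1%N t,
      continuous (c 1%N) /\ continuous (s 1%N),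
      exists2 K, 0 <= K & forall t, `|c 1%N t - 1 + 2^-1 * (v * t) ^+ 2| <= K * `|t| ^+ 3
                                 /\ `|s 1%N t| <= K * `|t| ^+ 3
    & (forall t, c 1%N t ^+ 2 + s 1%N t ^+ 2 <= 1) /\
      (forall t, 0 < t -> c 1%N t ^+ 2 + s 1%N t ^+ 2 < 1)].

Definition expo (al y : R) : R := if 0 < y then expR (- (al * y)) else 0.

Lemma expo_ge0 al y : 0 <= expo al y.
Proof. by rewrite /expo; case: ifP => // _; exact: expR_ge0. Qed.

Lemma measurable_expo al : measurable_fun setT (expo al).
Proof.
apply: measurable_fun_ifT => //; first exact: measurable_fun_ltr.
by do 2 apply: measurableT_comp => //; exact: measurable_funM.
Qed.

Lemma expo_le1 al y : 0 < al -> expo al y <= 1.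
Proof.
move=> al0; rewrite /expo; case: ifP => // y0.
by rewrite -[X in _ <= X](@expR0 R) ler_expR oppr_le0 mulr_ge0// ltW.
Qed.

(** The shift dl - z lies between 0 and 2 dl: a positive argument stays positive and the exponential
    loses at most the stated factor. The jump of [expo] at 0 is thus crossed in the harmless
    direction. *)
Lemma expo_up al dl y z : 0 < al -> `|z| <= dl ->
  expo al y <= expR (2 * al * dl) * expo al (y + dl - z).
Proof.
move=> al0; rewrite ler_norml => /andP[z1 z2].
rewrite {1}/expo; case: ifP => y0; last by rewrite mulr_ge0 ?expR_ge0 ?expo_ge0.
rewrite /expo (lt_le_trans y0); last by lra.
rewrite -expRD ler_expR.
have : 0 <= al * (dl + z) by rewrite mulr_ge0 ?(ltW al0)//; lra.
lra.
Qed.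

Lemma expo_down al dl y z : 0 < al -> `|z| <= dl ->
  expo al (y - dl - z) <= expR (2 * al * dl) * expo al y.
Proof.
move=> al0 zd; have := @expo_up al dl (y - dl - z) (- z) al0.
rewrite normrN => /(_ zd); rewrite (_ : y - dl - z + dl - - z = y)//; ring.
Qed.

Lemma integral_expo al : 0 < al -> (\int[mu]_u (expo al u)%:E = (1 / al)%:E)%E.
Proof.
move=> al0.
have dF (x : R) : is_derive x 1 (fun x : R => - (al^-1 * expR (- (al * x)))) (expR (- (al * x))).
  by apply: is_derive_eq; rewrite /GRing.scale/=; field; rewrite gt_eqF.
have := @FTC0y R _ _ _ dF _ _.
rewrite mulr0 oppr0 expR0 mulr1 opprK div1r => <-.
- rewrite -[RHS]integral_itv_obnd_cbnd; last first.
    apply/measurable_EFinP; apply: measurable_funTS.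
    by do 2 apply: measurableT_comp => //; exact: measurable_funM.
  rewrite [RHS]integral_indic_mul; apply: eq_integral => x _.
  rewrite indicE /expo -EFinM; congr EFin.
  have [x0|x0] := ltP 0 x.
    by rewrite mem_set ?mulr1//= in_itv/= x0.
  by rewrite memNset ?mulr0//= in_itv/= andbT ltNge x0.
- by move=> x _; exact: expR_ge0.
- apply: (derive_cont (dF := fun x => - (al * expR (- (al * x))))) => x.
  by apply: is_derive_eq; rewrite /GRing.scale/=; ring.
- apply: (@cvg0_bound_inv _ _ (al^-1 ^+ 2)) => x x0.
  have ax : 0 < al * x by rewrite mulr_gt0.
  rewrite normrN normrM !ger0_norm ?expR_ge0 ?invr_ge0 ?(ltW al0)//.
  have -> : al^-1 ^+ 2 / x = al^-1 * (1 / (al * x)) by field; rewrite !gt_eqF.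
  by rewrite ler_pM2l ?invr_gt0// expRN_le_inv.
Qed.

Variables (S : nat -> T -> R).
Hypothesis mS : forall n, measurable_fun setT (S n).
Definition meancos n t : R := fine (\int[P]_w (cos (t * S n w))%:E)%E.
Definition meansin n t : R := fine (\int[P]_w (sin (t * S n w))%:E)%E.

Lemma mcosS n (t u : R) : measurable_fun setT (fun w => cos (t * (S n w - u))).
Proof.
apply: (measurableT_comp (@measurable_cos R)); apply: measurable_funM => //.
exact: measurable_funB.
Qed.

Lemma cosSE n t : (\int[P]_w (cos (t * S n w))%:E = (meancos n t)%:E)%E.
Proof.
rewrite fineK//; apply: integrable_fin_num => //.
apply: (@bounded_integrable (fun w => cos (t * S n w)) 1).
  by apply: (measurableT_comp (@measurable_cos R)); exact: measurable_funM.
by move=> w; exact: cos_max.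
Qed.

Lemma sinSE n t : (\int[P]_w (sin (t * S n w))%:E = (meansin n t)%:E)%E.
Proof.
rewrite fineK//; apply: integrable_fin_num => //.
apply: (@bounded_integrable (fun w => sin (t * S n w)) 1).
  by apply: (measurableT_comp (@measurable_sin R)); exact: measurable_funM.
by move=> w; exact: sin_max.
Qed.

Lemma int1cos n t u :
  (\int[P]_w (1 + cos (t * (S n w - u)))%:E = (1 + psi meancos meansin n u t)%:E)%E.
Proof.
have mc : measurable_fun setT (fun w => cos (t * S n w)).
  by apply: (measurableT_comp (@measurable_cos R)); exact: measurable_funM.
have ms : measurable_fun setT (fun w => sin (t * S n w)).
  by apply: (measurableT_comp (@measurable_sin R)); exact: measurable_funM.
have i1 : P.-integrable setT (EFin \o (fun w => cos (t * S n w))).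
  by apply: (bounded_integrable mc) => w; exact: cos_max.
have i2 : P.-integrable setT (EFin \o (fun w => sin (t * S n w))).
  by apply: (bounded_integrable ms) => w; exact: sin_max.
transitivity (\int[P]_w ((cst 1%R w)%:E + ((cos (t * u))%:E * (cos (t * S n w))%:E + (sin (t * u))%:E * (sin (t * S n w))%:E)))%E.
  apply: eq_integral => w _; rewrite -!EFinM -!EFinD; congr EFin.
  by rewrite mulrBr cosB /=; ring.
have i1' := integrableZl measurableT (cos (t * u)) i1.
have i2' := integrableZl measurableT (sin (t * u)) i2.
have i0 : P.-integrable setT (EFin \o (cst 1 : T -> R)).
  by apply: (@bounded_integrable _ 1) => // w; rewrite normr1.
rewrite integralD//; last exact: integrableD.
rewrite integralD// !integralZl// cosSE sinSE.
rewrite (_ : integral _ _ _ = 1%E); first by [].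
have := @integral_cst _ _ _ P setT measurableT 1%:E; rewrite mul1e => ->.
exact: probability_setT.
Qed.

(** Tonelli is applied to the nonnegative function 1 + cos; the constant 1 is then cancelled from
    both sides, both integrals being finite. *)
Lemma hker_smooth n u : continuous (meancos n) /\ continuous (meansin n) ->
  (\int[P]_w (hker (S n w - u))%:E =
   \int[mu]_(t in `[0%R, 1%R]) (2 * (1 - t) * psi meancos meansin n u t)%:E)%E.
Proof.
move=> [cc cs].
pose D : set R := `[0%R, 1%R]%classic.
have mD : measurable D by exact: measurable_itv.
have mDs : measurable (D : set (measurableTypeR R)) by exact: measurable_itv.
pose f (z : T * R) : \bar R := ((2 * (1 - z.2) * (1 + cos (z.2 * (S n z.1 - u)))) * \1_D z.2)%:E.
have mf : measurable_fun setT f.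
  apply/measurable_EFinP; apply: measurable_funM; last first.
    have mi : measurable_fun setT (\1_D : R -> R) by exact: measurable_indic.
    exact: (measurableT_comp mi measurable_snd).
  apply: measurable_funM.
    by apply: measurable_funM => //; apply: measurable_funB => //; exact: measurable_snd.
  apply: measurable_funD => //; apply: (measurableT_comp (@measurable_cos R)).
  apply: measurable_funM; first exact: measurable_snd.
  by apply: measurable_funB => //; exact: (measurableT_comp (mS n) measurable_fst).
have D1 (t : R) : D t -> 0 <= t /\ t <= 1 by rewrite /D/= in_itv/= => /andP[].
have f0 (z : T * R) : (0 <= f z)%E.
  rewrite lee_fin indicE; have [|] := boolP (z.2 \in D); last by rewrite mulr0.
  have h1 : 0 <= 1 + cos (z.2 * (S n z.1 - u)) by have := cos_geN1 (z.2 * (S n z.1 - u)); lra.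
  rewrite inE => /D1[t0 t1]; rewrite mulr1; apply: mulr_ge0 => //.
  by apply: mulr_ge0 => //; rewrite subr_ge0.
have := @fubini_tonelli _ _ _ _ R P mu f mf f0.
rewrite [LHS](_ : _ = \int[P]_w ((cst 1%R w)%:E + (hker (S n w - u))%:E))%E; last first.
  apply: eq_integral => w _; rewrite -EFinD /= -hker_fourier (integral_indic_mul mu `[0%R, 1%R]).
  by apply: eq_integral => t _; rewrite /f/= EFinM.
have mh : measurable_fun setT (fun w => (hker (S n w - u))%:E).
  apply/measurable_EFinP; apply: (measurableT_comp measurable_hker).
  exact: measurable_funB.
rewrite ge0_integralD//; last by move=> w _; rewrite lee_fin hker_ge0.
rewrite (_ : (\int[P]_w (cst 1%R w)%:E) = 1%E)%E; last first.
  have := @integral_cst _ _ _ P setT measurableT 1%:E; rewrite mul1e => ->.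
  exact: probability_setT.
rewrite [RHS](_ : _ = \int[mu]_(t in D) (2 * (1 - t) * (1 + psi meancos meansin n u t))%:E)%E; last first.
  rewrite [RHS]integral_indic_mul; apply: eq_integral => t _; rewrite /f/=.
  have mc1 : measurable_fun setT (fun w => (1 + cos (t * (S n w - u)))%:E).
    by apply/measurable_EFinP; apply: measurable_funD => //; exact: mcosS.
  have [tD|tD] := boolP (t \in D); last first.
    rewrite indicE (negbTE tD) mule0 integral0_eq// => w _.
    by rewrite mulr0.
  have /D1[t0 t1] : D t by rewrite -inE.
  have k0 : (0 <= (2 * (1 - t))%:E)%E.
    by rewrite lee_fin; apply: mulr_ge0 => //; rewrite subr_ge0.
  have c0 w : setT w -> (0 <= (1 + cos (t * (S n w - u)))%:E)%E.
    by move=> _; rewrite lee_fin; have := cos_geN1 (t * (S n w - u)); lra.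
  rewrite indicE tD mule1 EFinM -int1cos -(ge0_integralZl P measurableT mc1 c0 k0).
  by apply: eq_integral => w _; rewrite mulr1 EFinM.
have cpsi : continuous (psi meancos meansin n u).
  have l : continuous (fun t : R => t * u) by move=> t; apply: cvgM; [exact: cvg_id|exact: cvg_cst].
  move=> t; apply: cvgD; apply: cvgM.
  - exact: (cvg_comp _ _ (l t) (@continuous_cos R _)).
  - exact: cc.
  - exact: (cvg_comp _ _ (l t) (@continuous_sin R _)).
  - exact: cs.
have c2 : continuous (fun t : R => 2 * (1 - t)).
  by move=> t; apply: cvgM; [exact: cvg_cst|apply: cvgB; [exact: cvg_cst|exact: cvg_id]].
have ci (g : R -> R) : continuous g -> mu.-integrable D (EFin \o g).
  by move=> cg; apply: continuous_compact_integrable; [exact: segment_compact|exact: continuous_subspaceT].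
have j1 : mu.-integrable D (EFin \o (fun t => 2 * (1 - t))) by exact: ci.
have j2 : mu.-integrable D (EFin \o (fun t => 2 * (1 - t) * psi meancos meansin n u t)).
  by apply: ci => t; apply: cvgM; [exact: c2|exact: cpsi].
rewrite [RHS](_ : _ = \int[mu]_(t in D) ((2 * (1 - t))%:E + (2 * (1 - t) * psi meancos meansin n u t)%:E))%E; last first.
  by apply: eq_integral => t _; rewrite -EFinD; congr EFin; ring.
rewrite integralD//.
have -> : (\int[mu]_(t in D) (2 * (1 - t))%:E = 1%E)%E.
  have := hker_fourier (0 : R).
  rewrite /hker eqxx => e.
  have e2 : (\int[mu]_(t in D) ((2 : R)%R%:E * (2 * (1 - t))%R%:E) = (1 + 1 : R)%R%:E)%E.
    by apply: etrans e; apply: eq_integral => t _; rewrite mulr0 cos0 -EFinM; congr EFin; ring.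
  have pos t : D t -> (0 <= (EFin \o (fun t : R => (2 * (1 - t))%R)) t)%E.
    by move=> /D1[t0 t1]; rewrite lee_fin; apply: mulr_ge0 => //; rewrite subr_ge0.
  have z2 : (0 <= (2 : R)%R%:E)%E by rewrite lee_fin.
  have := @ge0_integralZl _ (measurableTypeR R) R mu D mDs _ (measurable_int mu j1) _ pos z2.
  rewrite /comp e2; have := @integrable_fin_num _ (measurableTypeR R) R mu D mDs _ j1; rewrite /comp.
  case: (integral _ _ _) => // r _; rewrite -EFinM => -[e3].
  by congr EFin; lra.
have := @integrable_fin_num _ (measurableTypeR R) R mu D mDs _ j2; rewrite /comp.
case: (\int[mu]_(t in D) (2 * (1 - t) * psi meancos meansin n u t)%:E)%E => // r _.
have g0 : (0 <= \int[P]_w (hker (S n w - u))%:E)%E.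
  by apply: integral_ge0 => w _; rewrite lee_fin hker_ge0.
case: (\int[P]_w (hker (S n w - u))%:E)%E g0 => // q _ [].
  by move=> e; congr EFin; lra.
exact: (measurable_cst 1%:E).
Qed.

End smoothing.

(** * Comparison of a function with its kernel average *)

Section desmoothing.
Context d (T : measurableType d) (R : realType) (P : probability T R).
Local Notation mu := (@lebesgue_measure R).
Variables (S : nat -> T -> R).
Hypothesis mS : forall n, measurable_fun setT (S n).

(** [Nn] is the quantity whose limit is sought. Its kernel average [Gn] is also an exponential
    average of [gn], and [gn] is accessible through characteristic functions. *)
Definition Nn al n x : \bar R := ((Num.sqrt n%:R)%:E * \int[P]_w (expo al (S n w - x))%:E)%E.
Definition gn n u : \bar R := ((Num.sqrt n%:R)%:E * \int[P]_w (hker (S n w - u))%:E)%E.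
Definition Gn al n x : \bar R := (\int[mu]_z ((hker z)%:E * Nn al n (x + z)))%E.

Let sqn0 n : (0 <= (Num.sqrt n%:R : R)%:E)%E.
Proof. by rewrite lee_fin sqrtr_ge0. Qed.

Lemma Nn_ge0 al n x : (0 <= Nn al n x)%E.
Proof. by rewrite mule_ge0//; apply: integral_ge0 => w _; rewrite lee_fin expo_ge0. Qed.

Lemma gn_ge0 n x : (0 <= gn n x)%E.
Proof. by rewrite mule_ge0//; apply: integral_ge0 => w _; rewrite lee_fin hker_ge0. Qed.

Lemma mexpoS al n x : measurable_fun setT (fun w => (expo al (S n w - x))%:E).
Proof.
apply/measurable_EFinP; apply: (measurableT_comp (measurable_expo al)).
exact: measurable_funB.
Qed.

Lemma mhkerS n x : measurable_fun setT (fun w => (hker (S n w - x))%:E).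
Proof.
by apply/measurable_EFinP; apply: (measurableT_comp measurable_hker); exact: measurable_funB.
Qed.

Lemma measurable_Nn al n x : measurable_fun setT (fun z : R => Nn al n (x + z)).
Proof.
apply: measurable_funeM.
apply: (@measurable_fun_fubini_tonelli_F _ _ _ _ R P (fun z : R * T => (expo al (S n z.2 - (x + z.1)))%:E)).
- apply/measurable_EFinP; apply: (measurableT_comp (measurable_expo al)).
  apply: measurable_funB; first exact: (measurableT_comp (mS n) measurable_snd).
  by apply: measurable_funD => //; exact: measurable_fst.
- by move=> z; rewrite lee_fin expo_ge0.
Qed.

Lemma measurable_gn n x : measurable_fun setT (fun u : R => gn n (x + u)).
Proof.
apply: measurable_funeM.
apply: (@measurable_fun_fubini_tonelli_F _ _ _ _ R P (fun z : R * T => (hker (S n z.2 - (x + z.1)))%:E)).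
- apply/measurable_EFinP; apply: (measurableT_comp measurable_hker).
  apply: measurable_funB; first exact: (measurableT_comp (mS n) measurable_snd).
  by apply: measurable_funD => //; exact: measurable_fst.
- by move=> z; rewrite lee_fin hker_ge0.
Qed.

Lemma hk0 (z : R) : (0 <= (hker z)%:E)%E.
Proof. by rewrite lee_fin hker_ge0. Qed.

Lemma mhk : measurable_fun setT (fun z : R => (hker z)%:E).
Proof. by apply/measurable_EFinP; exact: measurable_hker. Qed.

Lemma mex al : measurable_fun setT (fun z : R => (expo al z)%:E).
Proof. by apply/measurable_EFinP; exact: measurable_expo. Qed.

(** For each outcome, the substitution u = S_n - x - z moves the translation from the exponential to
    the kernel. *)
Lemma Gn_eq al n x : Gn al n x = (\int[mu]_u ((expo al u)%:E * gn n (x + u)))%E.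
Proof.
have pull (f : R -> R) (h : R -> T -> R) (mf : measurable_fun setT (fun z => (f z)%:E))
    (f0 : forall z, 0 <= f z) (h0 : forall z w, 0 <= h z w)
    (mh : measurable_fun setT (fun z : R * T => h z.1 z.2)) :
    (\int[mu]_z ((f z)%:E * ((Num.sqrt n%:R)%:E * \int[P]_w (h z w)%:E)) =
     (Num.sqrt n%:R)%:E * \int[P]_w \int[mu]_z (f z * h z w)%:E)%E.
  have mh1 z : measurable_fun setT (fun w => (h z w)%:E).
    apply/measurable_EFinP; exact: (measurableT_comp mh (measurable_pair1 z)).
  have mF : measurable_fun setT (fun z : R * T => (f z.1 * h z.1 z.2)%:E).
    apply/measurable_EFinP; apply: measurable_funM => //.
    by apply: measurableT_comp; [exact/measurable_EFinP|exact: measurable_fst].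
  have F0 (z : R * T) : (0 <= (f z.1 * h z.1 z.2)%:E)%E by rewrite lee_fin mulr_ge0.
  rewrite -(@fubini_tonelli _ _ _ _ R mu P _ mF F0) -ge0_integralZl//.
  - apply: eq_integral => z _; rewrite muleCA; congr (_ * _)%E.
    transitivity (\int[P]_w ((f z)%:E * (h z w)%:E))%E; last by apply: eq_integral => w _; rewrite EFinM.
    have hz0 w : setT w -> (0 <= (h z w)%:E)%E by move=> _; rewrite lee_fin.
    by rewrite (ge0_integralZl P measurableT (mh1 z) hz0) ?lee_fin.
  - by apply: (measurable_fun_fubini_tonelli_F (fun z : R * T => (f z.1 * h z.1 z.2)%:E)).
  - by move=> z _; apply: integral_ge0 => w _; exact: (F0 (z, w)).
rewrite /Gn /Nn /gn pull; last 4 first.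
- exact: mhk.
- exact: hker_ge0.
- by move=> z w; exact: expo_ge0.
- apply: (measurableT_comp (measurable_expo al)).
  apply: measurable_funB; first exact: (measurableT_comp (mS n) measurable_snd).
  by apply: measurable_funD => //; exact: measurable_fst.
rewrite pull; last 4 first.
- exact: mex.
- exact: expo_ge0.
- by move=> z w; exact: hker_ge0.
- apply: (measurableT_comp measurable_hker).
  apply: measurable_funB; first exact: (measurableT_comp (mS n) measurable_snd).
  by apply: measurable_funD => //; exact: measurable_fst.
congr (_ * _)%E; apply: eq_integral => w _.
rewrite -(@lebesgue_reflect R (S n w - x)).
- apply: eq_integral => z _; congr EFin; rewrite mulrC; congr (expo _ _ * hker _); ring.
- by move=> z; rewrite lee_fin mulr_ge0 ?hker_ge0 ?expo_ge0.
- apply/measurable_EFinP; apply: measurable_funM; first exact: measurable_hker.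
  apply: (measurableT_comp (measurable_expo al)); apply: measurable_funB => //.
  exact: measurable_funD.
Qed.

Let Cset dl : set R := [set z | `|z| <= dl].
Let mC dl : measurable (Cset dl).
Proof.
rewrite (_ : Cset dl = (@Num.norm R R) @^-1` `]-oo, dl]).
  by rewrite -[X in measurable X]setTI; apply: normr_measurable.
by apply/seteqP; split => x/=; rewrite in_itv.
Qed.

Ltac nonneg := solve [ by [] | exact: mC | exact: measurableC | exact: mexpoS | exact: mhk | exact: mex | exact: (measurable_funTS mhk)
  | by apply: measurable_funeM; exact: mexpoS
  | by apply: emeasurable_funM => //; exact: mhk | by rewrite lee_fin | exact: Nn_ge0
  | by move=> ? _; rewrite lee_fin ?expo_ge0 ?hker_ge0
  | by move=> ? _; rewrite mule_ge0 ?Nn_ge0// lee_fin hker_ge0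
  | by rewrite mule_ge0 ?Nn_ge0
  | by apply: measurable_funTS; apply: measurable_funeM; exact: mhk
  | by apply: measurable_funTS; apply: measurable_funeM; apply: emeasurable_funM => //; exact: mhk
  | by apply: measurable_funeM; apply: emeasurable_funM => //; exact: mhk
  | by apply: measurable_funeM; exact: mhk
  | exact: measurable_funTS
  | by move=> z _; apply: mule_ge0; rewrite ?Nn_ge0 ?lee_fin ?hker_ge0
  | by move=> z _; apply: mule_ge0; rewrite ?lee_fin// mule_ge0 ?Nn_ge0// lee_fin hker_ge0
  | by move=> z _; apply: mule_ge0; rewrite ?lee_fin ?hker_ge0// mule_ge0 ?Nn_ge0// lee_fin ].

Lemma Nn_le al n x y k : 0 <= k ->
  (forall w, expo al (S n w - x) <= k * expo al (S n w - y)) ->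
  (Nn al n x <= k%:E * Nn al n y)%E.
Proof.
move=> k0 H; rewrite /Nn muleCA lee_wpmul2l// -ge0_integralZl; [ |nonneg..].
apply: ge0_le_integral => //.
- by move=> w _; rewrite lee_fin expo_ge0.
- exact: mexpoS.
- by apply: measurable_funeM; exact: mexpoS.
- by move=> w _; rewrite -EFinM lee_fin.
Qed.

(** By [expo_up], [Nn] at x is at most exp(2 al dl) times [Nn] at any x - dl + z with |z| <= dl;
    averaging over the centre of the kernel leaves the mass 2 pi - 8 / dl on the left. *)
Lemma Nn_up al n x dl : 0 < al -> 0 < dl ->
  (Nn al n x * (2 * pi - 8 / dl)%:E <= (expR (2 * al * dl))%:E * Gn al n (x - dl))%E.
Proof.
move=> al0 d0; set e := expR _; have e0 : 0 <= e by exact: expR_ge0.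
apply: (@le_trans _ _ (Nn al n x * \int[mu]_(z in Cset dl) (hker z)%:E)%E).
  by rewrite lee_wpmul2l ?Nn_ge0//; exact: hker_center.
have mNz : measurable_fun setT (fun z : R => Nn al n ((x - dl) + z)) by exact: measurable_Nn.
rewrite /Gn -(ge0_integralZl mu (D := setT)); [ |nonneg..].
rewrite -(ge0_integralZl mu (D := Cset dl)); [ |nonneg..].
apply: (@le_trans _ _ (\int[mu]_(z in Cset dl) (e%:E * ((hker z)%:E * Nn al n (x - dl + z))))%E).
  apply: ge0_le_integral; [nonneg.. | ].
  move=> z zd; rewrite (muleC (Nn al n x)) (muleCA e%:E) lee_wpmul2l ?lee_fin ?hker_ge0//.
    apply: Nn_le => // w.
    have := @expo_up _ al dl (S n w - x) z al0 zd.
    by rewrite (_ : S n w - (x - dl + z) = S n w - x + dl - z)//; ring.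
apply: ge0_subset_integral; nonneg.
Qed.

(** The centre of the kernel is handled by [expo_down]. Outside it only a uniform bound on [Nn] is
    at hand, which is why [Nn_up] must yield such a bound before this estimate can be used. *)
Lemma Nn_down al n x dl K : 0 < al -> 0 < dl -> 0 <= K -> (forall y, Nn al n y <= K%:E)%E ->
  (Gn al n (x + dl) <= (expR (2 * al * dl) * (2 * pi))%:E * Nn al n x + (K * (8 / dl))%:E)%E.
Proof.
move=> al0 d0 K0 NK; set e := expR _; have e0 : 0 <= e by exact: expR_ge0.
have mNz : measurable_fun setT (fun z : R => Nn al n ((x + dl) + z)) by exact: measurable_Nn.
have mF : measurable_fun setT (fun z : R => (hker z)%:E * Nn al n (x + dl + z))%E.
  by apply: emeasurable_funM => //; exact: mhk.
have F0 z : (0 <= (hker z)%:E * Nn al n (x + dl + z))%E.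
  by rewrite mule_ge0 ?Nn_ge0// lee_fin hker_ge0.
have CE : ~` Cset dl = [set z | dl < `|z|].
  by apply/seteqP; split => z /=; rewrite ltNge => /negP.
have dC : [disjoint Cset dl & ~` Cset dl] by apply/eqP; rewrite setICr.
rewrite /Gn -(setUv (Cset dl)) (@ge0_integral_setU _ (measurableTypeR R) R mu _ _ (mC dl) (measurableC (mC dl)) _ (measurable_funTS mF) (fun z _ => F0 z) dC).
apply: leeD.
- apply: (@le_trans _ _ (\int[mu]_(z in Cset dl) ((e%:E * Nn al n x) * (hker z)%:E))%E).
    apply: ge0_le_integral; [nonneg.. | ].
    move=> z zd; rewrite (muleC (e%:E * Nn al n x)%E) lee_wpmul2l ?lee_fin ?hker_ge0//.
      apply: Nn_le => // w.
      have := @expo_down _ al dl (S n w - x) z al0 zd.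
      by rewrite (_ : S n w - (x + dl + z) = S n w - x - dl - z)//; ring.
  apply: (@le_trans _ _ (\int[mu]_z ((e%:E * Nn al n x) * (hker z)%:E))%E).
    apply: ge0_subset_integral; nonneg.
  have eN0 : (0 <= e%:E * Nn al n x)%E by rewrite mule_ge0 ?Nn_ge0// lee_fin.
  rewrite (ge0_integralZl mu measurableT mhk (fun z _ => hk0 z) eN0).
  by rewrite hker_mass -muleA (muleC (Nn al n x)) muleA -EFinM.
- rewrite CE; have mCC : measurable [set z : R | dl < `|z|] by rewrite -CE; exact: measurableC.
  apply: (@le_trans _ _ (\int[mu]_(z in [set z | (dl < `|z|)%R]) (K%:E * (hker z)%:E))%E).
    have mN2 : measurable_fun setT (fun z : R => K%:E * (hker z)%:E)%E by apply: measurable_funeM; exact: mhk.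
    apply: (@ge0_le_integral _ (measurableTypeR R) R mu _ mCC _ _ (fun z _ => F0 z) (measurable_funTS mF) (measurable_funTS mN2)).
    by move=> z zd; rewrite (muleC K%:E) lee_wpmul2l ?lee_fin ?hker_ge0.
  have K0' : (0 <= K%:E)%E by rewrite lee_fin.
  rewrite (ge0_integralZl mu mCC (measurable_funTS mhk) (fun z _ => hk0 z) K0').
  by rewrite EFinM lee_wpmul2l ?lee_fin//; exact: hker_tail.
Qed.

End desmoothing.

(** * Limit of the smoothed quantities and a uniform bound *)

Section local_limit.
Context d (T : measurableType d) (R : realType) (P : probability T R).
Local Notation mu := (@lebesgue_measure R).
Variables (S : nat -> T -> R).
Hypothesis mS : forall n, measurable_fun setT (S n).
Local Notation Nn := (Nn P S).
Local Notation gn := (gn P S).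
Local Notation Gn := (Gn P S).
Variable v : R.
Hypothesis v0 : 0 < v.
Hypothesis hcf : cfhyp (meancos P S) (meansin P S) v.

Lemma gn_facts : (forall u, gn n u @[n --> \oo] --> (Num.sqrt (2 * pi) / v)%:E) /\
  exists2 B : R, 0 <= B & forall n u, (gn n u <= B%:E)%E.
Proof.
have [h0 hS [cc cs] [K K0 hK] [m1 m2]] := hcf.
pose c := meancos P S; pose s := meansin P S.
have hc0 t : c 0%N t = 1 by have [] := h0 t.
have hs0 t : s 0%N t = 0 by have [] := h0 t.
have hcS n t : c n.+1 t = c n t * c 1%N t - s n t * s 1%N t by have [] := hS n t.
have hsS n t : s n.+1 t = s n t * c 1%N t + c n t * s 1%N t by have [] := hS n t.
have hCK t : `|c 1%N t - 1 + 2^-1 * (v * t) ^+ 2| <= K * `|t| ^+ 3 by have [] := hK t.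
have hSK t : `|s 1%N t| <= K * `|t| ^+ 3 by have [] := hK t.
have hm2 t : 0 < t -> t <= 1 -> c 1%N t ^+ 2 + s 1%N t ^+ 2 < 1 by move=> t0 _; exact: m2.
have ccn n : continuous (c n) /\ continuous (s n).
  exact: (cf_cont hc0 hs0 hcS hsS cc cs).
have gE n u : (0 < n)%N -> gn n u = (\int[mu]_(x in `[0%R, +oo[) (gsc c s n u x)%:E)%E.
  move=> n0; rewrite /gn (hker_smooth mS _ (ccn n)).
  rewrite -(gsc_scale hc0 hs0 hcS hsS cc cs _ n0).
  have cg : continuous (fun t : R => 2 * (1 - t) * psi c s n u t).
    move=> t; apply: cvgM; last exact: (psi_cont hc0 hs0 hcS hsS cc cs).
    by apply: cvgM; [exact: cvg_cst|apply: cvgB; [exact: cvg_cst|exact: cvg_id]].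
  have ig : mu.-integrable `[0%R, 1%R] (EFin \o (fun t : R => 2 * (1 - t) * psi c s n u t)).
    by apply: continuous_compact_integrable; [exact: segment_compact|exact: continuous_subspaceT].
  under [RHS]eq_integral do rewrite EFinM.
  by rewrite (integralZl _ ig).
have main u := gsc_integral_cvg hc0 hs0 hcS hsS cc cs v0 K0 hCK hSK m1 hm2 u.
split.
  move=> u; have [+ _] := main u; apply: cvg_trans; apply: near_eq_cvg; near=> n.
  by rewrite gE//; near: n; exact: nbhs_infty_gt.
have [_ [B B0 hB]] := main 0; exists B => // n u.
have [->|n0] := posnP n; first by rewrite /gn sqrtr0 mul0e lee_fin.
by rewrite gE//; apply: (le_trans (lee_abs _)); exact: hB.
Unshelve. all: end_near. Qed.

Lemma Gn_facts al : 0 < al ->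
  (forall x, Gn al n x @[n --> \oo] --> (Num.sqrt (2 * pi) / v / al)%:E) /\
  exists2 B : R, 0 <= B & forall n x, (Gn al n x <= B%:E)%E.
Proof.
move=> al0; have [glim [B B0 gB]] := gn_facts.
have intB (b : R) : 0 <= b -> (\int[mu]_u ((expo al u)%:E * b%:E) = (b / al)%:E)%E.
  move=> b0; rewrite ge0_integralZr ?lee_fin//.
  - by rewrite integral_expo// -EFinM; congr EFin; rewrite mulrC div1r.
  - exact: mex.
  - by move=> u _; rewrite lee_fin expo_ge0.
split; last first.
  exists (B / al); first by rewrite divr_ge0// ltW.
  move=> n x; rewrite (Gn_eq P mS) -intB//; apply: ge0_le_integral => //.
  - by move=> u _; rewrite mule_ge0 ?gn_ge0// lee_fin expo_ge0.
  - by apply: emeasurable_funM; [exact: mex|exact: (measurable_gn P mS)].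
  - by apply: emeasurable_funM => //; exact: mex.
  - by move=> u _; rewrite lee_wpmul2l ?lee_fin ?expo_ge0.
move=> x; rewrite -intB ?divr_ge0 ?sqrtr_ge0 ?(ltW v0)//.
under eq_fun do rewrite (Gn_eq P mS).
apply: (@dominated_cvg _ _ _ mu _ _ (fun n u => ((expo al u)%:E * gn n (x + u))%E) _ (fun u => ((expo al u)%:E * B%:E)%E)) => //.
- by move=> n; apply: emeasurable_funM; [exact: mex|exact: (measurable_gn P mS)].
- by move=> u _; apply: cvgeZl => //; exact: glim.
- apply/integrableP; split; first by apply: emeasurable_funM => //; exact: mex.
  under eq_integral do rewrite gee0_abs ?mule_ge0 ?lee_fin ?expo_ge0//.
  by rewrite intB// ltry.
- move=> n u _; rewrite gee0_abs; last by rewrite mule_ge0 ?gn_ge0// lee_fin expo_ge0.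
  by rewrite lee_wpmul2l ?lee_fin ?expo_ge0.
Qed.

(** For the radius 8 the central mass of the kernel is at least 2 pi - 1 >= 1. *)
Lemma Nn_bounded al : 0 < al -> exists2 K : R, 0 <= K & forall n x, (Nn al n x <= K%:E)%E.
Proof.
move=> al0; have [_ [B B0 hB]] := Gn_facts al0.
exists (expR (2 * al * 8) * B); first by rewrite mulr_ge0 ?expR_ge0.
move=> n x; have := @Nn_up _ _ _ P S mS al n x 8 al0 (ltr0n _ 8) => H.
apply: (@le_trans _ _ (Nn al n x * (2 * pi - 8 / 8)%:E)%E).
  rewrite -{1}[Nn al n x]mule1 lee_wpmul2l ?Nn_ge0// lee_fin.
  by rewrite divff//; have := pi_ge2 R; lra.
by apply: (le_trans H); rewrite EFinM lee_wpmul2l// lee_fin expR_ge0.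
Qed.

End local_limit.

(** The bounding sequences need only have limits close to [L]: an auxiliary parameter is fixed while
    n tends to infinity. *)
Lemma cvg_squeeze_family (R : realType) (u : nat -> R) (L : R) :
  (forall e, 0 < e -> exists U l, [/\ U @ \oo --> l, l < L + e & \forall n \near \oo, u n <= U n]) ->
  (forall e, 0 < e -> exists U l, [/\ U @ \oo --> l, L - e < l & \forall n \near \oo, U n <= u n]) ->
  u @ \oo --> L.
Proof.
move=> up dn; apply/cvgrPdist_lt => e e0.
have [U [l [Ul lL uU]]] := up e e0; have [V [m [Vm mL uV]]] := dn e e0.
have h1 : \forall n \near \oo, U n < L + e by exact: (cvgr_lt l Ul).
have h2 : \forall n \near \oo, L - e < V n by exact: (cvgr_gt m Vm).
near=> n; rewrite ltr_distlC; apply/andP; split.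
  by apply: (@lt_le_trans _ _ (V n)); near: n.
by apply: (@le_lt_trans _ _ (U n)); near: n.
Unshelve. all: end_near. Qed.

(** * Rescaling and the local limit *)

Section scaling.
Context d (T : measurableType d) (R : realType) (P : probability T R).
Variables (S : nat -> T -> R) (v : R).
Hypothesis mS : forall n, measurable_fun setT (S n).
Hypothesis v0 : 0 < v.
Hypothesis hcf : cfhyp (meancos P S) (meansin P S) v.

Lemma cfhyp_scale a : 0 < a ->
  cfhyp (meancos P (fun n w => a * S n w)) (meansin P (fun n w => a * S n w)) (a * v).
Proof.
move=> a0; set S' := fun n w => a * S n w.
have cE n t : meancos P S' n t = meancos P S n (t * a).
  by rewrite /meancos; congr fine; apply: eq_integral => w _; rewrite mulrA.
have sE n t : meansin P S' n t = meansin P S n (t * a).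
  by rewrite /meansin; congr fine; apply: eq_integral => w _; rewrite mulrA.
have [h0 hS [cc cs] [K K0 hK] [m1 m2]] := hcf.
have ca : continuous (fun t : R => t * a) by move=> t; apply: cvgM; [exact: cvg_id|exact: cvg_cst].
split.
- by move=> t; rewrite cE sE; exact: h0.
- by move=> n t; rewrite !cE !sE; exact: hS.
- split.
  + rewrite (_ : meancos P S' 1 = meancos P S 1 \o (fun t => t * a)); last by apply/funext => t; exact: cE.
    by move=> t; exact: (continuous_comp (ca t) (cc _)).
  + rewrite (_ : meansin P S' 1 = meansin P S 1 \o (fun t => t * a)); last by apply/funext => t; exact: sE.
    by move=> t; exact: (continuous_comp (ca t) (cs _)).
- exists (K * a ^+ 3); first by rewrite mulr_ge0// exprn_ge0// ltW.
  move=> t; rewrite cE sE; have [] := hK (t * a).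
  rewrite normrM (ger0_norm (ltW a0)) => h1 h2.
  have -> : K * a ^+ 3 * `|t| ^+ 3 = K * (`|t| * a) ^+ 3 by ring.
  split; last exact: h2.
  by rewrite (_ : a * v * t = v * (t * a))//; ring.
- by split=> [t|t t0]; rewrite cE sE; [exact: m1|apply: m2; rewrite mulr_gt0].
Qed.

Lemma expo_scale (a al y : R) : 0 < a -> expo (al / a) (a * y) = expo al y.
Proof.
move=> a0; rewrite /expo pmulr_rgt0//; case: ifP => // _.
by congr expR; field; rewrite gt_eqF.
Qed.

Lemma Nn_scale a al n x : 0 < a ->
  Nn P (fun n w => a * S n w) (al / a) n (a * x) = Nn P S al n x.
Proof.
move=> a0; rewrite /Nn; congr (_ * _)%E; apply: eq_integral => w _.
by rewrite -mulrBr expo_scale.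
Qed.

(** In [Nn_up] and [Nn_down] the error 8 / dl asks for a large radius and the factor exp(2 al dl)
    for a small one. Replacing the walk by a times itself and the rate by al / a leaves [Nn]
    unchanged, but turns the factor into exp(2 al dl / a); both errors then vanish along a suitable
    choice of a and dl. *)
Theorem local_limit al x : 0 < al ->
  fine (Nn P S al n x) @[n --> \oo] --> 1 / (al * v * Num.sqrt (2 * pi)).
Proof.
move=> al0; have [K K0 NK] := @Nn_bounded _ _ _ P S mS v v0 hcf al al0.
set L := 1 / _.
have tp : 4 <= 2 * pi :> R by have := pi_ge2 R; lra.
have tp0 : 0 < 2 * pi :> R by lra.
pose q : R := Num.sqrt (2 * pi); have q0 : 0 < q by rewrite sqrtr_gt0.
have qq : q * q = 2 * pi by rewrite -expr2 sqr_sqrtr// ltW.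
pose Ginf := q / v / al.
have LE : L = Ginf / (2 * pi) by rewrite /L -/q -qq /Ginf; field; rewrite !gt_eqF.
pose N n := fine (Nn P S al n x).
have NE n : Nn P S al n x = (N n)%:E.
  rewrite fineK// ge0_fin_numE ?Nn_ge0//; exact: (le_lt_trans (NK n x) (ltry _)).
pose et (j : nat) : R := j.+1%:R^-1.
have et0 j : 0 < et j by rewrite invr_gt0 ltr0n.
have etl : et j @[j --> \oo] --> (0 : R) by exact: cvg_harmonic.
(* With radius 1 / et and scale 1 / et^2 the exponent becomes 2 al et and the kernel tail 8 et. *)
pose a j := (et j) ^- 2; have a0 j : 0 < a j by rewrite invr_gt0 exprn_gt0.
pose S' j := fun n w => a j * S n w.
have mS' j n : measurable_fun setT (S' j n) by exact: measurable_funM.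
have av0 j : 0 < a j * v by rewrite mulr_gt0.
have ala j : 0 < al / a j by rewrite divr_gt0.
have GF j := @Gn_facts _ _ _ P (S' j) (mS' j) (a j * v) (av0 j) (cfhyp_scale (a0 j)) (al / a j) (ala j).
pose g j n y := fine (Gn P (S' j) (al / a j) n y).
have Gge0 j n y : (0 <= Gn P (S' j) (al / a j) n y)%E.
  by apply: integral_ge0 => z _; rewrite mule_ge0 ?Nn_ge0// lee_fin hker_ge0.
have gE j n y : Gn P (S' j) (al / a j) n y = (g j n y)%:E.
  have [_ [B _ hB]] := GF j.
  rewrite fineK// ge0_fin_numE//; exact: (le_lt_trans (hB n y) (ltry _)).
(* The scale cancels between the standard deviation a v and the rate al / a, so all smoothed limits
   coincide. *)
have gl j y : g j n y @[n --> \oo] --> Ginf.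
  have [h _] := GF j; have /fine_cvg := h y.
  have -> // : Num.sqrt (2 * pi) / (a j * v) / (al / a j) = Ginf.
  by rewrite /Ginf -/q; field; rewrite !gt_eqF.
have exE j : 2 * (al / a j) * (et j)^-1 = 2 * al * et j.
  by rewrite /a; field; rewrite gt_eqF.
have d0 j : 0 < (et j)^-1 by rewrite invr_gt0.
have up j n : N n * (2 * pi - 8 * et j) <= expR (2 * al * et j) * g j n (a j * x - (et j)^-1).
  have := @Nn_up _ _ _ P (S' j) (mS' j) (al / a j) n (a j * x) (et j)^-1 (ala j) (d0 j).
  by rewrite Nn_scale// NE gE exE invrK -!EFinM lee_fin.
have dn j n : g j n (a j * x + (et j)^-1) <= expR (2 * al * et j) * (2 * pi) * N n + K * (8 * et j).
  have NK' y : (Nn P (S' j) (al / a j) n y <= K%:E)%E.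
    rewrite (_ : y = a j * (y / a j)); last by field; rewrite gt_eqF.
    by rewrite Nn_scale.
  have := @Nn_down _ _ _ P (S' j) (mS' j) (al / a j) n (a j * x) (et j)^-1 K (ala j) (d0 j) K0 NK'.
  by rewrite Nn_scale// NE gE exE invrK -!EFinM -EFinD lee_fin.
have ex0 : expR (2 * al * et j) @[j --> \oo] --> (1 : R).
  have h : 2 * al * et j @[j --> \oo] --> (0 : R).
    by rewrite -[X in _ --> X](mulr0 (2 * al)); exact: cvgMl_tmp.
  by rewrite -[X in _ --> X](@expR0 R); exact: (cvg_comp _ _ h (@continuous_expR R 0)).
have big j : (1 < j)%N -> 0 < 2 * pi - 8 * et j.
  move=> j1; have : et j <= 3^-1 by rewrite lef_pV2 ?posrE ?ltr0n// ler_nat.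
  by move=> h; lra.
have invl (c : R) : c != 0 -> forall f : nat -> R, f j @[j --> \oo] --> c -> (f j)^-1 @[j --> \oo] --> c^-1.
  by move=> c0 f fl; exact: cvgV.
apply: cvg_squeeze_family => e e0.
- pose f j := expR (2 * al * et j) * Ginf / (2 * pi - 8 * et j).
  have fl : f j @[j --> \oo] --> L.
    rewrite LE -[X in X / _]mul1r; apply: cvgM; first by apply: cvgM; [exact: ex0|exact: cvg_cst].
    apply: invl; first by rewrite gt_eqF.
    rewrite -[X in _ --> X]subr0; apply: cvgB; first exact: cvg_cst.
    by rewrite -[X in _ --> X](mulr0 8); apply: cvgMl_tmp.
  have : \forall j \near \oo, f j < L + e /\ (1 < j)%N.
    near=> j; split; near: j; last exact: nbhs_infty_gt.
    by apply: (cvgr_lt L fl); rewrite ltrDl.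
  move=> [j0 _ hj0]; have [fj j1] := hj0 j0 (leqnn j0).
  exists (fun n => expR (2 * al * et j0) * g j0 n (a j0 * x - (et j0)^-1) / (2 * pi - 8 * et j0)), (f j0).
  split; [ |exact: fj| ].
    by apply: cvgM; [apply: cvgMl_tmp; exact: gl|exact: cvg_cst].
  near=> n; rewrite ler_pdivlMr; last exact: big.
  exact: up.
- pose f j := (Ginf - K * (8 * et j)) / (expR (2 * al * et j) * (2 * pi)).
  have fl : f j @[j --> \oo] --> L.
    have -> : L = (Ginf - K * (8 * 0)) / (1 * (2 * pi)) by rewrite LE !mulr0 subr0 mul1r.
    apply: cvgM.
      by apply: cvgB; [exact: cvg_cst|do 2 apply: cvgMl_tmp].
    apply: invl; first by rewrite mul1r gt_eqF.
    by apply: cvgM; [exact: ex0|exact: cvg_cst].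
  have : \forall j \near \oo, L - e < f j.
    by apply: (cvgr_gt L fl); rewrite ltrBlDr ltrDl.
  move=> [j0 _ hj0]; have fj := hj0 j0 (leqnn j0).
  exists (fun n => (g j0 n (a j0 * x + (et j0)^-1) - K * (8 * et j0)) / (expR (2 * al * et j0) * (2 * pi))), (f j0).
  split; [ |exact: fj| ].
    apply: cvgM; last exact: cvg_cst.
    by apply: cvgB; [exact: gl|exact: cvg_cst].
  near=> n; rewrite ler_pdivrMr; last by rewrite mulr_gt0 ?expR_gt0.
  by rewrite lerBlDr [X in _ <= X + _]mulrC; exact: dn.
Unshelve. all: end_near. Qed.

End scaling.

(** * Lipschitz bounds, solutions of cos x = 1, derivatives from quadratic remainders *)

Section trigonometric_bounds.
Variable R : realType.
Implicit Types x y u : R.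

Lemma abs_sin_le u : `|sin u| <= `|u|.
Proof.
wlog u0 : u / 0 <= u.
  by move=> H; have [/H//|/ltW u0] := leP 0 u; rewrite -normrN -sinN -(normrN u); apply: H; rewrite oppr_ge0.
rewrite (ger0_norm u0) ler_norml sin_le// andbT.
have [u1|u1] := leP u 1; last by apply: le_trans (sin_geN1 u); rewrite lerN2 ltW.
have := sin_ge u0; have : u ^+ 3 <= u.
  by rewrite -[leRHS]expr1; apply: ler_wiXn2l.
lra.
Qed.

Lemma abs_cosB1_le u : `|cos u - 1| <= 2 * `|u|.
Proof.
wlog u0 : u / 0 <= u.
  by move=> H; have [/H//|/ltW u0] := leP 0 u; rewrite -cosN -(normrN u); apply: H; rewrite oppr_ge0.
rewrite (ger0_norm u0) ler0_norm ?subr_le0 ?cos_le1// opprB.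
have [u1|u1] := leP u 1; last by have := cos_geN1 u; lra.
have := cos_ge u0; have : u ^+ 2 <= u by rewrite -[leRHS]expr1; apply: ler_wiXn2l.
lra.
Qed.

Lemma trig_lip x u : `|cos (x + u) - cos x| <= 3 * `|u| /\ `|sin (x + u) - sin x| <= 3 * `|u|.
Proof.
have h1 := abs_sin_le u; have h2 := abs_cosB1_le u.
have c1 := cos_max x; have s1 := sin_max x.
have key (a b : R) : `|a| <= 1 -> `|b| <= 1 -> `|a * (cos u - 1) + b * sin u| <= 3 * `|u|.
  move=> a1 b1; apply: (le_trans (ler_normD _ _)); rewrite !normrM.
  have := ler_piMl (normr_ge0 (cos u - 1)) a1; have := ler_piMl (normr_ge0 (sin u)) b1; lra.
split.
  rewrite cosD (_ : _ - _ = cos x * (cos u - 1) + (- sin x) * sin u); last by ring.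
  by apply: key; rewrite ?normrN.
by rewrite sinD (_ : _ - _ = sin x * (cos u - 1) + cos x * sin u); [exact: key|ring].
Qed.

(** After reduction modulo 2 pi, a remainder r in (0, 2 pi) would have sin(r/2) > 0 and hence cos r
    = 1 - 2 sin(r/2)^2 < 1. *)
Lemma cos_eq1 x : cos x = 1 -> exists k : int, x = 2 * pi * k%:~R.
Proof.
move=> cx; have p0 : 0 < 2 * pi :> R by have := pi_gt0 R; lra.
pose k := Num.floor (x / (2 * pi)); exists k.
have /andP[k1 k2] := floor_itv (x / (2 * pi)); rewrite -/k in k1 k2.
have r1 : 0 <= x - 2 * pi * k%:~R by move: k1; rewrite ler_pdivlMr// mulrC; lra.
have r2 : x - 2 * pi * k%:~R < 2 * pi.
  by move: k2; rewrite ltr_pdivrMr// intrD1; lra.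
have shift (n : nat) y : cos (y + 2 * pi * n%:R) = cos y.
  elim: n => [|n IH]; first by rewrite mulr0 addr0.
  have -> : y + 2 * pi * n.+1%:R = (y + 2 * pi * n%:R) + pi *+ 2.
    by rewrite -natr1 -mulr_natl; ring.
  by rewrite cosD2pi.
have shiftz (k' : int) y : cos (y - 2 * pi * k'%:~R) = cos y.
  case: k' => n; first by rewrite -(shift n (y - _)) subrK.
  by rewrite NegzE mulrNz mulrN opprK; exact: shift.
apply/eqP; rewrite -subr_eq0; apply/eqP; set r := x - _ in r1 r2 *.
apply/eqP; rewrite eq_le r1 andbT leNgt; apply/negP => r0.
have s0 : 0 < sin (r / 2) by apply: sin_gt0_pi; lra.
have e1 := cos2Dsin2 (r / 2).
have : cos (r / 2 + r / 2) = 1.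
  by rewrite (_ : r / 2 + r / 2 = r); [rewrite /r shiftz|lra].
rewrite cosD -!expr2 => e2.
have : 0 < sin (r / 2) ^+ 2 by rewrite exprn_gt0.
lra.
Qed.

Lemma expR_quad y : `|expR y - 1 - y| <= y ^+ 2 * expR `|y|.
Proof.
rewrite ger0_norm; last by have := expR_ge1Dx y; lra.
have [y0|y0] := leP 0 y.
  rewrite (ger0_norm y0).
  have : expR y - 1 <= y * expR y.
    have := expR_ge1Dx (- y); rewrite expRN => h.
    have : (1 - y) * expR y <= 1 by rewrite -ler_pdivlMr ?expR_gt0// div1r.
    lra.
  move=> h; have : y * (expR y - 1) <= y * (y * expR y) by rewrite ler_wpM2l.
  lra.
have h := expR_ge1Dx y; have n0 : 0 <= - y by lra.
have h1 : - y * (1 - expR y) <= - y * - y by rewrite ler_wpM2l//; lra.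
have h2 : expR y - 1 <= y * expR y.
  have := expR_ge1Dx (- y); rewrite expRN => h'.
  have : (1 - y) * expR y <= 1 by rewrite -ler_pdivlMr ?expR_gt0// div1r.
  lra.
have : y ^+ 2 * 1 <= y ^+ 2 * expR `|y|.
  rewrite ler_wpM2l ?sqr_ge0//; have := expR_ge1Dx `|y|; have := normr_ge0 y; lra.
lra.
Qed.

(** A remainder of this form is what [expR_quad] gives once integrated, so that the exponential
    moments can be differentiated. *)
Lemma is_derive_quad (f : R -> R) x l C dl : 0 < dl -> 
  (forall h, `|h| < dl -> `|f (x + h) - f x - h * l| <= C * h ^+ 2) -> is_derive x 1 f l.
Proof.
move=> d0 H.
have lim : h^-1 *: (f (h *: 1 + x) - f x) @[h --> 0^'] --> l.
  apply/cvgrPdist_le => /= e e0.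
  have C0 : 0 <= `|C| + 1 by rewrite addr_ge0.
  have C1 : 0 < `|C| + 1 by rewrite ltr_wpDl.
  near=> h.
  have h0 : h != 0 by near: h; exact: nbhs_dnbhs_neq.
  have hd : `|h| < dl by near: h; apply: dnbhs0_lt.
  have he : `|h| <= e / (`|C| + 1) by near: h; apply: dnbhs0_le; rewrite divr_gt0.
  rewrite distrC /GRing.scale/= mulr1.
  have := H h hd; rewrite (addrC x h) => Hh.
  have -> : h^-1 * (f (h + x) - f x) - l = h^-1 * (f (h + x) - f x - h * l) by field.
  rewrite normrM normfV mulrC ler_pdivrMr ?normr_gt0//.
  apply: (le_trans Hh); rewrite -(real_normK (num_real h)) expr2 mulrA ler_wpM2r//.
  apply: (@le_trans _ _ ((`|C| + 1) * `|h|)).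
    by rewrite ler_wpM2r//; have := ler_norm C; lra.
  by rewrite mulrC -ler_pdivlMr.
have dv : derivable f x 1 by apply/cvg_ex; exists l.
by apply: DeriveDef => //; apply: cvg_lim.
Unshelve. all: end_near. Qed.

End trigonometric_bounds.

Lemma Rintegral_cst1 d (T : measurableType d) (R : realType) (P : probability T R) (r : R) :
  \int[P]_w r = r.
Proof.
rewrite Rintegral_cst//; transitivity (r * fine (1%E : \bar R)); last by rewrite mulr1.
by congr (_ * fine _); exact: probability_setT.
Qed.

(** * A variable with exponential moments: derivatives and characteristic function *)

Section exponential_moments.
Context d (T : measurableType d) (R : realType) (P : probability T R).
Variables (L : T -> R) (e0 : R).
Hypothesis mL : measurable_fun setT L.
Hypothesis e0_gt0 : 0 < e0.
Hypothesis expfin : forall a, `|a| < e0 -> (\int[P]_w (expR (a * L w))%:E < +oo)%E.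

Local Notation s := (e0 / 2).
Let dom w := expR (s * `|L w|).

Let mexp a : measurable_fun setT (fun w => expR (a * L w)).
Proof. by apply: measurableT_comp => //; exact: measurable_funM. Qed.

Let mabs : measurable_fun setT (fun w => `|L w|).
Proof. exact: measurableT_comp. Qed.

Let mdom : measurable_fun setT dom.
Proof. by apply: measurableT_comp => //; exact: measurable_funM. Qed.

Let dom_int : P.-integrable setT (EFin \o dom).
Proof.
apply/integrableP; split; first exact/measurable_EFinP.
have eg := e0_gt0; have s0 : `|s| < e0 by rewrite ger0_norm; lra.
have sN : `|- s| < e0 by rewrite normrN.
apply: (@le_lt_trans _ _ (\int[P]_w ((expR (s * L w))%:E + (expR (- s * L w))%:E))%E).
  apply: ge0_le_integral => //.
  - by apply: measurableT_comp => //; exact/measurable_EFinP.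
  - by apply: emeasurable_funD; apply/measurable_EFinP.
  - move=> w _; rewrite /= lee_fin ger0_norm ?expR_ge0// /dom.
    have [l0|l0] := leP 0 (L w); first by rewrite (ger0_norm l0) lerDl expR_ge0.
    by rewrite (ltr0_norm l0) mulrN mulNr lerDr expR_ge0.
rewrite ge0_integralD//; first by rewrite lte_add_pinfty// expfin.
all: try (by move=> w _; rewrite lee_fin expR_ge0).
all: exact/measurable_EFinP.
Qed.

Lemma dom_integrable (f : T -> R) C : measurable_fun setT f -> (forall w, `|f w| <= C * dom w) ->
  P.-integrable setT (EFin \o f).
Proof.
move=> mf fC; have := integrableZl measurableT C dom_int.
apply: le_integrable => //; first exact/measurable_EFinP.
by move=> w _; rewrite /= lee_fin (le_trans (fC w))// ler_norm.
Qed.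

Let K := \int[P]_w dom w.

Let K0 : 0 <= K.
Proof. by apply: fine_ge0; apply: integral_ge0 => w _; rewrite lee_fin expR_ge0. Qed.

Lemma dom_bound (f : T -> R) C : measurable_fun setT f -> (forall w, `|f w| <= C * dom w) ->
  `|\int[P]_w f w| <= C * K.
Proof.
move=> mf fC; have fi := dom_integrable mf fC.
apply: (le_trans (le_normr_Rintegral measurableT fi)).
rewrite /K -RintegralZl//; apply: le_Rintegral => //.
- apply: (@dom_integrable (fun w => `|f w|) C); first exact: measurableT_comp.
  by move=> w; rewrite normr_id.
- exact: (integrableZl measurableT C dom_int).
Qed.

(** From |L| <= (6 / s) exp(s |L| / 6), a power up to the third costs at most exp(s |L| / 2); each
    of the two exponentials costs exp(s |L| / 4), and the total is [dom]. *)
Lemma pow_dom k w a b : (k <= 3)%N -> `|a| <= s / 4 -> `|b| <= s / 4 ->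
  `|L w| ^+ k * expR (a * L w) * expR `|b * L w| <= (6 / s) ^+ k * dom w.
Proof.
move=> k3 ha hb; have eg := e0_gt0; have s0 : 0 < s by lra.
have l1 : `|L w| <= 6 / s * expR (s / 6 * `|L w|).
  rewrite -ler_pdivrMl ?divr_gt0// invf_div.
  have := expR_ge1Dx (s / 6 * `|L w|); lra.
have l2 : `|L w| ^+ k <= (6 / s) ^+ k * expR (s / 2 * `|L w|).
  apply: (@le_trans _ _ ((6 / s * expR (s / 6 * `|L w|)) ^+ k)).
    by rewrite lerXn2r ?nnegrE// mulr_ge0 ?expR_ge0// divr_ge0// ltW.
  have c0 : 0 <= (6 / s) ^+ k by apply: exprn_ge0; apply: divr_ge0 => //; exact: ltW.
  rewrite exprMn -expRM_natl; apply: (ler_wpM2l c0); rewrite ler_expR.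
  have : k%:R <= 3 :> R by rewrite (ler_nat _ k 3).
  have q0 : 0 <= s / 6 * `|L w| by rewrite mulr_ge0// divr_ge0// ltW.
  by move=> /(ler_wpM2r q0) /le_trans; apply; lra.
have [h1 h2] : a * L w <= s / 4 * `|L w| /\ `|b * L w| <= s / 4 * `|L w|.
  split; last by rewrite normrM ler_wpM2r.
  by apply: (le_trans (ler_norm _)); rewrite normrM ler_wpM2r.
have -> : dom w = expR (s / 2 * `|L w|) * expR (s / 4 * `|L w|) * expR (s / 4 * `|L w|).
  by rewrite -!expRD /dom; congr expR; lra.
rewrite !mulrA; apply: ler_pM; rewrite ?expR_ge0 ?ler_expR// ?mulr_ge0 ?expR_ge0 ?exprn_ge0//.
by apply: ler_pM; rewrite ?expR_ge0 ?ler_expR// ?exprn_ge0.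
Qed.

Definition mom k a : R := \int[P]_w (L w ^+ k * expR (a * L w)).

Let mmom k a : measurable_fun setT (fun w => L w ^+ k * expR (a * L w)).
Proof. by apply: measurable_funM => //; exact: measurable_funX. Qed.

Lemma mom_integrable k a : (k <= 3)%N -> `|a| <= s / 4 ->
  P.-integrable setT (EFin \o (fun w => L w ^+ k * expR (a * L w))).
Proof.
move=> k3 ha; have eg := e0_gt0; apply: (dom_integrable (C := (6 / s) ^+ k)) => // w.
have z0 : `|0 : R| <= s / 4 by rewrite normr0; lra.
have := @pow_dom k w a 0 k3 ha z0; rewrite mul0r normr0 expR0 mulr1.
by rewrite normrM normrX (ger0_norm (expR_ge0 _)).
Qed.

(** The remainder of [expR_quad] carries two more powers of L; k <= 1 keeps the exponent within the
    three powers covered by [pow_dom]. *)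
Lemma mom_derive k (a : R) : (k <= 1)%N -> `|a| < s / 8 -> is_derive a 1 (mom k) (mom k.+1 a).
Proof.
move=> k1 ha; have eg := e0_gt0; have s0 : 0 < s by lra.
apply: (@is_derive_quad _ _ _ _ ((6 / s) ^+ k.+2 * K) (s / 8)); first by lra.
move=> h hh.
have ha' : `|a| <= s / 4 by lra.
have hah : `|a + h| <= s / 4 by apply: (le_trans (ler_normD _ _)); lra.
have i1 := @mom_integrable k _ (leq_trans k1 (isT : (1 <= 3)%N)) hah.
have i2 := @mom_integrable k _ (leq_trans k1 (isT : (1 <= 3)%N)) ha'.
have i3 := @mom_integrable k.+1 _ (leq_trans k1 (isT : (1 <= 2)%N)) ha'.
have i3' := integrableZl measurableT h i3.
have i12 := integrableB measurableT i1 i2.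
rewrite /mom -RintegralB// -RintegralZl// -RintegralB//.
have -> : (6 / s) ^+ k.+2 * K * h ^+ 2 = (6 / s) ^+ k.+2 * h ^+ 2 * K by ring.
apply: dom_bound.
  by apply: measurable_funB; [apply: measurable_funB|apply: measurable_funM].
move=> w.
have -> : L w ^+ k * expR ((a + h) * L w) - L w ^+ k * expR (a * L w) - h * (L w ^+ k.+1 * expR (a * L w))
  = L w ^+ k * expR (a * L w) * (expR (h * L w) - 1 - h * L w).
  by rewrite mulrDl expRD exprS; ring.
rewrite !normrM normrX (ger0_norm (expR_ge0 _)).
apply: (@le_trans _ _ (`|L w| ^+ k * expR (a * L w) * ((h * L w) ^+ 2 * expR `|h * L w|))).
  by rewrite ler_wpM2l ?expR_quad// mulr_ge0 ?exprn_ge0 ?expR_ge0.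
have hh' : `|h| <= s / 4 by lra.
have := @pow_dom k.+2 w a h k1 ha' hh'.
have e : (h * L w) ^+ 2 = h ^+ 2 * `|L w| ^+ 2 by rewrite exprMn real_normK ?num_real.
rewrite e => H.
have -> : `|L w| ^+ k * expR (a * L w) * (h ^+ 2 * `|L w| ^+ 2 * expR `|h * L w|)
  = h ^+ 2 * (`|L w| ^+ k.+2 * expR (a * L w) * expR `|h * L w|) by rewrite !exprS; ring.
have -> : (6 / s) ^+ k.+2 * h ^+ 2 * dom w = h ^+ 2 * ((6 / s) ^+ k.+2 * dom w) by ring.
by apply: ler_wpM2l H; exact: sqr_ge0.
Qed.

Lemma mom0 : mom 0 0 = 1.
Proof.
have -> : mom 0 0 = \int[P]_w 1.
  by apply: eq_Rintegral => w _; rewrite mul0r expR0 mulr1.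
exact: Rintegral_cst1.
Qed.

Lemma lip_continuous (F : R -> R) C : (forall x h, `|F (x + h) - F x| <= C * `|h|) -> continuous F.
Proof.
move=> H x; apply/cvgrPdist_le => e e0'.
have C1 : 0 < `|C| + 1 by rewrite ltr_wpDl.
near=> y; have := H x (y - x); rewrite (_ : x + (y - x) = y); last by ring.
rewrite distrC => /le_trans; apply.
apply: (@le_trans _ _ ((`|C| + 1) * `|y - x|)).
  by rewrite ler_wpM2r//; have := ler_norm C; lra.
rewrite mulrC -ler_pdivlMr// distrC; near: y; apply: cvgr_dist_le; first exact: cvg_id.
by rewrite divr_gt0.
Unshelve. all: end_near. Qed.

Let mcos t : measurable_fun setT (fun w => cos (t * L w)).
Proof. by apply: (measurableT_comp (@measurable_cos R)); exact: measurable_funM. Qed.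

Let msin t : measurable_fun setT (fun w => sin (t * L w)).
Proof. by apply: (measurableT_comp (@measurable_sin R)); exact: measurable_funM. Qed.

Let icos t : P.-integrable setT (EFin \o (fun w => cos (t * L w))).
Proof. by apply: (@bounded_integrable _ _ _ P _ 1 (mcos t)) => w; exact: cos_max. Qed.

Let isin t : P.-integrable setT (EFin \o (fun w => sin (t * L w))).
Proof. by apply: (@bounded_integrable _ _ _ P _ 1 (msin t)) => w; exact: sin_max. Qed.

Let dom1 k w : (k <= 3)%N -> `|L w| ^+ k <= (6 / s) ^+ k * dom w.
Proof.
move=> k3; have eg := e0_gt0; have z0 : `|0 : R| <= s / 4 by rewrite normr0; lra.
have := @pow_dom k w 0 0 k3 z0 z0.
by rewrite !mul0r normr0 expR0 !mulr1.
Qed.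

Lemma cf_continuous : continuous (fun t : R => \int[P]_w cos (t * L w)) /\
  continuous (fun t : R => \int[P]_w sin (t * L w)).
Proof.
have key (f : R -> R) : (forall t, measurable_fun setT (fun w => f (t * L w))) ->
    (forall t, P.-integrable setT (EFin \o (fun w => f (t * L w)))) ->
    (forall x u, `|f (x + u) - f x| <= 3 * `|u|) ->
    continuous (fun t : R => \int[P]_w f (t * L w)).
  move=> mf If lf; apply: (@lip_continuous _ (3 * (6 / s) * K)) => x h.
  rewrite -RintegralB//.
  rewrite (_ : 3 * (6 / s) * K * `|h| = 3 * (6 / s) * `|h| * K); last by ring.
  apply: dom_bound; first exact: measurable_funB.
  move=> w; rewrite mulrDl; apply: (le_trans (lf _ _)); rewrite normrM.
  have := @dom1 1 w isT; rewrite !expr1 => H.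
  rewrite (_ : 3 * (6 / s) * `|h| * dom w = 3 * `|h| * (6 / s * dom w)); last by ring.
  by rewrite mulrA; apply: ler_wpM2l H; rewrite mulr_ge0.
by split; apply: key => // x u; have [] := trig_lip x u.
Qed.

Lemma cf_taylor v : mom 1 0 = 0 -> mom 2 0 = v ^+ 2 -> exists2 C : R, 0 <= C &
  forall t, `|\int[P]_w cos (t * L w) - 1 + 2^-1 * (v * t) ^+ 2| <= C * `|t| ^+ 3 /\
            `|\int[P]_w sin (t * L w)| <= C * `|t| ^+ 3.
Proof.
move=> m1 m2; have eg := e0_gt0.
have z0 : `|0 : R| <= s / 4 by rewrite normr0; lra.
have i0 := @mom_integrable 0 0 isT z0.
have i1 := @mom_integrable 1 0 isT z0.
have i2 := @mom_integrable 2 0 isT z0.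
have bnd (g : R -> R) t : (forall y, `|g y| <= `|y| ^+ 3) -> measurable_fun setT (fun w => g (t * L w)) ->
    `|\int[P]_w g (t * L w)| <= (6 / s) ^+ 3 * K * `|t| ^+ 3.
  move=> gy mg; rewrite (_ : _ * K * _ = (6 / s) ^+ 3 * `|t| ^+ 3 * K); last by ring.
  apply: dom_bound => // w; apply: (le_trans (gy _)); rewrite normrM exprMn.
  rewrite (_ : _ * _ * dom w = `|t| ^+ 3 * ((6 / s) ^+ 3 * dom w)); last by ring.
  by rewrite ler_wpM2l ?exprn_ge0// dom1.
exists ((6 / s) ^+ 3 * K).
  by rewrite mulr_ge0// exprn_ge0// divr_ge0//; lra.
move=> t; split.
- have j2 := integrableZl measurableT (2^-1 * t ^+ 2) i2.
  have ij := integrableB measurableT (icos t) i0.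
  have -> : \int[P]_w cos (t * L w) - 1 + 2^-1 * (v * t) ^+ 2 =
      \int[P]_w (cos (t * L w) - 1 + 2^-1 * (t * L w) ^+ 2).
    transitivity (\int[P]_w cos (t * L w) - mom 0 0 + 2^-1 * t ^+ 2 * mom 2 0).
      by rewrite mom0 m2; ring.
    rewrite /mom -RintegralZl// -RintegralB// -RintegralD//.
    by apply: eq_Rintegral => w _; rewrite mul0r expR0 /=; ring.
  apply: (@bnd (fun y => cos y - 1 + 2^-1 * y ^+ 2)); first exact: cos_taylor.
  apply: measurable_funD; first exact: measurable_funB.
  by apply: measurable_funM => //; apply: measurable_funX; exact: measurable_funM.
- have j1 := integrableZl measurableT t i1.
  have -> : \int[P]_w sin (t * L w) = \int[P]_w (sin (t * L w) - t * L w).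
    transitivity (\int[P]_w sin (t * L w) - t * mom 1 0); first by rewrite m1 mulr0 subr0.
    rewrite /mom -RintegralZl// -RintegralB//.
    by apply: eq_Rintegral => w _; rewrite mul0r expR0 /=; ring.
  apply: (@bnd (fun y => sin y - y)); first exact: sin_taylor.
  by apply: measurable_funB => //; exact: measurable_funM.
Qed.

(** 1 minus the squared modulus is the variance of exp(i t L), the mean of the nonnegative function
    [f]; if it vanishes, exp(i t L) is almost surely constant. *)
Lemma cf_modulus t : let c := \int[P]_w cos (t * L w) in let s' := \int[P]_w sin (t * L w) in
  c ^+ 2 + s' ^+ 2 <= 1 /\
  (c ^+ 2 + s' ^+ 2 = 1 -> {ae P, forall w, cos (t * L w) = c /\ sin (t * L w) = s'}).
Proof.
move=> c s'; set f := fun w => (cos (t * L w) - c) ^+ 2 + (sin (t * L w) - s') ^+ 2.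
have f0 w : 0 <= f w by rewrite addr_ge0 ?sqr_ge0.
have mf : measurable_fun setT f.
  by apply: measurable_funD; apply: measurable_funX; exact: measurable_funB.
have fE : \int[P]_w f w = 1 - (c ^+ 2 + s' ^+ 2).
  have i1 : P.-integrable setT (EFin \o (cst (1 + c ^+ 2 + s' ^+ 2) : T -> R)).
    by apply: (@bounded_integrable _ _ _ _ _ `|1 + c ^+ 2 + s' ^+ 2|).
  have j1 := integrableZl measurableT (2 * c) (icos t).
  have j2 := integrableZl measurableT (2 * s') (isin t).
  rewrite (_ : Rintegral P setT f = \int[P]_w (cst (1 + c ^+ 2 + s' ^+ 2) w - 2 * c * cos (t * L w) - 2 * s' * sin (t * L w))); last first.
    apply: eq_Rintegral => w _; rewrite /f /=; have := cos2Dsin2 (t * L w); lra.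
  have i1j := integrableB measurableT i1 j1.
  rewrite RintegralB// RintegralB// !RintegralZl// Rintegral_cst1.
  by rewrite -/c -/s' /=; ring.
split.
  have : 0 <= \int[P]_w f w by apply: fine_ge0; apply: integral_ge0 => w _; rewrite lee_fin.
  by rewrite fE; lra.
move=> e.
have fi : P.-integrable setT (EFin \o f).
  apply: (@bounded_integrable _ _ _ _ _ ((1 + `|c|) ^+ 2 + (1 + `|s'|) ^+ 2)) => // w.
  have sq (a b : R) : `|a| <= 1 -> (a - b) ^+ 2 <= (1 + `|b|) ^+ 2.
    move=> a1; rewrite -real_normK ?num_real// lerXn2r ?nnegrE ?addr_ge0//.
    by apply: (le_trans (ler_normB _ _)); rewrite lerD2r.
  by rewrite (ger0_norm (f0 w)) /f; apply: lerD; apply: sq; [exact: cos_max|exact: sin_max].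
have I0 : (\int[P]_w `|(EFin \o f) w| = 0)%E.
  transitivity (\int[P]_w (f w)%:E)%E.
    by apply: eq_integral => w _; rewrite /= ger0_norm.
  rewrite -[LHS]fineK; last exact: (integrable_fin_num measurableT fi).
  by have := fE; rewrite /Rintegral => ->; rewrite e subrr.
have mf' : measurable_fun setT (EFin \o f) by exact/measurable_EFinP.
have := (ae_eq_integral_abs P measurableT mf').1 I0.
apply: filterS => w /(_ Logic.I) /= [] fw.
have := fw; rewrite /f => /eqP; rewrite paddr_eq0 ?sqr_ge0// !sqrf_eq0 !subr_eq0.
by move=> /andP[/eqP -> /eqP ->].
Qed.

(** If the modulus were 1, then t L would be almost surely constant modulo 2 pi, and L would lie in
    a progression of step 2 pi / t with a shift. This is where the notion of non-arithmetic law with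
    arbitrary shift enters. *)
Lemma cf_lt1 t : non_arithmetic P L -> 0 < t ->
  (\int[P]_w cos (t * L w)) ^+ 2 + (\int[P]_w sin (t * L w)) ^+ 2 < 1.
Proof.
move=> hL t0; have [h1 h2] := cf_modulus t.
rewrite lt_neqAle h1 andbT; apply/eqP => e.
have H := h2 e.
have P0 : (0 < P setT)%E by rewrite (_ : P setT = 1%E)//; exact: probability_setT.
have [w0 [c0 s0]] := @filter_ex _ _ (ae_properfilter_algebraOfSetsType P0) _ H.
(* The shift is the value of L at one outcome [w0] of the almost sure event. *)
apply: (hL (L w0) (2 * pi / t)); first by rewrite divr_gt0// mulr_gt0// pi_gt0.
apply: filterS H => w [cw sw].
have : cos (t * L w - t * L w0) = 1 by rewrite cosB cw sw c0 s0 -e !expr2.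
move=> /cos_eq1[k hk]; exists k.
have : L w - L w0 = 2 * pi * k%:~R / t by rewrite -hk; field; rewrite gt_eqF.
by move=> /eqP; rewrite subr_eq => /eqP ->; ring.
Qed.

End exponential_moments.

(** * The walk of the logarithms of the means under the tilted law *)

Section tilted_walk.
Context d (T : measurableType d) (R : realType) (P : probability T R) (X : bprei_data T R).
Variables (alpha : R) (Pa : probability T R).
Hypothesis hX : is_bprei P X.
Hypothesis halpha : 0 < alpha.
Hypothesis ht : is_tilted P X alpha Pa.
Local Notation lam := (rLambda P X alpha).
Local Notation U k := (g_sigma_algebraType (past_gen X k)).

Definition wt (e : mark R) : R := markmean e `^ alpha * expR (- lam).

Let wt_ge0 e : 0 <= wt e.
Proof. by rewrite mulr_ge0 ?powR_ge0 ?expR_ge0. Qed.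

Let mwt : measurable_fun setT wt.
Proof. by apply: measurable_funM => //; apply: (measurableT_comp (@measurable_powR R alpha)); exact: measurable_markmean. Qed.

Lemma W_S n w : W X alpha lam n.+1 w = W X alpha lam n w * wt (env X n w).
Proof.
rewrite /W /wt /Pi big_ord_recr/= powRM ?M_ge0//; last exact: Pi_ge0.
have -> : - (n.+1%:R * lam) = - (n%:R * lam) + - lam by rewrite -natr1; ring.
by rewrite expRD -ME; ring.
Qed.

Lemma W_1 w : W X alpha lam 1 w = wt (env X 0 w).
Proof. by rewrite W_S /W /Pi big_ord0 powR1 mul0r oppr0 expR0 !mul1r. Qed.

(** The density is multiplicative, W_(k+1) = W_k times a function of mark k. Both sides are thus
    [P]-integrals, and independence of mark k from the past carries over to [Pa], with the law of
    mark 0 under [Pa]. *)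
Lemma tilt_indep_tonelli k d' (T' : measurableType d') (Y : T -> T')
    (F : T' * mark R -> \bar R) : measurable_fun setT (Y : U k -> T') ->
  (forall x, 0 <= F x)%E -> measurable_fun setT F ->
  (\int[Pa]_w F (Y w, env X k w) = \int[Pa]_w \int[Pa]_w' F (Y w, env X 0 w'))%E.
Proof.
move=> mY F0 mF.
have mYS : measurable_fun setT (Y : U k.+1 -> T').
  by apply: sub_sigma_fun mY => A pA; apply: (past_le (leqnSn k)); exact: sub_sigma_algebra.
have menv j : measurable_fun setT (env X j : U j.+1 -> mark R).
  by apply: past_fun; apply: envs_env; exact: (ltnSn j).
have mp : measurable_fun setT (fun w => F (Y w, env X k w) : \bar R).
  exact: (measurableT_comp mF (measurable_fun_pair (past_fun_measurable mYS) (measurable_env X k))).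
rewrite (@tilt_fun _ _ _ P X alpha Pa k.+1 _ hX ht); last 2 first.
- by move=> w; exact: F0.
- have h := measurableT_comp mF (measurable_fun_pair mYS (menv k)); exact h.
under eq_integral do rewrite W_S.
have inner y : (\int[Pa]_w' F (y, env X 0 w') = \int[P]_w' (F (y, env X 0 w') * (wt (env X 0 w'))%:E))%E.
  rewrite (@tilt_fun _ _ _ P X alpha Pa 1%N _ hX ht); last 2 first.
  - by move=> w; exact: F0.
  - have h := measurableT_comp (measurableT_comp mF (measurable_pair1 y)) (menv 0%N); exact h.
  by apply: eq_integral => w _; rewrite W_1.
have mG : measurable_fun setT (fun y => \int[Pa]_w' F (y, env X 0 w'))%E.
  apply: (@measurable_fun_fubini_tonelli_F _ _ _ _ R Pa (fun z : T' * T => F (z.1, env X 0 z.2))).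
  - apply: (measurableT_comp mF); apply: measurable_fun_pair; first exact: measurable_fst.
    exact: (measurableT_comp (measurable_env X 0) measurable_snd).
  - by move=> z; exact: F0.
rewrite [RHS](@tilt_fun _ _ _ P X alpha Pa k _ hX ht); last 2 first.
- by move=> w; apply: integral_ge0 => w' _; exact: F0.
- have h := measurableT_comp mG mY; exact h.
(* The density of the past is adjoined as a coordinate, in absolute value to keep the integrand
   nonnegative everywhere. *)
pose F' (z : (T' * R) * mark R) := (F (z.1.1, z.2) * (`|z.1.2| * wt z.2)%:E)%E.
have mF' : measurable_fun setT F'.
  apply: emeasurable_funM.
    apply: (measurableT_comp mF); apply: measurable_fun_pair; last exact: measurable_snd.
    exact: (measurableT_comp measurable_fst measurable_fst).
  apply/measurable_EFinP; apply: measurable_funM; last exact: (measurableT_comp mwt measurable_snd).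
  apply: measurableT_comp => //; exact: (measurableT_comp measurable_snd measurable_fst).
have F'0 z : (0 <= F' z)%E by rewrite mule_ge0// lee_fin mulr_ge0.
have mYW : measurable_fun setT ((fun w => (Y w, W X alpha lam k w)) : U k -> T' * R).
  by apply: measurable_fun_pair => //; exact: past_W.
transitivity (\int[P]_w F' ((Y w, W X alpha lam k w), env X k w))%E.
  by apply: eq_integral => w _; rewrite /F'/= (ger0_norm (W_ge0 _ _ _ _ _)).
rewrite (past_indep_tonelli hX mYW F'0 mF').
apply: eq_integral => w _; rewrite inner muleC.
have m1 : measurable_fun setT (fun w' => F (Y w, env X 0 w') * (wt (env X 0 w'))%:E)%E.
  apply: emeasurable_funM.
    exact: (measurableT_comp (measurableT_comp mF (measurable_pair1 (Y w))) (measurable_env X 0)).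
  by apply/measurable_EFinP; exact: (measurableT_comp mwt (measurable_env X 0)).
have p1 w' : setT w' -> (0 <= F (Y w, env X 0 w') * (wt (env X 0 w'))%:E)%E.
  by move=> _; rewrite mule_ge0 ?lee_fin.
have w0 : (0 <= (W X alpha lam k w)%:E)%E by rewrite lee_fin W_ge0.
rewrite -(ge0_integralZl P measurableT m1 p1 w0); apply: eq_integral => w' _.
by rewrite /F'/= (ger0_norm (W_ge0 _ _ _ _ _)) EFinM muleCA.
Qed.

(** Adding the constant 1 makes [F] nonnegative; finite integrals allow it to be cancelled
    afterwards. *)
Lemma tilt_indep_bounded k (Y : T -> R) (F : R * mark R -> R) :
  measurable_fun setT (Y : U k -> R) -> (forall x, `|F x| <= 1) -> measurable_fun setT F ->
  \int[Pa]_w F (Y w, env X k w) = \int[Pa]_w \int[Pa]_w' F (Y w, env X 0 w').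
Proof.
move=> mY F1 mF.
have mY' := past_fun_measurable mY.
have mA : measurable_fun setT (fun w => F (Y w, env X k w)).
  exact: (measurableT_comp mF (measurable_fun_pair mY' (measurable_env X k))).
have mB y : measurable_fun setT (fun w => F (y, env X 0 w)).
  exact: (measurableT_comp (measurableT_comp mF (measurable_pair1 y)) (measurable_env X 0)).
have iB y := @bounded_integrable _ _ _ Pa _ 1 (mB y) (fun w => F1 _).
have iA := @bounded_integrable _ _ _ Pa _ 1 mA (fun w => F1 _).
have i1 : Pa.-integrable setT (EFin \o (cst 1 : T -> R)).
  by apply: (@bounded_integrable _ _ _ _ _ 1) => // w; rewrite normr1.
have F10 z : 0 <= 1 + F z by have := F1 z; rewrite ler_norml => /andP[]; lra.
have mF1 : measurable_fun setT (fun z => (1 + F z)%:E).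
  by apply/measurable_EFinP; exact: measurable_funD.
have F10e z : (0 <= (1 + F z)%:E)%E by rewrite lee_fin.
have add1 (f : T -> R) : Pa.-integrable setT (EFin \o f) ->
    (\int[Pa]_w (1 + f w)%:E = (1 + \int[Pa]_w f w)%:E)%E.
  move=> fi; transitivity ((\int[Pa]_w (cst 1 w + f w))%:E); last by rewrite RintegralD// Rintegral_cst1.
  rewrite /Rintegral fineK//; apply: (integrable_fin_num measurableT).
  exact: (integrableD measurableT i1 fi).
pose g w := \int[Pa]_w' F (Y w, env X 0 w').
have gE y : \int[Pa]_w' F (y, env X 0 w') = fine (\int[Pa]_w' (1 + F (y, env X 0 w'))%:E)%E - 1.
  by rewrite add1//= [1 + _]addrC addrK.
have mh : measurable_fun setT (fun y => \int[Pa]_w' (1 + F (y, env X 0 w'))%:E)%E.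
  apply: (@measurable_fun_fubini_tonelli_F _ _ _ _ R Pa (fun z : R * T => (1 + F (z.1, env X 0 z.2))%:E)).
  - apply: (measurableT_comp mF1); apply: measurable_fun_pair; first exact: measurable_fst.
    exact: (measurableT_comp (measurable_env X 0) measurable_snd).
  - by move=> z; exact: F10e.
have mfh : measurable_fun setT (fun y => fine (\int[Pa]_w' (1 + F (y, env X 0 w'))%:E)%E).
  by apply: measurableT_comp.
have mg : measurable_fun setT g.
  rewrite /g; under eq_fun do rewrite gE.
  by apply: measurable_funB => //; exact: (measurableT_comp mfh mY').
have g1 w : `|g w| <= 1.
  apply: (le_trans (le_normr_Rintegral measurableT (iB (Y w)))).
  rewrite -[leRHS](Rintegral_cst1 Pa 1); apply: le_Rintegral => //.
  apply: (@bounded_integrable _ _ _ _ _ 1); first exact: measurableT_comp.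
  by move=> w'; rewrite normr_id.
have ig := @bounded_integrable _ _ _ Pa g 1 mg g1.
have := tilt_indep_tonelli mY F10e mF1; rewrite add1//.
under [X in _ = X -> _]eq_integral do rewrite add1//.
by rewrite add1// => -[] /addrI.
Qed.

Variable rho : R.
Definition walk n w : R := \sum_(i < n) (ln (M X i w) - rho).
Local Notation step := (fun e : mark R => ln (markmean e) - rho).

Let mstep : measurable_fun setT step.
Proof. by apply: measurable_funB => //; apply: (measurableT_comp (@measurable_ln R)); exact: measurable_markmean. Qed.

Lemma past_walk n : measurable_fun setT (walk n : U n -> R).
Proof.
apply: measurable_sum => -[i /= il]; apply: measurable_funB => //.
have h := measurableT_comp (@measurable_ln R) (@past_M _ _ _ X n i il); exact h.
Qed.

Lemma measurable_walk n : measurable_fun setT (walk n).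
Proof. have h := past_fun_measurable (@past_walk n); exact h. Qed.

Lemma walk1 w : walk 1 w = step (env X 0 w).
Proof. by rewrite /walk big_ord1. Qed.

Lemma walk_cf0 t : meancos Pa walk 0 t = 1 /\ meansin Pa walk 0 t = 0.
Proof.
rewrite /meancos /meansin; split.
  rewrite -[RHS](Rintegral_cst1 Pa 1); congr fine.
  by apply: eq_integral => w _; rewrite /walk big_ord0 mulr0 cos0.
rewrite -[RHS](Rintegral_cst1 Pa 0); congr fine.
by apply: eq_integral => w _; rewrite /walk big_ord0 mulr0 sin0.
Qed.

Let mcw n t : measurable_fun setT (fun w => cos (t * walk n w)).
Proof. by apply: (measurableT_comp (@measurable_cos R)); apply: measurable_funM => //; exact: measurable_walk. Qed.

Let msw n t : measurable_fun setT (fun w => sin (t * walk n w)).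
Proof. by apply: (measurableT_comp (@measurable_sin R)); apply: measurable_funM => //; exact: measurable_walk. Qed.

Let icw n t : Pa.-integrable setT (EFin \o (fun w => cos (t * walk n w))).
Proof. by apply: (@bounded_integrable _ _ _ _ _ 1) => // w; exact: cos_max. Qed.

Let isw n t : Pa.-integrable setT (EFin \o (fun w => sin (t * walk n w))).
Proof. by apply: (@bounded_integrable _ _ _ _ _ 1) => // w; exact: sin_max. Qed.

(** Addition formulas combined with independence of the last step: the characteristic function of
    the walk is multiplied by that of one step. *)
Lemma walk_cfS n t :
  meancos Pa walk n.+1 t = meancos Pa walk n t * meancos Pa walk 1 t - meansin Pa walk n t * meansin Pa walk 1 t /\
  meansin Pa walk n.+1 t = meansin Pa walk n t * meancos Pa walk 1 t + meancos Pa walk n t * meansin Pa walk 1 t.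
Proof.
have mz : measurable_fun setT (fun z : R * mark R => t * (z.1 + step z.2)).
  apply: measurable_funM => //; apply: measurable_funD; first exact: measurable_fst.
  exact: (measurableT_comp mstep measurable_snd).
have key (f : R -> R) (a b : R -> R) : measurable_fun setT f -> (forall y, `|f y| <= 1) ->
    (forall x y, f (x + y) = a x * cos y + b x * sin y) ->
    (\int[Pa]_w f (t * walk n.+1 w)) = \int[Pa]_w (a (t * walk n w) * meancos Pa walk 1 t + b (t * walk n w) * meansin Pa walk 1 t).
  move=> mf f1 fD.
  transitivity (\int[Pa]_w f (t * (walk n w + step (env X n w)))).
    by apply: eq_Rintegral => w _; rewrite /walk big_ord_recr.
  rewrite (@tilt_indep_bounded n (walk n) (fun z => f (t * (z.1 + step z.2))) (@past_walk n) (fun z => f1 _) (measurableT_comp mf mz)).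
  apply: eq_Rintegral => w _ /=.
  have j1 := integrableZl measurableT (a (t * walk n w)) (icw 1 t).
  have j2 := integrableZl measurableT (b (t * walk n w)) (isw 1 t).
  rewrite /meancos /meansin -RintegralZl// -RintegralZl// -RintegralD//.
  by apply: eq_Rintegral => w' _; rewrite walk1 mulrDr fD.
pose c1 := meancos Pa walk 1 t; pose s1 := meansin Pa walk 1 t; rewrite -/c1 -/s1.
have cE k : meancos Pa walk k t = \int[Pa]_w cos (t * walk k w) by [].
have sE k : meansin Pa walk k t = \int[Pa]_w sin (t * walk k w) by [].
rewrite !cE !sE; split.
  rewrite (key cos cos (fun x => - sin x)) //; last 3 first.
  - exact: measurable_cos.
  - by move=> y; exact: cos_max.
  - by move=> x y; rewrite cosD mulNr.
  have j1 := integrableZr measurableT c1 (icw n t).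
  have j2 := integrableZr measurableT s1 (isw n t).
  rewrite -RintegralZr// -RintegralZr// -RintegralB//.
  by apply: eq_Rintegral => w _; rewrite mulNr.
rewrite (key sin sin cos) //; last 3 first.
- exact: measurable_sin.
- by move=> y; exact: sin_max.
- by move=> x y; rewrite sinD.
have j1 := integrableZr measurableT c1 (isw n t).
have j2 := integrableZr measurableT s1 (icw n t).
by rewrite -RintegralZr// -RintegralZr// -RintegralD.
Qed.

End tilted_walk.

Lemma cos_int (R : realType) (k : int) : cos (2 * pi * k%:~R) = 1 :> R.
Proof.
have nat_case (n : nat) : cos (2 * pi * n%:R) = 1 :> R.
  elim: n => [|n IH]; first by rewrite mulr0 cos0.
  have -> : 2 * pi * n.+1%:R = 2 * pi * n%:R + pi *+ 2 :> R by rewrite -natr1 -mulr_natl; ring.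
  by rewrite cosD2pi.
by case: k => n; [exact: nat_case|rewrite NegzE mulrNz mulrN cosN; exact: nat_case].
Qed.

Lemma integral_one d (T : measurableType d) (R : realType) (P : probability T R) :
  (\int[P]_w (1 : R)%:E = 1)%E.
Proof. by rewrite integral_cst1//; exact: probability_setT. Qed.

(** * Centring, variance and non-arithmeticity of the tilted step *)

Section tilted_law.
Context d (T : measurableType d) (R : realType) (P : probability T R) (X : bprei_data T R).
Variables (alpha : R) (Pa : probability T R) (rho v : R).
Hypothesis hX : is_bprei P X.
Hypothesis halpha : 0 < alpha.
Hypothesis halphaD : interior (DLambda P X) alpha.
Hypothesis ht : is_tilted P X alpha Pa.
Hypothesis hM : non_arithmetic P (fun w => ln (M X 0 w)).
Hypothesis hrho : rho = derive1 (rLambda P X) alpha.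
Hypothesis hv : 0 < v.
Hypothesis hv2 : v ^+ 2 = derive1n 2 (rLambda P X) alpha.
Local Notation lam := (rLambda P X alpha).
Local Notation L := (fun w => ln (M X 0 w) - rho).
Local Notation U k := (g_sigma_algebraType (past_gen X k)).

Lemma M_gt0 : {ae P, forall w, forall n, 0 < M X n w}.
Proof.
apply/ae_foralln => n; apply: filterS (mean_pos_finite hX n) => w H.
by rewrite /M fine_gt0.
Qed.

Lemma past_f1 (f : R -> R) : measurable_fun setT f ->
  measurable_fun setT ((fun w => f (M X 0 w)) : U 1 -> R).
Proof. by move=> mf; have h := measurableT_comp mf (@past_M _ _ _ X 1 0 isT); exact h. Qed.

Lemma tilt_M (f : R -> R) : measurable_fun setT f -> (forall x, 0 <= f x) ->
  (\int[Pa]_w (f (M X 0 w))%:E = \int[P]_w (f (M X 0 w) * (M X 0 w `^ alpha * expR (- lam)))%:E)%E.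
Proof.
move=> mf f0; rewrite (@tilt_fun _ _ _ P X alpha Pa 1 (fun w => (f (M X 0 w))%:E) hX ht).
- by apply: eq_integral => w _; rewrite W_1 -EFinM.
- by move=> w; rewrite lee_fin.
- by apply/measurable_EFinP; exact: past_f1.
Qed.

(** Read off from the total mass 1 of [Pa] on the first mark, which forces E[M^alpha] to be finite
    and equal to the normalisation. *)
Lemma mean_powR : (\int[P]_w (M X 0 w `^ alpha)%:E = (expR lam)%:E)%E.
Proof.
have := @tilt_M (cst 1) (@measurable_cst _ _ _ _ _ _) (fun=> ler01).
rewrite integral_one.
under eq_integral do rewrite /= mul1r mulrC EFinM.
have mp : measurable_fun setT (fun w => (M X 0 w `^ alpha)%:E).
  by apply/measurable_EFinP; apply: (measurableT_comp (@measurable_powR R alpha)); exact: measurable_M.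
have p0 w : setT w -> (0 <= (M X 0 w `^ alpha)%:E)%E by move=> _; rewrite lee_fin powR_ge0.
have c0 : (0 <= (expR (- lam))%:E)%E by rewrite lee_fin expR_ge0.
rewrite (ge0_integralZl P measurableT mp p0 c0).
have : (0 <= \int[P]_w (M X 0 w `^ alpha)%:E)%E by apply: integral_ge0 => w _; rewrite lee_fin powR_ge0.
case: (integral _ _ _) => [r| |//]; last by rewrite gt0_muley ?lte_fin ?expR_gt0.
by move=> _ [e]; congr EFin; rewrite -[RHS]mulr1 e mulrA -expRD subrr expR0 mul1r.
Qed.

(** A progression is the zero set of a nonnegative function 1 - cos of the mean. Its integral under
    [Pa] is a [P]-integral with a density that is almost surely positive, so being carried by the
    progression transfers back to [P]. *)
Lemma non_arithmetic_tilt : non_arithmetic Pa L.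
Proof.
move=> a h h0 H; apply: (hM (a := a + rho) h0).
pose g x := 1 - cos (2 * pi / h * (ln x - rho - a)).
have mg : measurable_fun setT g.
  apply: measurable_funB => //; apply: (measurableT_comp (@measurable_cos R)); apply: measurable_funM => //.
  by do 2 apply: measurable_funB => //; exact: measurable_ln.
have g0 x : 0 <= g x by rewrite subr_ge0 cos_le1.
have mgM (Q' : probability T R) : measurable_fun setT (fun w => (g (M X 0 w))%:E).
  by apply/measurable_EFinP; exact: (measurableT_comp mg (measurable_M X 0)).
have e : (\int[Pa]_w (g (M X 0 w))%:E = 0)%E.
  rewrite (_ : 0%E = \int[Pa]_w (cst 0%E w))%E; last by rewrite integral0.
  apply: ae_eq_integral => //; first exact: mgM.
  apply: filterS H => w [k hk] _; rewrite /g hk /=.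
  have -> : 2 * pi / h * (a + h * k%:~R - a) = 2 * pi * k%:~R by field; rewrite gt_eqF.
  by rewrite cos_int subrr.
have := tilt_M mg g0; rewrite e => /esym I0.
have mw : measurable_fun setT (fun w => (g (M X 0 w) * (M X 0 w `^ alpha * expR (- lam)))%:E).
  apply/measurable_EFinP; apply: measurable_funM; first exact: (measurableT_comp mg (measurable_M X 0)).
  apply: measurable_funM => //; apply: (measurableT_comp (@measurable_powR R alpha)); exact: measurable_M.
have I1 : (\int[P]_w `|(g (M X 0 w) * (M X 0 w `^ alpha * expR (- lam)))%:E| = 0)%E.
  rewrite -[RHS]I0; apply: eq_integral => w _; rewrite gee0_abs// lee_fin mulr_ge0// mulr_ge0 ?powR_ge0 ?expR_ge0//.
have H2 := (ae_eq_integral_abs P measurableT mw).1 I1.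
apply: filterS2 H2 M_gt0 => w /(_ Logic.I) /= [] + /(_ 0%N) M0.
move=> /eqP; rewrite mulf_eq0 [X in _ || X]gt_eqF ?orbF; last by rewrite mulr_gt0 ?powR_gt0 ?expR_gt0.
rewrite subr_eq0 eq_sym => /eqP /cos_eq1[k hk]; exists k.
have : ln (M X 0 w) - rho - a = h * k%:~R.
  have p0 : pi != 0 :> R by rewrite gt_eqF// pi_gt0.
  apply: (mulfI (_ : 2 * pi / h != 0)); first by rewrite !mulf_neq0// invr_eq0 gt_eqF.
  by rewrite hk; field; rewrite gt_eqF.
by lra.
Qed.

Lemma interior_ball : exists2 e0, 0 < e0 & forall a, `|a| < e0 -> (Lambda P X (alpha + a) < +oo)%E /\ `|a| < alpha.
Proof.
have /nbhs_ballP[e /= e0 He] : nbhs alpha (DLambda P X) by exact: halphaD.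
exists (Num.min e alpha); first by rewrite lt_min e0.
move=> a; rewrite lt_min => /andP[a1 a2]; split => //; apply: He.
by rewrite /ball/= opprD addNKr normrN.
Qed.

(** The condition |a| < alpha keeps alpha + a positive, so that M = 0 contributes 0 on both
    sides. *)
Lemma tilt_exp a : `|a| < alpha -> (\int[Pa]_w (expR (a * L w))%:E =
  (expR (- (a * rho) - lam))%:E * \int[P]_w (M X 0 w `^ (alpha + a))%:E)%E.
Proof.
rewrite ltr_norml => /andP[a1 a2].
have mf : measurable_fun setT (fun x : R => expR (a * (ln x - rho))).
  by apply: measurableT_comp => //; apply: measurable_funM => //; apply: measurable_funB => //; exact: measurable_ln.
rewrite (@tilt_M _ mf); last by move=> x; exact: expR_ge0.
have mp : measurable_fun setT (fun w => (M X 0 w `^ (alpha + a))%:E).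
  by apply/measurable_EFinP; apply: (measurableT_comp (@measurable_powR R _)); exact: measurable_M.
have p0 w : setT w -> (0 <= (M X 0 w `^ (alpha + a))%:E)%E by move=> _; rewrite lee_fin powR_ge0.
have c0 : (0 <= (expR (- (a * rho) - lam))%:E)%E by rewrite lee_fin expR_ge0.
rewrite -(ge0_integralZl P measurableT mp p0 c0).
apply: eq_integral => w _; rewrite -EFinM; congr EFin.
have := M_ge0 X 0 w; rewrite le_eqVlt => /predU1P[<-|Mw].
  rewrite !powR0; first by rewrite !(mul0r, mulr0).
  - by rewrite gt_eqF//; lra.
  - by rewrite gt_eqF.
rewrite /powR (gt_eqF Mw) -!expRD; congr expR; ring.
Qed.

(** By [tilt_exp], Lambda(alpha + a) is Lambda(alpha) + a rho plus the log-Laplace transform of the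
    tilted centred step. Its first derivative at 0 gives mean 0, because rho = Lambda'(alpha), and
    the second gives variance v^2. *)
Theorem walk_cfhyp : cfhyp (meancos Pa (walk X rho)) (meansin Pa (walk X rho)) v.
Proof.
have [e0 e0_gt0 hL] := interior_ball.
have mL : measurable_fun setT L.
  by apply: measurable_funB => //; apply: (measurableT_comp (@measurable_ln R)); exact: measurable_M.
have mexp a : measurable_fun setT (fun w => (expR (a * L w))%:E).
  by apply/measurable_EFinP; apply: measurableT_comp => //; exact: measurable_funM.
have expfin a : `|a| < e0 -> (\int[Pa]_w (expR (a * L w))%:E < +oo)%E.
  move=> ha; have [h1 h2] := hL a ha; rewrite tilt_exp//.
  move: h1; rewrite /Lambda unlock.
  have : (0 <= \int[P]_w (M X 0 w `^ (alpha + a))%:E)%E by apply: integral_ge0 => w _; rewrite lee_fin powR_ge0.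
  by case: (integral _ _ _) => [r|//|//] _ _; rewrite -EFinM ltry.
have m0E a : `|a| < e0 -> (\int[Pa]_w (expR (a * L w))%:E = (mom Pa L 0 a)%:E)%E.
  move=> ha; rewrite /mom /Rintegral; under [in RHS]eq_integral do rewrite mul1r.
  by rewrite fineK// ge0_fin_numE ?expfin//; apply: integral_ge0 => w _; rewrite lee_fin expR_ge0.
have m0_gt0 a : `|a| < e0 -> 0 < mom Pa L 0 a.
  move=> ha; rewrite -lte_fin -m0E//; apply: (integral_gt0 (mexp a)) => [w|]; first by rewrite lee_fin expR_ge0.
  rewrite (_ : [set w | _] = setT); last by apply/seteqP; split => // w _ /=; rewrite lte_fin expR_gt0.
  by apply: (@lt_le_trans _ _ 1%E) => //; rewrite -(@probability_setT _ _ _ Pa).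
have rLE a : `|a| < e0 -> rLambda P X (alpha + a) = lam + a * rho + ln (mom Pa L 0 a).
  move=> ha; have [_ h2] := hL a ha; have := tilt_exp h2; rewrite m0E// => h.
  have pE : (\int[P]_w (M X 0 w `^ (alpha + a))%:E = (expR (lam + a * rho) * mom Pa L 0 a)%:E)%E.
    rewrite EFinM h muleA -EFinM -expRD (_ : lam + a * rho + (- (a * rho) - lam) = 0); last by ring.
    by rewrite expR0 mul1e.
  transitivity (fine (lne (expR (lam + a * rho) * mom Pa L 0 a)%:E)).
    by rewrite -pE /rLambda /Lambda unlock.
  have p0 : 0 < expR (lam + a * rho) * mom Pa L 0 a by rewrite mulr_gt0 ?expR_gt0 ?m0_gt0.
  by rewrite /= leNgt p0/= lnM ?posrE ?expR_gt0 ?m0_gt0// expRK.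
have e16 : 0 < e0 / 2 / 8 by lra.
have small (a : R) : `|a| < e0 / 2 / 8 -> `|a| < e0 by lra.
(* The derivative of Lambda at alpha + a, expressed by moments. *)
pose h a := mom Pa L 1 a / mom Pa L 0 a + rho.
have shiftD (f : R -> R) (x l : R) : is_derive (x - alpha) 1 f l ->
    is_derive x 1 (fun y => f (y - alpha)) l.
  move=> fd; have dg : is_derive x 1 (fun y : R => y - alpha) 1.
    by apply: is_derive_eq; rewrite subr0.
  by have := @is_derive1_comp R f (fun y => y - alpha) x l 1 fd dg; rewrite mulr1.
have ballN (x : R) : `|x - alpha| < e0 / 2 / 8 -> \forall y \near x, `|y - alpha| < e0 / 2 / 8.
  move=> hx; have eta0 : 0 < e0 / 2 / 8 - `|x - alpha| by rewrite subr_gt0.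
  near=> y; have : ball x (e0 / 2 / 8 - `|x - alpha|) y by near: y; exact: nbhsx_ballx.
  rewrite /ball/= => hy; have -> : y - alpha = (x - alpha) - (x - y) by ring.
  by apply: (le_lt_trans (ler_normB _ _)); lra.
have D1 x : `|x - alpha| < e0 / 2 / 8 -> derive1 (rLambda P X) x = h (x - alpha).
  move=> hx; rewrite derive1E.
  rewrite (@near_eq_derive _ _ _ _ (fun y => lam + (y - alpha) * rho + ln (mom Pa L 0 (y - alpha)))); last first.
    near=> y; have hy : `|y - alpha| < e0 / 2 / 8 by near: y; exact: ballN.
    by rewrite -rLE ?small// addrC subrK.
  have d0 := mom_derive mL e0_gt0 expfin (k := 0) isT hx.
  have dl := shiftD _ _ _ (is_derive1_comp (is_derive1_ln (m0_gt0 _ (small _ hx))) d0).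
  have dd : is_derive x 1 (fun y => lam + (y - alpha) * rho + ln (mom Pa L 0 (y - alpha))) (h (x - alpha)).
    apply: is_derive_eq; rewrite /GRing.scale/= /h; ring.
  by rewrite derive_val.
have hz : `|0 : R| < e0 / 2 / 8 by rewrite normr0.
have m00 : mom Pa L 0 0 = 1 by exact: mom0.
have m1 : mom Pa L 1 0 = 0.
  have := D1 alpha; rewrite subrr => /(_ hz); rewrite -hrho /h m00 divr1 => e.
  by lra.
have m2 : mom Pa L 2 0 = v ^+ 2.
  rewrite hv2 /= derive1E (@near_eq_derive _ _ _ _ (fun y => h (y - alpha))); last first.
    near=> y; apply: D1; near: y; apply: ballN; by rewrite subrr normr0.
  have d0 := mom_derive mL e0_gt0 expfin (k := 0) isT hz.
  have d1 := mom_derive mL e0_gt0 expfin (k := 1) isT hz.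
  have n0 : mom Pa L 0 0 != 0 by rewrite m00 oner_neq0.
  have dV := is_deriveV n0 d0.
  have dh : is_derive (0 : R) 1 h (mom Pa L 2 0).
    by apply: is_derive_eq; rewrite /GRing.scale/= m1 m00 expr1n invr1; ring.
  have dh' : is_derive (alpha - alpha) 1 h (mom Pa L 2 0) by rewrite subrr.
  by have := shiftD _ _ _ dh' => dd; rewrite derive_val.
have c1E t : meancos Pa (walk X rho) 1 t = \int[Pa]_w cos (t * L w).
  by rewrite /meancos; congr fine; apply: eq_integral => w _; rewrite walk1.
have s1E t : meansin Pa (walk X rho) 1 t = \int[Pa]_w sin (t * L w).
  by rewrite /meansin; congr fine; apply: eq_integral => w _; rewrite walk1.
have [cc cs] := cf_continuous mL e0_gt0 expfin.
have [C C0 hC] := cf_taylor mL e0_gt0 expfin m1 m2.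
split.
- exact: walk_cf0.
- exact: walk_cfS hX ht _.
- split.
    by rewrite (_ : meancos _ _ 1 = (fun t => \int[Pa]_w cos (t * L w)))//; apply/funext.
  by rewrite (_ : meansin _ _ 1 = (fun t => \int[Pa]_w sin (t * L w)))//; apply/funext.
- by exists C => // t; rewrite c1E s1E; exact: hC.
- split=> [t|t t0]; rewrite c1E s1E.
    by have [] := cf_modulus Pa mL t.
  by apply: cf_lt1 => //; exact: non_arithmetic_tilt.
Unshelve. all: end_near. Qed.

End tilted_law.

(** * Inequalities for real powers *)

Section power_bounds.
Variable R : realType.
Implicit Types x y a b e : R.

Lemma one_powR a : 1 `^ a = 1 :> R. Proof. by rewrite powR1. Qed.

Lemma powR_convex x t : 0 <= x -> 0 < t -> t < 1 -> x `^ t <= t * x + (1 - t).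
Proof.
move=> x0 t0 t1; have q0 : 0 < (1 - t)^-1 by rewrite invr_gt0 subr_gt0.
have p0 : 0 < t^-1 by rewrite invr_gt0.
have := @conjugate_powR R (x `^ t) 1 t^-1 (1 - t)^-1 (powR_ge0 _ _) ler01 p0 q0.
rewrite !invrK mulr1 -powRrM mulfV ?gt_eqF// powRr1// powR1 mul1r.
by rewrite [x * t]mulrC; apply; lra.
Qed.

Lemma powR_le_max x a b : 0 <= x -> 0 < a -> a <= b -> x `^ a <= 1 + x `^ b.
Proof.
move=> x0 a0 ab; have [x1|x1] := leP x 1.
  apply: (@le_trans _ _ 1); last by rewrite lerDl powR_ge0.
  by rewrite -[leRHS](one_powR a) ge0_ler_powR ?nnegrE// ltW.
apply: (@le_trans _ _ (x `^ b)); last by rewrite lerDr.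
by rewrite ler_powR// ltW.
Qed.

(** Beyond the threshold [J] one has x^(b - a) >= 1 / e, so the larger power wins; below it x^a is
    at most J^a. *)
Lemma powR_absorb a b e : 0 <= a -> a < b -> 0 < e ->
  exists2 K, 0 <= K & forall x, 0 <= x -> x `^ a <= e * x `^ b + K.
Proof.
move=> a0 ab e0; have ba : 0 < b - a by rewrite subr_gt0.
pose J := (e^-1) `^ (b - a)^-1; have J0 : 0 < J by rewrite powR_gt0 ?invr_gt0.
exists (J `^ a); first exact: powR_ge0.
move=> x x0; have [xJ|Jx] := leP x J.
  apply: (@le_trans _ _ (J `^ a)); last by rewrite lerDr mulr_ge0 ?powR_ge0 ?(ltW e0).
  by rewrite ge0_ler_powR ?nnegrE// ltW.
apply: (@le_trans _ _ (e * x `^ b)); last by rewrite lerDl powR_ge0.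
have xp : 0 < x by exact: lt_trans Jx.
have -> : x `^ b = x `^ a * x `^ (b - a).
  transitivity (x `^ (a + (b - a))); first by congr (powR x _); ring.
  by rewrite powRD// (gt_eqF xp) implybT.
have h : e^-1 <= x `^ (b - a).
  have -> : e^-1 = J `^ (b - a) by rewrite /J -powRrM mulVf ?gt_eqF// powRr1// invr_ge0 ltW.
  by rewrite ge0_ler_powR ?nnegrE// ltW.
rewrite mulrCA -[leLHS]mulr1 ler_wpM2l ?powR_ge0//.
by have := ler_wpM2l (ltW e0) h; rewrite divff// gt_eqF.
Qed.

(** The coefficient of x^b can be brought arbitrarily close to 1, for b below 1 as well as above:
    either y <= dl x, with (1 + dl)^b = 1 + e, or y controls x. *)
Lemma powR_add_le b e : 0 < b -> 0 < e ->
  exists2 K, 0 <= K & forall x y, 0 <= x -> 0 <= y -> (x + y) `^ b <= (1 + e) * x `^ b + K * y `^ b.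
Proof.
move=> b0 e0; pose dl := (1 + e) `^ b^-1 - 1.
have e1 : 1 < 1 + e by rewrite ltrDl.
have d0 : 0 < dl.
  rewrite subr_gt0 -[ltLHS](one_powR b^-1) gt0_ltr_powR ?nnegrE ?invr_gt0//.
  by rewrite addr_ge0// ltW.
have dE : (1 + dl) `^ b = 1 + e.
  by rewrite /dl addrC subrK -powRrM mulVf ?gt_eqF// powRr1// addr_ge0// ltW.
exists ((1 + dl^-1) `^ b); first exact: powR_ge0.
move=> x y x0 y0; have [yx|xy] := leP y (dl * x).
  apply: (@le_trans _ _ ((1 + e) * x `^ b)); last by rewrite lerDl mulr_ge0 ?powR_ge0.
  have d1 : 0 <= 1 + dl by rewrite addr_ge0// ltW.
  rewrite -dE -powRM// ge0_ler_powR ?nnegrE ?addr_ge0 ?mulr_ge0 ?(ltW b0)//.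
  by rewrite mulrDl mul1r lerD2l.
apply: (@le_trans _ _ ((1 + dl^-1) `^ b * y `^ b)); last by rewrite lerDr mulr_ge0 ?powR_ge0// ltW// (lt_trans ltr01).
have i0 : 0 <= 1 + dl^-1 by rewrite addr_ge0// invr_ge0 ltW.
rewrite -powRM// ge0_ler_powR ?nnegrE ?addr_ge0 ?mulr_ge0 ?(ltW b0)//.
by rewrite mulrDl mul1r addrC lerD2l mulrC ler_pdivlMr// mulrC ltW.
Qed.

Lemma cvg_powR (u : nat -> R) x a : 0 < a -> (forall n, 0 <= u n) ->
  u n @[n --> \oo] --> x -> u n `^ a @[n --> \oo] --> x `^ a.
Proof.
move=> a0 u0 ux.
have x0 : 0 <= x.
  rewrite leNgt; apply/negP => xn; have [n _ /(_ n (leqnn n))] := cvgr_lt x ux 0 xn.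
  by rewrite /= ltNge u0.
move: x0; rewrite le_eqVlt => /predU1P[x0|x0].
  rewrite -x0 powR0 ?gt_eqF//; rewrite -x0 in ux.
  apply/cvgrPdist_le => e e0; have ea : 0 < e `^ a^-1 by rewrite powR_gt0.
  near=> n; rewrite sub0r normrN ger0_norm ?powR_ge0//.
  have -> : e = (e `^ a^-1) `^ a by rewrite -powRrM mulVf ?gt_eqF// powRr1// ltW.
  rewrite ge0_ler_powR ?nnegrE ?(ltW a0) ?(ltW ea)//.
  have : `|0 - u n| <= e `^ a^-1 by near: n; move/cvgrPdist_le : ux; apply.
  by rewrite sub0r normrN ger0_norm.
have xin : x \in `]0%R, +oo[ by rewrite in_itv/= x0.
have h := @derivable_powR R 1 a x xin.
have c : {for x, continuous (fun y : R => y `^ a)} by exact/differentiable_continuous/derivable1_diffP.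
exact: (cvg_comp _ _ ux c).
Unshelve. all: end_near. Qed.

End power_bounds.

(** * The growth factor m = E[M^alpha] and the intermediate exponent *)

Section moments_of_Z.
Context d (T : measurableType d) (R : realType) (P : probability T R) (X : bprei_data T R).
Variables (alpha : R) (Pa : probability T R) (mu C beta : R).
Hypothesis hX : is_bprei P X.
Hypothesis halpha : 0 < alpha.
Hypothesis ht : is_tilted P X alpha Pa.
Hypothesis hM : non_arithmetic P (fun w => ln (M X 0 w)).
Hypothesis hlogM : ('E_P[fun w => `|ln (M X 0 w)|%R] < +oo)%E.
Hypothesis hmu : ('E_P[fun w => ln (M X 0 w)] = mu%:E)%E.
Hypothesis hmu0 : 0 <= mu.
Hypothesis beta0 : 0 <= beta.
Hypothesis beta_lt : beta < alpha.
Hypothesis hD : forall k : nat, ('E_P[fun w => (`|D X k w| `^ alpha)%R] <= (C * (1 + k%:R `^ beta))%:E)%E.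
Local Notation lam := (rLambda P X alpha).
Local Notation m := (expR lam).

Lemma measurable_M_powR a : measurable_fun setT (fun w => M X 0 w `^ a).
Proof. by apply: (measurableT_comp (@measurable_powR R a)); exact: measurable_M. Qed.

(** Integrating exp x >= 1 + x at x = alpha ln M gives m >= 1 + alpha mu >= 1. If m = 1, the
    integrand vanishes almost surely, hence ln M = 0 almost surely, against non-arithmeticity. The
    cases mu = 0 and mu > 0 are thus treated at once. *)
Lemma mean_powR_gt1 : 1 < m.
Proof.
have mMp a := measurable_M_powR a.
have mln : measurable_fun setT (fun w => ln (M X 0 w)).
  by apply: (measurableT_comp (@measurable_ln R)); exact: measurable_M.
have iln : P.-integrable setT (EFin \o (fun w => ln (M X 0 w))).
  by apply/integrableP; split; [exact/measurable_EFinP|move: hlogM; rewrite unlock].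
have mex : measurable_fun setT (fun w => expR (alpha * ln (M X 0 w))).
  by apply: measurableT_comp => //; exact: measurable_funM.
have exE : (\int[P]_w (expR (alpha * ln (M X 0 w)))%:E = m%:E)%E.
  rewrite -(mean_powR hX ht); apply: ae_eq_integral => //; try exact/measurable_EFinP.
  by apply: filterS (M_gt0 hX) => w /(_ 0%N) M0 _; rewrite /powR gt_eqF.
have iex : P.-integrable setT (EFin \o (fun w => expR (alpha * ln (M X 0 w)))).
  apply/integrableP; split; first exact/measurable_EFinP.
  rewrite (_ : integral _ _ _ = m%:E) ?ltry// -exE; apply: eq_integral => w _.
  by rewrite /= ger0_norm ?expR_ge0.
have i1 : P.-integrable setT (EFin \o (cst 1 : T -> R)).
  by apply: (@bounded_integrable _ _ _ _ _ 1) => // w; rewrite normr1.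
have il := integrableZl measurableT alpha iln.
have iB := integrableB measurableT iex i1.
pose f w := expR (alpha * ln (M X 0 w)) - 1 - alpha * ln (M X 0 w).
have f0 w : 0 <= f w by rewrite /f; have := expR_ge1Dx (alpha * ln (M X 0 w)); lra.
have mf : measurable_fun setT f.
  by apply: measurable_funB; [exact: measurable_funB|exact: measurable_funM].
have fi : P.-integrable setT (EFin \o f) by have h := integrableB measurableT iB il; exact h.
have fE : \int[P]_w f w = m - 1 - alpha * mu.
  rewrite (_ : Rintegral P setT f = \int[P]_w ((expR (alpha * ln (M X 0 w)) - cst 1 w) - alpha * ln (M X 0 w)))//.
  rewrite RintegralB// RintegralB// RintegralZl// Rintegral_cst1.
  by rewrite /Rintegral exE; move: hmu; rewrite unlock => ->.
have fge : 0 <= \int[P]_w f w by apply: Rintegral_ge0 => w _; exact: f0.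
have am : 0 <= alpha * mu by rewrite mulr_ge0// ltW.
have m1 : 1 <= m by move: fge; rewrite fE; lra.
rewrite lt_neqAle m1 andbT; apply/eqP => e.
have I0 : \int[P]_w f w = 0 by apply/eqP; rewrite eq_le fge andbT fE; lra.
have I1 : (\int[P]_w `|(EFin \o f) w| = 0)%E.
  transitivity (\int[P]_w (f w)%:E)%E; first by apply: eq_integral => w _; rewrite /= ger0_norm.
  by rewrite -[LHS]fineK; [rewrite [fine _]I0|exact: (integrable_fin_num measurableT fi)].
have mf' : measurable_fun setT (EFin \o f) by exact/measurable_EFinP.
have H := (ae_eq_integral_abs P measurableT mf').1 I1.
apply: (hM (a := 0) (h := 1)) => //; apply: filterS H => w /(_ Logic.I) /= [fw]; exists 0.
rewrite mulr0 addr0; apply/eqP; rewrite -[_ == _]negbK; apply/negP => ln0.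
have : alpha * ln (M X 0 w) != 0 by apply: mulf_neq0 => //; rewrite (gt_eqF halpha).
by move=> /expR_gt1Dx; move: fw; rewrite /f; lra.
Qed.

(** Otherwise offspring numbers would be at most 1, so M <= 1 and m <= 1. *)
Lemma offspring_ge2 : (0 < P [set w | 0 < Q X 0 w [set n | (2 <= n)%N]]%E)%E.
Proof.
rewrite lt0e measure_ge0 andbT; apply/eqP => H.
have mQ : measurable [set w | (0 < Q X 0 w [set n | (2 <= n)%N])%E].
  apply: (measurable_preimage (f := fun w => Q X 0 w [set n | (2 <= n)%N]) (B := [set x | 0 < x]%E)).
    apply: (measurableT_comp (@measurable_eval R _)).
    exact: (measurableT_comp measurable_fst (measurable_env X 0)).
  by rewrite -[X in measurable X]setTI; exact: emeasurable_fun_o_infty.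
have M1 : {ae P, forall w, M X 0 w <= 1}.
  exists [set w | (0 < Q X 0 w [set n | (2 <= n)%N])%E]; split => //.
  move=> w /= Mw; rewrite lt0e measure_ge0 andbT; apply/eqP => Q0; apply: Mw.
  have : (mean (Q X 0 w) <= 1)%E.
    have -> : (1 = \int[Q X 0 w]_k (1 : R)%:E)%E by rewrite integral_one.
    apply: ae_ge0_le_integral => //.
    exists [set n | (2 <= n)%N]; split => //= k; apply: contra_notP => /negP; rewrite -ltnNge ltnS => k1 _.
    by rewrite lee_fin; have := ler_nat R k 1; rewrite mulr1n => ->.
  have : (0 <= mean (Q X 0 w))%E by apply: integral_ge0 => k _; rewrite lee_fin.
  by rewrite /M; case: (mean _).
have := mean_powR_gt1; rewrite ltNge => /negP; apply.
rewrite -lee_fin -(mean_powR hX ht).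
have -> : (1 = \int[P]_w (1 : R)%:E)%E by rewrite integral_one.
have mMe : measurable_fun setT (fun w => (M X 0 w `^ alpha)%:E) by apply/measurable_EFinP; exact: measurable_M_powR.
have M0e w : setT w -> (0 <= (M X 0 w `^ alpha)%:E)%E by move=> _; rewrite lee_fin powR_ge0.
apply: (@ae_ge0_le_integral _ _ _ P setT measurableT _ _ M0e mMe) => //.
- apply: filterS M1 => w Mw _; rewrite lee_fin -[leRHS](one_powR alpha).
  by rewrite ge0_ler_powR ?nnegrE ?M_ge0 ?(ltW halpha).
Qed.

(** Any exponent strictly between beta and alpha would do: above beta so that Z^b dominates the
    moments of D, below alpha so that b-th moments grow more slowly than m^n. *)
Definition bexp : R := (beta + alpha) / 2.
Local Notation b := bexp.

Lemma b_gt0 : 0 < b. Proof. by have := halpha; have := beta0; rewrite /b; lra. Qed.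
Lemma b_lt : b < alpha. Proof. by have := beta_lt; rewrite /b; lra. Qed.
Lemma beta_b : beta < b. Proof. by have := beta_lt; rewrite /b; lra. Qed.

Lemma C_ge0 : 0 <= C.
Proof.
have := hD 0; rewrite unlock => h.
have : (0 <= (C * (1 + 0%:R `^ beta))%:E)%E.
  by apply: le_trans h; apply: integral_ge0 => w _; rewrite lee_fin powR_ge0.
by rewrite lee_fin pmulr_lge0// ltr_wpDr ?powR_ge0.
Qed.

Lemma measurable_S_real j : measurable_fun setT (fun w => (S X 0 j w)%:R : R).
Proof.
have h : measurable_fun setT (S X 0 j) by apply: measurable_nat_fun => z; exact: measurable_S.
by apply: (measurableT_comp _ h).
Qed.

Lemma D_S j w : D X j w = (S X 0 j w)%:R - M X 0 w * j%:R.
Proof.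
rewrite /D /S sumrB natrD natr_sum sumr_const card_ord -mulr_natr; ring.
Qed.

Lemma measurable_D j : measurable_fun setT (fun w => D X j w).
Proof.
rewrite (_ : (fun _ => _) = (fun w => (S X 0 j w)%:R - M X 0 w * j%:R)); last by apply/funext => w; exact: D_S.
apply: measurable_funB; first exact: measurable_S_real.
by apply: measurable_funM => //; exact: measurable_M.
Qed.

Lemma measurable_D_powR j a : measurable_fun setT (fun w => (`|D X j w| `^ a)%:E).
Proof.
apply/measurable_EFinP; apply: (measurableT_comp (@measurable_powR R a)).
by apply: measurableT_comp => //; exact: measurable_D.
Qed.

(** Convexity in the exponent; as m > 1, the right-hand side is strictly below m. *)
Lemma mean_powR_b : (\int[P]_w (M X 0 w `^ b)%:E <= (b / alpha * m + (1 - b / alpha))%:E)%E.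
Proof.
have t0 : 0 < b / alpha by rewrite divr_gt0// b_gt0.
have t1 : b / alpha < 1 by rewrite ltr_pdivrMr// mul1r b_lt.
rewrite EFinD EFinM -(mean_powR hX ht).
have mp : measurable_fun setT (fun w => (M X 0 w `^ alpha)%:E) by apply/measurable_EFinP; exact: measurable_M_powR.
have p0 w : setT w -> (0 <= (M X 0 w `^ alpha)%:E)%E by move=> _; rewrite lee_fin powR_ge0.
have c0 : (0 <= (b / alpha)%:E)%E by rewrite lee_fin ltW.
rewrite -(ge0_integralZl P measurableT mp p0 c0).
have -> : ((1 - b / alpha)%:E = \int[P]_w (1 - b / alpha)%:E)%E.
  by rewrite integral_cst//= [X in (_ * X)%E](@probability_setT _ _ _ P) mule1.
have k0 : (0 <= (1 - b / alpha)%:E)%E by rewrite lee_fin subr_ge0 ltW.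
rewrite -ge0_integralD//; last 2 first.
- by move=> w _; rewrite mule_ge0// p0.
- exact: measurable_funeM.
apply: ge0_le_integral => //.
- by move=> w _; rewrite lee_fin powR_ge0.
- by apply/measurable_EFinP; exact: measurable_M_powR.
- by apply: emeasurable_funD => //; exact: measurable_funeM.
- move=> w _; rewrite -EFinM -EFinD lee_fin.
  have -> : M X 0 w `^ b = (M X 0 w `^ alpha) `^ (b / alpha).
    by rewrite -powRrM; congr (_ `^ _); field; rewrite gt_eqF.
  by apply: powR_convex => //; exact: powR_ge0.
Qed.

End moments_of_Z.

(** * Growth of the b-th moments and size of the errors *)

Section moment_growth.
Context d (T : measurableType d) (R : realType) (P : probability T R) (X : bprei_data T R).
Variables (alpha : R) (Pa : probability T R) (mu C beta : R).
Hypothesis hX : is_bprei P X.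
Hypothesis halpha : 0 < alpha.
Hypothesis ht : is_tilted P X alpha Pa.
Hypothesis hM : non_arithmetic P (fun w => ln (M X 0 w)).
Hypothesis hlogM : ('E_P[fun w => `|ln (M X 0 w)|%R] < +oo)%E.
Hypothesis hmu : ('E_P[fun w => ln (M X 0 w)] = mu%:E)%E.
Hypothesis hmu0 : 0 <= mu.
Hypothesis beta0 : 0 <= beta.
Hypothesis beta_lt : beta < alpha.
Hypothesis hD : forall k : nat, ('E_P[fun w => (`|D X k w| `^ alpha)%R] <= (C * (1 + k%:R `^ beta))%:E)%E.
Local Notation lam := (rLambda P X alpha).
Local Notation m := (expR lam).
Local Notation b := (bexp alpha beta).

Let b0 : 0 < b. Proof. exact: b_gt0. Qed.
Let ba : b < alpha. Proof. exact: b_lt. Qed.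
Let bb : beta < b. Proof. exact: beta_b. Qed.
Let C0 : 0 <= C. Proof. exact: C_ge0 hD. Qed.

(** The restriction to a past event allows the bounds to be restarted from {Z_n = j}. *)
Definition Zb n (A : set T) : \bar R := (\int[P]_(w in A) ((Z X n w)%:R `^ b)%:E)%E.

Lemma measurable_Z_fun n (g : nat -> R) : measurable_fun setT (fun w => g (Z X n w)).
Proof. exact: (measurableT_comp (_ : measurable_fun setT g) (measurable_Z X n)). Qed.

Lemma Zb_ge0 n A : (0 <= Zb n A)%E.
Proof. by apply: integral_ge0 => w _; rewrite lee_fin powR_ge0. Qed.

Lemma Zb_affine n A c K : past X n A -> 0 <= c -> 0 <= K ->
  (\int[P]_(w in A) (c * (Z X n w)%:R `^ b + K)%:E = c%:E * Zb n A + K%:E * P A)%E.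
Proof.
move=> pA c0 K0; have mA : measurable A by exact: past_measurable pA.
have mz : measurable_fun A (fun w => ((Z X n w)%:R `^ b : R)%:E).
  by apply/measurable_EFinP; apply: measurable_funTS; exact: (measurable_Z_fun n (fun j => j%:R `^ b)).
have z0 w : A w -> (0 <= ((Z X n w)%:R `^ b : R)%:E)%E by move=> _; rewrite lee_fin powR_ge0.
have c0e : (0 <= c%:E)%E by rewrite lee_fin.
rewrite /Zb -(ge0_integralZl P mA mz z0 c0e) -integral_cst// -ge0_integralD//.
- by move=> w Aw; rewrite mule_ge0// z0.
- exact: measurable_funeM.
Qed.

Lemma Markov_le n A (phi : mark R -> nat -> nat -> \bar R) (g : nat -> R) : past X n A ->
  (forall e j z, 0 <= phi e j z)%E -> (forall j z, measurable_fun setT (fun e => phi e j z)) ->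
  (forall j, \int[P]_w' phi (env X 0 w') j (S X 0 j w') <= (g j)%:E)%E ->
  (\int[P]_(w in A) phi (env X n w) (Z X n w) (Z X n.+1 w) <= \int[P]_(w in A) (g (Z X n w))%:E)%E.
Proof.
move=> pA phi0 mphi H; rewrite (@Markov_step _ _ _ P X n A phi hX pA phi0 mphi).
have mA : measurable A by exact: past_measurable pA.
apply: ge0_le_integral => //.
- by move=> w _; apply: integral_ge0.
- apply: measurable_funTS.
  exact: (measurableT_comp (_ : measurable_fun setT (fun j => \int[P]_w' phi (env X 0 w') j (S X 0 j w'))%E) (measurable_Z X n)).
- by apply/measurable_EFinP; apply: measurable_funTS; exact: measurable_Z_fun.
Qed.

Lemma mean_D j : (\int[P]_w (`|D X j w| `^ alpha)%:E <= (C * (1 + j%:R `^ beta))%:E)%E.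
Proof. by have := hD j; rewrite unlock. Qed.

(** From state j the next size is M j + D(j). The first part multiplies j^b by almost E[M^b] < m,
    and D(j) contributes O(1 + j^beta), which is absorbed into a small multiple of j^b. *)
Lemma moment_step : exists k K, [/\ 1 < k, k < m, 0 <= K &
  forall n A, past X n A -> (Zb n.+1 A <= k%:E * Zb n A + K%:E * P A)%E].
Proof.
have m1 : 1 < m := mean_powR_gt1 hX halpha ht hM hlogM hmu hmu0.
pose t := b / alpha.
have t0 : 0 < t by rewrite divr_gt0.
have t1 : t < 1 by rewrite ltr_pdivrMr// mul1r.
pose k1 := t * m + (1 - t).
have k1E : k1 = 1 + t * (m - 1) by rewrite /k1; ring.
have tm0 : 0 < t * (m - 1) by rewrite mulr_gt0// subr_gt0.
have tm1 : t * (m - 1) < m - 1 by rewrite -[ltRHS]mul1r ltr_pM2r// subr_gt0.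
(* Midpoint between the bound [k1] on E[M^b] and m. *)
pose k := (k1 + m) / 2.
have k1_gt1 : 1 < k1 by lra.
have k1_gt0 : 0 < k1 by lra.
have kk1 : k1 < k by rewrite /k; lra.
have km : k < m by rewrite /k; lra.
(* The gap k - k1 is shared: [e1] raises k1 to the midpoint of k1 and k, and [e2] below lets the
   contribution of D take at most the other half. *)
pose e1 := (k - k1) / (2 * k1).
have e10 : 0 < e1 by rewrite divr_gt0 ?mulr_gt0//; lra.
have [K1 K10 hK1] := powR_add_le b0 e10.
have KC : 0 <= K1 * C by rewrite mulr_ge0.
pose e2 := (k - k1) / (2 * (K1 * C + 1)).
have e20 : 0 < e2 by rewrite divr_gt0//; lra.
have [K2 K20 hK2] := powR_absorb beta0 bb e20.
exists k, (K1 * (1 + C * (1 + K2))); split => //; first by lra.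
  by rewrite mulr_ge0// addr_ge0// mulr_ge0// addr_ge0.
move=> n A pA; rewrite -Zb_affine//; last 2 first.
- by lra.
- by rewrite mulr_ge0// addr_ge0// mulr_ge0// addr_ge0.
apply: (@Markov_le n A (fun _ _ z => (z%:R `^ b)%:E) (fun j => k * j%:R `^ b + K1 * (1 + C * (1 + K2))) pA).
- by move=> *; rewrite lee_fin powR_ge0.
- by [].
move=> j; set jb := j%:R `^ b; have jb0 : 0 <= jb by exact: powR_ge0.
have c10 : 0 <= (1 + e1) * jb by rewrite mulr_ge0// addr_ge0// ltW.
have mM : measurable_fun setT (fun w => (M X 0 w `^ b)%:E) by apply/measurable_EFinP; exact: measurable_M_powR.
have M0 w : setT w -> (0 <= (M X 0 w `^ b)%:E)%E by move=> _; rewrite lee_fin powR_ge0.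
have mD := measurable_D_powR X j alpha.
have D0 w : setT w -> (0 <= (`|D X j w| `^ alpha)%:E)%E by move=> _; rewrite lee_fin powR_ge0.
have c10e : (0 <= ((1 + e1) * jb)%:E)%E by rewrite lee_fin.
have K10e : (0 <= K1%:E)%E by rewrite lee_fin.
apply: (@le_trans _ _ (\int[P]_w (((1 + e1) * jb)%:E * (M X 0 w `^ b)%:E + (K1%:E + K1%:E * (`|D X j w| `^ alpha)%:E)))%E).
  apply: ge0_le_integral => //.
  - apply/measurable_EFinP; apply: (measurableT_comp (@measurable_powR R b)).
    exact: measurable_S_real.
  - apply: emeasurable_funD; first exact: measurable_funeM.
    by apply: emeasurable_funD => //; exact: measurable_funeM.
  - move=> w _; rewrite -!EFinM -!EFinD lee_fin.
    have Mj : 0 <= M X 0 w * j%:R by rewrite mulr_ge0// M_ge0.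
    apply: (@le_trans _ _ ((M X 0 w * j%:R + `|D X j w|) `^ b)).
      rewrite ge0_ler_powR ?nnegrE ?addr_ge0 ?(ltW b0)//.
      by have := ler_norm (D X j w); rewrite {1}D_S; lra.
    apply: (le_trans (hK1 _ _ Mj (normr_ge0 _))).
    rewrite powRM// ?M_ge0// -/jb.
    have := powR_le_max (normr_ge0 (D X j w)) b0 (ltW ba) => h.
    have := ler_wpM2l K10 h; lra.
have i1 : (\int[P]_w K1%:E = K1%:E)%E.
  by rewrite integral_cst//= [X in (_ * X)%E](@probability_setT _ _ _ P) mule1.
have mA1 : measurable_fun setT (fun w => ((1 + e1) * jb)%:E * (M X 0 w `^ b)%:E)%E by exact: measurable_funeM.
have mA2 : measurable_fun setT (fun w => K1%:E * (`|D X j w| `^ alpha)%:E)%E by exact: measurable_funeM.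
have A10 w : setT w -> (0 <= ((1 + e1) * jb)%:E * (M X 0 w `^ b)%:E)%E by move=> Tw; rewrite mule_ge0// M0.
have A20 w : setT w -> (0 <= K1%:E * (`|D X j w| `^ alpha)%:E)%E by move=> Tw; rewrite mule_ge0// D0.
have mA3 : measurable_fun setT (fun w => K1%:E + K1%:E * (`|D X j w| `^ alpha)%:E)%E by apply: emeasurable_funD.
have A30 w : setT w -> (0 <= K1%:E + K1%:E * (`|D X j w| `^ alpha)%:E)%E by move=> Tw; rewrite adde_ge0// A20.
rewrite (ge0_integralD P measurableT A10 mA1 A30 mA3).
rewrite (ge0_integralD P measurableT (fun _ _ => K10e) (measurable_cst _) A20 mA2) i1.
rewrite (ge0_integralZl P measurableT mM M0 c10e) (ge0_integralZl P measurableT mD D0 K10e).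
apply: (@le_trans _ _ ((((1 + e1) * jb)%:E * k1%:E + (K1%:E + K1%:E * (C * (1 + j%:R `^ beta))%:E)))%E).
  apply: leeD; first by apply: lee_wpmul2l => //; apply: mean_powR_b ht _ _.
  by apply: leeD => //; apply: lee_wpmul2l => //; exact: mean_D.
rewrite -!EFinM -!EFinD lee_fin.
have hj := hK2 j%:R (ler0n _ _); rewrite -/jb in hj.
have e1E : (1 + e1) * k1 = k1 + (k - k1) / 2 by rewrite /e1; field; rewrite gt_eqF.
have e2E : K1 * C * e2 <= (k - k1) / 2.
  have -> : (k - k1) / 2 = (K1 * C + 1) * e2 by rewrite /e2; field; rewrite gt_eqF// ltr_wpDl.
  by rewrite ler_wpM2r ?(ltW e20)// lerDl.
have h1 := ler_wpM2l KC hj.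
have h2 := ler_wpM2r jb0 e2E.
have -> : (1 + e1) * jb * k1 = (k1 + (k - k1) / 2) * jb by rewrite -e1E; ring.
lra.
Qed.

Lemma error_step : exists2 K, 0 <= K & forall n A, past X n A ->
  (\int[P]_(w in A) (`|(Z X n.+1 w)%:R - M X n w * (Z X n w)%:R| `^ alpha)%:E
    <= K%:E * Zb n A + K%:E * P A)%E.
Proof.
have [K2 K20 hK2] := powR_absorb beta0 bb (ltr01 : 0 < 1 :> R).
have K0 : 0 <= C * (1 + K2) by rewrite mulr_ge0// addr_ge0.
exists (C * (1 + K2)) => // n A pA; rewrite -Zb_affine//.
apply: (@Markov_le n A (fun e j z => (`|z%:R - markmean e * j%:R| `^ alpha)%:E) (fun j => C * (1 + K2) * j%:R `^ b + C * (1 + K2)) pA).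
- by move=> *; rewrite lee_fin powR_ge0.
- move=> j z; apply/measurable_EFinP; apply: (measurableT_comp (@measurable_powR R alpha)).
  apply: measurableT_comp => //; apply: measurable_funB => //; apply: measurable_funM => //.
  exact: measurable_markmean.
move=> j; under eq_integral do rewrite -ME -D_S.
apply: (le_trans (mean_D j)); rewrite lee_fin.
have := hK2 j%:R (ler0n _ _); rewrite mul1r => hj.
have jb0 : 0 <= j%:R `^ b :> R by exact: powR_ge0.
have h1 : C * j%:R `^ beta <= C * (j%:R `^ b + K2) by rewrite ler_wpM2l.
have h2 : 0 <= C * K2 * j%:R `^ b by rewrite !mulr_ge0.
lra.
Qed.

(** The alpha-th moment of the error Z_(n+i+1) - M Z_(n+i) is at most of the order of the b-th
    moment of Z_(n+i), which grows like k^i with k < m. *)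
Lemma moment_bounds : exists k K, [/\ 0 < k, k < m, 0 < K &
  forall n A i, past X n A ->
  (\int[P]_(w in A) (`|(Z X (n + i).+1 w)%:R - M X (n + i) w * (Z X (n + i) w)%:R| `^ alpha)%:E
    <= (K * k ^+ i)%:E * (P A + Zb n A))%E].
Proof.
have [k [K [k1 km K0 hK]]] := moment_step.
have [L L0 hL] := error_step.
have k0 : 0 < k by lra.
have K'0 : 0 <= K / (k - 1) by rewrite divr_ge0// subr_ge0 ltW.
exists k, (L * (1 + K / (k - 1)) + 1); split => //.
  by rewrite ltr_wpDl// mulr_ge0// addr_ge0.
move=> n A i pA.
have ki : 1 <= k ^+ i by rewrite exprn_ege1// ltW.
have L1 : 0 < L * (1 + K / (k - 1)) + 1 by rewrite ltr_wpDl// mulr_ge0// addr_ge0.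
have c0 : 0 < (L * (1 + K / (k - 1)) + 1) * k ^+ i by rewrite mulr_gt0// (lt_le_trans ltr01).
have mA : measurable A by exact: past_measurable pA.
pose p := fine (P A).
have pE : P A = p%:E by rewrite fineK// fin_num_measure.
have p0 : 0 <= p by exact: fine_ge0.
have := Zb_ge0 n A; case zE : (Zb n A) => [z| |//] z0; last first.
  by rewrite addey ?pE// gt0_muley ?leey// lte_fin.
have pAi l : past X (n + l) A by apply: past_le pA; rewrite leq_addr.
(* Exact solution of the affine recursion z -> k z + K p, with fixed point - K p / (k - 1). *)
have IH l : (Zb (n + l) A <= (k ^+ l * (z + K / (k - 1) * p) - K / (k - 1) * p)%:E)%E.
  elim: l => [|l IHl]; first by rewrite addn0 zE lee_fin expr0; lra.
  rewrite addnS; apply: (le_trans (hK _ _ (pAi l))).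
  apply: (@le_trans _ _ (k%:E * (k ^+ l * (z + K / (k - 1) * p) - K / (k - 1) * p)%:E + K%:E * P A)%E).
    by rewrite leeD2r// lee_wpmul2l// lee_fin ltW.
  rewrite pE -!EFinM -EFinD lee_fin exprS.
  rewrite le_eqVlt; apply/orP; left; apply/eqP; field.
  by rewrite subr_eq0 gt_eqF.
apply: (le_trans (hL _ _ (pAi i))).
apply: (@le_trans _ _ (L%:E * (k ^+ i * (z + K / (k - 1) * p) - K / (k - 1) * p)%:E + L%:E * P A)%E).
  by rewrite leeD2r// lee_wpmul2l// lee_fin.
rewrite pE -!EFinM -!EFinD -?EFinM lee_fin.
move: z0; rewrite lee_fin => z0.
set K' := K / (k - 1) in K'0 *; set q := k ^+ i in ki c0 *.
have h1 : L * (q * (z + K' * p)) <= L * (1 + K') * q * (p + z).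
  have -> : L * (1 + K') * q * (p + z) = L * (q * (z + K' * p)) + L * q * (p + K' * z) by ring.
  rewrite lerDl mulr_ge0//; first by rewrite mulr_ge0// (le_trans ler01).
  by rewrite addr_ge0// mulr_ge0.
have Lp : L * p <= L * q * p by rewrite -mulrA ler_wpM2l// ler_peMl.
have q0 : 0 <= q by exact: le_trans ki.
have e : L * (1 + K') * q * (p + z) = L * (q * (z + K' * p)) + L * q * p + L * q * K' * z by ring.
have n1 : 0 <= L * q * K' * z by do 3 (apply: mulr_ge0 => //).
have n2 : 0 <= q * (p + z) by rewrite mulr_ge0// addr_ge0.
have n3 : 0 <= L * K' * p by do 2 (apply: mulr_ge0 => //).
have -> : (L * (1 + K') + 1) * q * (p + z) = L * (1 + K') * q * (p + z) + q * (p + z) by ring.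
lra.
Qed.

End moment_growth.

(** Taking a-th roots turns the hypothesis into geometric increments of ratio s = q^(1/a); this
    works for a < 1 too, where the triangle inequality for a-norms fails. *)
Lemma seq_control (R : realType) (u : nat -> R) (a q b : R) : 0 < a -> 0 < q -> q < 1 -> 0 <= b ->
  (forall i, `|u i.+1 - u i| `^ a <= q ^+ i * b) ->
  exists2 l, u n @[n --> \oo] --> l &
    forall n, `|l - u n| `^ a <= (1 - q `^ a^-1)^-1 `^ a * (q ^+ n * b).
Proof.
move=> a0 q0 q1 b0 H; pose s := q `^ a^-1; pose b' := b `^ a^-1.
have an : a != 0 by rewrite gt_eqF.
have s0 : 0 < s by exact: powR_gt0.
have s1 : s < 1 by rewrite -[ltRHS](one_powR a^-1) gt0_ltr_powR ?nnegrE ?invr_gt0// ltW.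
have s1' : 0 < 1 - s by rewrite subr_gt0.
have b'0 : 0 <= b' by exact: powR_ge0.
have sa n : (s ^+ n) `^ a = q ^+ n.
  have sA : s `^ a = q by rewrite /s -powRrM mulVf// powRr1// ltW.
  by rewrite -(powR_mulrn n (ltW s0)) (powRAC s) sA powR_mulrn// ltW.
have ba : b' `^ a = b by rewrite /b' -powRrM mulVf// powRr1.
have step i : `|u i.+1 - u i| <= s ^+ i * b'.
  have h : (`|u i.+1 - u i| `^ a) `^ a^-1 <= (q ^+ i * b) `^ a^-1.
    by rewrite ge0_ler_powR ?nnegrE ?powR_ge0 ?invr_ge0 ?(ltW a0)// mulr_ge0// exprn_ge0// ltW.
  move: h; rewrite -powRrM mulfV// powRr1// powRM ?exprn_ge0 ?(ltW q0)//.
  by rewrite -/b' -(sa i) -powRrM mulfV// powRr1// exprn_ge0// ltW.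
have gap n k : `|u (n + k)%N - u n| <= s ^+ n * b' * ((1 - s ^+ k) / (1 - s)).
  elim: k => [|k IH]; first by rewrite addn0 subrr normr0 expr0 subrr mul0r mulr0.
  rewrite addnS (_ : u (n + k).+1 - u n = (u (n + k).+1 - u (n + k)%N) + (u (n + k)%N - u n)); last by ring.
  apply: (le_trans (ler_normD _ _)); apply: (le_trans (lerD (step _) IH)).
  rewrite exprD exprS le_eqVlt; apply/orP; left; apply/eqP; field.
  by rewrite gt_eqF.
have gap' n k : `|u (n + k)%N - u n| <= s ^+ n * b' / (1 - s).
  apply: (le_trans (gap n k)); rewrite ler_wpM2l ?mulr_ge0 ?exprn_ge0 ?(ltW s0)//.
  rewrite -[leRHS]mul1r ler_wpM2r ?invr_ge0 ?(ltW s1')//.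
  by rewrite gerBl exprn_ge0// ltW.
have cu : cvgn u.
  have -> : u = (fun n => u 0%N + series (telescope u) n) by apply/funext => n; exact: eq_sum_telescope.
  apply: is_cvgD; first exact: is_cvg_cst.
  apply: normed_cvg; apply: (@series_le_cvg _ _ (geometric b' s)).
  - by move=> n /=.
  - by move=> n /=; rewrite mulr_ge0// exprn_ge0// ltW.
  - by move=> n /=; rewrite /telescope mulrC; exact: step.
  - by apply: is_cvg_geometric_series; rewrite ger0_norm// ltW.
exists (limn u) => // n.
have h : `|limn u - u n| <= s ^+ n * b' / (1 - s).
  apply/ler_addgt0Pr => e e0.
  have : \forall k \near \oo, `|limn u - u k| <= e by move/cvgrPdist_le : cu; apply.
  move=> [N _ /(_ (n + N)%N (leq_addl _ _))] /= hN.
  rewrite (_ : limn u - u n = (u (n + N)%N - u n) + (limn u - u (n + N)%N)); last by ring.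
  by apply: (le_trans (ler_normD _ _)); apply: lerD.
apply: (@le_trans _ _ ((s ^+ n * b' / (1 - s)) `^ a)).
  rewrite ge0_ler_powR ?nnegrE ?(ltW a0)//.
  by rewrite !mulr_ge0 ?exprn_ge0 ?invr_ge0 ?(ltW s0) ?(ltW s1').
rewrite powRM ?mulr_ge0 ?exprn_ge0 ?invr_ge0 ?(ltW s0) ?(ltW s1')//.
by rewrite powRM ?exprn_ge0 ?(ltW s0)// sa ba mulrC.
Qed.

(** * Increments of the normalised process under the tilted law *)

Section martingale_limit.
Context d (T : measurableType d) (R : realType) (P : probability T R) (X : bprei_data T R).
Variables (alpha : R) (Pa : probability T R) (mu C beta : R).
Hypothesis hX : is_bprei P X.
Hypothesis halpha : 0 < alpha.
Hypothesis ht : is_tilted P X alpha Pa.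
Hypothesis hM : non_arithmetic P (fun w => ln (M X 0 w)).
Hypothesis hlogM : ('E_P[fun w => `|ln (M X 0 w)|%R] < +oo)%E.
Hypothesis hmu : ('E_P[fun w => ln (M X 0 w)] = mu%:E)%E.
Hypothesis hmu0 : 0 <= mu.
Hypothesis beta0 : 0 <= beta.
Hypothesis beta_lt : beta < alpha.
Hypothesis hD : forall k : nat, ('E_P[fun w => (`|D X k w| `^ alpha)%R] <= (C * (1 + k%:R `^ beta))%:E)%E.
Local Notation lam := (rLambda P X alpha).
Local Notation m := (expR lam).
Local Notation b := (bexp alpha beta).
Local Notation U k := (g_sigma_algebraType (past_gen X k)).
Local Notation Zb := (Zb P X alpha beta).
Local Notation err k w := ((Z X k.+1 w)%:R - M X k w * (Z X k w)%:R).

Definition Vn n w : R := (Z X n w)%:R / Pi X n w.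

Lemma Vn_ge0 n w : 0 <= Vn n w.
Proof. by rewrite divr_ge0// Pi_ge0. Qed.

Lemma past_Vn k n : (n <= k)%N -> measurable_fun setT (Vn n : U k -> R).
Proof.
move=> nk; apply: measurable_funM.
  have h := measurableT_comp (_ : measurable_fun setT (fun j : nat => j%:R : R)) (@past_Z_fun _ _ _ X k n nk).
  by apply: h.
have h := measurableT_comp (@measurable_invr R) (@past_Pik _ _ _ X k 0 n nk); exact h.
Qed.

Lemma measurable_Vn n : measurable_fun setT (Vn n).
Proof. have h := past_fun_measurable (past_Vn (leqnn n)); exact h. Qed.

Lemma measurable_err k : measurable_fun setT (fun w => err k w).
Proof.
apply: measurable_funB; first exact: (measurable_Z_fun X k.+1 (fun j => j%:R)).
by apply: measurable_funM; [exact: measurable_M|exact: (measurable_Z_fun X k (fun j => j%:R))].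
Qed.

Lemma measurable_powabs (f : T -> R) : measurable_fun setT f ->
  measurable_fun setT (fun w => (`|f w| `^ alpha)%:E).
Proof.
move=> mf; apply/measurable_EFinP; apply: (measurableT_comp (@measurable_powR R alpha)).
exact: measurableT_comp.
Qed.

Lemma powabs_ge0 (x : R) : (0 <= (`|x| `^ alpha)%:E)%E.
Proof. by rewrite lee_fin powR_ge0. Qed.

(** The factor Pi_(k+1)^alpha of the density clears the denominators and leaves the error Z_(k+1) -
    M_k Z_k. Where Pi_(k+1) = 0 the left integrand vanishes with the density, whence an
    inequality. *)
Lemma tilt_increment k A : past X k A ->
  (\int[Pa]_(w in A) (`|Vn k.+1 w - Vn k w| `^ alpha)%:E <=
   (expR (- (k.+1%:R * lam)))%:E * \int[P]_(w in A) (`|err k w| `^ alpha)%:E)%E.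
Proof.
move=> pA; have mA : measurable A by exact: past_measurable pA.
have pA1 : past X k.+1 A by exact: past_le pA.
have mW1 : measurable_fun setT (fun w => `|Vn k.+1 w - Vn k w| `^ alpha : R).
  apply: (measurableT_comp (@measurable_powR R alpha)); apply: measurableT_comp => //.
  by apply: measurable_funB; exact: measurable_Vn.
rewrite (integral_indic_mul Pa A).
rewrite (@tilt_fun _ _ _ P X alpha Pa k.+1 _ hX ht); last 2 first.
- by move=> w; rewrite mule_ge0 ?powabs_ge0 ?lee_fin.
- apply: emeasurable_funM; apply/measurable_EFinP; last exact: (@measurable_indic _ (U k.+1) R setT A).
  have mV : measurable_fun setT ((fun w => `|Vn k.+1 w - Vn k w|) : U k.+1 -> R).
    apply: (@measurableT_comp _ _ _ _ _ _ (@Num.norm R R)) => //.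
    by apply: measurable_funB; exact: past_Vn.
  have h := measurableT_comp (@measurable_powR R alpha) mV; exact h.
have mE : measurable_fun A (fun w => (`|err k w| `^ alpha)%:E).
  by apply: measurable_funTS; apply: measurable_powabs; exact: measurable_err.
have c0 : (0 <= (expR (- (k.+1%:R * lam)))%:E)%E by rewrite lee_fin expR_ge0.
rewrite -(ge0_integralZl P mA mE (fun w _ => powabs_ge0 (err k w)) c0) (integral_indic_mul P A).
have mI : measurable_fun setT (fun w => (\1_A w : R)%:E) by apply/measurable_EFinP.
apply: ge0_le_integral => //.
- by move=> w _; rewrite mule_ge0 ?mule_ge0 ?powabs_ge0 ?lee_fin ?W_ge0.
- apply: emeasurable_funM; last by apply/measurable_EFinP; exact: measurable_W.
  by apply: emeasurable_funM => //; exact/measurable_EFinP.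
- apply: emeasurable_funM => //; apply: measurable_funeM.
  by apply: measurable_powabs; exact: measurable_err.
move=> w _; rewrite -!EFinM lee_fin mulrAC; apply: ler_wpM2r; first by [].
rewrite /W mulrA mulrC; apply: ler_wpM2l; first exact: expR_ge0.
have := Pi_ge0 X k.+1 w; rewrite le_eqVlt => /predU1P[<-|Pp].
  by rewrite powR0 ?gt_eqF// mulr0 powR_ge0.
rewrite -powRM ?(ltW Pp)// -[X in _ * X](ger0_norm (ltW Pp)) -normrM.
have PS : Pi X k.+1 w = Pi X k w * M X k w by rewrite /Pi big_ord_recr.
have Pk : Pi X k w != 0 by apply/eqP => e; rewrite PS e mul0r ltxx in Pp.
have Mk : M X k w != 0 by apply/eqP => e; rewrite PS e mulr0 ltxx in Pp.
rewrite /Vn PS (_ : (_ / _ - _ / _) * _ = err k w)//; field.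
by rewrite Pk.
Qed.

(** Increments decay like (k/m)^i. With q = sqrt(k/m) this is q^i q^i: one factor pays for the
    weight q^(-i), which gives pathwise control later, the other makes the series converge. *)
Lemma increment_bounds : exists q K, [/\ 0 < q, q < 1, 0 < K &
  forall n A, past X n A ->
  (\int[Pa]_(w in A) \sum_(i <oo) (q ^- i * `|Vn (n + i).+1 w - Vn (n + i) w| `^ alpha)%:E
    <= (K * expR (- (n%:R * lam)))%:E * (P A + Zb n A))%E] /\
  forall n, (\int[P]_w (`|err n w| `^ alpha)%:E <= (K * (q ^+ n * q ^+ n) * expR (n.+1%:R * lam))%:E * (1 + Zb 0 setT))%E.
Proof.
have m1 : 1 < m := mean_powR_gt1 hX halpha ht hM hlogM hmu hmu0.
have [k [K [k0 km K0 hK]]] := moment_bounds hX halpha ht hM hlogM hmu hmu0 beta0 beta_lt hD.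
have m0 : 0 < m by exact: expR_gt0.
pose q := Num.sqrt (k / m).
have r0 : 0 < k / m by rewrite divr_gt0.
have q0 : 0 < q by rewrite sqrtr_gt0.
have qq : q * q = k / m by rewrite -expr2 sqr_sqrtr// ltW.
have q1 : q < 1.
  rewrite -(@ltr_pXn2r _ 2%N)// ?nnegrE ?(ltW q0)// expr1n expr2 qq.
  by rewrite ltr_pdivrMr// mul1r.
have q1' : 0 < 1 - q by rewrite subr_gt0.
have emn n : expR (- (n%:R * lam)) = m ^- n by rewrite expRN expRM_natl.
have KK : K <= K / (1 - q) by rewrite ler_pdivlMr// mulrBr mulr1 gerBl mulr_ge0// ltW.
exists q, (K / (1 - q)); split; last first.
  move=> n; have pT : past X 0 setT by exact: (@measurableT _ (U 0)).
  have := hK 0%N setT n pT; rewrite !add0n (_ : P setT = 1%E); last exact: probability_setT.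
  move=> /le_trans; apply; apply: lee_wpmul2r.
    by apply: adde_ge0; [rewrite lee_fin|exact: Zb_ge0].
  rewrite lee_fin.
  rewrite -exprMn qq expRM_natl exprMn -mulrA.
  have -> : k ^+ n * m^-1 ^+ n * m ^+ n.+1 = k ^+ n * m.
    by rewrite exprS exprVn; field; rewrite expf_neq0 ?gt_eqF.
  apply: ler_pM => //; rewrite ?(ltW K0) ?exprn_ge0 ?(ltW k0)//.
  by rewrite ler_peMr ?exprn_ge0 ?(ltW k0)// ltW.
split => //; first by rewrite divr_gt0.
move=> n A pA; have mA : measurable A by exact: past_measurable pA.
have mi i : measurable_fun A (fun w => (`|Vn (n + i).+1 w - Vn (n + i) w| `^ alpha)%:E).
  apply: measurable_funTS; apply: measurable_powabs.
  by apply: measurable_funB; exact: measurable_Vn.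
have qi i : (0 <= (q ^- i)%:E)%E by rewrite lee_fin invr_ge0 exprn_ge0// ltW.
under eq_integral do under eq_eseriesr do rewrite EFinM.
rewrite integral_nneseries//; last 2 first.
- by move=> i; apply: measurable_funeM.
- by move=> i w _; rewrite mule_ge0 ?powabs_ge0.
have PZ0 : (0 <= P A + Zb n A)%E by rewrite adde_ge0 ?Zb_ge0.
have [fz|nf] := boolP ((P A + Zb n A)%E \is a fin_num); last first.
  have -> : (P A + Zb n A = +oo)%E by move: PZ0 nf; case: (P A + Zb n A)%E.
  by rewrite gt0_muley ?leey// lte_fin mulr_gt0 ?divr_gt0 ?expR_gt0.
apply: (@le_trans _ _ (\sum_(i <oo) ((K * m ^- n)%:E * (P A + Zb n A)) * (q ^+ i)%:E)%E).
  apply: lee_nneseries => [i _ _|i _].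
    by rewrite integral_ge0// => w _; rewrite mule_ge0 ?powabs_ge0.
  rewrite (ge0_integralZl Pa mA (mi i) (fun w _ => powabs_ge0 _) (qi i)).
  have pAi : past X (n + i) A by apply: past_le pA; rewrite leq_addr.
  apply: (@le_trans _ _ ((q ^- i)%:E * ((expR (- ((n + i).+1%:R * lam)))%:E * ((K * k ^+ i)%:E * (P A + Zb n A))))%E).
    apply: lee_wpmul2l => //; apply: (le_trans (tilt_increment pAi)).
    by apply: lee_wpmul2l; [rewrite lee_fin expR_ge0|exact: hK].
  rewrite !muleA -!EFinM [leRHS]muleAC -EFinM; apply: lee_wpmul2r => //.
  rewrite lee_fin emn exprS exprD.
  have mn : m ^+ n != 0 by rewrite expf_neq0 ?gt_eqF.
  have mi' : m ^+ i != 0 by rewrite expf_neq0 ?gt_eqF.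
  have qi' : q ^+ i != 0 by rewrite expf_neq0 ?gt_eqF.
  have -> : k ^+ i = q ^+ i * q ^+ i * m ^+ i.
    by rewrite -exprMn qq -exprMn divfK// gt_eqF.
  have -> : q ^- i * (m * (m ^+ n * m ^+ i))^-1 * (K * (q ^+ i * q ^+ i * m ^+ i)) =
    K * m ^- n * q ^+ i / m by field; rewrite mn mi' qi' gt_eqF.
  rewrite ler_pdivrMr// ler_peMr ?(ltW m1)//.
  by rewrite !mulr_ge0 ?invr_ge0 ?exprn_ge0 ?(ltW K0) ?(ltW m0) ?(ltW q0).
rewrite -(fineK fz) -EFinM nneseriesZl; last by move=> i _; rewrite lee_fin exprn_ge0// ltW.
have -> : (\sum_(i <oo) (q ^+ i)%:E = ((1 - q)^-1)%:E)%E.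
  have := @cvg_geometric_series R 1 q; rewrite ger0_norm ?(ltW q0)// => /(_ q1) h.
  apply: cvg_lim => //.
  rewrite (_ : (fun n => \sum_(0 <= i < n) (q ^+ i)%:E)%E = EFin \o series (geometric 1 q)).
    by rewrite div1r in h; exact: (cvg_comp _ _ h).
  by apply/funext => N /=; rewrite sumEFin; congr EFin; apply: eq_bigr => i _; rewrite /geometric/= mul1r.
rewrite -!EFinM lee_fin emn.
by rewrite le_eqVlt; apply/orP; left; apply/eqP; ring.
Qed.

End martingale_limit.

(** * Existence of the limit *)

Section limit.
Context d (T : measurableType d) (R : realType) (P : probability T R) (X : bprei_data T R).
Variables (alpha : R) (Pa : probability T R) (mu C beta : R).
Hypothesis hX : is_bprei P X.
Hypothesis halpha : 0 < alpha.
Hypothesis ht : is_tilted P X alpha Pa.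
Hypothesis hM : non_arithmetic P (fun w => ln (M X 0 w)).
Hypothesis hlogM : ('E_P[fun w => `|ln (M X 0 w)|%R] < +oo)%E.
Hypothesis hmu : ('E_P[fun w => ln (M X 0 w)] = mu%:E)%E.
Hypothesis hmu0 : 0 <= mu.
Hypothesis beta0 : 0 <= beta.
Hypothesis beta_lt : beta < alpha.
Hypothesis hD : forall k : nat, ('E_P[fun w => (`|D X k w| `^ alpha)%R] <= (C * (1 + k%:R `^ beta))%:E)%E.
Hypothesis hZ0 : ('E_P[fun w => ((Z0 X w)%:R `^ alpha)%R] < +oo)%E.
Local Notation lam := (rLambda P X alpha).
Local Notation m := (expR lam).
Local Notation b := (bexp alpha beta).
Local Notation U k := (g_sigma_algebraType (past_gen X k)).
Local Notation Zb := (Zb P X alpha beta).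
Local Notation Vn := (Vn X).
Local Notation err k w := ((Z X k.+1 w)%:R - M X k w * (Z X k w)%:R).

Lemma Zb0_fin : (Zb 0 setT < +oo)%E.
Proof.
have b0 : 0 < b by exact: b_gt0.
have mZ a : measurable_fun setT (fun w => ((Z X 0 w)%:R `^ a : R)%:E).
  by apply/measurable_EFinP; exact: (measurable_Z_fun X 0 (fun j => j%:R `^ a)).
apply: (@le_lt_trans _ _ (\int[P]_w (1%:E + ((Z X 0 w)%:R `^ alpha)%:E))%E).
  apply: ge0_le_integral => //.
  - by apply: emeasurable_funD.
  - by move=> w _; rewrite -EFinD lee_fin; apply: powR_le_max => //; apply: ltW; exact: b_lt.
rewrite (ge0_integralD P measurableT (f1 := fun=> 1%:E)) //.
by rewrite integral_one lte_add_pinfty ?ltry//; move: hZ0; rewrite unlock.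
Qed.

(** The density cancels the denominator Pi_n^alpha wherever Pi_n > 0, that is, almost surely under
    [P]. *)
Lemma tilt_Vn n A : past X n A ->
  (\int[Pa]_(w in A) (Vn n w `^ alpha)%:E = (expR (- (n%:R * lam)))%:E * \int[P]_(w in A) ((Z X n w)%:R `^ alpha)%:E)%E.
Proof.
move=> pA; have mA : measurable A by exact: past_measurable pA.
have mVp : measurable_fun setT (fun w => (Vn n w `^ alpha)%:E).
  by apply/measurable_EFinP; apply: (measurableT_comp (@measurable_powR R alpha)); exact: measurable_Vn.
have mZp : measurable_fun setT (fun w => ((Z X n w)%:R `^ alpha : R)%:E).
  by apply/measurable_EFinP; exact: (measurable_Z_fun X n (fun j => j%:R `^ alpha)).
have mI : measurable_fun setT (fun w => (\1_A w : R)%:E) by apply/measurable_EFinP.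
have c0 : (0 <= (expR (- (n%:R * lam)))%:E)%E by rewrite lee_fin expR_ge0.
have z0 w : A w -> (0 <= ((Z X n w)%:R `^ alpha : R)%:E)%E by move=> _; rewrite lee_fin powR_ge0.
rewrite -(ge0_integralZl P mA (measurable_funTS mZp) z0 c0).
rewrite (integral_indic_mul Pa A) (integral_indic_mul P A).
rewrite (@tilt_fun _ _ _ P X alpha Pa n _ hX ht); last 2 first.
- by move=> w; rewrite mule_ge0 ?lee_fin ?powR_ge0.
- apply: emeasurable_funM; apply/measurable_EFinP; last exact: (@measurable_indic _ (U n) R setT A).
  have h := measurableT_comp (@measurable_powR R alpha) (@past_Vn _ _ _ X n n (leqnn n)); exact h.
apply: ae_eq_integral => //.
- apply: emeasurable_funM; last by apply/measurable_EFinP; exact: measurable_W.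
  exact: emeasurable_funM.
- by apply: emeasurable_funM => //; exact: measurable_funeM.
apply: filterS (M_gt0 hX) => w Mw _.
have Pp : 0 < Pi X n w by apply: prodr_gt0 => i _; exact: Mw.
rewrite -!EFinM; congr EFin; rewrite /W /Vn powRM ?invr_ge0 ?(ltW Pp)//.
have -> : (Pi X n w)^-1 `^ alpha = (Pi X n w `^ alpha)^-1 by rewrite -powR_inv1 ?(ltW Pp)// powRAC powR_inv1 ?powR_ge0.
by field; rewrite gt_eqF// powR_gt0.
Qed.

(** The weighted series of increments has finite mean under [Pa], hence is almost surely finite;
    [seq_control] then applies path by path and yields at once the limit, its rate and an integrable
    majorant. Restarting the series at time [n] on a past event gives the localised bound. *)
Lemma limit_exists : exists V : T -> R, [/\ measurable_fun setT V, forall w, 0 <= V w,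
  {ae Pa, forall w, Vn n w @[n --> \oo] --> V w}
  & exists q K, [/\ [/\ 0 < q, q < 1 & 0 < K],
   forall n A, past X n A -> (\int[Pa]_(w in A) (`|V w - Vn n w| `^ alpha)%:E <=
      (K * expR (- (n%:R * lam)))%:E * (P A + Zb n A))%E,
   exists g : T -> \bar R, [/\ measurable_fun setT g, forall w, (0 <= g w)%E, (\int[Pa]_w g w < +oo)%E &
     {ae Pa, forall w, forall n, (`|V w - Vn n w| `^ alpha)%:E <= (q ^+ n)%:E * g w}%E]
   & forall n, (\int[P]_w (`|err n w| `^ alpha)%:E <= (K * (q ^+ n * q ^+ n) * expR (n.+1%:R * lam))%:E)%E]].
Proof.
have [q [K [[q0 q1 K0 hK] hE]]] := increment_bounds hX halpha ht hM hlogM hmu hmu0 beta0 beta_lt hD.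
(* A version measurable and nonnegative on the whole space; [VE] identifies it with the limit
   wherever the sequence converges. *)
pose V w := `|fine (limn_esup (fun n => (Vn n w)%:E))|.
have mV : measurable_fun setT V.
  do 2 apply: measurableT_comp => //.
  by apply: measurable_fun_limn_esup => n; apply/measurable_EFinP; exact: measurable_Vn.
have VE w l : Vn n w @[n --> \oo] --> l -> V w = l.
  move=> h; have l0 : 0 <= l.
    rewrite leNgt; apply/negP => ln; have [n _ /(_ n (leqnn n))] := cvgr_lt l h 0 ln.
    by rewrite /= ltNge Vn_ge0.
  have h' : (Vn n w)%:E @[n --> \oo] --> l%:E by apply: cvg_EFin => //; near=> n.
  rewrite /V is_cvg_limn_esupE; last by apply/cvg_ex; exists l%:E.
  by rewrite (cvg_lim _ h')//= ger0_norm.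
(* Each term being at most the sum, |V_(n+i+1) - V_(n+i)|^alpha <= q^i B n, the hypothesis of
   [seq_control]. *)
pose B n w := (\sum_(i <oo) (q ^- i * `|Vn (n + i).+1 w - Vn (n + i) w| `^ alpha)%:E)%E.
have t0 n w i : (0 <= (q ^- i * `|Vn (n + i).+1 w - Vn (n + i) w| `^ alpha)%:E)%E.
  by rewrite lee_fin mulr_ge0 ?powR_ge0// invr_ge0 exprn_ge0// ltW.
have B0 n w : (0 <= B n w)%E by apply: nneseries_ge0 => i _ _; exact: t0.
have mB n : measurable_fun setT (B n).
  apply: (@ge0_emeasurable_sum _ _ _ _ (fun i w => (q ^- i * `|Vn (n + i).+1 w - Vn (n + i) w| `^ alpha)%:E) predT) => [i w _ _|i _]; first exact: t0.
  apply/measurable_EFinP; apply: measurable_funM => //.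
  apply: (measurableT_comp (@measurable_powR R alpha)); apply: measurableT_comp => //.
  by apply: measurable_funB; exact: measurable_Vn.
pose Ck := (1 - q `^ alpha^-1)^-1 `^ alpha.
have Ck0 : 0 <= Ck by exact: powR_ge0.
have ctrl n w : (B n w < +oo)%E -> exists2 l, Vn (n + j) w @[j --> \oo] --> l &
    forall j, `|l - Vn (n + j) w| `^ alpha <= Ck * (q ^+ j * fine (B n w)).
  move=> fB; apply: seq_control => //; first exact: fine_ge0.
  move=> i; rewrite addnS -ler_pdivrMl ?exprn_gt0// -lee_fin fineK ?ge0_fin_numE//.
  apply: le_trans (nneseries_lim_ge i.+1 (fun i _ _ => t0 n w i)).
  by rewrite big_nat_recr//= leeDr// sume_ge0.
have pT : past X 0 setT by exact: (@measurableT _ (U 0)).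
have PT1 : P setT = 1%E by exact: probability_setT.
have fZ : (1 + Zb 0 setT)%E \is a fin_num.
  have Zp : (0 <= 1 + Zb 0 setT)%E by apply: adde_ge0; [rewrite lee_fin|exact: Zb_ge0].
  by rewrite (ge0_fin_numE Zp); apply: lte_add_pinfty; [exact: ltry|exact: Zb0_fin].
pose z := fine (1 + Zb 0 setT)%E.
have zE : (1 + Zb 0 setT = z%:E)%E by rewrite fineK.
have z1 : 1 <= z by rewrite -lee_fin -zE leeDl// Zb_ge0.
have IB : (\int[Pa]_w B 0%N w < +oo)%E.
  by have := hK 0%N setT pT => /le_lt_trans; apply; rewrite PT1 zE -EFinM ltry.
have iB : Pa.-integrable setT (B 0%N).
  apply/integrableP; split; first exact: mB.
  by under eq_integral do rewrite gee0_abs//.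
have aeB : {ae Pa, forall w, (B 0%N w < +oo)%E}.
  apply: filterS (integrable_ae measurableT iB) => w /(_ Logic.I).
  by rewrite ge0_fin_numE.
have aeV : {ae Pa, forall w, Vn n w @[n --> \oo] --> V w}.
  apply: filterS aeB => w /ctrl[l h _]; under eq_fun do rewrite -[n in Vn n](add0n).
  by rewrite (VE w l).
(* Only nonnegativity of [Ck] is recorded, so adding [B n w] makes the right-hand side infinite
   wherever the series diverges. *)
have bnd n w j : Vn n w @[n --> \oo] --> V w -> ((`|V w - Vn (n + j) w| `^ alpha)%:E <= (q ^+ j)%:E * (Ck%:E * B n w + B n w))%E.
  move=> h; have [fB|] := ltP (B n w) +oo%E; last first.
    rewrite leye_eq => /eqP ->; rewrite addey; last by rewrite gt_eqF// (lt_le_trans (ltNyr 0))// mule_ge0// lee_fin.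
    by rewrite gt0_muley ?leey// lte_fin exprn_gt0.
  have [l hl H] := ctrl n w fB.
  have lV : l = V w.
    have h2 : Vn (n + j) w @[j --> \oo] --> V w.
      by rewrite (_ : (fun j => Vn (n + j) w) = (fun j => Vn (j + n) w)); [rewrite (cvg_shiftn n (fun k => Vn k w))|apply/funext => j'; rewrite addnC].
    by rewrite -(cvg_lim (@Rhausdorff R) hl) (cvg_lim (@Rhausdorff R) h2).
  rewrite lV in H; have := H j.
  have bE : B n w = (fine (B n w))%:E by rewrite fineK// ge0_fin_numE.
  have f0 : 0 <= fine (B n w) by exact: fine_ge0.
  move=> Hj; rewrite bE; apply: (@le_trans _ _ (q ^+ j * (Ck * fine (B n w) + fine (B n w)))%:E); last by [].
  rewrite lee_fin; apply: (le_trans Hj).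
  have qj : 0 <= q ^+ j by rewrite exprn_ge0// ltW.
  have : 0 <= q ^+ j * fine (B n w) by rewrite mulr_ge0.
  lra.
exists V; split; [exact: mV|by move=> w; exact: normr_ge0|exact: aeV|].
exists q, ((Ck + 1) * K * z); split.
- by split => //; rewrite !mulr_gt0 ?(lt_le_trans ltr01 z1)// ltr_wpDl.
- move=> n A pA; have mA : measurable A by exact: past_measurable pA.
  have Ck1 : (0 <= (Ck + 1)%:E)%E by rewrite lee_fin addr_ge0.
  have mBA : measurable_fun A (B n) by apply: measurable_funTS.
  apply: (@le_trans _ _ (\int[Pa]_(w in A) ((Ck + 1)%:E * B n w))%E).
    apply: ae_ge0_le_integral => //.
    - apply: measurable_funTS; apply: measurable_powabs; apply: measurable_funB => //.
      exact: measurable_Vn.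
    - by move=> w _; rewrite mule_ge0.
    - exact: measurable_funeM.
    - apply: filterS aeV => w h _; have := bnd n w 0%N h.
      by rewrite addn0 expr0 mul1e EFinD ge0_muleDl ?lee_fin// mul1e.
  rewrite (ge0_integralZl Pa mA mBA (fun w _ => B0 n w) Ck1).
  apply: (le_trans (lee_wpmul2l Ck1 (hK n A pA))).
  rewrite muleA -EFinM; apply: lee_wpmul2r; first by apply: adde_ge0 => //; exact: Zb_ge0.
  rewrite lee_fin mulrA [leRHS]mulrAC; apply: ler_peMr => //.
  by rewrite !mulr_ge0 ?expR_ge0 ?(ltW K0)// addr_ge0.
- exists (fun w => Ck%:E * B 0%N w + B 0%N w)%E; split.
  + by apply: emeasurable_funD => //; exact: measurable_funeM.
  + by move=> w; rewrite adde_ge0// mule_ge0// lee_fin.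
  + have Cke : (0 <= Ck%:E)%E by rewrite lee_fin.
    rewrite (ge0_integralD Pa measurableT (f1 := fun w => (Ck%:E * B 0%N w)%E)) //.
    * rewrite (ge0_integralZl Pa measurableT (mB 0%N) (fun w _ => B0 0%N w) Cke).
      have := IB; have : (0 <= \int[Pa]_w B 0%N w)%E by apply: integral_ge0.
      by case: (\int[Pa]_w B 0%N w)%E => [r|//|//] _ _; rewrite -EFinM -EFinD ltry.
    * by move=> w _; rewrite mule_ge0.
    * exact: measurable_funeM.
  + by apply: filterS aeV => w h n; exact: (bnd 0%N w n h).
- move=> n; apply: (le_trans (hE n)); rewrite zE -EFinM lee_fin.
  have H : 0 <= K * (q ^+ n * q ^+ n) * expR (n.+1%:R * lam) * z.
    by rewrite !mulr_ge0 ?expR_ge0 ?exprn_ge0 ?(ltW K0) ?(ltW q0)// (le_trans ler01).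
  have H2 : 0 <= Ck * (K * (q ^+ n * q ^+ n) * expR (n.+1%:R * lam) * z) by rewrite mulr_ge0.
  lra.
Unshelve. all: end_near. Qed.

End limit.

(** * Positivity and moments of the limit *)

Section consequences.
Context d (T : measurableType d) (R : realType) (P : probability T R) (X : bprei_data T R).
Variables (alpha : R) (Pa : probability T R) (mu C beta : R).
Hypothesis hX : is_bprei P X.
Hypothesis halpha : 0 < alpha.
Hypothesis ht : is_tilted P X alpha Pa.
Hypothesis hM : non_arithmetic P (fun w => ln (M X 0 w)).
Hypothesis hlogM : ('E_P[fun w => `|ln (M X 0 w)|%R] < +oo)%E.
Hypothesis hmu : ('E_P[fun w => ln (M X 0 w)] = mu%:E)%E.
Hypothesis hmu0 : 0 <= mu.
Hypothesis beta0 : 0 <= beta.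
Hypothesis beta_lt : beta < alpha.
Hypothesis hD : forall k : nat, ('E_P[fun w => (`|D X k w| `^ alpha)%R] <= (C * (1 + k%:R `^ beta))%:E)%E.
Hypothesis hZ0 : ('E_P[fun w => ((Z0 X w)%:R `^ alpha)%R] < +oo)%E.
Hypothesis hpos : (0 < P [set w | (0 < Z0 X w)%N] + P [set w | (0 < immig X 1 w)%N])%E.
Local Notation lam := (rLambda P X alpha).
Local Notation b := (bexp alpha beta).
Local Notation U k := (g_sigma_algebraType (past_gen X k)).
Local Notation Zb := (Zb P X alpha beta).
Local Notation Vn := (Vn X).
Local Notation err k w := ((Z X k.+1 w)%:R - M X k w * (Z X k w)%:R).

(** If V vanished almost surely, the localised bound on {Z_n = j} would read j^alpha <= K (1 + j^b),
    after cancelling the density factor and the positive probability of the event. Large j are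
    reached by [Z_unbounded], and there this fails. *)
Lemma limit_pos (V : T -> R) (K : R) : measurable_fun setT V -> (forall w, 0 <= V w) -> 0 < K ->
  (forall n A, past X n A -> (\int[Pa]_(w in A) (`|V w - Vn n w| `^ alpha)%:E <=
      (K * expR (- (n%:R * lam)))%:E * (P A + Zb n A))%E) ->
  (0 < Pa [set w | 0 < V w]%R)%E.
Proof.
move=> mV V0 K0 H; rewrite lt0e measure_ge0 andbT; apply/eqP => PV.
have mVp : measurable [set w | 0 < V w].
  rewrite (_ : [set w | 0 < V w] = V @^-1` `]0%R, +oo[); first exact: measurable_preimage.
  by apply/seteqP; split => w /=; rewrite in_itv/= andbT.
have aeV0 : {ae Pa, forall w, V w = 0}.
  exists [set w | 0 < V w]; split => // w /= Vw; rewrite lt0r V0 andbT.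
  by apply/eqP.
have b_gt : 0 < b by exact: b_gt0.
(* With this constant, K j^b is at most j^alpha / 2 plus K K1, so the false inequality would give
   j^alpha <= c; [j] is then taken with j^alpha >= c + 1. *)
have e0 : 0 < (2 * K)^-1 by rewrite invr_gt0 mulr_gt0.
have [K1 K10 hK1] := powR_absorb (ltW b_gt) (b_lt beta_lt) e0.
pose c := 2 * K * (1 + K1); have c0 : 0 <= c by rewrite !mulr_ge0 ?addr_ge0 ?(ltW K0).
have [n [j [Jj PA]]] := Z_unbounded hX (offspring_ge2 hX halpha ht hM hlogM hmu hmu0) hpos (Num.Def.archi_bound ((c + 1) `^ alpha^-1)).
have jc : c + 1 <= j%:R `^ alpha.
  have -> : c + 1 = ((c + 1) `^ alpha^-1) `^ alpha by rewrite -powRrM mulVf ?gt_eqF// powRr1// addr_ge0.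
  rewrite ge0_ler_powR ?nnegrE ?powR_ge0 ?(ltW halpha)//.
  apply: (@le_trans _ _ (Num.Def.archi_bound ((c + 1) `^ alpha^-1))%:R); last by rewrite ler_nat.
  by apply: ltW; apply: archi_boundP; exact: powR_ge0.
pose A := Z X n @^-1` [set j].
have pA : past X n A by exact: past_Z.
have mA : measurable A by exact: past_measurable pA.
pose p := fine (P A); have pE : P A = p%:E by rewrite fineK// fin_num_measure.
have p0 : 0 < p by rewrite -lte_fin -pE.
have cstZ a : (\int[P]_(w in A) ((Z X n w)%:R `^ a)%:E = (j%:R `^ a * p)%:E)%E.
  transitivity (\int[P]_(w in A) (j%:R `^ a)%:E)%E; last first.
    by transitivity ((j%:R `^ a)%:E * P A)%E; [exact: integral_cst|rewrite pE -EFinM].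
  by apply: eq_integral => w /set_mem; rewrite /A/= => ->.
have := H n A pA.
have -> : (\int[Pa]_(w in A) (`|V w - Vn n w| `^ alpha)%:E = \int[Pa]_(w in A) (Vn n w `^ alpha)%:E)%E.
  apply: ae_eq_integral => //.
  - by apply: measurable_funTS; apply: measurable_powabs; apply: measurable_funB => //; exact: measurable_Vn.
  - apply/measurable_EFinP; apply: measurable_funTS; apply: (measurableT_comp (@measurable_powR R alpha)).
    exact: measurable_Vn.
  - by apply: filterS aeV0 => w -> _; rewrite sub0r normrN ger0_norm ?Vn_ge0.
rewrite (tilt_Vn hX ht pA) cstZ /Zb cstZ pE -EFinD -!EFinM lee_fin.
set e := expR _; have ep : 0 < e by exact: expR_gt0.
have -> : K * e * (p + j%:R `^ b * p) = e * (K * (1 + j%:R `^ b) * p) by ring.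
rewrite ler_pM2l// ler_pM2r// => h.
have h2 := ler_wpM2l (ltW K0) (hK1 j%:R (ler0n _ _)).
have h3 : K * ((2 * K)^-1 * j%:R `^ alpha) = j%:R `^ alpha / 2 by field; rewrite gt_eqF.
rewrite /c in jc; lra.
Qed.

(** The pathwise rate q^n g gives convergence in mean of order alpha, and [g] also dominates all
    V_n^alpha; dominated convergence identifies the limit of their means, which [tilt_Vn] turns into
    moments of Z_n under [P]. *)
Lemma limit_properties : exists V : T -> R, [/\ measurable_fun setT V, forall w, 0 <= V w,
  {ae Pa, forall w, Vn n w @[n --> \oo] --> V w}, (0 < Pa [set w | 0 < V w]%R)%E
  & [/\ (forall n, (\int[Pa]_w (`|Vn n w| `^ alpha)%:E < +oo)%E),
        ((0 < \int[Pa]_w (V w `^ alpha)%:E < +oo)%E),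
        (\int[Pa]_w (`|Vn n w - V w| `^ alpha)%:E @[n --> \oo] --> 0)%E,
        ((expR (- (n%:R * lam)))%:E * \int[P]_w ((Z X n w)%:R `^ alpha)%:E @[n --> \oo] --> \int[Pa]_w (V w `^ alpha)%:E)%E
      & exists q K, [/\ 0 < q, q < 1, 0 < K & forall n, (\int[P]_w (`|err n w| `^ alpha)%:E <= (K * (q ^+ n * q ^+ n) * expR (n.+1%:R * lam))%:E)%E]]].
Proof.
have [V [mV V0 aeV [q [K [[q0 q1 K0] hK [g [mg g0 Ig aeg]] hE]]]]] :=
  limit_exists hX halpha ht hM hlogM hmu hmu0 beta0 beta_lt hD hZ0.
exists V; split => //; first exact: limit_pos mV V0 K0 hK.
have PV := limit_pos mV V0 K0 hK.
have mVa : measurable_fun setT (fun w => (V w `^ alpha)%:E).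
  by apply/measurable_EFinP; exact: (measurableT_comp (@measurable_powR R alpha) mV).
have mVna n : measurable_fun setT (fun w => (Vn n w `^ alpha)%:E).
  by apply/measurable_EFinP; apply: (measurableT_comp (@measurable_powR R alpha)); exact: measurable_Vn.
have Vna0 n w : (0 <= (Vn n w `^ alpha)%:E)%E by rewrite lee_fin powR_ge0.
have [K1' K10' hK1'] := powR_add_le halpha (ltr01 : 0 < 1 :> R).
pose K1 := K1' + 1; have K1p : 0 < K1 by rewrite /K1; lra.
have K10 : 0 <= K1 by exact: ltW.
have hK1 x y : 0 <= x -> 0 <= y -> (x + y) `^ alpha <= 2 * x `^ alpha + K1 * y `^ alpha.
  move=> x0 y0; apply: (le_trans (hK1' _ _ x0 y0)); rewrite /K1 mulrDl mul1r.
  by have := powR_ge0 y alpha; lra.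
(* V is compared with V_0, then V_n with V, each time by (x + y)^alpha <= 2 x^alpha + K1 y^alpha:
   this gives 4 V_0^alpha, and 2 K1 + K1 times [g]. *)
pose G w := (4%:E * (Vn 0 w `^ alpha)%:E + (3 * K1)%:E * g w)%E.
have K1e : (0 <= (3 * K1)%:E)%E by rewrite lee_fin mulr_ge0.
have f4 : (0 <= 4%:E :> \bar R)%E by rewrite lee_fin.
have G0 w : (0 <= G w)%E by rewrite adde_ge0// mule_ge0.
have mG : measurable_fun setT G by apply: emeasurable_funD; exact: measurable_funeM.
have pT : past X 0 setT by exact: (@measurableT _ (U 0)).
have IV0 : (\int[Pa]_w (Vn 0 w `^ alpha)%:E < +oo)%E.
  rewrite (tilt_Vn hX ht pT) mul0r oppr0 expR0 mul1e.
  by move: hZ0; rewrite unlock.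
have IG : (\int[Pa]_w G w < +oo)%E.
  rewrite (ge0_integralD Pa measurableT (f1 := fun w => (4%:E * (Vn 0 w `^ alpha)%:E)%E)) //.
  - rewrite (ge0_integralZl Pa measurableT (mVna 0%N) (fun w _ => Vna0 0%N w) f4).
    rewrite (ge0_integralZl Pa measurableT mg (fun w _ => g0 w) K1e).
    have : (0 <= \int[Pa]_w g w)%E by apply: integral_ge0.
    have : (0 <= \int[Pa]_w (Vn 0 w `^ alpha)%:E)%E by apply: integral_ge0.
    move: Ig IV0; case: (\int[Pa]_w g w)%E => [r|//|//] _; case: (integral _ _ _) => [s|//|//] _ _ _.
    by rewrite -!EFinM -EFinD ltry.
  - by move=> w _; rewrite mule_ge0.
  - exact: measurable_funeM.
  - by move=> w _; rewrite mule_ge0.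
  - exact: measurable_funeM.
have iG : Pa.-integrable setT G.
  by apply/integrableP; split => //; under eq_integral do rewrite gee0_abs//.
have qn n : q ^+ n <= 1 by rewrite exprn_ile1// ltW.
have dom : {ae Pa, forall w, forall n, setT w -> (`|(Vn n w `^ alpha)%:E| <= G w)%E}.
  apply: filterS aeg => w hg n _; rewrite gee0_abs//.
  have hg' k : ((`|V w - Vn k w| `^ alpha)%:E <= g w)%E.
    apply: (le_trans (hg k)); rewrite -[leRHS]mul1e; apply: lee_wpmul2r => //.
    by rewrite lee_fin.
  pose dk k := `|V w - Vn k w| `^ alpha.
  have h1 : V w `^ alpha <= 2 * Vn 0 w `^ alpha + K1 * dk 0%N.
    apply: le_trans (hK1 _ _ (Vn_ge0 X 0 w) (normr_ge0 (V w - Vn 0 w))).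
    rewrite ge0_ler_powR ?nnegrE ?addr_ge0 ?Vn_ge0 ?(ltW halpha)//.
    by have := ler_norm (V w - Vn 0 w); lra.
  have h2 : Vn n w `^ alpha <= 2 * V w `^ alpha + K1 * dk n.
    apply: le_trans (hK1 _ _ (V0 w) (normr_ge0 (V w - Vn n w))).
    rewrite ge0_ler_powR ?nnegrE ?addr_ge0 ?Vn_ge0 ?(ltW halpha)//.
    by rewrite -normrN opprB; have := ler_norm (Vn n w - V w); lra.
  have gw := g0 w; rewrite /G; move: (hg' 0%N) (hg' n); rewrite -/(dk 0%N) -/(dk n).
  case: (g w) gw => [r| |//] _; last first.
    move=> _ _; have -> : ((3 * K1)%:E * +oo = +oo)%E by rewrite gt0_muley// lte_fin mulr_gt0.
    by rewrite -EFinM addey// leey.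
  rewrite lee_fin => r0; rewrite lee_fin => rn.
  apply: (@le_trans _ _ (4 * Vn 0 w `^ alpha + 3 * K1 * r)%:E); last by [].
  rewrite lee_fin.
  have := ler_wpM2l K10 r0; have := ler_wpM2l K10 rn; lra.
have cva : {ae Pa, forall w, setT w -> (Vn n w `^ alpha)%:E @[n --> \oo] --> (V w `^ alpha)%:E}.
  apply: filterS aeV => w h _; apply: cvg_EFin; first by near=> n.
  by apply: cvg_powR => // n; exact: Vn_ge0.
have [iV _ lim] := dominated_convergence measurableT mVna mVa cva iG dom.
have IVfin : (\int[Pa]_w (V w `^ alpha)%:E < +oo)%E.
  move/integrableP : iV => [_]; under eq_integral do rewrite gee0_abs ?lee_fin ?powR_ge0//.
  by [].
split.
- move=> n; under eq_integral do rewrite ger0_norm ?Vn_ge0//.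
  apply: le_lt_trans IG; apply: ae_ge0_le_integral => //.
  by apply: filterS dom => w /(_ n Logic.I) + _; rewrite gee0_abs.
- rewrite IVfin andbT; apply: (integral_gt0 mVa) => [w|]; first by rewrite lee_fin powR_ge0.
  apply: (lt_le_trans PV); apply: le_measure; rewrite ?inE.
  + rewrite (_ : [set w | 0 < V w] = V @^-1` `]0%R, +oo[); first exact: measurable_preimage.
    by apply/seteqP; split => w /=; rewrite in_itv/= andbT.
  + by rewrite -[X in measurable X]setTI; exact: emeasurable_fun_o_infty.
  + by move=> w /= Vw; rewrite lte_fin powR_gt0.
- have Igf : (\int[Pa]_w g w)%E \is a fin_num by rewrite ge0_fin_numE//; apply: integral_ge0.
  apply: (@squeeze_cvge _ _ _ _ (fun=> 0%E) _ (fun n => (q ^+ n)%:E * \int[Pa]_w g w)%E).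
  + near=> n; apply/andP; split; first by apply: integral_ge0 => w _; exact: powabs_ge0.
    have qe : (0 <= (q ^+ n)%:E)%E by rewrite lee_fin exprn_ge0// ltW.
    rewrite -(ge0_integralZl Pa measurableT mg (fun w _ => g0 w) qe).
    apply: ae_ge0_le_integral => //.
    * by apply: measurable_powabs; apply: measurable_funB => //; exact: measurable_Vn.
    * by move=> w _; rewrite mule_ge0.
    * exact: measurable_funeM.
    * by apply: filterS aeg => w /(_ n) + _; rewrite distrC.
  + exact: cvg_cst.
  + rewrite -(fineK Igf) -(mul0e (fine (\int[Pa]_w g w)%E)%:E).
    apply: cvgeZr => //; apply: cvg_EFin; first by near=> n.
    by apply: cvg_expr; rewrite ger0_norm// ltW.
- apply: cvg_trans lim; apply: near_eq_cvg; near=> n => /=.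
  have pTn : past X n setT by exact: (@measurableT _ (U n)).
  by rewrite (tilt_Vn hX ht pTn).
- by exists q, K.
Unshelve. all: end_near. Qed.

End consequences.

(** * Tails of products of means *)

Section large_deviations.
Context d (T : measurableType d) (R : realType) (P : probability T R) (X : bprei_data T R).
Variables (alpha : R) (Pa : probability T R) (rho Kn : R).
Hypothesis hX : is_bprei P X.
Hypothesis halpha : 0 < alpha.
Hypothesis ht : is_tilted P X alpha Pa.
Local Notation lam := (rLambda P X alpha).
Local Notation I := (alpha * rho - lam).
Local Notation U k := (g_sigma_algebraType (past_gen X k)).
Local Notation err k w := ((Z X k.+1 w)%:R - M X k w * (Z X k w)%:R).
Local Notation N := (Nn Pa (walk X rho) alpha).
Hypothesis Kn0 : 0 <= Kn.
Hypothesis hKn : forall n x, (N n x <= Kn%:E)%E.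

Definition tail l x : \bar R := P [set w | expR (rho * l%:R + x) < Pi X l w].

Let mgt (f : T -> R) c : measurable_fun setT f -> measurable [set w | c < f w].
Proof.
move=> mf; rewrite (_ : [set w | c < f w] = f @^-1` `]c, +oo[); first exact: measurable_preimage.
by apply/seteqP; split => w /=; rewrite in_itv/= andbT.
Qed.

Lemma ln_Pi l w : 0 < Pi X l w -> ln (Pi X l w) = walk X rho l w + l%:R * rho.
Proof.
elim: l => [|l IH]; first by rewrite /Pi /walk !big_ord0 ln1 mul0r addr0.
have PS : Pi X l.+1 w = Pi X l w * M X l w by rewrite /Pi big_ord_recr.
rewrite PS => Pp; have Pl : 0 < Pi X l w.
  by rewrite lt0r Pi_ge0 andbT; apply/eqP => e; rewrite e mul0r ltxx in Pp.
have Ml : 0 < M X l w.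
  by rewrite lt0r M_ge0 andbT; apply/eqP => e; rewrite e mulr0 ltxx in Pp.
rewrite lnM ?posrE// IH// /walk big_ord_recr/= -natr1; ring.
Qed.

(** Inverting the density on {Pi_l > exp(rho l + x)}, where ln Pi_l = S_l + rho l, leaves exp(-
    alpha S_l) on {S_l > x}; extracting exp(- alpha x) produces [expo]. *)
Lemma tail_base l x : ((expR (l%:R * I))%:E * tail l x =
  (expR (- (alpha * x)))%:E * \int[Pa]_w (expo alpha (walk X rho l w - x))%:E)%E.
Proof.
have mexW : measurable_fun setT (fun w => (expo alpha (walk X rho l w - x))%:E).
  apply/measurable_EFinP; apply: (measurableT_comp (measurable_expo alpha)).
  by apply: measurable_funB => //; exact: measurable_walk.
have mE : measurable [set w | expR (rho * l%:R + x) < Pi X l w] by apply: mgt; exact: measurable_Pi.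
rewrite (@tilt_fun _ _ _ P X alpha Pa l _ hX ht); last 2 first.
- by move=> w; rewrite lee_fin expo_ge0.
- apply/measurable_EFinP.
  have mw : measurable_fun setT ((fun w => walk X rho l w - x) : U l -> R).
    by apply: measurable_funB => //; exact: past_walk.
  have h := measurableT_comp (measurable_expo alpha) mw; exact h.
have mF : measurable_fun setT (fun w => (expo alpha (walk X rho l w - x))%:E * (W X alpha lam l w)%:E)%E.
  by apply: emeasurable_funM => //; apply/measurable_EFinP; exact: measurable_W.
have F0 w : setT w -> (0 <= (expo alpha (walk X rho l w - x))%:E * (W X alpha lam l w)%:E)%E.
  by move=> _; rewrite -EFinM lee_fin mulr_ge0 ?expo_ge0 ?W_ge0.
have c0 : (0 <= (expR (- (alpha * x)))%:E)%E by rewrite lee_fin expR_ge0.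
have c1 : (0 <= (expR (l%:R * I))%:E)%E by rewrite lee_fin expR_ge0.
rewrite -(ge0_integralZl P measurableT mF F0 c0).
rewrite /tail -[X in P X]setIT -integral_indic//.
rewrite -(ge0_integralZl P measurableT _ _ c1); last 2 first.
- by apply/measurable_EFinP.
- by move=> w _; rewrite lee_fin.
apply: eq_integral => w _; rewrite -!EFinM; congr EFin.
have := Pi_ge0 X l w; rewrite le_eqVlt => /predU1P[P0|Pp].
  rewrite /W -P0 powR0 ?gt_eqF// mul0r !mulr0 indicE memNset ?mulr0//=.
  by rewrite -P0 ltNge expR_ge0.
have lnE := ln_Pi Pp.
have PE : Pi X l w = expR (ln (Pi X l w)) by rewrite lnK.
rewrite /expo /W /powR (gt_eqF Pp) lnE indicE.
have eqv : (expR (rho * l%:R + x) < Pi X l w) = (0 < walk X rho l w - x).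
  by rewrite PE ltr_expR lnE -subr_gt0; congr (0 < _); ring.
case: ifP => h.
  rewrite mem_set ?mulr1; last by rewrite /= eqv.
  rewrite -!expRD; congr expR; ring.
by rewrite memNset ?mul0r ?mulr0//= eqv h.
Qed.

Lemma tail_Nn l x : ((Num.sqrt l%:R * expR (l%:R * I))%:E * tail l x = (expR (- (alpha * x)))%:E * N l x)%E.
Proof. by rewrite EFinM -muleA tail_base /Nn muleCA. Qed.

Lemma maxn1_gt0 l : 0 < (maxn l 1)%:R :> R.
Proof. by rewrite ltr0n leq_max orbT. Qed.

(** For l > 0 this is the uniform bound on [Nn]. At l = 0 the factor sqrt l is lost, whence
    [maxn l 1], and [expo] <= 1 serves instead, whence the extra 1 in Kn + 1. *)
Lemma tail_bound l x : (tail l x <= ((Kn + 1) * expR (- (l%:R * I)) / Num.sqrt (maxn l 1)%:R * expR (- (alpha * x)))%:E)%E.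
Proof.
have s0 : 0 < Num.sqrt (maxn l 1)%:R :> R by rewrite sqrtr_gt0 maxn1_gt0.
have key : ((Num.sqrt (maxn l 1)%:R * expR (l%:R * I))%:E * tail l x <= ((Kn + 1) * expR (- (alpha * x)))%:E)%E.
  case: l s0 => [|l] s0.
    have -> : Num.sqrt (maxn 0 1)%:R = 1 :> R by rewrite sqrtr1.
    rewrite mul1r tail_base (mulrC (Kn + 1)) EFinM; apply: lee_wpmul2l; first by rewrite lee_fin expR_ge0.
    apply: (@le_trans _ _ (\int[Pa]_w (1 : R)%:E)%E).
      apply: ge0_le_integral => //.
      - by move=> w _; rewrite lee_fin expo_ge0.
      - apply/measurable_EFinP; apply: (measurableT_comp (measurable_expo alpha)).
        by apply: measurable_funB => //; exact: measurable_walk.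
      - by move=> w _; rewrite lee_fin expo_le1.
    by rewrite integral_one lee_fin lerDr.
  have -> : maxn l.+1 1 = l.+1 by rewrite (maxn_idPl _).
  rewrite tail_Nn (mulrC (Kn + 1)) EFinM; apply: lee_wpmul2l; first by rewrite lee_fin expR_ge0.
  by apply: (le_trans (hKn _ _)); rewrite lee_fin lerDl.
have tE : tail l x = (fine (tail l x))%:E by rewrite fineK// fin_num_measure//; apply: mgt; exact: measurable_Pi.
move: key; rewrite tE -EFinM !lee_fin => key.
have e0 : 0 < expR (l%:R * I) by exact: expR_gt0.
have -> : (Kn + 1) * expR (- (l%:R * I)) / Num.sqrt (maxn l 1)%:R * expR (- (alpha * x)) =
    (Kn + 1) * expR (- (alpha * x)) / (Num.sqrt (maxn l 1)%:R * expR (l%:R * I)).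
  by rewrite (expRN (l%:R * I)); field; rewrite !gt_eqF.
by rewrite ler_pdivlMr ?mulr_gt0// mulrC.
Qed.

(** Independence of the product from the past allows [Y] to be frozen; a positive factor Y shifts
    the threshold by ln Y, and Y = 0 never exceeds it. *)
Lemma prod_tail k l (Y : T -> R) x : measurable_fun setT (Y : U k -> R) -> (forall w, 0 <= Y w) ->
  measurable_fun setT (fun w => if (0 < Y w)%R then tail l (x - ln (Y w)) else 0%E) /\
  (P [set w | (expR (rho * l%:R + x) < Y w * Pik X k l w)%R] =
   \int[P]_w (if (0 < Y w)%R then tail l (x - ln (Y w))%R else 0))%E.
Proof.
move=> mY Y0; set c := expR _; have c0 : 0 < c by exact: expR_gt0.
have mY' := past_fun_measurable mY.
pose F (z : R * R) : \bar R := (\1_[set z : R * R | c < z.1 * z.2] z)%:E.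
have mset : measurable [set z : R * R | c < z.1 * z.2].
  have mm : measurable_fun setT (fun z : R * R => z.1 * z.2) by apply: measurable_funM; [exact: measurable_fst|exact: measurable_snd].
  rewrite (_ : [set _ | _] = (fun z : R * R => z.1 * z.2) @^-1` `]c, +oo[); first exact: measurable_preimage.
  by apply/seteqP; split => w /=; rewrite in_itv/= andbT.
have mF : measurable_fun setT F by apply/measurable_EFinP.
have F0 z : (0 <= F z)%E by rewrite lee_fin.
have := past_Pik_tonelli l hX mY F0 mF.
have mYP : measurable [set w | c < Y w * Pik X k l w].
  by apply: mgt; apply: measurable_funM => //; exact: measurable_Pik.
rewrite (_ : (\int[P]_w F (Y w, Pik X k l w) = P [set w | (c < Y w * Pik X k l w)%R])%E); last first.
  transitivity (\int[P]_w (\1_[set w | c < Y w * Pik X k l w] w)%:E)%E; last by rewrite integral_indic// setIT.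
  apply: eq_integral => w _; rewrite /F !indicE.
  by case: (boolP (c < Y w * Pik X k l w)) => h; [rewrite !mem_set|rewrite !memNset//=; exact/negP].
move=> ->.
have mP' y : measurable [set w' | c < y * Pi X l w'].
  by apply: mgt; apply: measurable_funM => //; exact: measurable_Pi.
have E w : (\int[P]_w' F (Y w, Pi X l w') = if (0 < Y w)%R then tail l (x - ln (Y w))%R else 0)%E.
  have -> : (\int[P]_w' F (Y w, Pi X l w') = P [set w' | (c < Y w * Pi X l w')%R])%E.
    transitivity (\int[P]_w' (\1_[set w' | c < Y w * Pi X l w'] w')%:E)%E; last by rewrite integral_indic// setIT.
    apply: eq_integral => w' _; rewrite /F !indicE.
    by case: (boolP (c < Y w * Pi X l w')) => h; [rewrite !mem_set|rewrite !memNset//=; exact/negP].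
  have := Y0 w; rewrite le_eqVlt => /predU1P[<-|Yp].
    rewrite ltxx (_ : [set _ | _] = set0) ?measure0//.
    by apply/seteqP; split => w' //=; rewrite mul0r ltNge ltW.
  have eqv p : (c < Y w * p) = (expR (rho * l%:R + (x - ln (Y w))) < p).
    by rewrite addrA expRD expRN lnK ?posrE// ltr_pdivrMr// [p * _]mulrC.
  by rewrite Yp /tail; congr (P _); apply/seteqP; split => w' /=; rewrite eqv.
split; last by apply: eq_integral => w _; exact: E.
rewrite -(funext E); apply: (measurableT_comp (_ : measurable_fun setT (fun y => \int[P]_w' F (y, Pi X l w'))%E) mY').
apply: (@measurable_fun_fubini_tonelli_F _ _ _ _ R P (fun z : R * T => F (z.1, Pi X l z.2))).
- apply: (measurableT_comp mF); apply: measurable_fun_pair; first exact: measurable_fst.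
  exact: (measurableT_comp (measurable_Pi X l) measurable_snd).
- by move=> z; exact: F0.
Qed.

(** The shift of the threshold by ln Y multiplies the exponential tail bound by Y^alpha, so that
    only the alpha-th moment of Y matters. *)
Lemma prod_tail_bound k l (Y : T -> R) x : measurable_fun setT (Y : U k -> R) -> (forall w, 0 <= Y w) ->
  (P [set w | (expR (rho * l%:R + x) < Y w * Pik X k l w)%R] <=
   ((Kn + 1) * expR (- (l%:R * I)) / Num.sqrt (maxn l 1)%:R * expR (- (alpha * x)))%:E * \int[P]_w (Y w `^ alpha)%:E)%E.
Proof.
move=> mY Y0; have mY' := past_fun_measurable mY; have [mT ->] := prod_tail l x mY Y0.
set c := (Kn + 1) * _ / _; have c0 : 0 <= c by rewrite !mulr_ge0 ?invr_ge0 ?sqrtr_ge0 ?expR_ge0 ?addr_ge0.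
have ce : (0 <= (c * expR (- (alpha * x)))%:E)%E by rewrite lee_fin mulr_ge0 ?expR_ge0.
have mYa : measurable_fun setT (fun w => (Y w `^ alpha)%:E).
  by apply/measurable_EFinP; exact: (measurableT_comp (@measurable_powR R alpha) mY').
have Ya0 w : setT w -> (0 <= (Y w `^ alpha)%:E)%E by move=> _; rewrite lee_fin powR_ge0.
rewrite -(ge0_integralZl P measurableT mYa Ya0 ce).
apply: ge0_le_integral => //.
- by move=> w _; case: ifP => // _; exact: measure_ge0.
- exact: measurable_funeM.
move=> w _; case: ifP => Yp; last by apply: mule_ge0 => //; exact: Ya0.
apply: (le_trans (tail_bound _ _)); rewrite -EFinM lee_fin.
have -> : c * expR (- (alpha * x)) * Y w `^ alpha = c * (expR (- (alpha * x)) * Y w `^ alpha) by ring.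
apply: (ler_wpM2l c0).
rewrite /powR gt_eqF// -expRD ler_expR le_eqVlt; apply/orP; left; apply/eqP; ring.
Qed.

End large_deviations.

(** Telescoping: the error of generation m + i is carried to time m + n by the remaining means. *)
Lemma increment_decomp d (T : measurableType d) (R : realType) (X : bprei_data T R) m n w : (Z X (m + n) w)%:R - (Z X m w)%:R * Pik X m n w =
  \sum_(i < n) ((Z X (m + i).+1 w)%:R - M X (m + i) w * (Z X (m + i) w)%:R) * Pik X (m + i).+1 (n - i.+1) w :> R.
Proof.
elim: n => [|n IH]; first by rewrite addn0 big_ord0 /Pik big_ord0 mulr1 subrr.
have PS k l : Pik X k l.+1 w = Pik X k l w * M X (k + l) w by rewrite /Pik big_ord_recr.
have P0 k : Pik X k 0 w = 1 by rewrite /Pik big_ord0.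
rewrite big_ord_recr/= subnn P0 mulr1 PS addnS.
rewrite (eq_bigr (fun i : 'I_n => ((Z X (m + i).+1 w)%:R - M X (m + i) w * (Z X (m + i) w)%:R) * Pik X (m + i).+1 (n - i.+1) w * M X (m + n) w)); last first.
  move=> i _; rewrite subSn ?ltn_ord// PS -mulrA; congr (_ * (_ * M X _ w)).
  by have := ltn_ord i; lia.
by rewrite -big_distrl/= -IH; ring.
Qed.

(** With p = sqrt q one factor p^j absorbs the linear term. The linear term will arise from a ratio
    of square roots of times. *)
Lemma linear_geometric_bound (R : realType) (q : R) : 0 < q -> q < 1 -> exists c p : R,
  [/\ 0 <= c, 0 < p, p < 1 & forall j : nat, (j%:R + 2) * q ^+ j <= c * p ^+ j].
Proof.
move=> q0 q1; pose p := Num.sqrt q; have p0 : 0 < p by rewrite sqrtr_gt0.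
have pp : p * p = q by rewrite -expr2 sqr_sqrtr// ltW.
have p1 : p < 1 by rewrite -(@ltr_pXn2r _ 2%N)// ?nnegrE ?(ltW p0)// expr1n expr2 pp.
pose h := - ln p; have h0 : 0 < h by rewrite /h oppr_gt0 ln_lt0// p0.
have pj j : p ^+ j = expR (- (j%:R * h)) by rewrite /h mulrN opprK expRM_natl lnK.
exists (h^-1 + 2), p; split => //; first by rewrite addr_ge0// invr_ge0 ltW.
move=> j; rewrite -pp exprMn mulrA ler_wpM2r ?exprn_ge0 ?(ltW p0)// pj expRN.
rewrite ler_pdivrMr ?expR_gt0//.
have e := expR_ge1Dx (j%:R * h); have j0 : 0 <= j%:R :> R by exact: ler0n.
have jh : 0 <= j%:R * h by rewrite mulr_ge0// ltW.
have i0 : 0 <= h^-1 + 2 by rewrite addr_ge0// invr_ge0 ltW.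
apply: (@le_trans _ _ ((h^-1 + 2) * (1 + j%:R * h))); last by rewrite ler_wpM2l.
have -> : (h^-1 + 2) * (1 + j%:R * h) = h^-1 + j%:R + 2 + 2 * (j%:R * h) by field; rewrite gt_eqF.
have i1 : 0 < h^-1 by rewrite invr_gt0.
lra.
Qed.

Lemma cvg_ext (R : realType) (u v : nat -> R) (l : R) : (forall n, u n = v n) ->
  v n @[n --> \oo] --> l -> u n @[n --> \oo] --> l.
Proof. by move=> /funext ->. Qed.

Lemma square_bound k l a : (l <= a)%N -> (1 <= a)%N -> (k.+1 + l <= (k + 2) ^ 2 * a)%N.
Proof. by move=> la a1; nia. Qed.

(** * Error of freezing at generation m, and the main term *)

Section error_estimate.
Context d (T : measurableType d) (R : realType) (P : probability T R) (X : bprei_data T R).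
Variables (alpha : R) (Pa : probability T R) (rho Kn q Ke L : R).
Hypothesis hX : is_bprei P X.
Hypothesis halpha : 0 < alpha.
Hypothesis ht : is_tilted P X alpha Pa.
Local Notation lam := (rLambda P X alpha).
Local Notation I := (alpha * rho - lam).
Local Notation U k := (g_sigma_algebraType (past_gen X k)).
Local Notation err k w := ((Z X k.+1 w)%:R - M X k w * (Z X k w)%:R).
Local Notation N := (Nn Pa (walk X rho) alpha).
Hypothesis Kn0 : 0 <= Kn.
Hypothesis hKn : forall n x, (N n x <= Kn%:E)%E.
Hypothesis q0 : 0 < q.
Hypothesis q1 : q < 1.
Hypothesis Ke0 : 0 < Ke.
Hypothesis hKe : forall n, (\int[P]_w (`|err n w| `^ alpha)%:E <= (Ke * (q ^+ n * q ^+ n) * expR (n.+1%:R * lam))%:E)%E.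
Hypothesis L0 : 0 <= L.
Hypothesis hL : forall x, fine (N n x) @[n --> \oo] --> L.

Let mgt (f : T -> R) c : measurable_fun setT f -> measurable [set w | c < f w].
Proof.
move=> mf; rewrite (_ : [set w | c < f w] = f @^-1` `]c, +oo[); first exact: measurable_preimage.
by apply/seteqP; split => w /=; rewrite in_itv/= andbT.
Qed.

Definition gap m n w : R := (Z X (m + n) w)%:R - (Z X m w)%:R * Pik X m n w.

Lemma measurable_gap m n : measurable_fun setT (fun w => `|gap m n w|).
Proof.
apply: measurableT_comp => //; apply: measurable_funB; first exact: (measurable_Z_fun X (m + n) (fun j => j%:R)).
by apply: measurable_funM; [exact: (measurable_Z_fun X m (fun j => j%:R))|exact: measurable_Pik].
Qed.

Lemma past_err k : measurable_fun setT ((fun w => `|err k w|) : U k.+1 -> R).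
Proof.
have mZ i : (i <= k.+1)%N -> measurable_fun setT ((fun w => (Z X i w)%:R : R) : U k.+1 -> R).
  move=> ik; have h := measurableT_comp (_ : measurable_fun setT (fun j : nat => j%:R : R)) (@past_Z_fun _ _ _ X k.+1 i ik).
  by apply: h.
apply: (@measurableT_comp _ _ _ _ _ _ (@Num.norm R R)) => //.
apply: measurable_funB; first exact: mZ.
by apply: measurable_funM; [exact: past_M|exact: mZ].
Qed.

(** Union bound over the terms of [increment_decomp], each given a geometric share of the threshold.
    The price q^(-i) of the share is paid by the factor q^(2(m+i)) in the error moments, which
    leaves a sum over i bounded uniformly in n times q^m. *)
Lemma error_estimate y : exists2 E, 0 <= E & forall m n dl, 0 < dl ->
  Num.sqrt (m + n)%:R * expR ((m + n)%:R * I) *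
    fine (P [set w | dl * expR (rho * (m + n)%:R + y) < `|gap m n w|]) <= E * dl `^ (- alpha) * q ^+ m.
Proof.
have [c [p [c0 p0 p1 cp]]] := linear_geometric_bound q0 q1.
pose s := q `^ alpha^-1.
have s0 : 0 < s by exact: powR_gt0.
have s1 : s < 1 by rewrite -[ltRHS](one_powR alpha^-1) gt0_ltr_powR ?nnegrE ?invr_gt0// ltW.
have sE : s `^ alpha = q by rewrite /s -powRrM mulVf ?gt_eqF// powRr1// ltW.
have s1' : 0 < 1 - s by rewrite subr_gt0.
pose E0 := (Kn + 1) * Ke * expR (- (alpha * y)) * (1 - s) `^ (- alpha).
have E00 : 0 <= E0 by rewrite !mulr_ge0 ?expR_ge0 ?powR_ge0 ?addr_ge0 ?(ltW Ke0).
have p1' : 0 < 1 - p by rewrite subr_gt0.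
exists (E0 * (c / (1 - p))); first by rewrite mulr_ge0// divr_ge0// ltW.
move=> m n dl d0; set t := expR (rho * (m + n)%:R + y).
have t0 : 0 < t by exact: expR_gt0.
(* The shares sum to less than 1, so a large total forces some term above its share; raised to the
   power alpha, s^i becomes q^i. *)
pose wt i := (1 - s) * s ^+ i.
have wt0 i : 0 < wt i by rewrite mulr_gt0// exprn_gt0.
have wt_sum k : \sum_(i < k) wt i = 1 - s ^+ k.
  elim: k => [|k IH]; first by rewrite big_ord0 expr0 subrr.
  by rewrite big_ord_recr/= IH /wt exprS; ring.
pose A i := [set w | dl * wt i * t < `|err (m + i) w| * Pik X (m + i).+1 (n - i.+1) w].
have mA i : measurable (A i).
  apply: mgt; apply: measurable_funM; last exact: measurable_Pik.
  exact: past_fun_measurable (@past_err (m + i)).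
have mgap : measurable [set w | dl * t < `|gap m n w|] by apply: mgt; exact: measurable_gap.
have sub : [set w | dl * t < `|gap m n w|] `<=` \big[setU/set0]_(i < n) A i.
  move=> w /= gw; rewrite -bigcup_mkord; apply: contrapT => nA.
  have le1 (i : 'I_n) : `|err (m + i) w * Pik X (m + i).+1 (n - i.+1) w| <= dl * wt i * t.
    rewrite normrM (ger0_norm (Pik_ge0 _ _ _ _)) leNgt; apply/negP => H.
    by apply: nA; exists (i : nat); [exact: (ltn_ord i)|exact: H].
  move: gw; rewrite ltNge => /negP; apply; rewrite /gap increment_decomp.
  apply: (le_trans (ler_norm_sum _ _ _)).
  apply: (@le_trans _ _ (\sum_(i < n) dl * wt i * t)); first by apply: ler_sum => i _; exact: le1.
  rewrite -big_distrl/= -big_distrr/= wt_sum ler_wpM2r ?(ltW t0)//.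
  by rewrite ler_piMr ?(ltW d0)// gerBl exprn_ge0// ltW.
pose nI := Num.sqrt (m + n)%:R * expR ((m + n)%:R * I).
have nI0 : 0 <= nI by rewrite mulr_ge0 ?sqrtr_ge0 ?expR_ge0.
have EE : 0 <= E0 * dl `^ (- alpha) * q ^+ m.
  by apply: mulr_ge0; [apply: mulr_ge0 => //; exact: powR_ge0|rewrite exprn_ge0// ltW].
have fPA i : P (A i) = (fine (P (A i)))%:E by rewrite fineK// fin_num_measure.
have PA i : (i < n)%N -> nI * fine (P (A i)) <= E0 * dl `^ (- alpha) * q ^+ m * (c * p ^+ i).
  move=> ni; set k := (m + i).+1; set l := (n - i.+1)%N.
  have kl : (m + n)%N = (k + l)%N by rewrite /k /l -addnS -addnA subnKC.
  pose x := rho * k%:R + y + ln (dl * wt i).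
  have dw0 : 0 < dl * wt i by rewrite mulr_gt0.
  have xE : dl * wt i * t = expR (rho * l%:R + x).
    rewrite /x /t kl natrD (_ : rho * l%:R + _ = (rho * (k%:R + l%:R) + y) + ln (dl * wt i)); last by ring.
    by rewrite [in RHS]expRD lnK ?posrE// mulrC.
  have H0 := prod_tail_bound hX halpha ht Kn0 hKn l x (@past_err (m + i)) (fun w => normr_ge0 (err (m + i) w)).
  have c1 : 0 <= (Kn + 1) * expR (- (l%:R * I)) / Num.sqrt (maxn l 1)%:R * expR (- (alpha * x)).
    by rewrite !mulr_ge0 ?invr_ge0 ?sqrtr_ge0 ?expR_ge0 ?addr_ge0.
  have H : fine (P (A i)) <= (Kn + 1) * expR (- (l%:R * I)) / Num.sqrt (maxn l 1)%:R * expR (- (alpha * x)) *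
      (Ke * (q ^+ (m + i) * q ^+ (m + i)) * expR (k%:R * lam)).
    rewrite -lee_fin -fPA /A xE; apply: (le_trans H0); rewrite [leRHS]EFinM.
    by apply: lee_wpmul2l; [rewrite lee_fin|exact: hKe].
  apply: (le_trans (ler_wpM2l nI0 H)).
  have sm0 : 0 < Num.sqrt (maxn l 1)%:R :> R by rewrite sqrtr_gt0 maxn1_gt0.
  (* When few factors remain, the gain 1 / sqrt l is lost against sqrt(m + n); the loss is at most
     linear in m + i. *)
  have sq : Num.sqrt (m + n)%:R <= ((m + i)%:R + 2) * Num.sqrt (maxn l 1)%:R :> R.
    have e2 : (m + i)%:R + 2 = Num.sqrt (((m + i)%:R + 2) ^+ 2) :> R by rewrite sqrtr_sqr ger0_norm// addr_ge0.
    rewrite e2 -sqrtrM ?sqr_ge0// ler_sqrt ?mulr_ge0 ?sqr_ge0//.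
    rewrite -natrD -natrX -natrM ler_nat kl /k.
    by apply: square_bound; rewrite ?leq_maxl ?leq_maxr.
  have xa : expR (- (alpha * x)) = expR (- (alpha * (rho * k%:R))) * expR (- (alpha * y)) * (dl `^ (- alpha) * (1 - s) `^ (- alpha) * q ^- i).
    have -> : dl `^ (- alpha) * (1 - s) `^ (- alpha) * q ^- i = (dl * wt i) `^ (- alpha).
      rewrite /wt !powRM ?mulr_ge0 ?exprn_ge0 ?(ltW d0) ?(ltW s0) ?(ltW s1')// mulrA; congr (_ * _).
      by rewrite powRN -(powR_mulrn i (ltW s0)) powRAC sE powR_mulrn// ltW.
    by rewrite {1}/powR (gt_eqF dw0) -!expRD; congr expR; rewrite /x; ring.
  (* Since m + n = k + l, the rate over l generations, the threshold over k generations and the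
     growth m^k of the error moment balance exactly. *)
  have cancel_exp : expR ((m + n)%:R * I) * expR (- (l%:R * I)) * expR (- (alpha * (rho * k%:R))) * expR (k%:R * lam) = 1.
    by rewrite -!expRD -[RHS](@expR0 R); congr expR; rewrite kl natrD; ring.
  have qi : q ^+ i != 0 by rewrite expf_neq0// gt_eqF.
  have -> : nI * ((Kn + 1) * expR (- (l%:R * I)) / Num.sqrt (maxn l 1)%:R * expR (- (alpha * x)) * (Ke * (q ^+ (m + i) * q ^+ (m + i)) * expR (k%:R * lam)))
    = E0 * dl `^ (- alpha) * q ^+ m * (Num.sqrt (m + n)%:R / Num.sqrt (maxn l 1)%:R * q ^+ (m + i)) *
      (expR ((m + n)%:R * I) * expR (- (l%:R * I)) * expR (- (alpha * (rho * k%:R))) * expR (k%:R * lam)).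
    by rewrite xa /nI /E0 (exprD _ m i); field; rewrite qi gt_eqF.
  rewrite cancel_exp mulr1; apply: (ler_wpM2l EE).
  apply: (@le_trans _ _ (((m + i)%:R + 2) * q ^+ (m + i))).
    by rewrite ler_wpM2r ?exprn_ge0 ?(ltW q0)// ler_pdivrMr.
  apply: (le_trans (cp _)); apply: ler_wpM2l => //.
  by rewrite exprD ler_piMl ?exprn_ge0 ?(ltW p0)// exprn_ile1 ?(ltW p0) ?(ltW p1).
have Ple : fine (P [set w | dl * t < `|gap m n w|]) <= \sum_(i < n) fine (P (A i)).
  rewrite -lee_fin fineK ?fin_num_measure// -sumEFin.
  apply: (@le_trans _ _ (P (\big[setU/set0]_(i < n) A i))).
    apply: le_measure => //; rewrite inE//; exact: bigsetU_measurable.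
  apply: (le_trans (Boole_inequality P (fun i _ => mA i))).
  by apply: lee_sum => i _; rewrite -fPA.
rewrite -/nI; apply: (le_trans (ler_wpM2l nI0 Ple)); rewrite mulr_sumr.
apply: (@le_trans _ _ (\sum_(i < n) E0 * dl `^ (- alpha) * q ^+ m * (c * p ^+ i))).
  by apply: ler_sum => i _; apply: PA.
rewrite -mulr_sumr -mulr_sumr.
have -> : E0 * (c / (1 - p)) * dl `^ (- alpha) * q ^+ m = E0 * dl `^ (- alpha) * q ^+ m * (c / (1 - p)) by ring.
apply: (ler_wpM2l EE).
apply: ler_wpM2l => //; rewrite -div1r ler_pdivlMr//.
have psum k : (\sum_(i < k) p ^+ i) * (1 - p) = 1 - p ^+ k.
  elim: k => [|k IH]; first by rewrite big_ord0 mul0r expr0 subrr.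
  by rewrite big_ord_recr/= mulrDl IH exprS; ring.
by rewrite psum gerBl exprn_ge0// ltW.
Qed.

(** Conditionally on Z_m > 0, the threshold for the future product is shifted by ln Z_m. The local
    limit holds for each shift and the uniform bound on [N] dominates, so the limit is the one for a
    pure product times a normalised moment of Z_m. *)
Lemma main_term m x : (\int[P]_w ((Z X m w)%:R `^ alpha)%:E < +oo)%E ->
  Num.sqrt (m + n)%:R * expR ((m + n)%:R * I) *
    fine (P [set w | expR (rho * (m + n)%:R + x) < (Z X m w)%:R * Pik X m n w]) @[n --> \oo]
  --> expR (- (alpha * x)) * L * fine ((expR (- (m%:R * lam)))%:E * \int[P]_w ((Z X m w)%:R `^ alpha)%:E)%E.
Proof.
move=> Zfin; set IZ := (\int[P]_w _)%E.
have IZ0 : (0 <= IZ)%E by apply: integral_ge0 => w _; rewrite lee_fin powR_ge0.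
have IZE : IZ = (fine IZ)%:E by rewrite fineK// ge0_fin_numE.
have mZ : measurable_fun setT (fun w => ((Z X m w)%:R `^ alpha : R)%:E).
  by apply/measurable_EFinP; exact: (measurable_Z_fun X m (fun j => j%:R `^ alpha)).
have Zp0 w : setT w -> (0 <= ((Z X m w)%:R `^ alpha : R)%:E)%E by move=> _; rewrite lee_fin powR_ge0.
have Kne : (0 <= Kn%:E)%E by rewrite lee_fin.
have Le : (0 <= L%:E)%E by rewrite lee_fin.
have mZU : measurable_fun setT ((fun w => (Z X m w)%:R : R) : U m -> R).
  have h := measurableT_comp (_ : measurable_fun setT (fun j : nat => j%:R : R)) (@past_Z_fun _ _ _ X m m (leqnn m)).
  by apply: h.
have mlnZ : measurable_fun setT (fun w => (rho * m%:R + x - ln (Z X m w)%:R)).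
  by apply: measurable_funB => //; exact: (measurable_Z_fun X m (fun j => ln j%:R)).
have mS n : measurable_fun setT (walk X rho n) by exact: measurable_walk.
pose f n w := (((Z X m w)%:R `^ alpha)%:E * N n (rho * m%:R + x - ln (Z X m w)%:R))%E.
have mN n : measurable_fun setT (fun y => N n y).
  by have := measurable_Nn Pa mS alpha n 0; under eq_fun do rewrite add0r.
have mf n : measurable_fun setT (f n) by apply: emeasurable_funM => //; exact: (measurableT_comp (mN n) mlnZ).
have NE n y : N n y = (fine (N n y))%:E.
  by rewrite fineK// ge0_fin_numE ?Nn_ge0//; exact: (le_lt_trans (hKn n y) (ltry _)).
have fl : (\int[P]_w f n w @[n --> \oo] --> \int[P]_w (((Z X m w)%:R `^ alpha)%:E * L%:E))%E.
  apply: (@dominated_cvg _ _ _ P setT measurableT f _ (fun w => ((Z X m w)%:R `^ alpha)%:E * Kn%:E)%E) => //.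
  - move=> w _; apply: cvgeZl => //.
    rewrite (_ : (fun n => _) = (fun n => (fine (N n (rho * m%:R + x - ln (Z X m w)%:R)))%:E)); last by apply/funext => n; exact: NE.
    by apply: cvg_EFin; [near=> n|exact: hL].
  - apply/integrableP; split; first by apply: emeasurable_funM.
    rewrite (_ : (\int[P]_w _ = Kn%:E * IZ)%E); first by rewrite IZE -EFinM ltry.
    rewrite -(ge0_integralZl P measurableT mZ Zp0 Kne).
    by apply: eq_integral => w _; rewrite gee0_abs 1?muleC// mule_ge0 ?lee_fin ?powR_ge0.
  - move=> n w _; rewrite /f gee0_abs; last by rewrite mule_ge0 ?Nn_ge0// lee_fin powR_ge0.
    by apply: lee_wpmul2l; rewrite ?lee_fin ?powR_ge0.
have cE n : ((Num.sqrt n.+1%:R * expR (n.+1%:R * I))%:E * P [set w | (expR (rho * (m + n.+1)%:R + x) < (Z X m w)%:R * Pik X m n.+1 w)%R]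
    = (expR (- (alpha * (rho * m%:R + x))))%:E * \int[P]_w f n.+1%N w)%E.
  have xE : rho * (m + n.+1)%:R + x = rho * n.+1%:R + (rho * m%:R + x) by rewrite natrD; ring.
  rewrite xE; have [mT ->] := prod_tail rho hX n.+1 (rho * m%:R + x) mZU (fun w => ler0n _ _).
  have t0 w : setT w -> (0 <= (if (0 < (Z X m w)%:R :> R)%R then tail P X rho n.+1 (rho * m%:R + x - ln (Z X m w)%:R)%R else 0))%E.
    by move=> _; case: ifP => // _; exact: measure_ge0.
  have s0 : (0 <= (Num.sqrt n.+1%:R * expR (n.+1%:R * I))%:E)%E by rewrite lee_fin mulr_ge0 ?sqrtr_ge0 ?expR_ge0.
  have f0 w : setT w -> (0 <= f n.+1%N w)%E by move=> _; rewrite mule_ge0 ?Nn_ge0// lee_fin powR_ge0.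
  have e0 : (0 <= (expR (- (alpha * (rho * m%:R + x))))%:E)%E by rewrite lee_fin expR_ge0.
  rewrite -(ge0_integralZl P measurableT mT t0 s0) -(ge0_integralZl P measurableT (mf n.+1) f0 e0).
  apply: eq_integral => w _; case: ifP => Zp.
    have pe : (Z X m w)%:R `^ alpha = expR (alpha * ln (Z X m w)%:R) by rewrite /powR gt_eqF.
    transitivity ((expR (- (alpha * (rho * m%:R + x - ln (Z X m w)%:R))))%:E * N n.+1 (rho * m%:R + x - ln (Z X m w)%:R))%E.
      by rewrite -(tail_Nn _ hX halpha ht).
    by rewrite /f [RHS]muleA pe -EFinM -expRD; congr ((expR _)%:E * _)%E; ring.
  have z0' : (0 : R) `^ alpha = 0 by rewrite powR0// gt_eqF.
  have Zw : (Z X m w)%:R = 0 :> R by move: Zp; case: (Z X m w) => // j; rewrite ltr0n.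
  by rewrite /f Zw z0' mul0e !mule0.
have limE : (\int[P]_w (((Z X m w)%:R `^ alpha)%:E * L%:E) = (fine IZ * L)%:E)%E.
  rewrite EFinM -IZE muleC -(ge0_integralZl P measurableT mZ Zp0 Le).
  by apply: eq_integral => w _; rewrite muleC.
rewrite limE in fl; have fl' := fine_cvg fl.
(* Corrects sqrt n for the m frozen generations; indices are shifted by one so that the denominator
   is not 0. *)
pose r n : R := Num.sqrt (m + n.+1)%:R / Num.sqrt n.+1%:R.
have rl : r n @[n --> \oo] --> (1 : R).
  have h1 : 1 + m%:R * n.+1%:R^-1 @[n --> \oo] --> (1 : R).
    rewrite -[X in _ --> X]addr0 -[X in _ --> _ + X](mulr0 m%:R).
    by apply: cvgD; [exact: cvg_cst|apply: cvgMl_tmp; exact: cvg_harmonic].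
  have h2 := cvg_comp _ _ h1 (@sqrt_continuous R 1); rewrite sqrtr1 in h2.
  apply: (cvg_ext _ h2) => n /=.
  rewrite /r -sqrtrV ?ler0n// -sqrtrM ?ler0n//; congr Num.sqrt.
  by rewrite natrD mulrDl divff ?pnatr_eq0// addrC.
rewrite -(cvg_shiftS (fun n => Num.sqrt (m + n)%:R * expR ((m + n)%:R * I) *
    fine (P [set w | expR (rho * (m + n)%:R + x) < (Z X m w)%:R * Pik X m n w]))).
have fS : fine (\int[P]_w f n.+1%N w)%E @[n --> \oo] --> fine IZ * L.
  by rewrite (cvg_shiftS (fun n => fine (\int[P]_w f n w)%E)); exact: fl'.
have main : r n * (expR (- (alpha * x)) * expR (- (m%:R * lam))) * fine (\int[P]_w f n.+1%N w)%E @[n --> \oo]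
    --> 1 * (expR (- (alpha * x)) * expR (- (m%:R * lam))) * (fine IZ * L).
  by apply: cvgM => //; apply: cvgM => //; exact: cvg_cst.
have -> : expR (- (alpha * x)) * L * fine ((expR (- (m%:R * lam)))%:E * IZ)%E =
    1 * (expR (- (alpha * x)) * expR (- (m%:R * lam))) * (fine IZ * L).
  by rewrite IZE /=; ring.
apply: (cvg_ext _ main) => n.
have mEv : measurable [set w | expR (rho * (m + n.+1)%:R + x) < (Z X m w)%:R * Pik X m n.+1 w].
  by apply: mgt; apply: measurable_funM; [exact: (measurable_Z_fun X m (fun j => j%:R))|exact: measurable_Pik].
have PE := cE n; move: PE; set pp := P _ => PE.
have pE : pp = (fine pp)%:E by rewrite fineK// fin_num_measure.
have fE : fine (\int[P]_w f n.+1%N w)%E = expR (alpha * (rho * m%:R + x)) * (Num.sqrt n.+1%:R * expR (n.+1%:R * I) * fine pp).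
  have ex : (expR (alpha * (rho * m%:R + x)))%:E != 0%:E :> \bar R by rewrite eqe gt_eqF// expR_gt0.
  have -> : (\int[P]_w f n.+1%N w = (expR (alpha * (rho * m%:R + x)))%:E * ((expR (- (alpha * (rho * m%:R + x))))%:E * \int[P]_w f n.+1%N w))%E.
    by rewrite muleA -EFinM -expRD subrr expR0 mul1e.
  by rewrite -PE pE -!EFinM.
rewrite fE /r.
have sn : Num.sqrt n.+1%:R != 0 :> R by rewrite gt_eqF// sqrtr_gt0 ltr0n.
transitivity (Num.sqrt (m + n.+1)%:R * (expR (- (alpha * x)) * expR (- (m%:R * lam)) * expR (alpha * (rho * m%:R + x)) * expR (n.+1%:R * I)) * fine pp).
  by congr (_ * _ * _); rewrite -!expRD; congr expR; rewrite natrD; ring.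
by field.
Unshelve. all: end_near. Qed.

End error_estimate.

Section conclusion.
Context d (T : measurableType d) (R : realType) (P : probability T R) (X : bprei_data T R).
Variables (alpha : R) (Pa : probability T R) (rho Kn q Ke L c : R).
Hypothesis hX : is_bprei P X.
Hypothesis halpha : 0 < alpha.
Hypothesis ht : is_tilted P X alpha Pa.
Local Notation lam := (rLambda P X alpha).
Local Notation I := (alpha * rho - lam).
Local Notation err k w := ((Z X k.+1 w)%:R - M X k w * (Z X k w)%:R).
Local Notation N := (Nn Pa (walk X rho) alpha).
Hypothesis Kn0 : 0 <= Kn.
Hypothesis hKn : forall n x, (N n x <= Kn%:E)%E.
Hypothesis q0 : 0 < q.
Hypothesis q1 : q < 1.
Hypothesis Ke0 : 0 < Ke.
Hypothesis hKe : forall n, (\int[P]_w (`|err n w| `^ alpha)%:E <= (Ke * (q ^+ n * q ^+ n) * expR (n.+1%:R * lam))%:E)%E.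
Hypothesis L0 : 0 <= L.
Hypothesis hL : forall x, fine (N n x) @[n --> \oo] --> L.
Hypothesis Zfin : forall n, (\int[P]_w ((Z X n w)%:R `^ alpha)%:E < +oo)%E.
Hypothesis hc : fine ((expR (- (n%:R * lam)))%:E * \int[P]_w ((Z X n w)%:R `^ alpha)%:E)%E @[n --> \oo] --> c.

(** Up to the event that the gap exceeds a fraction dl of the threshold, Z_n exceeds it only if the
    main term exceeds (1 - dl) times it, and does so if the main term exceeds (1 + dl) times it. For
    given precision dl is fixed close to 0, then m large, and n tends to infinity. *)
Lemma large_deviation_limit y :
  Num.sqrt n%:R * expR (n%:R * I) * fine (P [set w | expR (rho * n%:R + y) < (Z X n w)%:R])
    @[n --> \oo] --> c * expR (- (alpha * y)) * L.
Proof.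
have [E E0 hE] := error_estimate hX halpha ht Kn0 hKn q0 q1 Ke0 hKe y.
pose cm m := fine ((expR (- (m%:R * lam)))%:E * \int[P]_w ((Z X m w)%:R `^ alpha)%:E)%E.
pose A x m n := Num.sqrt (m + n)%:R * expR ((m + n)%:R * I) *
    fine (P [set w | expR (rho * (m + n)%:R + x) < (Z X m w)%:R * Pik X m n w]).
have AL x m : A x m n @[n --> \oo] --> expR (- (alpha * x)) * L * cm m.
  by apply: (main_term hX halpha ht Kn0 hKn L0 hL); exact: Zfin.
pose nI n : R := Num.sqrt n%:R * expR (n%:R * I).
have nI0 n : 0 <= nI n by rewrite mulr_ge0 ?sqrtr_ge0 ?expR_ge0.
pose ev n := [set w | expR (rho * n%:R + y) < (Z X n w)%:R].
pose gv m n dl := [set w | dl * expR (rho * (m + n)%:R + y) < `|gap X m n w|].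
pose mv x m n := [set w | expR (rho * (m + n)%:R + x) < (Z X m w)%:R * Pik X m n w].
have mgt (f : T -> R) (a : R) : measurable_fun setT f -> measurable [set w | a < f w].
  move=> mf; rewrite (_ : [set w | a < f w] = f @^-1` `]a, +oo[); first exact: measurable_preimage.
  by apply/seteqP; split => w /=; rewrite in_itv/= andbT.
have mev n : measurable (ev n) by apply: mgt; exact: (measurable_Z_fun X n (fun j => j%:R)).
have mgv m n dl : measurable (gv m n dl) by apply: mgt; exact: measurable_gap.
have mmv x m n : measurable (mv x m n).
  by apply: mgt; apply: measurable_funM; [exact: (measurable_Z_fun X m (fun j => j%:R))|exact: measurable_Pik].
have fin B : measurable B -> P B = (fine (P B))%:E by move=> mB; rewrite fineK// fin_num_measure.
have union B1 B2 B3 : measurable B1 -> measurable B2 -> measurable B3 -> B1 `<=` B2 `|` B3 ->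
    fine (P B1) <= fine (P B2) + fine (P B3).
  move=> m1 m2 m3 s; rewrite -lee_fin EFinD -!fin//.
  apply: (@le_trans _ _ (P (B2 `|` B3))); last exact: measureU2.
  by apply: le_measure => //; rewrite inE//; exact: measurableU.
have shift m (u : nat -> R) l : u n @[n --> \oo] --> l -> u (n - m)%N @[n --> \oo] --> l.
  move=> h; rewrite -(cvg_shiftn m (fun n => u (n - m)%N)).
  by rewrite (_ : [sequence u (n + m - m)%N]_n = u)//; apply/funext => n /=; rewrite addnK.
have scale dl n : 0 < dl -> expR (rho * n%:R + (y + ln dl)) = dl * expR (rho * n%:R + y).
  by move=> d0; rewrite addrA expRD lnK ?posrE// mulrC.
have expl dl : 0 < dl -> expR (- (alpha * (y + ln dl))) = expR (- (alpha * y)) * dl `^ (- alpha).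
  by move=> d0; rewrite /powR gt_eqF// -expRD; congr expR; ring.
pose B := expR (- (alpha * y)) * L.
have B0 : 0 <= B by rewrite mulr_ge0 ?expR_ge0.
have -> : c * expR (- (alpha * y)) * L = B * c by rewrite /B; ring.
have qm : q ^+ m @[m --> \oo] --> (0 : R) by apply: cvg_expr; rewrite ger0_norm// ltW.
(* The shift by two keeps the margin below 1, so that 1 - dl is positive. *)
pose et (j : nat) : R := j.+2%:R^-1.
have etl : et j @[j --> \oo] --> (0 : R).
  by rewrite (cvg_shiftS (fun j => j.+1%:R^-1 : R)); exact: cvg_harmonic.
have et0 j : 0 < et j by rewrite invr_gt0 ltr0n.
have et1 j : et j < 1 by rewrite invf_lt1 ?ltr0n// ltr1n.
have powl (e : R -> R) : (forall j, 0 < e (et j)) -> e (et j) @[j --> \oo] --> (1 : R) ->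
    e (et j) `^ (- alpha) @[j --> \oo] --> (1 : R).
  move=> e0 h; have h1 : e (et j) `^ alpha @[j --> \oo] --> (1 : R) `^ alpha.
    by apply: cvg_powR => // j; exact: ltW.
  rewrite one_powR in h1; have h2 : (e (et j) `^ alpha)^-1 @[j --> \oo] --> (1 : R).
    by rewrite -[X in _ --> X]invr1; apply: cvgV => //; exact: oner_neq0.
  by apply: (cvg_ext _ h2) => j; rewrite powRN.
have pickm (f : nat -> R) l e : f m @[m --> \oo] --> l -> 0 < e -> exists m, `|l - f m| < e.
  move=> fl e0; have : \forall m \near \oo, `|l - f m| < e by move/cvgrPdist_lt : fl; apply.
  by move=> [m _ /(_ m (leqnn m))]; exists m.
have e3 (e : R) : 0 < e -> 0 < e / 2 by move=> e0; lra.
apply: cvg_squeeze_family => e e0.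
- have f1 : B * (1 - et j) `^ (- alpha) * c @[j --> \oo] --> B * 1 * c.
    apply: cvgM; last exact: cvg_cst.
    apply: cvgMl_tmp; apply: (powl (fun z => 1 - z)) => [j|]; first by rewrite subr_gt0.
    by rewrite -[X in _ --> X]subr0; apply: cvgB => //; exact: cvg_cst.
  have [j hj] := pickm _ _ _ f1 (e3 _ e0); rewrite mulr1 in hj.
  set dl := et j in hj; have d0 : 0 < dl by exact: et0.
  have d1 : 0 < 1 - dl by rewrite subr_gt0; exact: et1.
  have f2 : B * (1 - dl) `^ (- alpha) * cm m + E * dl `^ (- alpha) * q ^+ m @[m --> \oo] -->
      B * (1 - dl) `^ (- alpha) * c + E * dl `^ (- alpha) * 0.
    by apply: cvgD; apply: cvgMl_tmp; [exact: hc|exact: qm].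
  have [m hm] := pickm _ _ _ f2 (e3 _ e0); rewrite mulr0 addr0 in hm.
  exists (fun n => A (y + ln (1 - dl)) m (n - m)%N + E * dl `^ (- alpha) * q ^+ m),
    (B * (1 - dl) `^ (- alpha) * cm m + E * dl `^ (- alpha) * q ^+ m); split.
  + apply: cvgD; last exact: cvg_cst.
    apply: shift; have := AL (y + ln (1 - dl)) m; rewrite expl//.
    by rewrite (_ : _ * _ * L * cm m = B * (1 - dl) `^ (- alpha) * cm m)//; rewrite /B; ring.
  + by move: hj hm; rewrite !ltr_distl => /andP[h0 h1] /andP[h2 h3]; lra.
  + near=> n; have mn : (m <= n)%N by near: n; exact: nbhs_infty_ge.
    have nE : (m + (n - m))%N = n by rewrite subnKC.
    (* With a gap of at most dl times the threshold, the main term must account for the remaining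
       fraction 1 - dl. *)
    have s : ev n `<=` mv (y + ln (1 - dl)) m (n - m)%N `|` gv m (n - m)%N dl.
      move=> w; rewrite /ev /mv /gv /= nE scale// => h.
      have [h1|h1] := ltP (dl * expR (rho * n%:R + y)) `|gap X m (n - m) w|; [by right|left].
      have := ler_norm (gap X m (n - m) w); rewrite {1}/gap nE => h2; lra.
    have := union _ _ _ (mev n) (mmv _ _ _) (mgv _ _ _) s => h.
    have := ler_wpM2l (nI0 n) h => h4.
    have := hE m (n - m)%N dl d0; rewrite nE => h5.
    by move: h4; rewrite mulrDr /A nE -/(nI n); move: h5; rewrite -/(nI n) /gv nE /mv nE /ev; lra.
- have f1 : B * (1 + et j) `^ (- alpha) * c @[j --> \oo] --> B * 1 * c.
    apply: cvgM; last exact: cvg_cst.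
    apply: cvgMl_tmp; apply: (powl (fun z => 1 + z)) => [j|]; first by rewrite addr_gt0.
    by rewrite -[X in _ --> X]addr0; apply: cvgD => //; exact: cvg_cst.
  have [j hj] := pickm _ _ _ f1 (e3 _ e0); rewrite mulr1 in hj.
  set dl := et j in hj; have d0 : 0 < dl by exact: et0.
  have d1 : 0 < 1 + dl by rewrite addr_gt0.
  have f2 : B * (1 + dl) `^ (- alpha) * cm m - E * dl `^ (- alpha) * q ^+ m @[m --> \oo] -->
      B * (1 + dl) `^ (- alpha) * c - E * dl `^ (- alpha) * 0.
    by apply: cvgB; apply: cvgMl_tmp; [exact: hc|exact: qm].
  have [m hm] := pickm _ _ _ f2 (e3 _ e0); rewrite mulr0 subr0 in hm.
  exists (fun n => A (y + ln (1 + dl)) m (n - m)%N - E * dl `^ (- alpha) * q ^+ m),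
    (B * (1 + dl) `^ (- alpha) * cm m - E * dl `^ (- alpha) * q ^+ m); split.
  + apply: cvgB; last exact: cvg_cst.
    apply: shift; have := AL (y + ln (1 + dl)) m; rewrite expl//.
    by rewrite (_ : _ * _ * L * cm m = B * (1 + dl) `^ (- alpha) * cm m)//; rewrite /B; ring.
  + by move: hj hm; rewrite !ltr_distl => /andP[h0 h1] /andP[h2 h3]; lra.
  + near=> n; have mn : (m <= n)%N by near: n; exact: nbhs_infty_ge.
    have nE : (m + (n - m))%N = n by rewrite subnKC.
    have s : mv (y + ln (1 + dl)) m (n - m)%N `<=` ev n `|` gv m (n - m)%N dl.
      move=> w; rewrite /ev /mv /gv /= nE scale// => h.
      have [h1|h1] := ltP (dl * expR (rho * n%:R + y)) `|gap X m (n - m) w|; [by right|left].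
      have := ler_norm (- gap X m (n - m) w); rewrite normrN {1}/gap nE => h2; lra.
    have := union _ _ _ (mmv _ _ _) (mev n) (mgv _ _ _) s => h.
    have := ler_wpM2l (nI0 n) h => h4.
    have := hE m (n - m)%N dl d0; rewrite nE => h5.
    by move: h4; rewrite mulrDr /A nE -/(nI n); move: h5; rewrite -/(nI n) /gv nE /mv nE /ev; lra.
Unshelve. all: end_near. Qed.

End conclusion.

(** * Norms of order alpha and assembly of the theorem *)

Lemma LnormE d (T : measurableType d) (R : realType) (Pa : probability T R) (a : R) (f : T -> R) :
  Lnorm Pa a%:E (EFin \o f) = ((\int[Pa]_w (`|f w| `^ a)%:E) `^ a^-1)%E.
Proof. by rewrite unlock. Qed.

Lemma finite_normP d (T : measurableType d) (R : realType) (Pa : probability T R) (a : R) (f : T -> R) :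
  (\int[Pa]_w (`|f w| `^ a)%:E < +oo)%E -> finite_norm Pa a%:E f.
Proof.
rewrite /finite_norm LnormE.
have : (0 <= \int[Pa]_w (`|f w| `^ a)%:E)%E by apply: integral_ge0 => w _; rewrite lee_fin powR_ge0.
by case: (\int[Pa]_w (`|f w| `^ a)%:E)%E => [r|//|//] _ _; rewrite poweR_EFin ltry.
Qed.

Theorem theorem3p4 (d : measure_display) (T : measurableType d) (R : realType)
  (P : probability T R) (X : bprei_data T R)
  (alpha : R) (Pa : probability T R) (mu rho v : R)
  (hX : is_bprei P X)
  (halpha : 0 < alpha)
  (halphaD : interior (DLambda P X) alpha)
  (hPa : is_tilted P X alpha Pa)
  (hM : non_arithmetic P (fun w => ln (M X 0 w)))
  (hlogM : ('E_P[fun w => `|ln (M X 0 w)|%R] < +oo)%E)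
  (hmu : ('E_P[fun w => ln (M X 0 w)] = mu%:E)%E)
  (hmu0 : 0 <= mu)
  (hrho : rho = derive1 (rLambda P X) alpha)
  (hrhomu : mu < rho)
  (hv : 0 < v)
  (hv2 : v ^+ 2 = derive1n 2 (rLambda P X) alpha)
  (hZ0 : ('E_P[fun w => ((Z0 X w)%:R `^ alpha)%R] < +oo)%E)
  (hD : exists C beta : R, [/\ 0 <= beta, beta < alpha &
     forall k : nat,
       ('E_P[fun w => (`|D X k w| `^ alpha)%R]
          <= (C * (1 + k%:R `^ beta))%:E)%E])
  (hpos : (0 < P [set w | (0 < Z0 X w)%N] + P [set w | (0 < immig X 1 w)%N])%E) :
  exists V : {RV Pa >-> R},
    let c := ('E_Pa[fun w => (V w `^ alpha)%R])%E in
    let I := alpha * rho - rLambda P X alpha in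
    [/\ (forall w, 0 <= V w) /\ (0 < Pa [set w | 0 < V w]%R)%E,
        {ae Pa, forall w, (Z X n w)%:R / Pi X n w @[n --> \oo] --> V w}
        /\ cvg_in_Lp Pa alpha (fun n w => (Z X n w)%:R / Pi X n w) V,
        (0 < c < +oo)%E,
        ((expR (- (n%:R * rLambda P X alpha)))%:E
           * 'E_P[fun w => ((Z X n w)%:R `^ alpha)%R])%E @[n --> \oo] --> c
      & forall y : R,
          Num.sqrt n%:R * expR (n%:R * I)
            * fine (P [set w | expR (rho * n%:R + y) < (Z X n w)%:R])
            @[n --> \oo]
          --> fine c * expR (- (alpha * y))
              / (alpha * v * Num.sqrt (2 * pi))].
Proof.
have [C [beta [beta0 beta_lt hDk]]] := hD.
have [V [mV V0 aeV PV [Vfin cfin Lp mom [q [Ke [q0 q1 Ke0 hKe]]]]]] :=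
  limit_properties hX halpha hPa hM hlogM hmu hmu0 beta0 beta_lt hDk hZ0 hpos.
pose mVf := isMeasurableFun.Build _ _ _ _ V mV.
pose VR : {RV Pa >-> R} := HB.pack V mVf.
have cE : ('E_Pa[fun w => (V w `^ alpha)%R] = \int[Pa]_w (V w `^ alpha)%:E)%E by rewrite unlock.
have zE n : ('E_P[fun w => ((Z X n w)%:R `^ alpha)%R] = \int[P]_w ((Z X n w)%:R `^ alpha)%:E)%E by rewrite unlock.
have IV0 : (0 <= \int[Pa]_w (V w `^ alpha)%:E)%E by apply: integral_ge0 => w _; rewrite lee_fin powR_ge0.
have cfn : (\int[Pa]_w (V w `^ alpha)%:E)%E \is a fin_num by rewrite ge0_fin_numE//; case/andP: cfin.
exists VR => c I0; rewrite /c /= cE {c}; split => //.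
- split => //; split.
  + by move=> n; apply: finite_normP; exact: Vfin.
  + apply: finite_normP; under eq_integral do rewrite ger0_norm//.
    by case/andP: cfin.
  + have a0 n : (0 <= \int[Pa]_w (`|Vn X n w - V w| `^ alpha)%:E)%E.
      by apply: integral_ge0 => w _; rewrite lee_fin powR_ge0.
    have /fine_cvg aL : (\int[Pa]_w (`|Vn X n w - V w| `^ alpha)%:E @[n --> \oo] --> (0 : R)%:E)%E by exact: Lp.
    have ia : 0 < alpha^-1 by rewrite invr_gt0.
    have := cvg_powR ia (fun n => fine_ge0 (a0 n)) aL; rewrite powR0 ?gt_eqF// => h.
    have h' : (fine (\int[Pa]_w (`|Vn X n w - V w| `^ alpha)%:E)%E `^ alpha^-1)%:E @[n --> \oo] --> (0 : R)%:E.
      by apply: cvg_EFin => //; near=> n.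
    apply: cvg_trans h'; apply: near_eq_cvg.
    (* Eventually the integral is finite, so that its extended-real root is the real power whose
       limit was just taken. *)
    have fin : \forall n \near \oo, (\int[Pa]_w (`|Vn X n w - V w| `^ alpha)%:E < 1%:E)%E.
      have /fine_cvgP[+ _] : (\int[Pa]_w (`|Vn X n w - V w| `^ alpha)%:E @[n --> \oo] --> (0 : R)%:E)%E by exact: Lp.
      move=> fn; near=> n.
      have fnn : (\int[Pa]_w (`|Vn X n w - V w| `^ alpha)%:E)%E \is a fin_num by near: n.
      rewrite -(fineK fnn) lte_fin; near: n; exact: (cvgr_lt 0 aL _ ltr01).
    near=> n; rewrite LnormE.
    have : (\int[Pa]_w (`|Vn X n w - V w| `^ alpha)%:E < 1%:E)%E by near: n.
    move: (a0 n); case: (\int[Pa]_w (`|Vn X n w - V w| `^ alpha)%:E)%E => [r|//|//] _ _.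
    by rewrite poweR_EFin.
- by under eq_fun do rewrite zE.
- move=> y; have hcf := walk_cfhyp hX halpha halphaD hPa hM hrho hv2.
  have mW := measurable_walk X rho.
  have [Kn Kn0 hKn] := Nn_bounded mW hv hcf halpha.
  have hL x := local_limit mW hv hcf x halpha.
  have L0 : 0 <= 1 / (alpha * v * Num.sqrt (2 * pi)).
    by rewrite divr_ge0// !mulr_ge0 ?sqrtr_ge0 ?(ltW halpha) ?(ltW hv).
  have Zfin n : (\int[P]_w ((Z X n w)%:R `^ alpha)%:E < +oo)%E.
    have pT : past X n setT by exact: (@measurableT _ (g_sigma_algebraType (past_gen X n))).
    have := tilt_Vn hX hPa pT; have := Vfin n.
    under eq_integral do rewrite ger0_norm ?Vn_ge0//.
    (* Finiteness of the moment under [P] is read from that of V_n^alpha under [Pa], as the factor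
       between them is positive. *)
    move=> + e; rewrite e.
    have : (0 <= \int[P]_w ((Z X n w)%:R `^ alpha)%:E)%E by apply: integral_ge0 => w _; rewrite lee_fin powR_ge0.
    case: (\int[P]_w ((Z X n w)%:R `^ alpha)%:E)%E => [r _ _|_|//]; first exact: ltry.
    by rewrite gt0_muley ?lte_fin ?expR_gt0// ltxx.
  have hc := mom; rewrite -(fineK cfn) in hc; have /fine_cvg hc' := hc.
  have H := large_deviation_limit (y := y) hX halpha hPa Kn0 hKn q0 q1 Ke0 hKe L0 hL Zfin hc'.
  by rewrite div1r in H; exact: H.
Unshelve. all: end_near. Qed.
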